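(* Let $\mathbb{K}$ be a field. Any $\mathbb{K}$-linear triangulated category $\mathcal{T}$ with a full strong exceptional sequence $\langle E_1,E_2\rangle$ such that $\dim_{\mathbb{K}}\operatorname{Hom}(E_1,E_2)<\infty$ is algebraic. In particular, $\mathcal{T}$ is equivalent, as a triangulated category, to $\operatorname{D}^{\operatorname{b}}(\operatorname{mod-}A)$, where $A=\operatorname{End}(E_1\oplus E_2)$.
   Context: An object $E$ of a $\mathbb{K}$-linear triangulated category $\mathcal{T}$ is exceptional if $\operatorname{Hom}(E,E[n])$ equals $\mathbb{K}$ for $n=0$ and $0$ for $n\neq 0$. An exceptional sequence is a sequence $E_1,\dots,E_m$ of exceptional objects with $\operatorname{Hom}(E_i,E_j[n])=0$ for all $i>j$ and all $n\in\mathbb{Z}$. It is full if $\mathcal{T}$ is generated by $E_1,\dots,E_m$, i.e. $\mathcal{T}$ is (exactly equivalent to) the smallest full triangulated subcategory of $\mathcal{T}$ containing $E_1,\dots,E_m$. It is strong if $\operatorname{Hom}(E_i,E_j[n])=0$ for all $i,j$ and all $n\neq 0$. A triangulated category is algebraic if it is equivalent, as a triangulated category, to the stable category of a Frobenius exact category. $\operatorname{mod-}A$ is the category of finite-dimensional right $A$-modules and $\operatorname{D}^{\operatorname{b}}$ denotes the bounded derived category. All categories are assumed locally small. *)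

(* Defs.v *)
From HB Require Import structures.
From mathcomp Require Import all_boot all_order all_algebra.
From mathcomp Require Import boolp zify.

Set Implicit Arguments.
Unset Strict Implicit.
Unset Printing Implicit Defensive.

Import GRing.Theory.
Local Open Scope ring_scope.
#[local] Obligation Tactic := idtac.

(** Hom-sets carry an explicit equality [heq], so that quotient categories
    (stable categories) and localizations (derived categories) are obtained by
    changing [heq] only. *)

Record category := Category {
  ob :> Type;
  hom : ob -> ob -> Type;
  heq : forall X Y, hom X Y -> hom X Y -> Prop;
  idc : forall X, hom X X;
  comp : forall X Y Z, hom Y Z -> hom X Y -> hom X Z;
  heq_refl : forall X Y (f : hom X Y), heq f f;
  heq_sym : forall X Y (f g : hom X Y), heq f g -> heq g f;
  heq_trans : forall X Y (f g h : hom X Y), heq f g -> heq g h -> heq f h;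
  comp_heq : forall X Y Z (g g' : hom Y Z) (f f' : hom X Y),
    heq g g' -> heq f f' -> heq (comp g f) (comp g' f');
  compA : forall X Y Z W (h : hom Z W) (g : hom Y Z) (f : hom X Y),
    heq (comp h (comp g f)) (comp (comp h g) f);
  comp1l : forall X Y (f : hom X Y), heq (comp (idc Y) f) f;
  comp1r : forall X Y (f : hom X Y), heq (comp f (idc X)) f
}.

Arguments idc {c} X.
Arguments comp {c X Y Z}.
Arguments heq {c X Y}.

Definition is_iso (C : category) (X Y : C) (f : hom X Y) : Prop :=
  exists g : hom Y X, heq (comp g f) (idc X) /\ heq (comp f g) (idc Y).

Record functor (C D : category) := Functor {
  fob :> C -> D;
  fmap : forall X Y, hom X Y -> hom (fob X) (fob Y);
  fmap_heq : forall X Y (f g : hom X Y), heq f g -> heq (fmap f) (fmap g);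
  fmap_id : forall X, heq (fmap (idc X)) (idc (fob X));
  fmap_comp : forall X Y Z (g : hom Y Z) (f : hom X Y),
    heq (fmap (comp g f)) (comp (fmap g) (fmap f))
}.

Arguments fmap {C D} _ {X Y}.

Definition fully_faithful (C D : category) (F : functor C D) : Prop :=
  (forall (X Y : C) (f g : hom X Y), heq (fmap F f) (fmap F g) -> heq f g) /\
  (forall (X Y : C) (h : hom (F X) (F Y)), exists f : hom X Y, heq (fmap F f) h).

Definition essentially_surjective (C D : category) (F : functor C D) : Prop :=
  forall Y : D, exists (X : C) (f : hom (F X) Y), is_iso f.

Record additive_category := AdditiveCategory {
  aob :> Type;
  ahom : aob -> aob -> zmodType;
  aid : forall X, ahom X X;
  acomp : forall X Y Z, ahom Y Z -> ahom X Y -> ahom X Z;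
  acompA : forall X Y Z W (h : ahom Z W) (g : ahom Y Z) (f : ahom X Y),
    acomp h (acomp g f) = acomp (acomp h g) f;
  acomp1l : forall X Y (f : ahom X Y), acomp (aid Y) f = f;
  acomp1r : forall X Y (f : ahom X Y), acomp f (aid X) = f;
  acompDl : forall X Y Z (g g' : ahom Y Z) (f : ahom X Y),
    acomp (g + g') f = acomp g f + acomp g' f;
  acompDr : forall X Y Z (g : ahom Y Z) (f f' : ahom X Y),
    acomp g (f + f') = acomp g f + acomp g f';
  azero : aob;
  aid_azero : aid azero = 0;
  oplus : aob -> aob -> aob;
  inj1 : forall X Y, ahom X (oplus X Y);
  inj2 : forall X Y, ahom Y (oplus X Y);
  prj1 : forall X Y, ahom (oplus X Y) X;
  prj2 : forall X Y, ahom (oplus X Y) Y;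
  prj1_inj1 : forall X Y, acomp (prj1 X Y) (inj1 X Y) = aid X;
  prj2_inj2 : forall X Y, acomp (prj2 X Y) (inj2 X Y) = aid Y;
  prj1_inj2 : forall X Y, acomp (prj1 X Y) (inj2 X Y) = 0;
  prj2_inj1 : forall X Y, acomp (prj2 X Y) (inj1 X Y) = 0;
  oplus_id : forall X Y,
    acomp (inj1 X Y) (prj1 X Y) + acomp (inj2 X Y) (prj2 X Y)
      = aid (oplus X Y)
}.

Arguments aid {a} X.
Arguments acomp {a X Y Z}.
Arguments azero {a}.
Notation "g \oc f" := (acomp g f) (at level 40, left associativity) : ring_scope.

Program Definition add_cat (A : additive_category) : category :=
  @Category A (fun X Y => ahom X Y : Type) (fun X Y f g => f = g)
    (fun X => aid X) (fun X Y Z g f => acomp g f) _ _ _ _ _ _ _.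
Next Obligation. by []. Qed.
Next Obligation. by move=> A X Y f g ->. Qed.
Next Obligation. by move=> A X Y f g h -> ->. Qed.
Next Obligation. by move=> A X Y Z g g' f f' -> ->. Qed.
Next Obligation. by move=> A X Y Z W h g f; exact: acompA. Qed.
Next Obligation. by move=> A X Y f; exact: acomp1l. Qed.
Next Obligation. by move=> A X Y f; exact: acomp1r. Qed.

Definition aiso (A : additive_category) (X Y : A) (f : ahom X Y) : Prop :=
  @is_iso (add_cat A) X Y f.

Record triangulated_category := TriangulatedCategory {
  tcat :> additive_category;
  shift : functor (add_cat tcat) (add_cat tcat);
  shift_add : forall (X Y : tcat) (f g : ahom X Y),
    fmap shift (f + g : ahom X Y) = fmap shift f + fmap shift g
      :> ahom (shift X) (shift Y);
  (* the shift is an autoequivalence, with quasi-inverse [unshift] *)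
  unshift : functor (add_cat tcat) (add_cat tcat);
  shiftK : forall X : tcat, ahom (unshift (shift X)) X;
  shiftK_iso : forall X, aiso (shiftK X);
  shiftK_nat : forall (X Y : tcat) (f : ahom X Y),
    f \oc shiftK X = shiftK Y \oc fmap unshift (fmap shift f);
  unshiftK : forall X : tcat, ahom (shift (unshift X)) X;
  unshiftK_iso : forall X, aiso (unshiftK X);
  unshiftK_nat : forall (X Y : tcat) (f : ahom X Y),
    f \oc unshiftK X = unshiftK Y \oc fmap shift (fmap unshift f);
  dist : forall X Y Z : tcat,
    ahom X Y -> ahom Y Z -> ahom Z (shift X) -> Prop;
  dist_iso : forall (X Y Z X' Y' Z' : tcat)
    (u : ahom X Y) (v : ahom Y Z) (w : ahom Z (shift X))
    (u' : ahom X' Y') (v' : ahom Y' Z') (w' : ahom Z' (shift X'))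
    (f : ahom X X') (g : ahom Y Y') (h : ahom Z Z'),
    aiso f -> aiso g -> aiso h ->
    g \oc u = u' \oc f -> h \oc v = v' \oc g ->
    (fmap shift f : ahom (shift X) (shift X')) \oc w = w' \oc h ->
    dist u v w -> dist u' v' w';
  dist_id : forall X : tcat, @dist X X azero (aid X) 0 0;
  dist_complete : forall (X Y : tcat) (u : ahom X Y),
    exists (Z : tcat) (v : ahom Y Z) (w : ahom Z (shift X)), dist u v w;
  dist_rot : forall (X Y Z : tcat)
    (u : ahom X Y) (v : ahom Y Z) (w : ahom Z (shift X)),
    dist u v w <-> dist v w (- (fmap shift u : ahom (shift X) (shift Y)));
  dist_mor : forall (X Y Z X' Y' Z' : tcat)
    (u : ahom X Y) (v : ahom Y Z) (w : ahom Z (shift X))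
    (u' : ahom X' Y') (v' : ahom Y' Z') (w' : ahom Z' (shift X'))
    (f : ahom X X') (g : ahom Y Y'),
    dist u v w -> dist u' v' w' -> g \oc u = u' \oc f ->
    exists h : ahom Z Z', h \oc v = v' \oc g /\
      (fmap shift f : ahom (shift X) (shift X')) \oc w = w' \oc h;
  octahedral : forall (X Y Z X' Y' Z' : tcat)
    (u : ahom X Y) (j : ahom Y Z') (k : ahom Z' (shift X))
    (v : ahom Y Z) (l : ahom Z X') (i : ahom X' (shift Y))
    (m : ahom Z Y') (n : ahom Y' (shift X)),
    dist u j k -> dist v l i -> dist (v \oc u) m n ->
    exists (f : ahom Z' Y') (g : ahom Y' X'),
      [/\ dist f g ((fmap shift j : ahom (shift Y) (shift Z')) \oc i),
          f \oc j = m \oc v, n \oc f = k, g \oc m = l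
        & i \oc g = (fmap shift u : ahom (shift X) (shift Y)) \oc n]
}.

Arguments shift {t}.
Arguments unshift {t}.
Arguments dist {t X Y Z}.

Definition shiftz (T : triangulated_category) (n : int) (X : T) : T :=
  match n with
  | Posz m => iter m (fun Y : T => shift Y) X
  | Negz m => iter m.+1 (fun Y : T => unshift Y) X
  end.

Definition triangulated_subcategory (T : triangulated_category)
    (P : T -> Prop) : Prop :=
  [/\ P azero,
      forall (X Y : T) (f : ahom X Y), aiso f -> P X -> P Y,
      forall X : T, P X -> P (shift X),
      forall X : T, P X -> P (unshift X)
    & forall (X Y Z : T) (u : ahom X Y) (v : ahom Y Z) (w : ahom Z (shift X)),
        dist u v w -> P X -> P Y -> P Z].

Definition generated (T : triangulated_category) (I : Type) (E : I -> T)
    (X : T) : Prop :=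
  forall P : T -> Prop,
    triangulated_subcategory P -> (forall i, P (E i)) -> P X.

Record linear_triangulated_category (K : fieldType) :=
  LinearTriangulatedCategory {
  ltcat :> triangulated_category;
  lscale : forall X Y : ltcat, K -> ahom X Y -> ahom X Y;
  lscaleA : forall (X Y : ltcat) (a b : K) (f : ahom X Y),
    lscale a (lscale b f) = lscale (a * b) f;
  lscale1 : forall (X Y : ltcat) (f : ahom X Y), lscale 1 f = f;
  lscaleDr : forall (X Y : ltcat) (a : K) (f g : ahom X Y),
    lscale a (f + g) = lscale a f + lscale a g;
  lscaleDl : forall (X Y : ltcat) (f : ahom X Y) (a b : K),
    lscale (a + b) f = lscale a f + lscale b f;
  lscale_compl : forall (X Y Z : ltcat) (a : K) (g : ahom Y Z) (f : ahom X Y),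
    lscale a (g \oc f) = lscale a g \oc f;
  lscale_compr : forall (X Y Z : ltcat) (a : K) (g : ahom Y Z) (f : ahom X Y),
    lscale a (g \oc f) = g \oc lscale a f;
  lscale_shift : forall (X Y : ltcat) (a : K) (f : ahom X Y),
    fmap shift (lscale a f) = lscale a (fmap shift f)
}.

Definition lhom (K : fieldType) (T : linear_triangulated_category K)
  (X Y : T) : Type := ahom X Y.

Section LinearHom.
Variables (K : fieldType) (T : linear_triangulated_category K).

HB.instance Definition _ (X Y : T) := GRing.Zmodule.on (lhom X Y).
HB.instance Definition _ (X Y : T) :=
  GRing.Zmodule_isLmodule.Build K (lhom X Y)
    (@lscaleA _ T X Y) (@lscale1 _ T X Y) (@lscaleDr _ T X Y)
    (@lscaleDl _ T X Y).

End LinearHom.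

Definition finite_dimensional (K : fieldType) (V : lmodType K) : Prop :=
  exists (n : nat) (e : 'I_n -> V),
    forall v : V, exists c : 'I_n -> K, v = \sum_(i < n) c i *: e i.

(** [algType] requires [1 != 0], which fails for the endomorphism ring of a zero
    object; hence the following variant. *)
Record kalgebra (K : fieldType) := KAlgebra {
  kalg_ring :> pzRingType;
  kalg_in : {rmorphism K -> kalg_ring};
  kalg_central : forall (c : K) (a : kalg_ring), kalg_in c * a = a * kalg_in c
}.

(** The product of [endo X] is composition, [a * b = a \oc b]. *)
Definition endo (K : fieldType) (T : linear_triangulated_category K)
  (X : T) : Type := lhom X X.

Section Endo.
Variables (K : fieldType) (T : linear_triangulated_category K) (X : T).

HB.instance Definition _ := GRing.Zmodule.on (endo X).
HB.instance Definition _ :=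
  GRing.Zmodule_isPzRing.Build (endo X)
    (@acompA T X X X X) (@acomp1l T X X) (@acomp1r T X X)
    (fun f g h => @acompDl T X X X f g h) (@acompDr T X X X).
Definition endo_in (c : K) : endo X := c *: (aid X : lhom X X).

Lemma endo_in_zmod_morphism : zmod_morphism endo_in.
Proof. by move=> a b; rewrite /endo_in scalerBl. Qed.

Lemma endo_in_monoid_morphism : monoid_morphism endo_in.
Proof.
split=> [|a b]; first exact: scale1r.
rewrite /endo_in -scalerA.
transitivity (lscale a (aid X \oc lscale b (aid X))).
  by rewrite acomp1l.
exact: lscale_compl.
Qed.

HB.instance Definition _ :=
  GRing.isZmodMorphism.Build K (endo X) endo_in endo_in_zmod_morphism.
HB.instance Definition _ :=
  GRing.isMonoidMorphism.Build K (endo X) endo_in endo_in_monoid_morphism.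

Lemma endo_in_central (c : K) (a : endo X) : endo_in c * a = a * endo_in c.
Proof.
transitivity (lscale c (aid X \oc a)); first by symmetry; exact: lscale_compl.
transitivity (lscale c (a \oc aid X)); first by rewrite acomp1l acomp1r.
exact: lscale_compr.
Qed.

Definition endo_algebra : kalgebra K := KAlgebra endo_in_central.

End Endo.

Section Exceptional.
Variables (K : fieldType) (T : linear_triangulated_category K).

Definition exceptional (X : T) : Prop :=
  bijective (fun c : K => c *: (aid X : lhom X X)) /\
  forall (n : int) (f : ahom X (shiftz n X)), n != 0 -> f = 0.

Definition exceptional_sequence (m : nat) (E : 'I_m -> T) : Prop :=
  (forall i, exceptional (E i)) /\
  (forall (i j : 'I_m) (n : int) (f : ahom (E i) (shiftz n (E j))),
     (j < i)%N -> f = 0).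

Definition full_sequence (m : nat) (E : 'I_m -> T) : Prop :=
  forall X : T, generated E X.

Definition strong_sequence (m : nat) (E : 'I_m -> T) : Prop :=
  forall (i j : 'I_m) (n : int) (f : ahom (E i) (shiftz n (E j))),
    n != 0 -> f = 0.

Definition full_strong_exceptional_sequence (m : nat) (E : 'I_m -> T) : Prop :=
  [/\ exceptional_sequence E, full_sequence E & strong_sequence E].

End Exceptional.

(** The structure that exact functors have to respect: a category with a shift
    and a class of distinguished triangles. *)

Record triangle_category := TriangleCategory {
  trcat :> category;
  trshift : functor trcat trcat;
  trdist : forall X Y Z : trcat,
    hom X Y -> hom Y Z -> hom Z (trshift X) -> Prop
}.

Arguments trshift {t}.
Arguments trdist {t X Y Z}.

Definition underlying_triangle_category (T : triangulated_category) :
    triangle_category :=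
  @TriangleCategory (add_cat T) (@shift T) (@dist T).

Coercion underlying_triangle_category :
  triangulated_category >-> triangle_category.

(** Only the exactness data are recorded: an equivalence between additive
    categories is automatically additive. *)
Record exact_equivalence (C D : triangle_category) := ExactEquivalence {
  eqv_functor :> functor C D;
  eqv_ff : fully_faithful eqv_functor;
  eqv_es : essentially_surjective eqv_functor;
  eqv_shift : forall X : C,
    hom (eqv_functor (trshift X)) (trshift (eqv_functor X));
  eqv_shift_iso : forall X, is_iso (eqv_shift X);
  eqv_shift_nat : forall (X Y : C) (f : hom X Y),
    heq (comp (eqv_shift Y) (fmap eqv_functor (fmap trshift f)))
        (comp (fmap trshift (fmap eqv_functor f)) (eqv_shift X));
  eqv_dist : forall (X Y Z : C)
    (u : hom X Y) (v : hom Y Z) (w : hom Z (trshift X)),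
    trdist u v w ->
    trdist (fmap eqv_functor u) (fmap eqv_functor v)
           (comp (eqv_shift X) (fmap eqv_functor w))
}.

(** Closure of a class [S] of triangles under isomorphism. *)
Definition iso_triangle (C : category) (F : functor C C)
    (S : forall X Y Z : C, hom X Y -> hom Y Z -> hom Z (F X) -> Prop)
    (X Y Z : C) (u : hom X Y) (v : hom Y Z) (w : hom Z (F X)) : Prop :=
  exists (X' Y' Z' : C) (u' : hom X' Y') (v' : hom Y' Z') (w' : hom Z' (F X'))
    (f : hom X' X) (g : hom Y' Y) (h : hom Z' Z),
    S X' Y' Z' u' v' w' /\
    [/\ is_iso f, is_iso g & is_iso h] /\
    [/\ heq (comp g u') (comp u f), heq (comp h v') (comp v g)
      & heq (comp (fmap F f) w') (comp w h)].

Section KernelCokernel.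
Variable A : additive_category.

Definition is_kernel (X Y Z : A) (i : ahom X Y) (p : ahom Y Z) : Prop :=
  p \oc i = 0 /\
  forall (W : A) (f : ahom W Y), p \oc f = 0 ->
    exists! g : ahom W X, i \oc g = f.

Definition is_cokernel (X Y Z : A) (i : ahom X Y) (p : ahom Y Z) : Prop :=
  p \oc i = 0 /\
  forall (W : A) (f : ahom Y W), f \oc i = 0 ->
    exists! g : ahom Z W, g \oc p = f.

Definition is_pushout (X Y X' Y' : A) (i : ahom X Y) (f : ahom X X')
    (f' : ahom Y Y') (i' : ahom X' Y') : Prop :=
  f' \oc i = i' \oc f /\
  forall (W : A) (a : ahom Y W) (b : ahom X' W), a \oc i = b \oc f ->
    exists! c : ahom Y' W, c \oc f' = a /\ c \oc i' = b.

Definition is_pullback (Y' Z' Y Z : A) (p' : ahom Y' Z') (f' : ahom Y' Y)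
    (f : ahom Z' Z) (p : ahom Y Z) : Prop :=
  p \oc f' = f \oc p' /\
  forall (W : A) (a : ahom W Y) (b : ahom W Z'), p \oc a = f \oc b ->
    exists! c : ahom W Y', f' \oc c = a /\ p' \oc c = b.

Definition inflation_of
    (conf : forall X Y Z : A, ahom X Y -> ahom Y Z -> Prop)
    (X Y : A) (i : ahom X Y) : Prop :=
  exists (Z : A) (p : ahom Y Z), conf X Y Z i p.

Definition deflation_of
    (conf : forall X Y Z : A, ahom X Y -> ahom Y Z -> Prop)
    (Y Z : A) (p : ahom Y Z) : Prop :=
  exists (X : A) (i : ahom X Y), conf X Y Z i p.

End KernelCokernel.

Record exact_category := ExactCategory {
  ecat :> additive_category;
  conflation : forall X Y Z : ecat, ahom X Y -> ahom Y Z -> Prop;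
  conflation_kernel : forall (X Y Z : ecat) (i : ahom X Y) (p : ahom Y Z),
    conflation i p -> is_kernel i p;
  conflation_cokernel : forall (X Y Z : ecat) (i : ahom X Y) (p : ahom Y Z),
    conflation i p -> is_cokernel i p;
  conflation_iso : forall (X Y Z X' Y' Z' : ecat)
    (i : ahom X Y) (p : ahom Y Z) (i' : ahom X' Y') (p' : ahom Y' Z')
    (a : ahom X X') (b : ahom Y Y') (c : ahom Z Z'),
    aiso a -> aiso b -> aiso c -> b \oc i = i' \oc a -> c \oc p = p' \oc b ->
    conflation i p -> conflation i' p';
  inflation_id : forall X : ecat, inflation_of conflation (aid X);
  deflation_id : forall X : ecat, deflation_of conflation (aid X);
  inflation_comp : forall (X Y Z : ecat) (i : ahom X Y) (j : ahom Y Z),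
    inflation_of conflation i -> inflation_of conflation j ->
    inflation_of conflation (j \oc i);
  deflation_comp : forall (X Y Z : ecat) (p : ahom X Y) (q : ahom Y Z),
    deflation_of conflation p -> deflation_of conflation q ->
    deflation_of conflation (q \oc p);
  inflation_pushout : forall (X Y X' : ecat) (i : ahom X Y) (f : ahom X X'),
    inflation_of conflation i ->
    exists (Y' : ecat) (f' : ahom Y Y') (i' : ahom X' Y'),
      is_pushout i f f' i' /\ inflation_of conflation i';
  deflation_pullback : forall (Y Z Z' : ecat) (p : ahom Y Z) (f : ahom Z' Z),
    deflation_of conflation p ->
    exists (Y' : ecat) (p' : ahom Y' Z') (f' : ahom Y' Y),
      is_pullback p' f' f p /\ deflation_of conflation p'
}.

Arguments conflation {e X Y Z}.

Definition inflation (A : exact_category) (X Y : A) (i : ahom X Y) : Prop :=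
  inflation_of (@conflation A) i.
Definition deflation (A : exact_category) (Y Z : A) (p : ahom Y Z) : Prop :=
  deflation_of (@conflation A) p.

Definition projective (A : exact_category) (P : A) : Prop :=
  forall (Y Z : A) (p : ahom Y Z) (f : ahom P Z), deflation p ->
    exists g : ahom P Y, p \oc g = f.

Definition injective_object (A : exact_category) (I : A) : Prop :=
  forall (X Y : A) (i : ahom X Y) (f : ahom X I), inflation i ->
    exists g : ahom Y I, g \oc i = f.

Record frobenius_category := FrobeniusCategory {
  frcat :> exact_category;
  enough_projectives : forall X : frcat,
    exists (Z P : frcat) (i : ahom Z P) (p : ahom P X),
      conflation i p /\ projective P;
  enough_injectives : forall X : frcat,
    exists (I Z : frcat) (i : ahom X I) (p : ahom I Z),
      conflation i p /\ injective_object I;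
  projective_injective : forall X : frcat, projective X <-> injective_object X
}.

Section AdditiveLemmas.
Variable A : additive_category.

Lemma acomp0l (X Y Z : A) (f : ahom X Y) : (0 : ahom Y Z) \oc f = 0.
Proof. by apply: (addIr (0 \oc f)); rewrite -acompDl !add0r. Qed.

Lemma acomp0r (X Y Z : A) (g : ahom Y Z) : g \oc (0 : ahom X Y) = 0.
Proof. by apply: (addIr (g \oc 0)); rewrite -acompDr !add0r. Qed.

Lemma acompNl (X Y Z : A) (g : ahom Y Z) (f : ahom X Y) :
  (- g) \oc f = - (g \oc f).
Proof. by apply: (addIr (g \oc f)); rewrite -acompDl !addNr acomp0l. Qed.

Lemma acompNr (X Y Z : A) (g : ahom Y Z) (f : ahom X Y) :
  g \oc (- f) = - (g \oc f).
Proof. by apply: (addIr (g \oc f)); rewrite -acompDr !addNr acomp0r. Qed.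

Lemma acompBl (X Y Z : A) (g g' : ahom Y Z) (f : ahom X Y) :
  (g - g') \oc f = g \oc f - g' \oc f.
Proof. by rewrite acompDl acompNl. Qed.

Lemma acompBr (X Y Z : A) (g : ahom Y Z) (f f' : ahom X Y) :
  g \oc (f - f') = g \oc f - g \oc f'.
Proof. by rewrite acompDr acompNr. Qed.

Lemma cokernel_epi (X Y Z W : A) (i : ahom X Y) (p : ahom Y Z)
    (g g' : ahom Z W) :
  is_cokernel i p -> g \oc p = g' \oc p -> g = g'.
Proof.
move=> [pi0 univ] e.
have [|h [_ uh]] := univ W (g \oc p); first by rewrite -acompA pi0 acomp0r.
by rewrite -(uh g erefl) -(uh g' (esym e)).
Qed.

End AdditiveLemmas.

Section Stable.
Variable A : frobenius_category.

Definition stably_trivial (X Y : A) (f : ahom X Y) : Prop :=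
  exists (P : A) (a : ahom X P) (b : ahom P Y), projective P /\ f = b \oc a.

Definition stable_eq (X Y : A) (f g : ahom X Y) : Prop :=
  stably_trivial (f - g).

Lemma projective0 : projective (azero : A).
Proof.
move=> Y Z p f _; exists 0; rewrite acomp0r.
by rewrite -[f]acomp1r aid_azero acomp0r.
Qed.

Lemma projective_oplus (P Q : A) :
  projective P -> projective Q -> projective (oplus P Q).
Proof.
move=> hP hQ Y Z p f hp.
have [g1 e1] := hP Y Z p (f \oc inj1 P Q) hp.
have [g2 e2] := hQ Y Z p (f \oc inj2 P Q) hp.
exists (g1 \oc prj1 P Q + g2 \oc prj2 P Q).
by rewrite acompDr !acompA e1 e2 -!acompA -acompDr oplus_id acomp1r.
Qed.

Lemma stably_trivial0 (X Y : A) : stably_trivial (0 : ahom X Y).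
Proof.
by exists azero, 0, 0; split; [exact: projective0 | rewrite acomp0r].
Qed.

Lemma stably_trivialN (X Y : A) (f : ahom X Y) :
  stably_trivial f -> stably_trivial (- f).
Proof.
by move=> [P [a [b [hP ->]]]]; exists P, a, (- b); rewrite acompNl.
Qed.

Lemma stably_trivialD (X Y : A) (f g : ahom X Y) :
  stably_trivial f -> stably_trivial g -> stably_trivial (f + g).
Proof.
move=> [P [a [b [hP ->]]]] [Q [c [d [hQ ->]]]].
exists (oplus P Q), (inj1 P Q \oc a + inj2 P Q \oc c),
  (b \oc prj1 P Q + d \oc prj2 P Q).
split; first exact: projective_oplus.
rewrite acompDl !acompDr -!acompA.
rewrite !(acompA (prj1 P Q)) !(acompA (prj2 P Q)).
rewrite prj1_inj1 prj1_inj2 prj2_inj1 prj2_inj2 !acomp0l !acomp1l !acomp0r.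
by rewrite addr0 add0r.
Qed.

Lemma stably_trivial_comp (X Y Z W : A)
    (h : ahom Z W) (f : ahom Y Z) (g : ahom X Y) :
  stably_trivial f -> stably_trivial (h \oc f \oc g).
Proof.
move=> [P [a [b [hP ->]]]]; exists P, (a \oc g), (h \oc b).
by rewrite !acompA.
Qed.

Lemma stable_refl (X Y : A) (f : ahom X Y) : stable_eq f f.
Proof. by rewrite /stable_eq subrr; exact: stably_trivial0. Qed.

Lemma stable_sym (X Y : A) (f g : ahom X Y) : stable_eq f g -> stable_eq g f.
Proof. by move=> /stably_trivialN; rewrite opprB. Qed.

Lemma stable_trans (X Y : A) (f g h : ahom X Y) :
  stable_eq f g -> stable_eq g h -> stable_eq f h.
Proof. by move=> e1 /(stably_trivialD e1); rewrite addrA subrK. Qed.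

Lemma stable_comp (X Y Z : A) (g g' : ahom Y Z) (f f' : ahom X Y) :
  stable_eq g g' -> stable_eq f f' -> stable_eq (g \oc f) (g' \oc f').
Proof.
move=> eg ef; rewrite /stable_eq.
have -> : g \oc f - g' \oc f'
    = aid Z \oc (g - g') \oc f + g' \oc (f - f') \oc aid X.
  by rewrite acomp1l acomp1r acompBl acompBr addrA subrK.
by apply: stably_trivialD; exact: stably_trivial_comp.
Qed.

Definition stable_cat : category :=
  @Category A (fun X Y => ahom X Y : Type) stable_eq
    (fun X => aid X) (fun X Y Z g f => g \oc f)
    stable_refl stable_sym stable_trans stable_comp
    (fun X Y Z W h g f => eq_ind _ (stable_eq (h \oc (g \oc f)))
       (stable_refl _) _ (acompA h g f))
    (fun X Y f => eq_ind_r (fun x => stable_eq x f)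
       (stable_refl f) (acomp1l f))
    (fun X Y f => eq_ind_r (fun x => stable_eq x f)
       (stable_refl f) (acomp1r f)).

(** A chosen conflation [X -> hull X -> cosyz X] with [hull X] injective; the
    shift of the stable category is [cosyz]. *)

Definition hull_data (X : A) :=
  cid (enough_injectives X).
Definition hull (X : A) : A := projT1 (hull_data X).
Definition cosyz_data (X : A) := cid (projT2 (hull_data X)).
Definition cosyz (X : A) : A := projT1 (cosyz_data X).
Definition hull_in_data (X : A) := cid (projT2 (cosyz_data X)).
Definition hull_in (X : A) : ahom X (hull X) := projT1 (hull_in_data X).
Definition hull_out_data (X : A) := cid (projT2 (hull_in_data X)).
Definition hull_out (X : A) : ahom (hull X) (cosyz X) :=
  projT1 (hull_out_data X).

Lemma hull_conflation (X : A) : conflation (hull_in X) (hull_out X).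
Proof. by case: (projT2 (hull_out_data X)). Qed.

Lemma hull_injective (X : A) : injective_object (hull X).
Proof. by case: (projT2 (hull_out_data X)). Qed.

Lemma hull_inflation (X : A) : inflation (hull_in X).
Proof. by exists (cosyz X), (hull_out X); exact: hull_conflation. Qed.

Lemma hull_cokernel (X : A) : is_cokernel (hull_in X) (hull_out X).
Proof. exact: conflation_cokernel (hull_conflation X). Qed.

Definition cosyz_lift (X Y : A) (f : ahom X Y) (g : ahom (cosyz X) (cosyz Y)) :
    Prop :=
  exists h : ahom (hull X) (hull Y),
    h \oc hull_in X = hull_in Y \oc f /\ g \oc hull_out X = hull_out Y \oc h.

Lemma cosyz_lift_exists (X Y : A) (f : ahom X Y) : exists g, cosyz_lift f g.
Proof.
have [h hE] := hull_injective (hull_in Y \oc f) (hull_inflation X).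
have [|g [gE _]] := (hull_cokernel X).2 _ (hull_out Y \oc h).
  by rewrite -acompA hE acompA (hull_cokernel Y).1 acomp0l.
by exists g, h.
Qed.

Lemma cosyz_lift_uniq (X Y : A) (f f' : ahom X Y)
    (g g' : ahom (cosyz X) (cosyz Y)) :
  stable_eq f f' -> cosyz_lift f g -> cosyz_lift f' g' -> stable_eq g g'.
Proof.
move=> [P [a [b [hP ff']]]] [h [h1 h2]] [h' [h1' h2']].
have [a' a'E] : exists a' : ahom (hull X) P, a' \oc hull_in X = a.
  by have [iP _] := projective_injective P; exact: iP hP _ _ _ _ (hull_inflation X).
have [|t [tE _]] :=
    (hull_cokernel X).2 _ (h - h' - hull_in Y \oc b \oc a').
  rewrite !acompBl h1 h1' -!acompA a'E -ff' acompBr.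
  by rewrite subrr.
exists (hull Y), t, (hull_out Y); split.
  by apply/projective_injective; exact: hull_injective.
apply: (cokernel_epi (hull_cokernel X)).
rewrite acompBl h2 h2' -acompA tE !acompBr !acompA (hull_cokernel Y).1.
by rewrite !acomp0l subr0.
Qed.

Definition cosyz_map (X Y : A) (f : ahom X Y) : ahom (cosyz X) (cosyz Y) :=
  projT1 (cid (cosyz_lift_exists f)).

Lemma cosyz_mapP (X Y : A) (f : ahom X Y) : cosyz_lift f (cosyz_map f).
Proof. exact: projT2 (cid (cosyz_lift_exists f)). Qed.

Lemma cosyz_map_heq (X Y : A) (f g : ahom X Y) :
  stable_eq f g -> stable_eq (cosyz_map f) (cosyz_map g).
Proof. by move=> e; apply: (cosyz_lift_uniq e); exact: cosyz_mapP. Qed.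

Lemma cosyz_map_id (X : A) : stable_eq (cosyz_map (aid X)) (aid (cosyz X)).
Proof.
apply: (cosyz_lift_uniq (stable_refl (aid X))); first exact: cosyz_mapP.
by exists (aid (hull X)); rewrite !acomp1l !acomp1r.
Qed.

Lemma cosyz_map_comp (X Y Z : A) (g : ahom Y Z) (f : ahom X Y) :
  stable_eq (cosyz_map (g \oc f)) (cosyz_map g \oc cosyz_map f).
Proof.
apply: (cosyz_lift_uniq (stable_refl (g \oc f))); first exact: cosyz_mapP.
have [h [h1 h2]] := cosyz_mapP f; have [k [k1 k2]] := cosyz_mapP g.
exists (k \oc h); split; first by rewrite -acompA h1 acompA k1 acompA.
by rewrite -acompA h2 acompA k2 acompA.
Qed.

Definition stable_shift : functor stable_cat stable_cat :=
  @Functor stable_cat stable_cat cosyz cosyz_map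
    cosyz_map_heq cosyz_map_id cosyz_map_comp.

(** A conflation [X -i-> Y -p-> Z] gives the triangle [(i, p, w)], where [w] is
    induced on cokernels by an extension [e : Y -> hull X] of [hull_in X]. *)
Definition stable_standard (X Y Z : A)
    (i : ahom X Y) (p : ahom Y Z) (w : ahom Z (cosyz X)) : Prop :=
  conflation i p /\
  exists e : ahom Y (hull X), e \oc i = hull_in X /\ w \oc p = hull_out X \oc e.

Definition stable_triangle_category : triangle_category :=
  @TriangleCategory stable_cat stable_shift
    (@iso_triangle stable_cat stable_shift stable_standard).

End Stable.

Definition algebraic (T : triangulated_category) : Prop :=
  exists A : frobenius_category,
    inhabited (exact_equivalence (stable_triangle_category A) T).

Section Localization.
Variables (C : category) (W : forall X Y : C, hom X Y -> Prop).

Inductive zigzag (X : C) : C -> Type :=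
| zz_nil : zigzag X X
| zz_fwd Y Z : zigzag X Y -> hom Y Z -> zigzag X Z
| zz_bwd Y Z (s : hom Z Y) : zigzag X Y -> W s -> zigzag X Z.

Inductive zz_eq (X : C) : forall Y : C, zigzag X Y -> zigzag X Y -> Prop :=
| zz_refl Y (p : zigzag X Y) : zz_eq p p
| zz_sym Y (p q : zigzag X Y) : zz_eq p q -> zz_eq q p
| zz_trans Y (p q r : zigzag X Y) : zz_eq p q -> zz_eq q r -> zz_eq p r
| zz_fwd_eq Y Z (p q : zigzag X Y) (f g : hom Y Z) :
    zz_eq p q -> heq f g -> zz_eq (zz_fwd p f) (zz_fwd q g)
| zz_bwd_eq Y Z (p q : zigzag X Y) (s : hom Z Y) (Ws Ws' : W s) :
    zz_eq p q -> zz_eq (zz_bwd p Ws) (zz_bwd q Ws')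
| zz_id Y (p : zigzag X Y) : zz_eq (zz_fwd p (idc Y)) p
| zz_comp Y Z U (p : zigzag X Y) (f : hom Y Z) (g : hom Z U) :
    zz_eq (zz_fwd (zz_fwd p f) g) (zz_fwd p (comp g f))
| zz_invl Y Z (p : zigzag X Y) (s : hom Z Y) (Ws : W s) :
    zz_eq (zz_fwd (zz_bwd p Ws) s) p
| zz_invr Y Z (p : zigzag X Z) (s : hom Z Y) (Ws : W s) :
    zz_eq (zz_bwd (zz_fwd p s) Ws) p.

Fixpoint zz_cat (X Y Z : C) (p : zigzag X Y) (q : zigzag Y Z) : zigzag X Z :=
  match q in zigzag _ Z return zigzag X Z with
  | zz_nil => p
  | zz_fwd _ _ q f => zz_fwd (zz_cat p q) f
  | zz_bwd _ _ _ q Ws => zz_bwd (zz_cat p q) Ws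
  end.

Lemma zz_cat_eql (X Y Z : C) (p p' : zigzag X Y) (q : zigzag Y Z) :
  zz_eq p p' -> zz_eq (zz_cat p q) (zz_cat p' q).
Proof.
move=> e; elim: q => [//|U V q IH f|U V s q IH Ws] /=.
  by apply: zz_fwd_eq (heq_refl f); exact: IH.
by apply: zz_bwd_eq; exact: IH.
Qed.

Lemma zz_cat_eqr (X Y Z : C) (p : zigzag X Y) (q q' : zigzag Y Z) :
  zz_eq q q' -> zz_eq (zz_cat p q) (zz_cat p q').
Proof.
elim=> {q q'} /=.
- by move=> U q; exact: zz_refl.
- by move=> U q q' _; exact: zz_sym.
- by move=> U q q' q'' _ e _; exact: zz_trans.
- by move=> U V q q' f g _ e fg; exact: zz_fwd_eq.
- by move=> U V q q' s Ws Ws' _ e; exact: zz_bwd_eq.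
- by move=> U q; exact: zz_id.
- by move=> U V V' q f g; exact: zz_comp.
- by move=> U V q s Ws; exact: zz_invl.
- by move=> U V q s Ws; exact: zz_invr.
Qed.

Lemma zz_catA (X Y Z U : C) (p : zigzag X Y) (q : zigzag Y Z) (r : zigzag Z U) :
  zz_cat p (zz_cat q r) = zz_cat (zz_cat p q) r.
Proof. by elim: r => [//|V V' r IH f|V V' s r IH Ws] /=; rewrite IH. Qed.

Lemma zz_cat_nil (X Y : C) (q : zigzag X Y) : zz_cat (zz_nil X) q = q.
Proof. by elim: q => [//|V V' r IH f|V V' s r IH Ws] /=; rewrite IH. Qed.

Program Definition localization : category :=
  @Category C zigzag (@zz_eq) zz_nil (fun X Y Z q p => zz_cat p q)
    (@zz_refl) (@zz_sym) (@zz_trans) _ _ _ _.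
Next Obligation.
move=> X Y Z q q' p p' eq ep; apply: (zz_trans (zz_cat_eql q ep)).
exact: zz_cat_eqr.
Qed.
Next Obligation. by move=> X Y Z U r q p; rewrite /= zz_catA; exact: zz_refl. Qed.
Next Obligation. by move=> X Y p; exact: zz_refl. Qed.
Next Obligation. by move=> X Y p; rewrite /= zz_cat_nil; exact: zz_refl. Qed.

Program Definition loc_functor : functor C localization :=
  @Functor C localization id (fun X Y f => zz_fwd (zz_nil X) f) _ _ _.
Next Obligation. by move=> X Y f g e; apply: zz_fwd_eq => //; exact: zz_refl. Qed.
Next Obligation. by move=> X; exact: zz_id. Qed.
Next Obligation. by move=> X Y Z g f; apply: zz_sym; exact: zz_comp. Qed.

Variable F : functor C C.
Hypothesis FW : forall (X Y : C) (s : hom X Y), W s -> W (fmap F s).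

Fixpoint zz_map (X Y : C) (p : zigzag X Y) : zigzag (F X) (F Y) :=
  match p in zigzag _ Y return zigzag (F X) (F Y) with
  | zz_nil => zz_nil (F X)
  | zz_fwd _ _ p f => zz_fwd (zz_map p) (fmap F f)
  | zz_bwd _ _ _ p Ws => zz_bwd (zz_map p) (FW Ws)
  end.

Lemma zz_map_eq (X Y : C) (p q : zigzag X Y) :
  zz_eq p q -> zz_eq (zz_map p) (zz_map q).
Proof.
elim=> {p q} /=.
- by move=> U p; exact: zz_refl.
- by move=> U p q _; exact: zz_sym.
- by move=> U p q r _ e _; exact: zz_trans.
- by move=> U V p q f g _ e fg; apply: zz_fwd_eq => //; exact: fmap_heq.
- by move=> U V p q s Ws Ws' _ e; exact: zz_bwd_eq.
- move=> U p; apply: (zz_trans _ (zz_id _)).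
  by apply: zz_fwd_eq; [exact: zz_refl | exact: fmap_id].
- move=> U V V' p f g; apply: (zz_trans (zz_comp _ _ _)).
  by apply: zz_fwd_eq; [exact: zz_refl | apply: heq_sym; exact: fmap_comp].
- by move=> U V p s Ws; exact: zz_invl.
- by move=> U V p s Ws; exact: zz_invr.
Qed.

Lemma zz_map_cat (X Y Z : C) (p : zigzag X Y) (q : zigzag Y Z) :
  zz_map (zz_cat p q) = zz_cat (zz_map p) (zz_map q).
Proof. by elim: q => [//|V V' r IH f|V V' s r IH Ws] /=; rewrite IH. Qed.

Program Definition loc_endofunctor : functor localization localization :=
  @Functor localization localization F zz_map zz_map_eq _ _.
Next Obligation. by move=> X; exact: zz_refl. Qed.
Next Obligation. by move=> X Y Z q p; rewrite /= zz_map_cat; exact: zz_refl. Qed.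

End Localization.

Section Modules.
Variables (K : fieldType) (A : kalgebra K).

Record fdmod := FdMod {
  fdcar :> vectType K;
  act : fdcar -> A -> fdcar;
  act_linl : forall a, linear (act^~ a);
  act_addr : forall v a b, act v (a + b) = act v a + act v b;
  act_in : forall v c, act v (kalg_in A c) = c *: v;
  actM : forall v a b, act v (a * b) = act (act v a) b
}.

Record mhom (M N : fdmod) := MHom {
  mfun :> M -> N;
  mfun_lin : linear mfun;
  mfun_act : forall v a, mfun (act v a) = act (mfun v) a
}.

Lemma mhomD (M N : fdmod) (f : mhom M N) u v : f (u + v) = f u + f v.
Proof. by have := mfun_lin f 1 u v; rewrite !scale1r. Qed.

Lemma mhom0 (M N : fdmod) (f : mhom M N) : f 0 = 0.
Proof. by apply: (addIr (f 0)); rewrite -mhomD !add0r. Qed.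

Lemma mhomZ (M N : fdmod) (f : mhom M N) c u : f (c *: u) = c *: f u.
Proof. by have := mfun_lin f c u 0; rewrite mhom0 !addr0. Qed.

Lemma mhomN (M N : fdmod) (f : mhom M N) u : f (- u) = - f u.
Proof. by rewrite -!scaleN1r mhomZ. Qed.

Lemma actD (M : fdmod) (u v : M) a : act (u + v) a = act u a + act v a.
Proof. by have := act_linl a 1 u v; rewrite !scale1r. Qed.

Lemma act0 (M : fdmod) a : act (0 : M) a = 0.
Proof. by apply: (addIr (act 0 a)); rewrite -actD !add0r. Qed.

Lemma actZ (M : fdmod) c (u : M) a : act (c *: u) a = c *: act u a.
Proof. by have := act_linl a c u 0; rewrite act0 !addr0. Qed.

Program Definition mhom_id (M : fdmod) : mhom M M := @MHom M M id _ _.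
Next Obligation. by []. Qed.
Next Obligation. by []. Qed.

Program Definition mhom_comp (M N P : fdmod) (g : mhom N P) (f : mhom M N) :
  mhom M P := @MHom M P (fun v => g (f v)) _ _.
Next Obligation. by move=> M N P g f c u v /=; rewrite !mfun_lin. Qed.
Next Obligation. by move=> M N P g f v a /=; rewrite !mfun_act. Qed.

Program Definition mhom_lin (M N : fdmod) (c : K) (f g : mhom M N) :
  mhom M N := @MHom M N (fun v => c *: f v + g v) _ _.
Next Obligation.
move=> M N c f g b u v /=; rewrite !mfun_lin !scalerDr !scalerA mulrC.
by rewrite addrACA.
Qed.
Next Obligation. by move=> M N c f g v a /=; rewrite !mfun_act actD actZ. Qed.

Program Definition mhom_opp (M N : fdmod) (f : mhom M N) : mhom M N :=
  @MHom M N (fun v => - f v) _ _.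
Next Obligation. by move=> M N f c u v /=; rewrite mfun_lin opprD scalerN. Qed.
Next Obligation.
by move=> M N f v a /=; rewrite mfun_act -!scaleN1r actZ.
Qed.

Program Definition mprod (M N : fdmod) : fdmod :=
  @FdMod (M * N)%type (fun v a => (act v.1 a, act v.2 a)) _ _ _ _.
Next Obligation. by move=> M N a c [u u'] [v v'] /=; rewrite !act_linl. Qed.
Next Obligation. by move=> M N [u u'] a b /=; rewrite !act_addr. Qed.
Next Obligation. by move=> M N [u u'] c /=; rewrite !act_in. Qed.
Next Obligation. by move=> M N [u u'] a b /=; rewrite !actM. Qed.

Record bcomplex := BComplex {
  cx :> int -> fdmod;
  cd : forall n, mhom (cx n) (cx (n + 1));
  cdd : forall n (x : cx n), cd (n + 1) (cd n x) = 0;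
  cx_bounded : exists N : nat,
    forall n : int, (N < `|n|)%N -> forall x : cx n, x = 0
}.

Record cmap (X Y : bcomplex) := CMap {
  cfun :> forall n, mhom (X n) (Y n);
  cfunE : forall n (x : X n), cfun (n + 1) (cd X n x) = cd Y n (cfun n x)
}.

Definition cmap_eq (X Y : bcomplex) (f g : cmap X Y) : Prop :=
  forall n (x : X n), f n x = g n x.

Program Definition cmap_id (X : bcomplex) : cmap X X :=
  @CMap X X (fun n => mhom_id (X n)) _.
Next Obligation. by []. Qed.

Program Definition cmap_comp (X Y Z : bcomplex) (g : cmap Y Z) (f : cmap X Y) :
  cmap X Z := @CMap X Z (fun n => mhom_comp (g n) (f n)) _.
Next Obligation. by move=> X Y Z g f n x /=; rewrite !cfunE. Qed.

Program Definition cmap_lin (X Y : bcomplex) (c : K) (f g : cmap X Y) :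
  cmap X Y := @CMap X Y (fun n => mhom_lin c (f n) (g n)) _.
Next Obligation. by move=> X Y c f g n x /=; rewrite !cfunE mfun_lin. Qed.

Program Definition complex_cat : category :=
  @Category bcomplex cmap cmap_eq cmap_id (fun X Y Z => @cmap_comp X Y Z)
    _ _ _ _ _ _ _.
Next Obligation. by []. Qed.
Next Obligation. by move=> X Y f g e n x; rewrite e. Qed.
Next Obligation. by move=> X Y f g h e e' n x; rewrite e. Qed.
Next Obligation. by move=> X Y Z g g' f f' e e' n x /=; rewrite e e'. Qed.
Next Obligation. by []. Qed.
Next Obligation. by []. Qed.
Next Obligation. by []. Qed.

Program Definition cshift (X : bcomplex) : bcomplex :=
  @BComplex (fun n => X (n + 1)) (fun n => mhom_opp (cd X (n + 1))) _ _.
Next Obligation. by move=> X n x /=; rewrite mhomN opprK cdd. Qed.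
Next Obligation.
move=> X; have [N hN] := cx_bounded X; exists N.+1 => n hn x.
by apply: hN; move: hn; lia.
Qed.

Program Definition cshift_map (X Y : bcomplex) (f : cmap X Y) :
  cmap (cshift X) (cshift Y) :=
  @CMap (cshift X) (cshift Y) (fun n => f (n + 1)) _.
Next Obligation. by move=> X Y f n x /=; rewrite mhomN cfunE. Qed.

Program Definition cshift_functor : functor complex_cat complex_cat :=
  @Functor complex_cat complex_cat cshift cshift_map _ _ _.
Next Obligation. by move=> X Y f g e n x; exact: e. Qed.
Next Obligation. by []. Qed.
Next Obligation. by []. Qed.

Section Cone.
Variables (X Y : bcomplex) (f : cmap X Y).

Program Definition cone_d (n : int) :
  mhom (mprod (X (n + 1)) (Y n)) (mprod (X (n + 1 + 1)) (Y (n + 1))) :=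
  @MHom (mprod (X (n + 1)) (Y n)) (mprod (X (n + 1 + 1)) (Y (n + 1)))
    (fun v => (- cd X (n + 1) v.1, f (n + 1) v.1 + cd Y n v.2)) _ _.
Next Obligation.
move=> n c [u u'] [v v'] /=; rewrite !mfun_lin opprD -scalerN.
by congr pair; rewrite /= scalerDr addrACA.
Qed.
Next Obligation.
move=> n [u u'] a /=; rewrite !mfun_act actD -!scaleN1r actZ.
by [].
Qed.

Program Definition cone : bcomplex :=
  @BComplex (fun n => mprod (X (n + 1)) (Y n)) cone_d _ _.
Next Obligation.
move=> n [x y] /=; rewrite mhomN cdd oppr0 mhomN cfunE mhomD cdd addr0.
by rewrite addNr oppr0.
Qed.
Next Obligation.
have [N hN] := cx_bounded X; have [N' hN'] := cx_bounded Y.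
exists (maxn N N').+1 => n hn [x y].
by congr pair; [apply: hN | apply: hN']; move: hn; lia.
Qed.

Program Definition cone_in : cmap Y cone :=
  @CMap Y cone (fun n => @MHom (Y n) (cone n) (fun y => (0, y)) _ _) _.
Next Obligation. by move=> n c u v; congr pair; rewrite /= scaler0 addr0. Qed.
Next Obligation. by move=> n v a /=; rewrite act0. Qed.
Next Obligation. by move=> n y /=; rewrite !mhom0 oppr0 add0r. Qed.

Program Definition cone_out : cmap cone (cshift X) :=
  @CMap cone (cshift X) (fun n => @MHom (cone n) (cshift X n) fst _ _) _.
Next Obligation. by []. Qed.
Next Obligation. by []. Qed.
Next Obligation. by []. Qed.

End Cone.

(** [H^(n + 1) f] is injective and surjective for every [n]; degrees are written
    [n + 1] so that coboundaries come from degree [n] without a cast. *)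
Definition quasi_iso (X Y : bcomplex) (f : cmap X Y) : Prop :=
  forall n : int,
    (forall x : X (n + 1), cd X (n + 1) x = 0 ->
       (exists y : Y n, f (n + 1) x = cd Y n y) ->
       exists z : X n, x = cd X n z) /\
    (forall y : Y (n + 1), cd Y (n + 1) y = 0 ->
       exists (x : X (n + 1)) (z : Y n),
         cd X (n + 1) x = 0 /\ y = f (n + 1) x + cd Y n z).

Lemma cshift_quasi_iso (X Y : bcomplex) (f : cmap X Y) :
  quasi_iso f -> quasi_iso (cshift_map f).
Proof.
move=> qf n; have [inj sur] := qf (n + 1); split=> [x /= dx [y fy]|y /= dy].
  have [||z ->] := inj x; first by rewrite -[LHS]opprK dx oppr0.
    by exists (- y); rewrite mhomN.
  by exists (- z); rewrite mhomN opprK.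
have [|x [z [dx ->]]] := sur y; first by rewrite -[LHS]opprK dy oppr0.
by exists x, (- z); rewrite dx oppr0 mhomN opprK.
Qed.

Definition derived_cat : category := @localization complex_cat quasi_iso.

Definition derived_functor : functor complex_cat derived_cat :=
  @loc_functor complex_cat quasi_iso.

Definition derived_shift : functor derived_cat derived_cat :=
  @loc_endofunctor complex_cat quasi_iso cshift_functor cshift_quasi_iso.

Inductive cone_triangle : forall X Y Z : derived_cat,
    hom X Y -> hom Y Z -> hom Z (derived_shift X) -> Prop :=
| ConeTriangle (X Y : bcomplex) (f : cmap X Y) :
    @cone_triangle X Y (cone f)
      (fmap derived_functor (f : @hom complex_cat X Y))
      (fmap derived_functor (cone_in f : @hom complex_cat Y (cone f)))
      (fmap derived_functor
         (cone_out f : @hom complex_cat (cone f) (cshift X))).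

Definition derived_triangle_category : triangle_category :=
  @TriangleCategory derived_cat derived_shift
    (@iso_triangle derived_cat derived_shift cone_triangle).

End Modules.

(** The linear structure of the derived category is the one that makes the
    localization functor from complexes linear, so linearity of a functor out of
    it is tested on complexes. *)
Definition derived_equivalent (K : fieldType)
    (T : linear_triangulated_category K) (A : kalgebra K) : Prop :=
  exists G : exact_equivalence (derived_triangle_category A) T,
    forall (X Y : bcomplex A) (c : K) (f g : cmap X Y),
      let GQ (h : cmap X Y) : lhom (G X) (G Y) :=
        fmap G (fmap (derived_functor A) (h : @hom (complex_cat A) X Y)) in
      GQ (cmap_lin c f g) = c *: GQ f + GQ g.

(* Main.v *)
From Stdlib Require Import Setoid Morphisms.
From HB Require Import structures.
Require Import Defs.
From mathcomp Require Import all_boot all_order all_algebra.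
From mathcomp Require Import boolp zify.
Require Import Defs.

(** Twisted complexes over [E1, E2] (graded sums of shifted copies of the [Ei]
    with a differential that uses only the maps of degree zero) form a Frobenius
    category whose stable category is their homotopy category. As there are no maps
    from [E2] to [E1] and nonzero endomorphisms of the [Ei] are invertible, Gaussian
    elimination and the vanishing of the square of the differential split every
    twisted complex into shifts of two-term complexes [S1 -> S2], where [Si] is a
    sum of copies of [Ei]. A two-term complex is sent to a cone of the corresponding
    map of [T]. Maps between shifts of cones are commutative squares in degree zero,
    extensions in degree one, and vanish otherwise, on both sides and compatibly with
    composition: this makes the assignment a fully faithful functor although cones
    are not functorial. It is exact by reduction, through the octahedral axiom, to
    triangles between objects concentrated in two consecutive degrees, and its image
    contains the generators.

    The functor [Hom(E1 (+) E2, -)] turns twisted complexes into bounded complexes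
    of modules over the endomorphism algebra. These are K-projective, and every
    bounded complex of modules has such a resolution, obtained by first covering the
    [e2]-part and then the [e1]-part; hence maps in the derived category out of them
    are homotopy classes of chain maps. *)

Set Implicit Arguments.
Unset Strict Implicit.
Unset Printing Implicit Defensive.

Import GRing.Theory.
Local Open Scope ring_scope.
#[local] Obligation Tactic := idtac.

(** * Subgroups and quotients of abelian groups *)

(** [T] carries no enhancement, so a functor into it cannot be defined by forming cones. What
    replaces coherence is rigidity. Let [S1 -> S2] and [S1' -> S2'] have cones shifted by [k] and
    [l]. Since there are no maps from shifts of [S2] to shifts of [S1'], a morphism of cones that
    vanishes on both ends factors through a map from [S1] shifted by [k + 1] to [S2'] shifted by
    [l], and this is zero unless [l = k + 1]. Hence for [l = k] a commutative square has exactly one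
    fill-in, and identities and composites are preserved automatically; for [l = k + 1] there is an
    explicit formula, and a product of two such maps is zero. The same vanishing serves again for
    exactness: the octahedral axiom describes a cone of the image of a map only up to an
    uncontrolled isomorphism, and the error lies in a group of maps that lower the index [k], which
    is zero. Signs of the two shifts have to be matched with care, because connecting morphisms
    enter the maps of degree one. *)

Record zsub (V : zmodType) := ZSub {
  zin :> V -> Prop;
  zin0 : zin 0;
  zinB : forall x y, zin x -> zin y -> zin (x - y)
}.

Lemma zinN (V : zmodType) (S : zsub V) x : S x -> S (- x).
Proof. by move=> Sx; rewrite -sub0r; apply: zinB => //; exact: zin0. Qed.

Lemma zinD (V : zmodType) (S : zsub V) x y : S x -> S y -> S (x + y).
Proof. by move=> Sx Sy; rewrite -[y]opprK; apply: zinB => //; exact: zinN. Qed.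

(** Membership is made boolean with [asbool], so that elements are equal as soon as their values
    are, and the choice structure is inherited. *)
Definition zsubT (V : zmodType) (S : zsub V) := {x : V | `[< S x >]}.

Section ZSub.
Variables (V : zmodType) (S : zsub V).

HB.instance Definition _ := Choice.copy (zsubT S) {x : V | `[< S x >]}.

Definition zmk (x : V) (Sx : S x) : zsubT S := exist _ x (asboolT Sx).

Lemma zsP (x : zsubT S) : S (sval x).
Proof. by apply/asboolP; case: x. Qed.

Lemma zs_inj (x y : zsubT S) : sval x = sval y -> x = y.
Proof. by move=> e; exact: val_inj. Qed.

Definition zs0 : zsubT S := zmk (zin0 S).
Definition zsN (x : zsubT S) : zsubT S := zmk (zinN (zsP x)).
Definition zsD (x y : zsubT S) : zsubT S := zmk (zinD (zsP x) (zsP y)).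

Lemma zsDA : associative zsD.
Proof. by move=> x y z; apply: zs_inj; rewrite /= addrA. Qed.
Lemma zsDC : commutative zsD.
Proof. by move=> x y; apply: zs_inj; rewrite /= addrC. Qed.
Lemma zs0D : left_id zs0 zsD.
Proof. by move=> x; apply: zs_inj; rewrite /= add0r. Qed.
Lemma zsND : left_inverse zs0 zsN zsD.
Proof. by move=> x; apply: zs_inj; rewrite /= addNr. Qed.

HB.instance Definition _ := GRing.isZmodule.Build (zsubT S) zsDA zsDC zs0D zsND.

Definition zrep (x : V) : V := sval (cid (ex_intro (fun y => S (x - y)) x
  (eq_ind_r S (zin0 S) (subrr x)))).

Lemma zrepP x : S (x - zrep x).
Proof. by rewrite /zrep; case: cid. Qed.

(** Congruent elements have the same predicate [fun y => S (x - y)], by functional and propositional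
    extensionality, and the representative is chosen from that predicate. *)
Lemma zrep_eq x y : S (x - y) -> zrep x = zrep y.
Proof.
move=> Sxy; rewrite /zrep; set ex := ex_intro _ _ _; set ey := ex_intro _ _ _.
have e : (fun z => S (x - z)) = (fun z => S (y - z)).
  apply: funext => z; apply: propext; split=> h.
    by rewrite -(subrKA x); apply: zinD => //; rewrite -opprB; exact: zinN.
  by rewrite -(subrKA y); exact: zinD.
by move: ex ey; rewrite e => ex ey; rewrite (Prop_irrelevance ex ey).
Qed.

(** The quotient is realised as the set of chosen representatives, so congruence becomes Leibniz
    equality, as the homs of an [additive_category] require. *)
Definition zquotT := {x : V | `[< zrep x = x >]}.
HB.instance Definition _ := Choice.copy zquotT {x : V | `[< zrep x = x >]}.

Lemma zrepK x : zrep (zrep x) = zrep x.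
Proof. by apply/esym/zrep_eq/zrepP. Qed.

Definition zpi (x : V) : zquotT := exist _ (zrep x) (asboolT (zrepK x)).
Definition zval (x : zquotT) : V := sval x.

Lemma zvalK x : zpi (zval x) = x.
Proof. by apply: val_inj => /=; apply/asboolP; case: x. Qed.

Lemma zpi_eq x y : zpi x = zpi y <-> S (x - y).
Proof.
split=> [/(congr1 val) /= e|/zrep_eq e]; last exact: val_inj.
have := zinB (zrepP x) (zrepP y).
by rewrite e opprB addrA subrK.
Qed.

Definition zq0 : zquotT := zpi 0.
Definition zqN (x : zquotT) : zquotT := zpi (- zval x).
Definition zqD (x y : zquotT) : zquotT := zpi (zval x + zval y).

Lemma zval_pi x : S (x - zval (zpi x)).
Proof. exact: zrepP. Qed.

Lemma zpiD_ x y : zqD (zpi x) (zpi y) = zpi (x + y).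
Proof.
apply/esym/zpi_eq; rewrite opprD addrACA.
by apply: zinD; exact: zval_pi.
Qed.
Lemma zpiN_ x : zqN (zpi x) = zpi (- x).
Proof. by apply/esym/zpi_eq; rewrite -opprD; apply: zinN; exact: zval_pi. Qed.

Lemma zqDA : associative zqD.
Proof.
by move=> x y z; rewrite -(zvalK x) -(zvalK y) -(zvalK z) !zpiD_ addrA.
Qed.
Lemma zqDC : commutative zqD.
Proof. by move=> x y; rewrite -(zvalK x) -(zvalK y) !zpiD_ addrC. Qed.
Lemma zq0D : left_id zq0 zqD.
Proof. by move=> x; rewrite -(zvalK x) !zpiD_ add0r. Qed.
Lemma zqND : left_inverse zq0 zqN zqD.
Proof. by move=> x; rewrite -(zvalK x) zpiN_ zpiD_ addNr. Qed.

HB.instance Definition _ := GRing.isZmodule.Build zquotT zqDA zqDC zq0D zqND.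

Lemma zpiD x y : zpi (x + y) = zpi x + zpi y.
Proof. by rewrite -zpiD_. Qed.
Lemma zpiN x : zpi (- x) = - zpi x.
Proof. by rewrite -zpiN_. Qed.
Lemma zpi0 : zpi 0 = 0.
Proof. by []. Qed.
Lemma zpi_surj (y : zquotT) : exists x, zpi x = y.
Proof. by exists (zval y); exact: zvalK. Qed.

End ZSub.

(* A decision procedure for equalities in abelian groups, by comparing integer
   coefficient vectors. *)
Inductive zexp := ZVar of nat | ZZero | ZAdd of zexp & zexp | ZOpp of zexp.

Fixpoint zeval (V : zmodType) (env : seq V) (e : zexp) : V :=
  match e with
  | ZVar n => nth 0 env n
  | ZZero => 0
  | ZAdd a b => zeval env a + zeval env b
  | ZOpp a => - zeval env a
  end.

Fixpoint zcoef (e : zexp) (n : nat) : int :=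
  match e with
  | ZVar m => Posz (m == n)
  | ZZero => 0
  | ZAdd a b => zcoef a n + zcoef b n
  | ZOpp a => - zcoef a n
  end.

Fixpoint zbounded (k : nat) (e : zexp) : bool :=
  match e with
  | ZVar m => (m < k)%N
  | ZZero => true
  | ZAdd a b => zbounded k a && zbounded k b
  | ZOpp a => zbounded k a
  end.

Lemma zevalE (V : zmodType) (env : seq V) e : zbounded (size env) e ->
  zeval env e = \sum_(i < size env) nth 0 env i *~ zcoef e i.
Proof.
elim: e => [m /= hm||a IHa b IHb /= /andP[ha hb]|a IHa ha] /=.
- rewrite (bigD1 (Ordinal hm)) //= eqxx mulr1z big1 ?addr0 // => i.
  by rewrite eq_sym -val_eqE /= => /negPf ->; rewrite mulr0z.
- by rewrite big1 // => i _; rewrite mulr0z.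
- by rewrite IHa // IHb // -big_split; apply: eq_bigr => i _; rewrite mulrzDr.
- by rewrite IHa // -sumrN; apply: eq_bigr => i _; rewrite mulrNz.
Qed.

Lemma zeval_eq (V : zmodType) (env : seq V) a b :
  [&& zbounded (size env) a, zbounded (size env) b
    & all (fun i => zcoef a i == zcoef b i) (iota 0 (size env))] ->
  zeval env a = zeval env b.
Proof.
move=> /and3P[ha hb /allP h]; rewrite !zevalE //; apply: eq_bigr => i _.
by congr (_ *~ _); apply/eqP; apply: h; rewrite mem_iota /=.
Qed.

Ltac zidx x l :=
  lazymatch l with
  | x :: _ => constr:(0%N)
  | _ :: ?t => let n := zidx x t in constr:(S n)
  end.
(** The [match] on a dummy term serves for backtracking: its second branch, which records a new
    atom, is tried when [zidx] fails. *)
Ltac zatoms e l :=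
  lazymatch e with
  | @Algebra.add _ ?a ?b => let l1 := zatoms a l in zatoms b l1
  | @Algebra.opp _ ?a => zatoms a l
  | @Algebra.zero _ => l
  | _ => match constr:(Set) with
         | _ => let n := zidx e l in l
         | _ => constr:(e :: l)
         end
  end.
Ltac zreify e l :=
  lazymatch e with
  | @Algebra.add _ ?a ?b =>
    let a' := zreify a l in let b' := zreify b l in constr:(ZAdd a' b')
  | @Algebra.opp _ ?a => let a' := zreify a l in constr:(ZOpp a')
  | @Algebra.zero _ => constr:(ZZero)
  | _ => let n := zidx e l in constr:(ZVar n)
  end.
Ltac zmod :=
  lazymatch goal with
  | |- @eq ?V ?a ?b =>
    let l0 := zatoms a (@nil V) in
    let l := zatoms b l0 in
    let a' := zreify a l in
    let b' := zreify b l in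
    exact (@zeval_eq _ l a' b' isT)
  end.

(** * Twisted complexes *)

Section Biproducts.
Variable A : additive_category.
Implicit Types X Y Z : A.

Lemma prj1_inj1_ X Y Z (f : ahom X Z) : f \oc prj1 X Y \oc inj1 X Y = f.
Proof. by rewrite -acompA prj1_inj1 acomp1r. Qed.
Lemma prj2_inj2_ X Y Z (f : ahom Y Z) : f \oc prj2 X Y \oc inj2 X Y = f.
Proof. by rewrite -acompA prj2_inj2 acomp1r. Qed.
Lemma prj1_inj2_ X Y Z (f : ahom X Z) : f \oc prj1 X Y \oc inj2 X Y = 0.
Proof. by rewrite -acompA prj1_inj2 acomp0r. Qed.
Lemma prj2_inj1_ X Y Z (f : ahom Y Z) : f \oc prj2 X Y \oc inj1 X Y = 0.
Proof. by rewrite -acompA prj2_inj1 acomp0r. Qed.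

(** Composites are kept associated to the left; an equation [g \oc f = h] is applied behind a prefix
    [x] in this form. *)
Lemma acl X Y Z W (g : ahom Y Z) (f : ahom X Y) (h : ahom X Z) :
  g \oc f = h -> forall x : ahom Z W, x \oc g \oc f = x \oc h.
Proof. by move=> e x; rewrite -acompA e. Qed.

Definition bipE := (prj1_inj1, prj2_inj2, prj1_inj2, prj2_inj1,
  prj1_inj1_, prj2_inj2_, prj1_inj2_, prj2_inj1_).

Definition acompE :=
  (@acomp0l A, @acomp0r A, @acomp1l A, @acomp1r A, @addr0, @add0r).

Definition expE := (@acompDl A, @acompDr A, @acompNl A, @acompNr A, @acompA A).

Definition zeroE := (bipE, acompE, @oppr0).

Lemma oplus_ext_in X Y Z (f g : ahom (oplus X Y) Z) :
  f \oc inj1 X Y = g \oc inj1 X Y -> f \oc inj2 X Y = g \oc inj2 X Y -> f = g.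
Proof.
by move=> e1 e2; rewrite -[f]acomp1r -[g]acomp1r -oplus_id !acompDr !acompA e1 e2.
Qed.

Lemma oplus_ext_out X Y Z (f g : ahom Z (oplus X Y)) :
  prj1 X Y \oc f = prj1 X Y \oc g -> prj2 X Y \oc f = prj2 X Y \oc g -> f = g.
Proof.
by move=> e1 e2; rewrite -[f]acomp1l -[g]acomp1l -oplus_id !acompDl -!acompA e1 e2.
Qed.

Lemma acomp_suml (I : Type) (r : seq I) (P : pred I) X Y Z
    (F : I -> ahom Y Z) (f : ahom X Y) :
  (\sum_(i <- r | P i) F i) \oc f = \sum_(i <- r | P i) (F i \oc f).
Proof.
elim/big_rec2: _ => [|i y x _ <-]; first exact: acomp0l.
exact: acompDl.
Qed.

Lemma acomp_sumr (I : Type) (r : seq I) (P : pred I) X Y Z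
    (F : I -> ahom X Y) (f : ahom Y Z) :
  f \oc (\sum_(i <- r | P i) F i) = \sum_(i <- r | P i) (f \oc F i).
Proof.
elim/big_rec2: _ => [|i y x _ <-]; first exact: acomp0r.
exact: acompDr.
Qed.

Definition biproduct (I : finType) (X : I -> A) (S : A)
    (ij : forall i, ahom (X i) S) (pj : forall i, ahom S (X i)) : Prop :=
  [/\ forall i, pj i \oc ij i = aid (X i),
      forall i j, i != j -> pj i \oc ij j = 0
    & \sum_i (ij i \oc pj i) = aid S].

Lemma biproduct_sum (I J : finType) (Z : I + J -> A) (S S' : A) ij pj ij' pj' :
  @biproduct I (fun i => Z (inl i)) S ij pj ->
  @biproduct J (fun j => Z (inr j)) S' ij' pj' ->
  @biproduct (I + J)%type Z (oplus S S')
    (fun k => match k with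
     | inl i => inj1 S S' \oc ij i | inr j => inj2 S S' \oc ij' j end)
    (fun k => match k with
     | inl i => pj i \oc prj1 S S' | inr j => pj' j \oc prj2 S S' end).
Proof.
move=> [h1 h2 h3] [k1 k2 k3].
split=> [[i|j]|[i|j] [i'|j']|].
- by rewrite acompA prj1_inj1_ h1.
- by rewrite acompA prj2_inj2_ k1.
- by move=> ne; rewrite acompA prj1_inj1_ h2.
- by rewrite acompA prj1_inj2_ acomp0l.
- by rewrite acompA prj2_inj1_ acomp0l.
- by move=> ne; rewrite acompA prj2_inj2_ k2.
rewrite big_sumType /= -oplus_id; congr (_ + _).
  rewrite -[inj1 S S' in RHS]acomp1r -h3 acomp_sumr acomp_suml.
  by apply: eq_bigr => i _; rewrite !acompA.
rewrite -[inj2 S S' in RHS]acomp1r -k3 acomp_sumr acomp_suml.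
by apply: eq_bigr => i _; rewrite !acompA.
Qed.

Lemma aiso_id X : aiso (aid X).
Proof. by exists (aid X); split; exact: acomp1l. Qed.

Lemma aiso_comp X Y Z (g : ahom Y Z) (f : ahom X Y) :
  aiso g -> aiso f -> aiso (g \oc f).
Proof.
move=> [g' [g1 g2]] [f' [f1 f2]]; rewrite /= in g1 g2 f1 f2.
exists (f' \oc g'); split=> /=.
  by rewrite acompA -(acompA f') g1 acomp1r f1.
by rewrite acompA -(acompA g) f2 acomp1r g2.
Qed.

Lemma aisoP X Y (f : ahom X Y) :
  aiso f <-> exists g, g \oc f = aid X /\ f \oc g = aid Y.
Proof. by split=> -[g [h1 h2]]; exists g. Qed.

End Biproducts.

(** * Gradings by projections and homogeneous maps *)

Section GradedMaps.
Variable T : additive_category.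

(** [p n] stands for the projection onto the part of degree [n]. Keeping all degrees inside one
    object of [T] avoids families of objects indexed by integers; idempotence and orthogonality are
    supplied by [honest]. *)
Definition grading (X : T) := int -> ahom X X.

Definition hdeg (X Y : T) (p : grading X) (q : grading Y) (k : int)
    (f : ahom X Y) : Prop :=
  forall n, q (n + k) \oc f = f \oc p n.

Lemma hdeg_eq (X Y : T) (p : grading X) (q : grading Y) k k' (f : ahom X Y) :
  k = k' -> hdeg p q k f -> hdeg p q k' f.
Proof. by move=> ->. Qed.

Lemma hdeg_comp (X Y Z : T) (p : grading X) (q : grading Y) (r : grading Z)
    k l (g : ahom Y Z) (f : ahom X Y) :
  hdeg q r l g -> hdeg p q k f -> hdeg p r (k + l) (g \oc f).
Proof. by move=> hg hf n; rewrite addrA acompA hg -acompA hf acompA. Qed.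

Section Deg.
Variables (X Y : T) (p : grading X) (q : grading Y).

Lemma hdeg0 k : hdeg p q k 0.
Proof. by move=> n; rewrite acomp0l acomp0r. Qed.

Lemma hdegD k f g : hdeg p q k f -> hdeg p q k g -> hdeg p q k (f + g).
Proof. by move=> hf hg n; rewrite acompDl acompDr hf hg. Qed.

Lemma hdegN k f : hdeg p q k f -> hdeg p q k (- f).
Proof. by move=> hf n; rewrite acompNl acompNr hf. Qed.

Lemma hdegB k f g : hdeg p q k f -> hdeg p q k g -> hdeg p q k (f - g).
Proof. by move=> hf hg; apply: hdegD => //; exact: hdegN. Qed.

Definition psum : grading (oplus X Y) := fun n =>
  inj1 X Y \oc p n \oc prj1 X Y + inj2 X Y \oc q n \oc prj2 X Y.

Lemma hdeg_inj1 : hdeg p psum 0 (inj1 X Y).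
Proof.
by move=> n; rewrite addr0 /psum acompDl prj1_inj1_ prj2_inj1_ addr0.
Qed.
Lemma hdeg_inj2 : hdeg q psum 0 (inj2 X Y).
Proof.
by move=> n; rewrite addr0 /psum acompDl prj1_inj2_ prj2_inj2_ add0r.
Qed.
Lemma hdeg_prj1 : hdeg psum p 0 (prj1 X Y).
Proof.
move=> n; rewrite addr0 /psum acompDr !acompA prj1_inj1 prj1_inj2.
by rewrite acomp1l !acomp0l addr0.
Qed.
Lemma hdeg_prj2 : hdeg psum q 0 (prj2 X Y).
Proof.
move=> n; rewrite addr0 /psum acompDr !acompA prj2_inj2 prj2_inj1.
by rewrite acomp1l !acomp0l add0r.
Qed.
End Deg.

Lemma hdeg_id (X : T) (p : grading X) : hdeg p p 0 (aid X).
Proof. by move=> n; rewrite addr0 acomp1l acomp1r. Qed.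

Definition pshift (X : T) (p : grading X) (k : int) : grading X :=
  fun n => p (n + k).

Lemma hdeg_shift (X Y : T) (p : grading X) (q : grading Y) a b k f :
  hdeg p q (k + b - a) f -> hdeg (pshift p a) (pshift q b) k f.
Proof.
by move=> h n; rewrite /pshift -h; congr (q _ \oc _); lia.
Qed.

Lemma hdeg_shiftr (X Y : T) (p : grading X) (q : grading Y) b k f :
  hdeg p q (k + b) f -> hdeg p (pshift q b) k f.
Proof. by move=> h n; rewrite /pshift -h addrA. Qed.

Lemma hdeg_shiftl (X Y : T) (p : grading X) (q : grading Y) a k f :
  hdeg p q (k - a) f -> hdeg (pshift p a) q k f.
Proof. by move=> h n; rewrite /pshift -h; congr (q _ \oc _); lia. Qed.

End GradedMaps.

(** * The additive category of twisted complexes *)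

Section Twisted.
Variables (T : additive_category) (L : Type) (E : L -> T).

Definition honest (X : T) (p : grading X) : Prop :=
  exists (I : finType) (l : I -> L) (k : I -> int)
    (ij : forall i, ahom (E (l i)) X) (pj : forall i, ahom X (E (l i))),
    biproduct ij pj /\ forall n, p n = \sum_(i | k i == n) (ij i \oc pj i).

Lemma honest_zero : honest (fun _ => 0 : ahom (azero : T) azero).
Proof.
exists void, (fun i : void => match i with end), (fun=> 0),
  (fun i : void => match i with end), (fun i : void => match i with end).
have z (f : ahom (azero : T) azero) : f = 0.
  by rewrite -[f]acomp1l aid_azero acomp0l.
by split=> [|n]; [split; [case|case|]; rewrite [RHS]z; apply: big1; case
  | apply/esym/big1; case].
Qed.

Lemma honest_shift (X : T) (p : grading X) k : honest p -> honest (pshift p k).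
Proof.
move=> [I [l [d [ij [pj [b e]]]]]].
exists I, l, (fun i => d i - k), ij, pj; split=> // n.
by rewrite /pshift e; apply: eq_bigl => i; rewrite subr_eq.
Qed.

Lemma honest_sum (X Y : T) (p : grading X) (q : grading Y) :
  honest p -> honest q -> honest (psum p q).
Proof.
move=> [I [l [d [ij [pj [b e]]]]]] [I' [l' [d' [ij' [pj' [b' e']]]]]].
pose l2 k := match k with inl i => l i | inr i => l' i end.
pose d2 k := match k with inl i => d i | inr i => d' i end.
have := @biproduct_sum T I I' (fun k => E (l2 k)) X Y ij pj ij' pj' b b'.
move=> b2; exists (I + I')%type, l2, d2; do 2!eexists; split; first exact: b2.
move=> n.
rewrite /psum e e' big_sumType /=; congr (_ + _).
  rewrite acomp_sumr acomp_suml; apply: eq_big => // i _.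
  by rewrite !acompA.
rewrite acomp_sumr acomp_suml; apply: eq_big => // i _.
by rewrite !acompA.
Qed.

(** In other words a bounded complex over the additive closure of the [E l], collected in one
    object. The degree of a cell is recorded by [tpi] alone, so every component of the differential
    is a map of [T] between unshifted objects. *)
Record tw := Tw {
  tcar : T;
  tpi : grading tcar;
  tdf : ahom tcar tcar;
  thon : honest tpi;
  tdeg : hdeg tpi tpi 1 tdf;
  tdd : tdf \oc tdf = 0
}.

Local Notation thom X Y := (ahom (tcar X) (tcar Y)).
Local Notation tdegree X Y := (hdeg (tpi X) (tpi Y)).

Definition chain (X Y : tw) (f : thom X Y) : Prop :=
  tdegree X Y 0 f /\ f \oc tdf X = tdf Y \oc f.

Lemma chain0 (X Y : tw) : chain (0 : thom X Y).
Proof. by split; [exact: hdeg0 | rewrite acomp0l acomp0r]. Qed.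

Lemma chainB (X Y : tw) (f g : thom X Y) : chain f -> chain g -> chain (f - g).
Proof.
move=> [f1 f2] [g1 g2]; split; first exact: hdegB.
by rewrite acompBl acompBr f2 g2.
Qed.

Definition chain_sub (X Y : tw) : zsub (ahom (tcar X) (tcar Y)) :=
  ZSub (chain0 X Y) (@chainB X Y).

Definition chom (X Y : tw) := zsubT (chain_sub X Y).
HB.instance Definition _ (X Y : tw) := GRing.Zmodule.on (chom X Y).

Definition cval (X Y : tw) (f : chom X Y) : thom X Y := sval f.

Lemma cvalP (X Y : tw) (f : chom X Y) : chain (cval f).
Proof. exact: (zsP f). Qed.

Definition cmk (X Y : tw) (f : thom X Y) (h : chain f) : chom X Y :=
  @zmk _ (chain_sub X Y) f h.

Lemma cval_inj (X Y : tw) (f g : chom X Y) : cval f = cval g -> f = g.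
Proof. exact: zs_inj. Qed.

Lemma chain_id (X : tw) : chain (aid (tcar X)).
Proof. by split; [exact: hdeg_id | rewrite acomp1l acomp1r]. Qed.

Lemma chain_comp (X Y Z : tw) (g : thom Y Z) (f : thom X Y) :
  chain g -> chain f -> chain (g \oc f).
Proof.
move=> [g1 g2] [f1 f2]; split; first exact: (hdeg_comp g1 f1).
by rewrite -acompA f2 acompA g2 acompA.
Qed.

Lemma chain_d (X Y : tw) (f : thom X Y) : chain f -> f \oc tdf X = tdf Y \oc f.
Proof. by case. Qed.

Lemma chain_deg (X Y : tw) (f : thom X Y) : chain f -> tdegree X Y 0 f.
Proof. by case. Qed.

Definition cid_ (X : tw) : chom X X := cmk (chain_id X).
Definition ccomp (X Y Z : tw) (g : chom Y Z) (f : chom X Y) : chom X Z :=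
  cmk (chain_comp (cvalP g) (cvalP f)).

(* [ext_df] is the matrix [[d_X, w; 0, d_Z]]. *)
Section Ext.
Variables (X Z : tw) (w : thom Z X).

Definition ext_df : ahom (oplus (tcar X) (tcar Z)) (oplus (tcar X) (tcar Z)) :=
  inj1 _ _ \oc tdf X \oc prj1 _ _ + inj2 _ _ \oc tdf Z \oc prj2 _ _
  + inj1 _ _ \oc w \oc prj2 _ _.

Lemma ext_df1 : prj1 _ _ \oc ext_df = tdf X \oc prj1 _ _ + w \oc prj2 _ _.
Proof.
rewrite /ext_df !acompDr !acompA prj1_inj1 prj1_inj2 !acomp1l !acomp0l.
by rewrite addr0.
Qed.

Lemma ext_df2 : prj2 _ _ \oc ext_df = tdf Z \oc prj2 _ _.
Proof.
rewrite /ext_df !acompDr !acompA prj2_inj1 prj2_inj2 !acomp1l !acomp0l.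
by rewrite addr0 add0r.
Qed.

Lemma ext_df1i : ext_df \oc inj1 _ _ = inj1 _ _ \oc tdf X.
Proof.
by rewrite /ext_df !acompDl prj1_inj1_ !prj2_inj1_ !addr0.
Qed.

Lemma ext_df2i : ext_df \oc inj2 _ _ = inj2 _ _ \oc tdf Z + inj1 _ _ \oc w.
Proof.
by rewrite /ext_df !acompDl prj1_inj2_ !prj2_inj2_ add0r.
Qed.

Hypothesis (wdeg : tdegree Z X 1 w) (wd : w \oc tdf Z = - (tdf X \oc w)).

Lemma ext_deg : hdeg (psum (tpi X) (tpi Z)) (psum (tpi X) (tpi Z)) 1 ext_df.
Proof.
have i1 := hdeg_inj1 (tpi X) (tpi Z); have i2 := hdeg_inj2 (tpi X) (tpi Z).
have p1 := hdeg_prj1 (tpi X) (tpi Z); have p2 := hdeg_prj2 (tpi X) (tpi Z).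
apply: hdegD; first apply: hdegD.
- exact: (hdeg_comp (hdeg_comp i1 (@tdeg X)) p1).
- exact: (hdeg_comp (hdeg_comp i2 (@tdeg Z)) p2).
- exact: (hdeg_comp (hdeg_comp i1 wdeg) p2).
Qed.

Lemma ext_dd : ext_df \oc ext_df = 0.
Proof.
apply: oplus_ext_out; rewrite acomp0r acompA.
  rewrite ext_df1 acompDl -!acompA ext_df1 ext_df2 acompDr !acompA tdd.
  by rewrite wd acomp0l acompNl add0r addrN.
by rewrite ext_df2 -acompA ext_df2 acompA tdd acomp0l.
Qed.

Definition text : tw :=
  @Tw (oplus (tcar X) (tcar Z)) (psum (tpi X) (tpi Z)) ext_df
    (honest_sum (@thon X) (@thon Z)) ext_deg ext_dd.

Lemma chain_inl : @chain X text (inj1 _ _).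
Proof. by split; [exact: hdeg_inj1 | rewrite -ext_df1i]. Qed.

Lemma chain_prr : @chain text Z (prj2 _ _).
Proof. by split; [exact: hdeg_prj2 | rewrite -ext_df2]. Qed.

End Ext.

Definition tzero : tw :=
  @Tw azero (fun=> 0) 0 honest_zero (hdeg0 _ _ 1) (acomp0l _ 0).

Lemma zero_wd (X Z : tw) : (0 : thom Z X) \oc tdf Z = - (tdf X \oc 0).
Proof. by rewrite acomp0l acomp0r oppr0. Qed.

Definition tplus (X Z : tw) : tw :=
  text (hdeg0 (tpi Z) (tpi X) 1) (zero_wd X Z).

Lemma chain_inr (X Z : tw) : @chain Z (tplus X Z) (inj2 _ _).
Proof. by split; [exact: hdeg_inj2 | rewrite /= ext_df2i acomp0r addr0]. Qed.

Lemma chain_prl (X Z : tw) : @chain (tplus X Z) X (prj1 _ _).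
Proof. by split; [exact: hdeg_prj1 | rewrite /= ext_df1 acomp0l addr0]. Qed.

Lemma ccompA (X Y Z W : tw) (h : chom Z W) (g : chom Y Z) (f : chom X Y) :
  ccomp h (ccomp g f) = ccomp (ccomp h g) f.
Proof. by apply: cval_inj; exact: acompA. Qed.
Lemma ccomp1l (X Y : tw) (f : chom X Y) : ccomp (cid_ Y) f = f.
Proof. by apply: cval_inj; exact: acomp1l. Qed.
Lemma ccomp1r (X Y : tw) (f : chom X Y) : ccomp f (cid_ X) = f.
Proof. by apply: cval_inj; exact: acomp1r. Qed.
Lemma ccompDl (X Y Z : tw) (g g' : chom Y Z) (f : chom X Y) :
  ccomp (g + g') f = ccomp g f + ccomp g' f.
Proof. by apply: cval_inj; exact: acompDl. Qed.
Lemma ccompDr (X Y Z : tw) (g : chom Y Z) (f f' : chom X Y) :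
  ccomp g (f + f') = ccomp g f + ccomp g f'.
Proof. by apply: cval_inj; exact: acompDr. Qed.

(** Transparent, so that composition and biproducts compute to those of [T]. *)
Definition tw_add : additive_category.
Proof.
refine (@AdditiveCategory tw (fun X Y => chom X Y : zmodType) cid_ ccomp
  ccompA ccomp1l ccomp1r ccompDl ccompDr tzero _ tplus
  (fun X Y => cmk (chain_inl _ _)) (fun X Y => cmk (chain_inr X Y))
  (fun X Y => cmk (chain_prl X Y)) (fun X Y => cmk (chain_prr _ _))
  _ _ _ _ _).
- by apply: cval_inj; exact: aid_azero.
- by move=> X Y; apply: cval_inj; exact: prj1_inj1.
- by move=> X Y; apply: cval_inj; exact: prj2_inj2.
- by move=> X Y; apply: cval_inj; exact: prj1_inj2.
- by move=> X Y; apply: cval_inj; exact: prj2_inj1.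
- by move=> X Y; apply: cval_inj; exact: oplus_id.
Defined.

End Twisted.

(** * The exact structure of degreewise split sequences *)

Section TwistedExact.
Variables (T : additive_category) (L : Type) (E : L -> T).

Local Notation tw := (tw E).
Local Notation TW := (tw_add E).
Local Notation thom X Y := (ahom (tcar X) (tcar Y)).
Local Notation tdegree X Y := (hdeg (tpi X) (tpi Y)).

Lemma cval_comp (X Y Z : TW) (g : ahom Y Z) (f : ahom X Y) :
  cval (g \oc f) = cval g \oc cval f.
Proof. by []. Qed.

Lemma cval_id (X : TW) : cval (aid X) = aid (tcar X).
Proof. by []. Qed.

Lemma cval0 (X Y : TW) : cval (0 : ahom X Y) = 0.
Proof. by []. Qed.

Definition gsplit (X Y Z : tw) (i : thom X Y) (p : thom Y Z) (r : thom Y X)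
    (s : thom Z Y) : Prop :=
  [/\ p \oc i = 0, r \oc i = aid _, p \oc s = aid _ & i \oc r + s \oc p = aid _].

(** The retraction and the section have degree zero but need not commute with the differentials. *)
Definition tconf (X Y Z : TW) (i : ahom X Y) (p : ahom Y Z) : Prop :=
  exists (r : thom Y X) (s : thom Z Y),
    [/\ gsplit (cval i) (cval p) r s, tdegree Y X 0 r & tdegree Z Y 0 s].

Section Split.
Variables (X Y Z : tw) (i : thom X Y) (p : thom Y Z) (r : thom Y X) (s : thom Z Y).
Hypothesis sp : gsplit i p r s.

Lemma gs_pi : p \oc i = 0. Proof. by case: sp. Qed.
Lemma gs_ri : r \oc i = aid _. Proof. by case: sp. Qed.
Lemma gs_ps : p \oc s = aid _. Proof. by case: sp. Qed.
Lemma gs_id : i \oc r + s \oc p = aid _. Proof. by case: sp. Qed.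

Lemma gs_ir : i \oc r = aid _ - s \oc p.
Proof. by rewrite -gs_id addrK. Qed.
Lemma gs_sp : s \oc p = aid _ - i \oc r.
Proof. by rewrite -gs_id [_ + s \oc p]addrC addrK. Qed.
Lemma gs_rs : r \oc s = 0.
Proof.
have : r \oc (i \oc r + s \oc p) \oc s = r \oc s by rewrite gs_id acomp1r.
rewrite acompDr acompDl !acompA gs_ri acomp1l -acompA gs_ps acomp1r.
by move=> h; apply: (addIr (r \oc s)); rewrite add0r.
Qed.

Definition gsE := ((gs_pi, gs_ri, gs_ps, gs_rs),
  (fun W => @acl T _ _ _ W _ _ _ gs_pi, fun W => @acl T _ _ _ W _ _ _ gs_ri,
   fun W => @acl T _ _ _ W _ _ _ gs_ps, fun W => @acl T _ _ _ W _ _ _ gs_rs)).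

Hypotheses (ci : chain i) (cp : chain p).

(** The cocycle of the extension: in the splitting by [i] and [s] the differential of [Y] is the
    matrix [[d_X, w; 0, d_Z]]. *)
Definition gs_w : thom Z X := r \oc tdf Y \oc s.

Lemma gs_ds : tdf Y \oc s = s \oc tdf Z + i \oc gs_w.
Proof.
rewrite /gs_w !acompA gs_ir acompBl acompBl acomp1l -!(acompA s).
by rewrite (chain_d cp) -!acompA gs_ps acomp1r addrC subrK.
Qed.

Lemma gs_rd : r \oc tdf Y = tdf X \oc r + gs_w \oc p.
Proof.
rewrite /gs_w -!acompA gs_sp !acompBr !acomp1r !acompA -!(acompA r).
by rewrite -(chain_d ci) !acompA gs_ri acomp1l addrC subrK.
Qed.

Lemma gs_w_deg : tdegree Y X 0 r -> tdegree Z Y 0 s -> tdegree Z X 1 gs_w.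
Proof. by move=> hr hs; exact: (hdeg_comp (hdeg_comp hr (@tdeg _ _ _ Y)) hs). Qed.

Lemma gs_w_d : gs_w \oc tdf Z = - (tdf X \oc gs_w).
Proof.
apply/eqP; rewrite -addr_eq0 addrC; apply/eqP.
have : r \oc (tdf Y \oc tdf Y) \oc s = 0 by rewrite tdd acomp0r acomp0l.
rewrite acompA gs_rd -acompA gs_ds acompDl !acompDr !acompA.
rewrite -!(acompA _ r) gs_rs gs_ri -!(acompA _ p) gs_ps gs_pi.
by rewrite !acomp0r !acomp0l !acomp1r add0r addr0.
Qed.

Lemma gs_wP : tdegree Y X 0 r -> tdegree Z Y 0 s ->
  exists w : thom Z X, [/\ tdegree Z X 1 w, w \oc tdf Z = - (tdf X \oc w),
    tdf Y \oc s = s \oc tdf Z + i \oc w & r \oc tdf Y = tdf X \oc r + w \oc p].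
Proof.
move=> dr ds; exists gs_w; split; [exact: gs_w_deg | exact: gs_w_d | exact: gs_ds
 | exact: gs_rd].
Qed.

End Split.

(** The graded complement [C] of a chain map inherits the differential [p \oc tdf Y \oc s].
    Composites of inflations are thus handled by exhibiting a graded complement. *)
Lemma split_inflation (X Y : tw) (i : thom X Y) (C : T) (q : grading C)
    (p : ahom (tcar Y) C) (r : thom Y X) (s : ahom C (tcar Y)) (ci : chain i) :
  honest E q -> [/\ p \oc i = 0, r \oc i = aid _, p \oc s = aid _
    & i \oc r + s \oc p = aid _] ->
  hdeg (tpi Y) q 0 p -> tdegree Y X 0 r -> hdeg q (tpi Y) 0 s ->
  exists (Z : TW) (p' : ahom (Y : TW) Z), tconf (cmk ci : ahom (X : TW) Y) p'.
Proof.
move=> hq [h1 h2 h3 h4] dp dr ds.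
have pd : p \oc tdf Y = (p \oc tdf Y \oc s) \oc p.
  rewrite -acompA -[in LHS](acomp1r (tdf Y)) -h4 acompDr acompDr.
  by rewrite (acompA _ i) -(chain_d ci) !acompA h1 !acomp0l add0r.
have dd : (p \oc tdf Y \oc s) \oc (p \oc tdf Y \oc s) = 0.
  by rewrite !acompA -pd -(acompA p) tdd acomp0r acomp0l.
pose Z := Tw hq (hdeg_comp (hdeg_comp dp (@tdeg _ _ _ Y)) ds) dd.
have cp : @chain _ _ _ Y Z p by split.
by exists Z, (cmk cp), r, s; split.
Qed.

Lemma split_deflation (Y Z : tw) (p : thom Y Z) (C : T) (q : grading C)
    (i : ahom C (tcar Y)) (r : ahom (tcar Y) C) (s : thom Z Y) (cp : chain p) :
  honest E q -> [/\ p \oc i = 0, r \oc i = aid _, p \oc s = aid _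
    & i \oc r + s \oc p = aid _] ->
  hdeg q (tpi Y) 0 i -> hdeg (tpi Y) q 0 r -> tdegree Z Y 0 s ->
  exists (X : TW) (i' : ahom X (Y : TW)), tconf i' (cmk cp : ahom (Y : TW) Z).
Proof.
move=> hq [h1 h2 h3 h4] di dr ds.
have pd : tdf Y \oc i = i \oc (r \oc tdf Y \oc i).
  rewrite -[in LHS](acomp1l (tdf Y)) -h4 !acompDl.
  by rewrite -!(acompA s) (chain_d cp) -(acompA _ p) h1 !acomp0r addr0 !acompA.
have dd : (r \oc tdf Y \oc i) \oc (r \oc tdf Y \oc i) = 0.
  by rewrite -(acompA _ i) -pd acompA -(acompA r) tdd acomp0r acomp0l.
pose X := Tw hq (hdeg_comp (hdeg_comp dr (@tdeg _ _ _ Y)) di) dd.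
have ci : @chain _ _ _ X Y i by split=> //; rewrite /= -pd.
by exists X, (cmk ci), r, s; split.
Qed.

(** The factorisation [r \oc f] is a chain map although [r] is not: the defect of [r] is [w \oc p],
    which vanishes on [f]. *)
Lemma gsplit_kernel (X Y Z : TW) (i : ahom X Y) (p : ahom Y Z) :
  tconf i p -> is_kernel i p.
Proof.
move=> [r [s [sp dr ds]]]; split; first exact/cval_inj/(gs_pi sp).
move=> W f /(congr1 (@cval _ _ _ _ _)); rewrite cval_comp cval0 => pf.
have irf : cval i \oc (r \oc cval f) = cval f.
  by rewrite acompA (gs_ir sp) acompBl acomp1l -acompA pf acomp0r subr0.
have cg : @chain _ _ _ W X (r \oc cval f).
  split; first exact: (hdeg_comp dr (chain_deg (cvalP f))).
  rewrite -acompA (chain_d (cvalP f)) acompA (gs_rd sp (cvalP i)).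
  by rewrite acompDl -(acompA _ (cval p)) pf acomp0r addr0 acompA.
exists (cmk cg); split; first exact: cval_inj.
move=> g' e; apply: cval_inj; rewrite /= -e cval_comp acompA.
by rewrite (gs_ri sp) acomp1l.
Qed.

Lemma gsplit_cokernel (X Y Z : TW) (i : ahom X Y) (p : ahom Y Z) :
  tconf i p -> is_cokernel i p.
Proof.
move=> [r [s [sp dr ds]]]; split; first exact/cval_inj/(gs_pi sp).
move=> W f /(congr1 (@cval _ _ _ _ _)); rewrite cval_comp cval0 => pf.
have fsp : (cval f \oc s) \oc cval p = cval f.
  by rewrite -acompA (gs_sp sp) acompBr acomp1r acompA pf acomp0l subr0.
have cg : @chain _ _ _ Z W (cval f \oc s).
  split; first exact: (hdeg_comp (chain_deg (cvalP f)) ds).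
  rewrite acompA -(chain_d (cvalP f)) -(acompA _ _ s) (gs_ds sp (cvalP p)).
  by rewrite acompDr (acompA _ (cval i)) pf acomp0l addr0 acompA.
exists (cmk cg); split; first exact: cval_inj.
move=> g' e; apply: cval_inj; rewrite /= -e cval_comp -acompA.
by rewrite (gs_ps sp) acomp1r.
Qed.

Lemma aiso_cval (X Y : TW) (f : ahom X Y) : aiso f ->
  exists g : ahom Y X, [/\ cval g \oc cval f = aid _, cval f \oc cval g = aid _
    & tdegree Y X 0 (cval g)].
Proof.
move=> [g [/(congr1 (@cval _ _ _ _ _)) h1 /(congr1 (@cval _ _ _ _ _)) h2]].
by exists g; split=> //; exact: chain_deg (cvalP g).
Qed.

Lemma tconf_iso (X Y Z X' Y' Z' : TW)
  (i : ahom X Y) (p : ahom Y Z) (i' : ahom X' Y') (p' : ahom Y' Z')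
  (a : ahom X X') (b : ahom Y Y') (c : ahom Z Z') :
  aiso a -> aiso b -> aiso c -> b \oc i = i' \oc a -> c \oc p = p' \oc b ->
  tconf i p -> tconf i' p'.
Proof.
move=> /aiso_cval[a' [a1 a2 a3]] /aiso_cval[b' [b1 b2 b3]]
  /aiso_cval[c' [c1 c2 c3]] /(congr1 (@cval _ _ _ _ _)) ei
  /(congr1 (@cval _ _ _ _ _)) ep [r [s [sp dr ds]]].
rewrite !cval_comp in ei ep.
have i'E : cval i' = cval b \oc cval i \oc cval a'.
  by rewrite ei -acompA a2 acomp1r.
have p'E : cval p' = cval c \oc cval p \oc cval b'.
  by rewrite ep -acompA b2 acomp1r.
exists (cval a \oc r \oc cval b'), (cval b \oc s \oc cval c').
have [[da db] dc] := (chain_deg (cvalP a), chain_deg (cvalP b), chain_deg (cvalP c)).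
split; last 2 first.
- exact: (hdeg_comp (hdeg_comp da dr) b3).
- exact: (hdeg_comp (hdeg_comp db ds) c3).
rewrite i'E p'E; split; rewrite !acompA.
- rewrite -(acompA _ (cval b')) b1 acomp1r -(acompA _ (cval p)) (gs_pi sp).
  by rewrite acomp0r acomp0l.
- by rewrite -(acompA _ (cval b')) b1 acomp1r -(acompA _ r) (gs_ri sp) acomp1r.
- by rewrite -(acompA _ (cval b')) b1 acomp1r -(acompA _ (cval p)) (gs_ps sp) acomp1r.
rewrite -(acompA _ (cval a')) a1 acomp1r -(acompA _ (cval c')) c1 acomp1r.
by rewrite -!acompDl -!(acompA (cval b)) -acompDr (gs_id sp) acomp1r.
Qed.

Lemma gsplit_ext (X Z : tw) (w : thom Z X) (dw : tdegree Z X 1 w)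
    (wd : w \oc tdf Z = - (tdf X \oc w)) :
  @tconf X (text dw wd) Z (cmk (chain_inl dw wd)) (cmk (chain_prr dw wd)).
Proof.
exists (prj1 _ _), (inj2 _ _); split; [split=> /= | |].
- exact: prj2_inj1.
- exact: prj1_inj1.
- exact: prj2_inj2.
- exact: oplus_id.
- exact: hdeg_prj1.
- exact: hdeg_inj2.
Qed.

Lemma t_inflation_id (X : TW) : inflation_of tconf (aid X).
Proof.
exists (azero : TW), 0, (aid (tcar X)), 0; split.
- split; rewrite ?cval0 ?acomp0l ?acomp0r ?cval_id ?acomp1l //.
    by rewrite aid_azero.
  by rewrite addr0.
- exact: hdeg_id.
- exact: hdeg0.
Qed.

Lemma t_deflation_id (X : TW) : deflation_of tconf (aid X).
Proof.
exists (azero : TW), 0, 0, (aid (tcar X)); split.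
- split; rewrite ?cval0 ?acomp0l ?acomp0r ?cval_id ?acomp1l //.
    by rewrite aid_azero.
  by rewrite add0r.
- exact: hdeg0.
- exact: hdeg_id.
Qed.

Lemma cmk_cval (X Y : TW) (f : ahom X Y) (h : chain (cval f)) : cmk h = f.
Proof. exact: cval_inj. Qed.

Lemma t_inflation_comp (X Y Z : TW) (i : ahom X Y) (j : ahom Y Z) :
  inflation_of tconf i -> inflation_of tconf j -> inflation_of tconf (j \oc i).
Proof.
move=> [A [p [r [s [sp dr ds]]]]] [B [q [r' [s' [sp' dr' ds']]]]].
have ci := cvalP (j \oc i); rewrite -(cmk_cval ci).
have [[dp dq] dj] := (chain_deg (cvalP p), chain_deg (cvalP q), chain_deg (cvalP j)).
pose C := oplus (tcar A) (tcar B).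
apply: (@split_inflation X Z _ C (psum (tpi A) (tpi B))
  (inj1 _ _ \oc cval p \oc r' + inj2 _ _ \oc cval q) (r \oc r')
  (cval j \oc s \oc prj1 _ _ + s' \oc prj2 _ _)).
- by apply: honest_sum; exact: thon.
- have R := (gsE sp, gsE sp'); rewrite cval_comp; split.
  + by rewrite acompDl !acompA !(R, acompE).
  + by rewrite !acompA !(R, acompE).
  + by rewrite !acompDr !acompDl !acompA !(R, acompE) oplus_id.
  + rewrite acompDr !acompDl !acompA !bipE !acompE addrA -!(acompA (cval j)).
    by rewrite -acompDr -acompDl (gs_id sp) acomp1l (gs_id sp').
- apply: hdegD.
    exact: (hdeg_comp (hdeg_comp (hdeg_inj1 _ _) dp) dr').
  exact: (hdeg_comp (hdeg_inj2 _ _) dq).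
- exact: (hdeg_comp dr dr').
- apply: hdegD.
    exact: (hdeg_comp (hdeg_comp dj ds) (hdeg_prj1 _ _)).
  exact: (hdeg_comp ds' (hdeg_prj2 _ _)).
Qed.

Lemma t_deflation_comp (X Y Z : TW) (p : ahom X Y) (q : ahom Y Z) :
  deflation_of tconf p -> deflation_of tconf q -> deflation_of tconf (q \oc p).
Proof.
move=> [A [i [r [s [sp dr ds]]]]] [B [j [r' [s' [sp' dr' ds']]]]].
have ci := cvalP (q \oc p); rewrite -(cmk_cval ci).
have [[di dj] dp] := (chain_deg (cvalP i), chain_deg (cvalP j), chain_deg (cvalP p)).
pose C := oplus (tcar A) (tcar B).
apply: (@split_deflation X Z _ C (psum (tpi A) (tpi B))
  (cval i \oc prj1 _ _ + s \oc cval j \oc prj2 _ _)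
  (inj1 _ _ \oc r + inj2 _ _ \oc r' \oc cval p) (s \oc s')).
- by apply: honest_sum; exact: thon.
- have R := (gsE sp, gsE sp'); rewrite cval_comp; split.
  + by rewrite acompDr !acompA !(R, acompE).
  + by rewrite !acompDr !acompDl !acompA !(R, acompE) oplus_id.
  + by rewrite !acompA !(R, acompE).
  + rewrite acompDr !acompDl !acompA !bipE !acompE -addrA -!(acompA s) -acompDr.
    by rewrite -acompDl (gs_id sp') acomp1l (gs_id sp).
- apply: hdegD.
    exact: (hdeg_comp di (hdeg_prj1 _ _)).
  exact: (hdeg_comp (hdeg_comp ds dj) (hdeg_prj2 _ _)).
- apply: hdegD.
    exact: (hdeg_comp (hdeg_inj1 _ _) dr).
  exact: (hdeg_comp (hdeg_comp (hdeg_inj2 _ _) dr') dp).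
- exact: (hdeg_comp ds ds').
Qed.

(** Pushing out along [f] replaces the cocycle [w] by [cval f \oc w], so the pushout is again an
    extension of [Z]. *)
Lemma t_pushout (X Y X' : TW) (i : ahom X Y) (f : ahom X X') :
  inflation_of tconf i ->
  exists (Y' : TW) (f' : ahom Y Y') (i' : ahom X' Y'),
    is_pushout i f f' i' /\ inflation_of tconf i'.
Proof.
move=> [Z [p [r [s [sp dr ds]]]]]; have [ci cp] := (cvalP i, cvalP p).
have [w [dw wd dsE rdE]] := gs_wP sp ci cp dr ds.
have df := chain_deg (cvalP f).
have dv := hdeg_comp df dw.
have vd : cval f \oc w \oc tdf Z = - (tdf X' \oc (cval f \oc w)).
  by rewrite -acompA wd acompNr !acompA (chain_d (cvalP f)).
pose Y' : TW := text dv vd.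
have cf' : @chain _ _ _ Y Y'
    (inj1 _ _ \oc cval f \oc r + inj2 _ _ \oc cval p).
  split.
    apply: hdegD; first exact: (hdeg_comp (hdeg_comp (hdeg_inj1 _ _) df) dr).
    exact: (hdeg_comp (hdeg_inj2 _ _) (chain_deg cp)).
  rewrite /= acompDl acompDr !acompA ext_df1i ext_df2i acompDl.
  rewrite -(acompA _ r) rdE acompDr !acompA -(acompA _ (cval f)).
  rewrite (chain_d (cvalP f)) -(acompA _ (cval p)) (chain_d cp) !acompA -!addrA.
  by congr (_ + _); rewrite addrC.
exists Y', (cmk cf'), (cmk (chain_inl dv vd)); split; last first.
  by exists Z, (cmk (chain_prr dv vd)); exact: gsplit_ext.
split.
  apply: cval_inj; rewrite !cval_comp /= acompDl -!(acompA _ _ (cval i)).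
  by rewrite (gs_ri sp) (gs_pi sp) acomp0r addr0 acomp1r.
move=> W a b /(congr1 (@cval _ _ _ _ _)); rewrite !cval_comp => ab.
have [da db] := (chain_deg (cvalP a), chain_deg (cvalP b)).
have cc : @chain _ _ _ Y' W
    (cval b \oc prj1 _ _ + cval a \oc s \oc prj2 _ _).
  split.
    apply: hdegD; first exact: (hdeg_comp db (hdeg_prj1 _ _)).
    exact: (hdeg_comp (hdeg_comp da ds) (hdeg_prj2 _ _)).
  rewrite /= acompDl -!(acompA _ _ (ext_df _)) ext_df1 ext_df2 acompDr.
  rewrite acompDr !acompA (chain_d (cvalP b)) -ab -(chain_d (cvalP a)).
  rewrite -(acompA _ _ s) dsE acompDr acompDl !acompA -addrA.
  by congr (_ + _); rewrite addrC.
exists (cmk cc); split.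
  split; apply: cval_inj; rewrite !cval_comp /= !acompDl ?acompDr ?acompA.
    rewrite !prj1_inj1_ !prj1_inj2_ !prj2_inj1_ !prj2_inj2_ !acomp0l.
    rewrite add0r addr0 -ab -!(acompA (cval a)) -acompDr (gs_id sp).
    by rewrite acomp1r.
  by rewrite prj1_inj1_ prj2_inj1_ addr0.
move=> c' [/(congr1 (@cval _ _ _ _ _)) e1 /(congr1 (@cval _ _ _ _ _)) e2].
rewrite !cval_comp /= in e1 e2.
apply: cval_inj => /=; apply: oplus_ext_in.
  by rewrite acompDl prj1_inj1_ prj2_inj1_ addr0 -e2.
rewrite acompDl prj1_inj2_ prj2_inj2_ add0r -e1 -acompA acompDl -!acompA.
by rewrite (gs_rs sp) (gs_ps sp) !acomp0r add0r acomp1r.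
Qed.

(** Dually to the pushout, the cocycle [w] becomes [w \oc cval f]. *)
Lemma t_pullback (Y Z Z' : TW) (p : ahom Y Z) (f : ahom Z' Z) :
  deflation_of tconf p ->
  exists (Y' : TW) (p' : ahom Y' Z') (f' : ahom Y' Y),
    is_pullback p' f' f p /\ deflation_of tconf p'.
Proof.
move=> [X [i [r [s [sp dr ds]]]]]; have [ci cp] := (cvalP i, cvalP p).
have [w [dw wd dsE rdE]] := gs_wP sp ci cp dr ds.
have df := chain_deg (cvalP f).
have dv := hdeg_comp dw df.
have vd : w \oc cval f \oc tdf Z' = - (tdf X \oc (w \oc cval f)).
  by rewrite -acompA (chain_d (cvalP f)) !acompA wd acompNl.
pose Y' : TW := text dv vd.
have cf' : @chain _ _ _ Y' Y
    (cval i \oc prj1 _ _ + s \oc cval f \oc prj2 _ _).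
  split.
    apply: hdegD; first exact: (hdeg_comp (chain_deg ci) (hdeg_prj1 _ _)).
    exact: (hdeg_comp (hdeg_comp ds df) (hdeg_prj2 _ _)).
  rewrite /= acompDl acompDr -!(acompA _ _ (ext_df _)) ext_df1 ext_df2.
  rewrite acompDr !acompA (chain_d ci) dsE !acompDl -!(acompA s).
  rewrite (chain_d (cvalP f)) -!addrA; congr (_ + _).
  by rewrite !acompA addrC.
exists Y', (cmk (chain_prr dv vd)), (cmk cf'); split; last first.
  by exists X, (cmk (chain_inl dv vd)); exact: gsplit_ext.
split.
  apply: cval_inj; rewrite !cval_comp /= acompDr !acompA.
  by rewrite (gs_pi sp) (gs_ps sp) acomp0l acomp1l add0r.
move=> W a b /(congr1 (@cval _ _ _ _ _)); rewrite !cval_comp => ab.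
have [da db] := (chain_deg (cvalP a), chain_deg (cvalP b)).
have cc : @chain _ _ _ W Y'
    (inj1 _ _ \oc r \oc cval a + inj2 _ _ \oc cval b).
  split.
    apply: hdegD; first exact: (hdeg_comp (hdeg_comp (hdeg_inj1 _ _) dr) da).
    exact: (hdeg_comp (hdeg_inj2 _ _) db).
  rewrite /= acompDl acompDr !acompA ext_df1i ext_df2i acompDl.
  rewrite -!(acompA _ _ (tdf W)) (chain_d (cvalP a)) (chain_d (cvalP b)).
  rewrite !acompA -(acompA _ r) rdE acompDr acompDl.
  rewrite -(acompA _ (cval f)) -ab !acompA -!addrA.
  by congr (_ + _); rewrite addrC.
exists (cmk cc); split.
  split; apply: cval_inj; rewrite !cval_comp /= ?acompDl ?acompDr ?acompA.
    rewrite !prj1_inj1_ !prj1_inj2_ !prj2_inj1_ !prj2_inj2_ !acomp0l.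
    rewrite add0r addr0 -(acompA s) -ab acompA.
    by rewrite -acompDl (gs_id sp) acomp1l.
  by rewrite prj2_inj1 prj2_inj2 !acomp0l acomp1l add0r.
move=> c' [/(congr1 (@cval _ _ _ _ _)) e1 /(congr1 (@cval _ _ _ _ _)) e2].
rewrite !cval_comp /= in e1 e2.
apply: cval_inj => /=; apply: oplus_ext_out.
  rewrite acompDr !acompA prj1_inj1 prj1_inj2 acomp0l acomp1l addr0 -e1.
  rewrite acompA acompDr !acompA (gs_ri sp) (gs_rs sp) !acomp0l addr0.
  by rewrite acomp1l.
by rewrite acompDr !acompA prj2_inj1 prj2_inj2 !acomp0l acomp1l add0r e2.
Qed.

Definition tw_exact : exact_category :=
  @ExactCategory TW tconf gsplit_kernel gsplit_cokernel tconf_iso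
    t_inflation_id t_deflation_id t_inflation_comp t_deflation_comp
    t_pushout t_pullback.

End TwistedExact.

(** * Contractible objects and the Frobenius property *)

Section TwistedFrobenius.
Variables (T : additive_category) (L : Type) (E : L -> T).

Local Notation tw := (tw E).
Local Notation TW := (tw_add E).
Local Notation TX := (tw_exact E).
Local Notation thom X Y := (ahom (tcar X) (tcar Y)).
Local Notation tdegree X Y := (hdeg (tpi X) (tpi Y)).

Lemma tshift_deg (X : tw) (k : int) :
  hdeg (pshift (tpi X) k) (pshift (tpi X) k) 1 (- tdf X).
Proof. by apply/hdegN/hdeg_shift; rewrite addrK; exact: tdeg. Qed.

Lemma tshift_dd (X : tw) : (- tdf X) \oc (- tdf X) = 0.
Proof. by rewrite acompNl acompNr opprK tdd. Qed.

(** The differential is negated whatever [k] is, which is the usual sign for odd [k]; the shift and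
    its inverse are [k = 1] and [k = -1]. *)
Definition tsh (k : int) (X : tw) : tw :=
  Tw (honest_shift k (@thon _ _ _ X)) (@tshift_deg X k) (tshift_dd X).

Definition nullh (X Y : tw) (f : thom X Y) : Prop :=
  exists h : thom X Y, tdegree X Y (-1) h /\ f = tdf Y \oc h + h \oc tdf X.

Definition contractible (X : tw) : Prop := nullh (aid (tcar X)).

Lemma nullh0 (X Y : tw) : nullh (0 : thom X Y).
Proof. by exists 0; split; [exact: hdeg0 | rewrite !acompE]. Qed.

Lemma nullhB (X Y : tw) (f g : thom X Y) : nullh f -> nullh g -> nullh (f - g).
Proof.
move=> [h [dh ->]] [k [dk ->]]; exists (h - k); split; first exact: hdegB.
by rewrite acompBl acompBr opprD addrACA.
Qed.

Lemma nullhD (X Y : tw) (f g : thom X Y) : nullh f -> nullh g -> nullh (f + g).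
Proof.
by move=> hf hg; rewrite -[g]opprK -[- g]sub0r; apply: nullhB => //; apply: nullhB;
  [exact: nullh0|].
Qed.

Lemma nullhN (X Y : tw) (f : thom X Y) : nullh f -> nullh (- f).
Proof. by move=> hf; rewrite -sub0r; apply: nullhB => //; exact: nullh0. Qed.

Lemma nullh_compl (X Y Z : tw) (g : thom Y Z) (f : thom X Y) :
  chain g -> nullh f -> nullh (g \oc f).
Proof.
move=> [g1 g2] [h [dh ->]]; exists (g \oc h); split.
  exact: (hdeg_eq _ (hdeg_comp g1 dh)).
by rewrite acompDr !acompA g2.
Qed.

Lemma nullh_compr (X Y Z : tw) (g : thom Y Z) (f : thom X Y) :
  chain f -> nullh g -> nullh (g \oc f).
Proof.
move=> [g1 g2] [h [dh ->]]; exists (h \oc f); split.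
  exact: (hdeg_eq _ (hdeg_comp dh g1)).
by rewrite acompDl -!acompA g2.
Qed.

Lemma chain_htp (X Y : tw) (h : thom X Y) : tdegree X Y (-1) h ->
  chain (tdf Y \oc h + h \oc tdf X).
Proof.
move=> dh; split.
  apply: hdegD; first exact: (hdeg_eq _ (hdeg_comp (@tdeg _ _ _ Y) dh)).
  exact: (hdeg_eq _ (hdeg_comp dh (@tdeg _ _ _ X))).
by rewrite acompDl acompDr !acompA -(acompA _ (tdf X)) !tdd !acompE.
Qed.

(** If [h] contracts [P] and [s] is a graded section of [p], the boundary of [s \oc cval f \oc h] is
    a chain map that lifts [f]. *)
Lemma contractible_projective (P : TX) : contractible P -> projective P.
Proof.
move=> [h [dh hE]] Y Z p f [X [i [r [s [sp dr ds]]]]].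
have df := chain_deg (cvalP f).
have dk : tdegree P Y (-1) (s \oc cval f \oc h).
  exact: (hdeg_eq _ (hdeg_comp (hdeg_comp ds df) dh)).
exists (cmk (chain_htp dk)); apply: cval_inj; rewrite cval_comp /=.
rewrite acompDr !acompA (chain_d (cvalP p)) !(gsE sp) !acompE.
by rewrite -(chain_d (cvalP f)) -!acompA -acompDr -hE acomp1r.
Qed.

Lemma contractible_injective (P : TX) : contractible P -> injective_object P.
Proof.
move=> [h [dh hE]] X Y i f [Z [p [r [s [sp dr ds]]]]].
have df := chain_deg (cvalP f).
have dk : tdegree Y P (-1) (h \oc cval f \oc r).
  exact: (hdeg_eq _ (hdeg_comp (hdeg_comp dh df) dr)).
exists (cmk (chain_htp dk)); apply: cval_inj; rewrite cval_comp /=.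
rewrite acompDl -(acompA _ (tdf Y)) -(chain_d (cvalP i)) !acompA !(gsE sp).
rewrite !acompE -(acompA _ (cval f)) (chain_d (cvalP f)) !acompA -acompDl.
by rewrite -hE acomp1l.
Qed.

Lemma contractible_retract (X P : TX) (a : ahom X P) (b : ahom P X) :
  b \oc a = aid X -> contractible P -> contractible X.
Proof.
move=> /(congr1 (@cval _ _ _ _ _)) ba cP.
by rewrite /contractible -[aid _]ba; apply: nullh_compl (cvalP b) _;
  rewrite -[cval a]acomp1l; apply: nullh_compr (cvalP a) cP.
Qed.

(** An invertible cocycle makes the extension the cone of an isomorphism, contracted by the inverse
    [v]. *)
Lemma ext_contractible (X Z : tw) (w : thom Z X) (v : thom X Z) (dw : tdegree Z X 1 w)
    (wd : w \oc tdf Z = - (tdf X \oc w)) :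
  tdegree X Z (-1) v -> w \oc v = aid _ -> v \oc w = aid _ ->
  contractible (text dw wd).
Proof.
move=> dv wv vw; exists (inj2 _ _ \oc v \oc prj1 _ _); split.
  exact: (hdeg_eq _ (hdeg_comp (hdeg_comp (hdeg_inj2 _ _) dv) (hdeg_prj1 _ _))).
have vd : v \oc tdf X = - (tdf Z \oc v).
  rewrite -[tdf X]acomp1r -wv !acompA -(acompA v) -[tdf X \oc w]opprK -wd.
  by rewrite acompNr !acompA vw !acompE acompNl.
rewrite /= !acompA ext_df2i -!(acompA _ (prj1 _ _)) ext_df1 acompDr !acompDl.
rewrite !acompA (acl vd) (acl vw) (acl wv) !acompE acompNr acompNl !acompA.
by rewrite addrACA addrN add0r oplus_id.
Qed.

Lemma sh_w_deg (X : tw) : tdegree (tsh 1 X) X 1 (aid (tcar X)).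
Proof. by move=> n; rewrite /= /pshift acomp1l acomp1r. Qed.
Lemma sh_w_d (X : tw) :
  aid (tcar X) \oc tdf (tsh 1 X) = - (tdf X \oc aid (tcar X)).
Proof. by rewrite acomp1l acomp1r. Qed.
Lemma ush_w_deg (X : tw) : tdegree X (tsh (-1) X) 1 (aid (tcar X)).
Proof. by move=> n; rewrite /= /pshift addrK acomp1l acomp1r. Qed.
Lemma ush_w_d (X : tw) :
  aid (tcar X) \oc tdf X = - (tdf (tsh (-1) X) \oc aid (tcar X)).
Proof. by rewrite acomp1l acomp1r opprK. Qed.

(** Cones of identities, written as extensions whose cocycle is the identity of [tcar X]; this map
    has degree one because of the shift. *)
Definition thull (X : tw) : tw := text (sh_w_deg X) (sh_w_d X).
Definition tcover (X : tw) : tw := text (ush_w_deg X) (ush_w_d X).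

Lemma thull_contractible X : contractible (thull X).
Proof.
apply: (@ext_contractible _ _ _ (aid _ : thom X (tsh 1 X))); rewrite ?acomp1l //.
by move=> n; rewrite /= /pshift subrK acomp1l acomp1r.
Qed.

Lemma tcover_contractible X : contractible (tcover X).
Proof.
apply: (@ext_contractible _ _ _ (aid _ : thom (tsh (-1) X) X)); rewrite ?acomp1l //.
by move=> n; rewrite /= /pshift acomp1l acomp1r.
Qed.

Lemma projective_contractible (P : TX) : projective P -> contractible P.
Proof.
move=> hP; have [|s sE] := hP _ _ (cmk (chain_prr (ush_w_deg P) (ush_w_d P)) :
  ahom (tcover P : TX) P) (aid P).
  by exists (tsh (-1) P), (cmk (chain_inl (ush_w_deg P) (ush_w_d P)));
    exact: gsplit_ext.
exact: contractible_retract sE (tcover_contractible P).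
Qed.

Lemma injective_contractible (P : TX) : injective_object P -> contractible P.
Proof.
move=> hP; have [|s sE] := hP _ _ (cmk (chain_inl (sh_w_deg P) (sh_w_d P)) :
  ahom P (thull P : TX)) (aid P).
  by exists (tsh 1 P), (cmk (chain_prr (sh_w_deg P) (sh_w_d P)));
    exact: gsplit_ext.
exact: contractible_retract sE (thull_contractible P).
Qed.

Lemma t_enough_projectives (X : TX) : exists (Z P : TX) (i : ahom Z P)
  (p : ahom P X), conflation i p /\ projective P.
Proof.
exists (tsh (-1) X), (tcover X), (cmk (chain_inl (ush_w_deg X) (ush_w_d X))),
  (cmk (chain_prr (ush_w_deg X) (ush_w_d X))); split; first exact: gsplit_ext.
exact/contractible_projective/tcover_contractible.
Qed.

Lemma t_enough_injectives (X : TX) : exists (I Z : TX) (i : ahom X I)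
  (p : ahom I Z), conflation i p /\ injective_object I.
Proof.
exists (thull X), (tsh 1 X), (cmk (chain_inl (sh_w_deg X) (sh_w_d X))),
  (cmk (chain_prr (sh_w_deg X) (sh_w_d X))); split; first exact: gsplit_ext.
exact/contractible_injective/thull_contractible.
Qed.

Lemma t_projective_injective (X : TX) : projective X <-> injective_object X.
Proof.
split; first by move/projective_contractible/contractible_injective.
by move/injective_contractible/contractible_projective.
Qed.

Definition tw_frobenius : frobenius_category :=
  @FrobeniusCategory TX t_enough_projectives t_enough_injectives
    t_projective_injective.

(** A null-homotopy [h] of [f] is the same as an extension [[f, h]] of [f] to the contractible hull
    of [X]. *)
Lemma stably_trivial_nullh (X Y : tw_frobenius) (f : ahom X Y) :
  stably_trivial f <-> nullh (cval f).
Proof.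
split.
  move=> [P [a [b [/projective_contractible cP ->]]]].
  rewrite cval_comp; apply: nullh_compl (cvalP b) _.
  by rewrite -[cval a]acomp1l; apply: nullh_compr (cvalP a) cP.
move=> [h [dh fE]].
have db : tdegree (thull X) Y 0 (cval f \oc prj1 _ _ + h \oc prj2 _ _).
  apply: hdegD; first exact: (hdeg_comp (chain_deg (cvalP f)) (hdeg_prj1 _ _)).
  have dh' : tdegree (tsh 1 X) Y 0 h by apply: hdeg_shiftl.
  exact: (hdeg_comp dh' (hdeg_prj2 _ _)).
have cb : @chain _ _ _ (thull X) Y (cval f \oc prj1 _ _ + h \oc prj2 _ _).
  split=> //; rewrite [tdf (thull X)]/(ext_df _) /=.
  rewrite !acompDr !acompDl !acompA !bipE !acompE (chain_d (cvalP f)).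
  rewrite -addrA; congr (_ + _).
  by rewrite fE acompNr acompNl acompDl addrCA addNr addr0.
exists (thull X), (cmk (chain_inl (sh_w_deg X) (sh_w_d X))), (cmk cb).
split; first exact/contractible_projective/thull_contractible.
by apply: cval_inj; rewrite cval_comp /= acompDl !bipE !acompE.
Qed.

End TwistedFrobenius.

(** * The homotopy category of twisted complexes *)

Section AdditiveIso.
Variable A : additive_category.
Implicit Types X Y Z : A.

Lemma aiso_lr X Y (f : ahom X Y) (g h : ahom Y X) :
  aiso (g \oc f) -> aiso (f \oc h) -> aiso f.
Proof.
move=> [a [a1 a2]] [b [b1 b2]]; rewrite /= in a1 a2 b1 b2.
have e : a \oc g = h \oc b.
  rewrite -[a \oc g]acomp1r -b2 !acompA -(acompA a) a1.
  by rewrite acomp1l.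
exists (h \oc b); split=> /=; first by rewrite -e -acompA.
by rewrite acompA.
Qed.

Lemma unipotent_iso X (f : ahom X X) :
  (f - aid X) \oc (f - aid X) = 0 -> aiso f.
Proof.
move=> h; exists (aid X - (f - aid X)).
have e : f = aid X + (f - aid X) by rewrite addrC subrK.
move: (f - aid X) h e => n nn ->; split=> /=.
  by rewrite acompBl !acompDr nn !acompE addrK.
by rewrite acompBr !acompDl nn !acompE addrK.
Qed.

Lemma aisoN X Y (f : ahom X Y) : aiso f -> aiso (- f).
Proof.
by move=> [g [g1 g2]]; exists (- g); split; rewrite /= acompNl acompNr opprK.
Qed.

Lemma aiso_epi X Y Z (f : ahom X Y) (g h : ahom Y Z) :
  aiso f -> g \oc f = h \oc f -> g = h.
Proof.
move=> [f' [_ e]] /(congr1 (fun x => x \oc f')); rewrite -!acompA.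
by rewrite /= in e; rewrite e !acomp1r.
Qed.

Lemma aiso_mono X Y Z (f : ahom Y Z) (g h : ahom X Y) :
  aiso f -> f \oc g = f \oc h -> g = h.
Proof.
move=> [f' [e _]] /(congr1 (fun x => f' \oc x)); rewrite !acompA.
by rewrite /= in e; rewrite e !acomp1l.
Qed.

End AdditiveIso.

Section HomotopyCategory.
Variables (T : additive_category) (L : Type) (E : L -> T).

Local Notation tw := (tw E).
Local Notation TW := (tw_add E).
Local Notation thom X Y := (ahom (tcar X) (tcar Y)).
Local Notation tdegree X Y := (hdeg (tpi X) (tpi Y)).

Lemma null0 (X Y : tw) : nullh (cval (0 : chom X Y)).
Proof. exact: nullh0. Qed.

Lemma nullB (X Y : tw) (f g : chom X Y) :
  nullh (cval f) -> nullh (cval g) -> nullh (cval (f - g)).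
Proof. exact: nullhB. Qed.

Definition null_sub (X Y : tw) : zsub (chom X Y) :=
  @ZSub (chom X Y) (fun f => nullh (cval f)) (null0 X Y) (@nullB X Y).

Definition khom (X Y : tw) := zquotT (null_sub X Y).
HB.instance Definition _ (X Y : tw) := GRing.Zmodule.on (khom X Y).

Definition kcl (X Y : tw) (f : thom X Y) (h : chain f) : khom X Y :=
  zpi (null_sub X Y) (cmk h).

Lemma kcl_surj (X Y : tw) (f : khom X Y) : exists g (h : chain g), f = @kcl X Y g h.
Proof.
have [x <-] := zpi_surj f; exists (cval x), (cvalP x).
by rewrite /kcl; congr zpi; exact: cval_inj.
Qed.

Lemma kcl_eq (X Y : tw) (f g : thom X Y) (hf : chain f) (hg : chain g) :
  kcl hf = kcl hg <-> nullh (f - g).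
Proof. exact: zpi_eq. Qed.

Lemma kcl_eq1 (X Y : tw) (f g : thom X Y) (hf : chain f) (hg : chain g) :
  f = g -> kcl hf = kcl hg.
Proof. by move=> e; apply/kcl_eq; rewrite e subrr; exact: nullh0. Qed.

Definition kcomp (X Y Z : tw) (g : khom Y Z) (f : khom X Y) : khom X Z :=
  zpi (null_sub X Z) (ccomp (zval g) (zval f)).

Lemma chain_add (X Y : tw) (f g : thom X Y) : chain f -> chain g -> chain (f + g).
Proof. exact: (@zinD _ (chain_sub X Y)). Qed.

Lemma chain_opp (X Y : tw) (f : thom X Y) : chain f -> chain (- f).
Proof. exact: (@zinN _ (chain_sub X Y)). Qed.

Lemma kcompE (X Y Z : tw) (g : thom Y Z) (f : thom X Y) (hg : chain g)
  (hf : chain f) : kcomp (kcl hg) (kcl hf) = kcl (chain_comp hg hf).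
Proof.
apply/zpi_eq; set g' := zval _; set f' := zval _.
have ng : nullh (g - cval g') := zval_pi (null_sub Y Z) (cmk hg).
have nf : nullh (f - cval f') := zval_pi (null_sub X Y) (cmk hf).
change (nullh (cval g' \oc cval f' - g \oc f)).
have -> : cval g' \oc cval f' - g \oc f
    = - ((g - cval g') \oc cval f' + g \oc (f - cval f')).
  by apply: oppr_inj; rewrite opprB opprK acompBl acompBr [RHS]addrC subrKA.
apply/nullhN/nullhD; first exact: nullh_compr (cvalP f') ng.
exact: nullh_compl hg nf.
Qed.

Lemma kclD (X Y : tw) (f g : thom X Y) (hf : chain f) (hg : chain g) :
  kcl hf + kcl hg = kcl (chain_add hf hg).
Proof.
rewrite /kcl -zpiD; congr zpi; exact: cval_inj.
Qed.

Lemma kclN (X Y : tw) (f : thom X Y) (hf : chain f) :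
  - kcl hf = kcl (chain_opp hf).
Proof. rewrite /kcl -zpiN; congr zpi; exact: cval_inj. Qed.

Lemma kcl0 (X Y : tw) (h : chain (0 : thom X Y)) : kcl h = 0.
Proof. by rewrite -(zpi0 (null_sub X Y)); congr zpi; exact: cval_inj. Qed.

Lemma kcompA (X Y Z W : tw) (h : khom Z W) (g : khom Y Z) (f : khom X Y) :
  kcomp h (kcomp g f) = kcomp (kcomp h g) f.
Proof.
have [[f0 [hf ->]] [g0 [hg ->]] [h0 [hh ->]]] :=
  And3 (kcl_surj f) (kcl_surj g) (kcl_surj h).
by rewrite !kcompE; apply: kcl_eq1; exact: acompA.
Qed.

Definition kid (X : tw) : khom X X := kcl (chain_id X).

Lemma kcomp1l (X Y : tw) (f : khom X Y) : kcomp (kid Y) f = f.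
Proof.
by have [f0 [hf ->]] := kcl_surj f; rewrite kcompE; apply: kcl_eq1; exact: acomp1l.
Qed.
Lemma kcomp1r (X Y : tw) (f : khom X Y) : kcomp f (kid X) = f.
Proof.
by have [f0 [hf ->]] := kcl_surj f; rewrite kcompE; apply: kcl_eq1; exact: acomp1r.
Qed.
Lemma kcompDl (X Y Z : tw) (g g' : khom Y Z) (f : khom X Y) :
  kcomp (g + g') f = kcomp g f + kcomp g' f.
Proof.
have [[f0 [hf ->]] [g0 [hg ->]] [h0 [hh ->]]] :=
  And3 (kcl_surj f) (kcl_surj g) (kcl_surj g').
by rewrite kclD !kcompE kclD; apply: kcl_eq1; exact: acompDl.
Qed.
Lemma kcompDr (X Y Z : tw) (g : khom Y Z) (f f' : khom X Y) :
  kcomp g (f + f') = kcomp g f + kcomp g f'.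
Proof.
have [[f0 [hf ->]] [g0 [hg ->]] [h0 [hh ->]]] :=
  And3 (kcl_surj f) (kcl_surj g) (kcl_surj f').
by rewrite kclD !kcompE kclD; apply: kcl_eq1; exact: acompDr.
Qed.

Definition kt_add : additive_category.
Proof.
refine (@AdditiveCategory tw (fun X Y => khom X Y : zmodType) kid kcomp
  kcompA kcomp1l kcomp1r kcompDl kcompDr (tzero E) _ (@tplus _ _ E)
  (fun X Y => kcl (chain_inl _ _)) (fun X Y => kcl (chain_inr X Y))
  (fun X Y => kcl (chain_prl X Y)) (fun X Y => kcl (chain_prr _ _))
  _ _ _ _ _).
- by rewrite -(kcl0 (chain0 _ _)); apply: kcl_eq1; exact: aid_azero.
- by move=> X Y; rewrite kcompE; apply: kcl_eq1; exact: prj1_inj1.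
- by move=> X Y; rewrite kcompE; apply: kcl_eq1; exact: prj2_inj2.
- by move=> X Y; rewrite kcompE -(kcl0 (chain0 _ _)); apply: kcl_eq1; exact: prj1_inj2.
- by move=> X Y; rewrite kcompE -(kcl0 (chain0 _ _)); apply: kcl_eq1; exact: prj2_inj1.
- by move=> X Y; rewrite !kcompE kclD; apply: kcl_eq1; exact: oplus_id.
Defined.

Local Notation HK := kt_add.

Lemma kclM (X Y Z : HK) (g : thom Y Z) (f : thom X Y) (hg : chain g)
  (hf : chain f) : (kcl hg : ahom Y Z) \oc (kcl hf : ahom X Y)
    = kcl (chain_comp hg hf).
Proof. exact: kcompE. Qed.

Lemma chain_sh (k : int) (X Y : tw) (f : thom X Y) :
  chain f -> @chain _ _ _ (tsh k X) (tsh k Y) f.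
Proof.
move=> [h1 h2]; split; first by move=> n; rewrite addr0 -h1 addr0.
by rewrite /= acompNl acompNr h2.
Qed.

Lemma nullh_sh (k : int) (X Y : tw) (f : thom X Y) :
  nullh f -> @nullh _ _ _ (tsh k X) (tsh k Y) f.
Proof.
move=> [h [dh fE]]; exists (- h); split.
  by apply/hdegN/hdeg_shift; rewrite addrK.
by rewrite /= !acompNl !acompNr !opprK.
Qed.

Definition ksh (k : int) (X Y : HK) (f : ahom X Y) :
    ahom (tsh k X : HK) (tsh k Y) :=
  zpi (null_sub (tsh k X) (tsh k Y)) (cmk (chain_sh k (cvalP (zval f)))).

Lemma kshE k (X Y : HK) (f : thom X Y) (hf : chain f) :
  ksh k (kcl hf : ahom X Y) = kcl (chain_sh k hf).
Proof.
apply/zpi_eq; set f' := zval _.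
have nf : nullh (f - cval f') := zval_pi (null_sub X Y) (cmk hf).
change (@nullh _ _ _ (tsh k X) (tsh k Y) (cval f' - f)).
by rewrite -opprB; apply/nullhN/nullh_sh.
Qed.

Lemma ksh_id k (X : HK) : ksh k (aid X) = aid (tsh k X : HK).
Proof. by rewrite [aid X]/(kcl _) kshE; exact: kcl_eq1. Qed.

Lemma ksh_comp k (X Y Z : HK) (g : ahom Y Z) (f : ahom X Y) :
  ksh k (g \oc f) = ksh k g \oc ksh k f.
Proof.
have [[f0 [hf ->]] [g0 [hg ->]]] := conj (kcl_surj f) (kcl_surj g).
by rewrite kclM !kshE kclM; exact: kcl_eq1.
Qed.

Lemma kshD k (X Y : HK) (f g : ahom X Y) :
  ksh k (f + g) = ksh k f + ksh k g.
Proof.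
have [[f0 [hf ->]] [g0 [hg ->]]] := conj (kcl_surj f) (kcl_surj g).
by rewrite kclD !kshE kclD; exact: kcl_eq1.
Qed.

Definition kshift (k : int) : functor (add_cat HK) (add_cat HK) :=
  @Functor (add_cat HK) (add_cat HK) (tsh k) (fun X Y f => ksh k f)
    (fun X Y f g e => congr1 _ e) (ksh_id k) (fun X Y Z g f => ksh_comp k g f).

Lemma chain_same (X Y : tw) (f : thom X Y) :
  (forall n, tpi Y n \oc f = f \oc tpi X n) -> f \oc tdf X = tdf Y \oc f -> chain f.
Proof. by move=> h1 h2; split=> // n; rewrite addr0. Qed.

Lemma sh_sh (a b : int) (X : tw) : a + b = 0 ->
  @chain _ _ _ (tsh a (tsh b X)) X (aid (tcar X)) /\
  @chain _ _ _ X (tsh a (tsh b X)) (aid (tcar X)).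
Proof.
move=> ab; split; apply: chain_same => [n|] /=.
- by rewrite /pshift acomp1l acomp1r -addrA ab addr0.
- by rewrite acomp1l acomp1r opprK.
- by rewrite /pshift acomp1l acomp1r -addrA ab addr0.
- by rewrite acomp1l acomp1r opprK.
Qed.

Definition kK (a b : int) (ab : a + b = 0) (X : HK) :
  ahom (tsh a (tsh b X) : HK) X := kcl (sh_sh X ab).1.

Lemma kK_iso a b (ab : a + b = 0) X : aiso (kK ab X).
Proof.
apply/aisoP; exists (kcl (sh_sh X ab).2); rewrite /kK; split; rewrite kclM; apply: kcl_eq1;
  exact: acomp1l.
Qed.

Lemma kK_nat a b (ab : a + b = 0) (X Y : HK) (f : ahom X Y) :
  f \oc kK ab X = kK ab Y \oc ksh a (ksh b f).
Proof.
have [f0 [hf ->]] := kcl_surj f; rewrite !kshE !kclM; apply: kcl_eq1.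
by rewrite acomp1l acomp1r.
Qed.

Lemma chain_w (X Z : tw) (w : thom Z X) : tdegree Z X 1 w ->
  w \oc tdf Z = - (tdf X \oc w) -> @chain _ _ _ Z (tsh 1 X) w.
Proof.
move=> dw wd; split; last by rewrite /= acompNl.
by apply: hdeg_shiftr; rewrite add0r.
Qed.

Lemma w_chain (X Z : tw) (w : thom Z X) : @chain _ _ _ Z (tsh 1 X) w ->
  tdegree Z X 1 w /\ w \oc tdf Z = - (tdf X \oc w).
Proof.
move=> [h1 h2]; split; last by rewrite h2 /= acompNl.
by move=> n; rewrite -h1 /= /pshift addr0.
Qed.

(** The standard triangles are the extensions, with the cocycle as connecting map, and an
    isomorphism is allowed at the middle term only; [kdist_iso] frees the ends. With extensions in
    place of mapping cones the octahedron becomes the reassociation of a threefold extension. *)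
Definition kdist (X Y Z : HK) (u : ahom X Y) (v : ahom Y Z)
    (w : ahom Z (tsh 1 X : HK)) : Prop :=
  exists (o : thom Z X) (dw : tdegree Z X 1 o) (wd : o \oc tdf Z = - (tdf X \oc o))
    (t : ahom (text dw wd : HK) Y),
  [/\ aiso t, u = t \oc kcl (chain_inl dw wd), v \oc t = kcl (chain_prr dw wd)
    & w = kcl (chain_w dw wd)].

Section ExtMaps.
Variables (X Z : HK) (o : thom Z X) (dw : tdegree Z X 1 o)
  (wd : o \oc tdf Z = - (tdf X \oc o)).
Local Notation TXZ := (text dw wd : HK).
Local Notation inl_ := (kcl (chain_inl dw wd) : ahom X TXZ).
Local Notation prr_ := (kcl (chain_prr dw wd) : ahom TXZ Z).

Lemma ext_dist : kdist inl_ prr_ (kcl (chain_w dw wd)).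
Proof.
by exists o, dw, wd, (aid _); split; rewrite ?acomp1l ?acomp1r //; exact: aiso_id.
Qed.

(** A null-homotopy [k] of the restriction of [f] to [X] extends by zero; subtracting its boundary
    makes [f] vanish on [X] strictly, and then [f] factors through the quotient. *)
Lemma ext_wcoker (Y : HK) (f : ahom TXZ Y) : f \oc inl_ = 0 ->
  exists t, f = t \oc prr_.
Proof.
have [f0 [hf ->]] := kcl_surj f.
rewrite kclM -(kcl0 (chain0 _ _)) => /kcl_eq; rewrite subr0 => -[k [dk fk]].
have dK : hdeg (tpi TXZ) (tpi Y) (-1) (k \oc prj1 _ _).
  exact: (hdeg_eq _ (hdeg_comp dk (hdeg_prj1 _ _))).
have cK := chain_htp (X := TXZ) (Y := Y) dK.
pose g0 := f0 - (tdf Y \oc (k \oc prj1 (tcar X) (tcar Z))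
   + k \oc prj1 (tcar X) (tcar Z) \oc tdf TXZ).
have g0i : g0 \oc inj1 (tcar X) (tcar Z) = 0.
  rewrite /g0 /= acompBl fk acompDl !acompA !bipE -(acompA _ (ext_df _)) ext_df1i.
  by rewrite !acompA !bipE subrr.
have cg0 : @chain _ _ _ TXZ Y g0 by exact: chainB.
have g0E : g0 = (g0 \oc inj2 _ _) \oc prj2 _ _.
  rewrite -[LHS]acomp1r; transitivity (g0 \oc aid (oplus (tcar X) (tcar Z))) => //.
  by rewrite -oplus_id acompDr acompA g0i !acompE acompA.
have ct : @chain _ _ _ Z Y (g0 \oc inj2 (tcar X) (tcar Z)).
  split.
    exact: (hdeg_comp (chain_deg cg0) (hdeg_inj2 _ _)).
  rewrite acompA -(chain_d cg0) /= -(acompA _ (ext_df _)) ext_df2i acompDr.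
  by rewrite !acompA g0i !acompE.
exists (kcl ct); rewrite kclM; apply/kcl_eq.
rewrite -g0E /g0 opprB addrC subrK.
by exists (k \oc prj1 _ _).
Qed.

(** [f - aid _] factors through the projection to [Z], which it does not change, so its square is
    zero. *)
Lemma ext_unipotent (f : ahom TXZ TXZ) :
  f \oc inl_ = inl_ -> prr_ \oc f = prr_ -> aiso f.
Proof.
move=> e1 e2; have [|t tE] := @ext_wcoker _ (f - aid _).
  by rewrite acompBl e1 acomp1l subrr.
apply: unipotent_iso; rewrite {1}tE -acompA acompBr e2 acomp1r subrr.
exact: acomp0r.
Qed.

Variables (X' Z' : HK) (o' : thom Z' X') (dw' : tdegree Z' X' 1 o')
  (wd' : o' \oc tdf Z' = - (tdf X' \oc o')).
Local Notation TXZ' := (text dw' wd' : HK).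
Local Notation inl_' := (kcl (chain_inl dw' wd') : ahom X' TXZ').
Local Notation prr_' := (kcl (chain_prr dw' wd') : ahom TXZ' Z').

(** The cocycles commute with [f] and [h] only up to a homotopy [k], and [- k] is the off-diagonal
    entry of the map of extensions. *)
Lemma ext_mor (f : ahom X X') (h : ahom Z Z') :
  ksh 1 f \oc kcl (chain_w dw wd) = (kcl (chain_w dw' wd') : ahom Z' _) \oc h ->
  exists g : ahom TXZ TXZ', g \oc inl_ = inl_' \oc f /\ prr_' \oc g = h \oc prr_.
Proof.
have [[f0 [hf ->]] [h0 [hh ->]]] := conj (kcl_surj f) (kcl_surj h).
rewrite kshE !kclM => /kcl_eq[k [dk kE]].
pose g0 := inj1 (tcar X') (tcar Z') \oc f0 \oc prj1 (tcar X) (tcar Z)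
  + inj2 _ _ \oc h0 \oc prj2 _ _ - inj1 _ _ \oc k \oc prj2 _ _.
have dk' : tdegree Z X' 0 k.
  by move=> n; rewrite -dk /= /pshift subrK addr0.
have cg : @chain _ _ _ TXZ TXZ' g0.
  split.
    apply: hdegB; first apply: hdegD.
    - exact: (hdeg_comp (hdeg_comp (hdeg_inj1 _ _) (chain_deg hf)) (hdeg_prj1 _ _)).
    - exact: (hdeg_comp (hdeg_comp (hdeg_inj2 _ _) (chain_deg hh)) (hdeg_prj2 _ _)).
    - exact: (hdeg_comp (hdeg_comp (hdeg_inj1 _ _) dk') (hdeg_prj2 _ _)).
  apply: oplus_ext_in; apply: oplus_ext_out;
    rewrite /g0 /= /ext_df !expE !zeroE ?(chain_d hf) ?(chain_d hh) //.
  move: kE; rewrite /= acompNl => /(canRL (subrK _)) ->.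
  by rewrite addrA [X in _ + X + _]addrC addrA addNr add0r addrC.
exists (kcl cg); split; rewrite !kclM; apply: kcl_eq1.
  by rewrite /g0 acompBl acompDl !bipE !acompE subr0.
by rewrite /g0 acompBr acompDr !acompA !bipE !acompE subr0.
Qed.

End ExtMaps.

End HomotopyCategory.

Section Reassociate.
Variables (T : additive_category) (A B C : T).
Definition ext_map (A B : T) (f : ahom A A) (g : ahom B B) (w : ahom B A) :
    ahom (oplus A B) (oplus A B) :=
  inj1 _ _ \oc f \oc prj1 _ _ + inj2 _ _ \oc g \oc prj2 _ _ + inj1 _ _ \oc w \oc prj2 _ _.

(** Both sides carry one and the same upper triangular differential on three summands, grouped in
    two ways; [s] is the associativity isomorphism. *)
Lemma ext_map_assoc (f : ahom A A) (g : ahom B B) (h : ahom C C) (w : ahom B A)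
    (v : ahom C (oplus A B)) :
  let s : ahom (oplus (oplus A B) C) (oplus A (oplus B C)) :=
    inj1 A (oplus B C) \oc prj1 A B \oc prj1 (oplus A B) C
    + inj2 A (oplus B C) \oc inj1 B C \oc prj2 A B \oc prj1 (oplus A B) C
    + inj2 A (oplus B C) \oc inj2 B C \oc prj2 (oplus A B) C in
  s \oc ext_map (ext_map f g w) h v
    = ext_map f (ext_map g h (prj2 A B \oc v)) (w \oc prj1 B C + prj1 A B \oc v \oc prj2 B C) \oc s.
Proof.
have vE : v = inj1 _ _ \oc (prj1 A B \oc v) + inj2 _ _ \oc (prj2 A B \oc v).
  by rewrite !acompA -acompDl oplus_id acomp1l.
move: vE; move: (prj1 A B \oc v) (prj2 A B \oc v) => a b -> /=; rewrite /ext_map.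
apply: oplus_ext_in; first (apply: oplus_ext_in); rewrite !expE !zeroE; zmod.
Qed.
End Reassociate.

(** * The triangulated structure of the homotopy category *)

Section HomotopyTriangulated.
Variables (T : additive_category) (L : Type) (E : L -> T).

Local Notation tw := (tw E).
Local Notation HK := (kt_add E).
Local Notation thom X Y := (ahom (tcar X) (tcar Y)).
Local Notation tdegree X Y := (hdeg (tpi X) (tpi Y)).
Local Notation "X [1]" := (tsh 1 X : HK) (at level 2, format "X [1]").

(** Composing [g] with a map of extensions over the inverses of [f] and [h] gives the identity on
    both ends, hence a unipotent map, on either side. *)
Lemma ext_five (X Z X' Z' : HK) (o : thom Z X) (dw : tdegree Z X 1 o)
  (wd : o \oc tdf Z = - (tdf X \oc o)) (o' : thom Z' X') (dw' : tdegree Z' X' 1 o')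
  (wd' : o' \oc tdf Z' = - (tdf X' \oc o'))
  (f : ahom X X') (h : ahom Z Z') (g : ahom (text dw wd : HK) (text dw' wd')) :
  aiso f -> aiso h ->
  ksh 1 f \oc kcl (chain_w dw wd) = (kcl (chain_w dw' wd') : ahom Z' _) \oc h ->
  g \oc kcl (chain_inl dw wd) = (kcl (chain_inl dw' wd') : ahom X' _) \oc f ->
  (kcl (chain_prr dw' wd') : ahom _ Z') \oc g = h \oc kcl (chain_prr dw wd) ->
  aiso g.
Proof.
move=> /aisoP[f' [f1 f2]] /aisoP[h' [h1 h2]] e eg1 eg2.
have [|g' [eg1' eg2']] := @ext_mor _ _ _ X' Z' o' dw' wd' X Z o dw wd f' h'.
  rewrite -[LHS]acomp1r -h2 !acompA -(acompA _ _ h) -e acompA -ksh_comp f1.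
  by rewrite ksh_id acomp1l.
apply: (@aiso_lr _ _ _ g g' g'); apply: ext_unipotent.
- by rewrite -acompA eg1 acompA eg1' -acompA f1 acomp1r.
- by rewrite acompA eg2' -acompA eg2 acompA h1 acomp1l.
- by rewrite -acompA eg1' acompA eg1 -acompA f2 acomp1r.
- by rewrite acompA eg2 -acompA eg2' acompA h2 acomp1l.
Qed.

Lemma kdist_iso (X Y Z X' Y' Z' : HK)
    (u : ahom X Y) (v : ahom Y Z) (w : ahom Z X[1])
    (u' : ahom X' Y') (v' : ahom Y' Z') (w' : ahom Z' X'[1])
    (f : ahom X X') (g : ahom Y Y') (h : ahom Z Z') :
  aiso f -> aiso g -> aiso h ->
  g \oc u = u' \oc f -> h \oc v = v' \oc g -> ksh 1 f \oc w = w' \oc h ->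
  kdist u v w -> kdist u' v' w'.
Proof.
move=> fi gi hi e1 e2 e3 [o [dw [wd [t [ti uE vE wE]]]]].
have [w0 [cw wE']] := kcl_surj w'; have [dw' wd'] := w_chain cw.
have e3' : ksh 1 f \oc kcl (chain_w dw wd) = (kcl (chain_w dw' wd') : ahom Z' _) \oc h.
  by rewrite -wE e3; congr (_ \oc _); rewrite wE'; exact: kcl_eq1.
have [s [s1 s2]] := ext_mor e3'.
have si := ext_five fi hi e3' s1 s2.
have [s' [k1 k2]] := (aisoP _).1 si.
exists w0, dw', wd', (g \oc t \oc s'); split.
- by apply: aiso_comp; [exact: aiso_comp | exists s].
- apply: (aiso_epi fi); rewrite -e1 uE -!acompA -s1.
  by congr (_ \oc (_ \oc _)); rewrite acompA k1 acomp1l.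
- apply: (aiso_epi si); rewrite s2 -!acompA k1 acomp1r !acompA -e2 -!acompA.
  by rewrite vE.
by rewrite wE'; exact: kcl_eq1.
Qed.

Lemma kdist_id (X : HK) : @kdist _ _ _ X X (azero : HK) (aid X) 0 0.
Proof.
have Zz (V : HK) (f g : ahom V (azero : HK)) : f = g.
  by rewrite -[f]acomp1l -[g]acomp1l aid_azero !acomp0l.
exists 0, (hdeg0 (tpi (tzero E)) (tpi X) 1), (zero_wd X (tzero E)),
  (kcl (chain_prl X (tzero E))); split; last 2 first.
- exact: Zz.
- by rewrite -(kcl0 (chain0 _ _)); exact: kcl_eq1.
- apply/aisoP; exists (kcl (chain_inl (hdeg0 (tpi (tzero E)) (tpi X) 1)
    (zero_wd X (tzero E)))); split; rewrite kclM; apply: kcl_eq1.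
    rewrite -oplus_id -[LHS]addr0; congr (_ + _).
    by rewrite -[prj2 _ _]acomp1l [aid (tcar (tzero E))]aid_azero !acomp0l acomp0r.
  exact: prj1_inj1.
- by rewrite kclM; apply: kcl_eq1; rewrite prj1_inj1.
Qed.

Section RotateA.
Variables (X Z : HK) (o : thom Z X) (dw : tdegree Z X 1 o)
  (wd : o \oc tdf Z = - (tdf X \oc o)).
Local Notation Y := (text dw wd).

Lemma rotA_deg : tdegree (tsh 1 X) Y 1 (- inj1 (tcar X) (tcar Z)).
Proof. by apply: hdeg_shiftl; apply: hdegN; exact: hdeg_inj1. Qed.

Lemma rotA_d : (- inj1 (tcar X) (tcar Z)) \oc tdf (tsh 1 X)
  = - (tdf Y \oc - inj1 (tcar X) (tcar Z)).
Proof. by rewrite /= acompNl !acompNr !opprK ext_df1i. Qed.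

Local Notation Q := (text rotA_deg rotA_d : HK).

Lemma rotA_chain : @chain _ _ _ Q Z
  (prj2 (tcar X) (tcar Z) \oc prj1 (oplus (tcar X) (tcar Z)) (tcar X)).
Proof.
split.
  exact: (hdeg_comp (@hdeg_prj2 _ _ _ (tpi X) (tpi Z)) (@hdeg_prj1 _ _ _ (tpi Y)
    (tpi (tsh 1 X)))).
by rewrite /= /ext_df /= /ext_df /= !expE !zeroE.
Qed.

(** [Q] is the cone of the inclusion of [X] in [Y], which ought to be [Z]. The graded section of [Z]
    is not a chain map, and the entry [o] of the inverse corrects it; the homotopy cancels the two
    copies of [X]. *)
Lemma rotA_iso : aiso (kcl rotA_chain : ahom Q Z).
Proof.
have ci : @chain _ _ _ Z Q (inj1 (tcar Y) (tcar X) \oc inj2 (tcar X) (tcar Z)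
    + inj2 _ _ \oc o).
  split.
    apply: hdegD; first exact: (hdeg_comp (hdeg_inj1 _ _) (hdeg_inj2 _ _)).
    exact: (hdeg_comp (@hdeg_inj2 _ _ _ (tpi Y) (tpi (tsh 1 X)))
      (chain_deg (chain_w dw wd))).
  rewrite /= /ext_df /= /ext_df /= !expE !zeroE (acl wd) !expE; zmod.
apply/aisoP; exists (kcl ci); split; rewrite kclM.
  apply/kcl_eq; exists (inj2 (tcar Y) (tcar X) \oc prj1 (tcar X) (tcar Z)
    \oc prj1 (tcar Y) (tcar X)); split.
    have d1 : tdegree X (tsh 1 X) (-1) (aid (tcar X)).
      by apply: hdeg_shiftr; exact: hdeg_id.
    have := hdeg_comp (hdeg_comp (@hdeg_inj2 _ _ _ (tpi Y) (tpi (tsh 1 X))) d1)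
      (hdeg_comp (hdeg_prj1 (tpi X) (tpi Z)) (@hdeg_prj1 _ _ _ (tpi Y) (tpi (tsh 1 X)))).
    by rewrite acomp1r acompA; apply: hdeg_eq.
  apply: oplus_ext_in; first (apply: oplus_ext_in);
    rewrite /= /ext_df /= /ext_df /= !expE !zeroE; zmod.
by apply: kcl_eq1; rewrite ?expE ?zeroE.
Qed.

Lemma rotA : kdist (kcl (chain_prr dw wd) : ahom (Y : HK) Z)
  (kcl (chain_w dw wd) : ahom Z X[1]) (- ksh 1 (kcl (chain_inl dw wd) : ahom X (Y : HK))).
Proof.
exists (- inj1 (tcar X) (tcar Z)), rotA_deg, rotA_d, (kcl rotA_chain); split.
- exact: rotA_iso.
- by rewrite kclM; apply: kcl_eq1; rewrite ?expE ?zeroE.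
- rewrite kclM; apply/kcl_eq.
  exists (prj1 (tcar X) (tcar Z) \oc prj1 (tcar Y) (tcar X)); split.
    have d1 : tdegree X (tsh 1 X) (-1) (aid (tcar X)).
      by apply: hdeg_shiftr; exact: hdeg_id.
    have := hdeg_comp d1
      (hdeg_comp (hdeg_prj1 (tpi X) (tpi Z)) (@hdeg_prj1 _ _ _ (tpi Y) (tpi (tsh 1 X)))).
    by rewrite acomp1l; apply: hdeg_eq.
  apply: oplus_ext_in; first (apply: oplus_ext_in);
    rewrite /= /ext_df /= /ext_df /= !expE !zeroE; zmod.
by rewrite kshE kclN; exact: kcl_eq1.
Qed.

End RotateA.

Section RotateB.
Variables (X Y : HK) (u : thom X Y) (cu : chain u).

Lemma rotB_deg : tdegree (tsh 1 X) Y 1 (- u).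
Proof. by apply: hdeg_shiftl; apply: hdegN; exact: chain_deg cu. Qed.

Lemma rotB_d : (- u) \oc tdf (tsh 1 X) = - (tdf Y \oc - u).
Proof. by rewrite /= acompNl !acompNr !opprK (chain_d cu). Qed.

(** The mapping cone of [u], as an extension with cocycle [- u]; the sign is the one of [- ksh 1 u]
    in the rotation axiom. *)
Definition kcone : HK := text rotB_deg rotB_d.
Local Notation Z := kcone.

Lemma cone_deg : tdegree Z X 1 (prj2 (tcar Y) (tcar X)).
Proof.
have d1 : tdegree (tsh 1 X) X 1 (aid (tcar X)).
  by apply: hdeg_shiftl; exact: hdeg_id.
have := hdeg_comp d1 (@hdeg_prj2 _ _ _ (tpi Y) (tpi (tsh 1 X))).
by rewrite acomp1l.
Qed.

Lemma cone_d : prj2 (tcar Y) (tcar X) \oc tdf Z = - (tdf X \oc prj2 (tcar Y) (tcar X)).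
Proof. by rewrite /= /ext_df /= ?expE ?zeroE. Qed.

Local Notation Q := (text cone_deg cone_d : HK).

Lemma rotB_chain : @chain _ _ _ Q Y
  (u \oc prj1 (tcar X) (tcar Z) + prj1 (tcar Y) (tcar X) \oc prj2 (tcar X) (tcar Z)).
Proof.
split.
  apply: hdegD; first exact: (hdeg_comp (chain_deg cu) (hdeg_prj1 _ _)).
  exact: (hdeg_comp (@hdeg_prj1 _ _ _ (tpi Y) (tpi (tsh 1 X))) (hdeg_prj2 _ (tpi Z))).
rewrite /= /ext_df /= /ext_df /= !expE !zeroE (chain_d cu); zmod.
Qed.

Lemma rotB_iso : aiso (kcl rotB_chain : ahom Q Y).
Proof.
have ci : @chain _ _ _ Y Q (inj2 (tcar X) (tcar Z) \oc inj1 (tcar Y) (tcar X)).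
  split.
    exact: (hdeg_comp (hdeg_inj2 _ (tpi Z)) (@hdeg_inj1 _ _ _ (tpi Y) (tpi (tsh 1 X)))).
  by rewrite /= /ext_df /= /ext_df /= !expE !zeroE.
apply/aisoP; exists (kcl ci); split; rewrite kclM.
  apply/kcl_eq; exists (- (inj2 (tcar X) (tcar Z) \oc inj2 (tcar Y) (tcar X)
    \oc prj1 (tcar X) (tcar Z))); split.
    have d1 : tdegree X (tsh 1 X) (-1) (aid (tcar X)).
      by apply: hdeg_shiftr; exact: hdeg_id.
    have := hdeg_comp (hdeg_comp (hdeg_comp (hdeg_inj2 (tpi X) (tpi Z))
      (@hdeg_inj2 _ _ _ (tpi Y) (tpi (tsh 1 X)))) d1) (hdeg_prj1 (tpi X) (tpi Z)).
    by rewrite acomp1r => /hdegN; apply: hdeg_eq.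
  apply: oplus_ext_in; last (apply: oplus_ext_in);
    rewrite /= /ext_df /= /ext_df /= !expE !zeroE; zmod.
by apply: kcl_eq1; rewrite ?expE ?zeroE.
Qed.

Lemma rotB : kdist (kcl cu : ahom X Y) (kcl (chain_inl rotB_deg rotB_d) : ahom Y Z)
  (kcl (chain_prr rotB_deg rotB_d) : ahom Z X[1]).
Proof.
exists (prj2 (tcar Y) (tcar X)), cone_deg, cone_d, (kcl rotB_chain); split.
- exact: rotB_iso.
- by rewrite kclM; apply: kcl_eq1; rewrite ?expE ?zeroE.
- rewrite kclM; apply/kcl_eq.
  exists (- (inj2 (tcar Y) (tcar X) \oc prj1 (tcar X) (tcar Z))); split.
    have d1 : tdegree X (tsh 1 X) (-1) (aid (tcar X)).
      by apply: hdeg_shiftr; exact: hdeg_id.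
    have := hdeg_comp (hdeg_comp
      (@hdeg_inj2 _ _ _ (tpi Y) (tpi (tsh 1 X))) d1) (hdeg_prj1 (tpi X) (tpi Z)).
    by rewrite acomp1r => /hdegN; apply: hdeg_eq.
  apply: oplus_ext_in; last (apply: oplus_ext_in);
    rewrite /= /ext_df /= /ext_df /= !expE !zeroE; zmod.
exact: kcl_eq1.
Qed.

End RotateB.

Lemma kdist_iso2 (X Y Z Y' : HK) (u : ahom X Y) (v : ahom Y Z) (w : ahom Z X[1])
    (g : ahom Y Y') (v' : ahom Y' Z) :
  aiso g -> v = v' \oc g -> kdist u v w -> kdist (g \oc u) v' w.
Proof.
move=> ig ev; apply: (kdist_iso (aiso_id _) ig (aiso_id _)).
- by rewrite acomp1r.
- by rewrite acomp1l.
- by rewrite ksh_id acomp1l acomp1r.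
Qed.

Lemma kdist_rot1 (X Y Z : HK) (u : ahom X Y) (v : ahom Y Z) (w : ahom Z X[1]) :
  kdist u v w -> kdist v w (- ksh 1 u).
Proof.
move=> [o [dw [wd [t [ti -> vE ->]]]]].
apply: (kdist_iso ti (aiso_id _) (aiso_id _)) (rotA dw wd).
- by rewrite acomp1l vE.
- by rewrite acomp1l acomp1r.
- by rewrite acompNr acomp1r ksh_comp.
Qed.

Lemma kdist_rot2 (X Y Z : HK) (u : ahom X Y) (v : ahom Y Z) (w : ahom Z X[1]) :
  kdist v w (- ksh 1 u) -> kdist u v w.
Proof.
have [u0 [cu uE]] := kcl_surj u; rewrite uE kshE kclN.
move=> [o [dw [wd [t [ti vE wE oE]]]]].
have e : ksh 1 (aid Y) \oc kcl (chain_w (rotB_deg cu) (rotB_d cu))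
    = (kcl (chain_w dw wd) : ahom _ Y[1]) \oc aid X[1].
  by rewrite ksh_id acomp1l acomp1r -oE; exact: kcl_eq1.
have [g [g1 g2]] := ext_mor e.
have gi := ext_five (aiso_id _) (aiso_id _) e g1 g2.
apply: (kdist_iso (aiso_id _) (aiso_id _) (aiso_comp ti gi)) (rotB cu).
- by rewrite acomp1l acomp1r.
- by rewrite -acompA g1 acomp1r acomp1r.
- by rewrite ksh_id acomp1l acompA wE g2 acomp1l.
Qed.

Lemma kdist_complete (X Y : HK) (u : ahom X Y) :
  exists (Z : HK) (v : ahom Y Z) (w : ahom Z X[1]), kdist u v w.
Proof.
by have [u0 [cu ->]] := kcl_surj u; do 3!eexists; exact: rotB.
Qed.

(** After one rotation the given square is a square of cocycles, for which [ext_mor] constructs the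
    fill-in and [ext_five] makes it invertible. *)
Lemma kdist_mor5 (X Y Z X' Y' Z' : HK)
    (u : ahom X Y) (v : ahom Y Z) (w : ahom Z X[1])
    (u' : ahom X' Y') (v' : ahom Y' Z') (w' : ahom Z' X'[1])
    (f : ahom X X') (g : ahom Y Y') :
  kdist u v w -> kdist u' v' w' -> g \oc u = u' \oc f ->
  exists h : ahom Z Z', [/\ h \oc v = v' \oc g, ksh 1 f \oc w = w' \oc h
    & aiso f -> aiso g -> aiso h].
Proof.
move=> /kdist_rot1[o [dw [wd [t [ti vE wE oE]]]]].
move=> /kdist_rot1[o' [dw' [wd' [t' [ti' vE' wE' oE']]]]] e.
have e1 : ksh 1 g \oc kcl (chain_w dw wd)
    = (kcl (chain_w dw' wd') : ahom _ Y'[1]) \oc ksh 1 f.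
  by rewrite -oE -oE' acompNl acompNr -!ksh_comp e.
have [s [s1 s2]] := ext_mor e1.
have [r [r1 r2]] := (aisoP _).1 ti.
exists (t' \oc s \oc r); split.
- by rewrite vE !acompA -(acompA _ r) r1 acomp1r -acompA s1 acompA vE'.
- by rewrite !acompA wE' s2 -acompA -wE -!acompA r2 acomp1r.
move=> fi gi; apply: aiso_comp; last by exists t.
apply: aiso_comp => //; apply: (ext_five gi _ e1 s1 s2).
have [f' [f1 f2]] := (aisoP _).1 fi.
by apply/aisoP; exists (ksh 1 f'); rewrite -!ksh_comp f1 f2 !ksh_id.
Qed.

Lemma kdist_mor (X Y Z X' Y' Z' : HK)
    (u : ahom X Y) (v : ahom Y Z) (w : ahom Z X[1])
    (u' : ahom X' Y') (v' : ahom Y' Z') (w' : ahom Z' X'[1])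
    (f : ahom X X') (g : ahom Y Y') :
  kdist u v w -> kdist u' v' w' -> g \oc u = u' \oc f ->
  exists h : ahom Z Z', h \oc v = v' \oc g /\ ksh 1 f \oc w = w' \oc h.
Proof. by move=> d d' e; have [h [h1 h2 _]] := kdist_mor5 d d' e; exists h. Qed.

Section Octahedron.
Variables (X Z' X' : HK) (o1 : thom Z' X) (d1 : tdegree Z' X 1 o1)
  (c1 : o1 \oc tdf Z' = - (tdf X \oc o1)).
Local Notation Y := (text d1 c1).
Variables (o2 : thom X' Y) (d2 : tdegree X' Y 1 o2)
  (c2 : o2 \oc tdf X' = - (tdf Y \oc o2)).
Local Notation V := (text d2 c2).

Let a := prj1 (tcar X) (tcar Z') \oc o2.
Let b := prj2 (tcar X) (tcar Z') \oc o2.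

Lemma oct_db : tdegree X' Z' 1 b.
Proof. exact: (hdeg_comp (hdeg_prj2 _ _) d2). Qed.
Lemma oct_cb : b \oc tdf X' = - (tdf Z' \oc b).
Proof. by rewrite -acompA c2 /= acompNr acompA ext_df2 acompA. Qed.

Local Notation Y0 := (text oct_db oct_cb).

(** [a] and [b] are the components of [o2] in [X] and [Z']. With [Y0] the extension of [X'] by [Z']
    along [b], this is the cocycle that presents [V] as an extension of [Y0] by [X]. *)
Definition oct_w := o1 \oc prj1 (tcar Z') (tcar X') + a \oc prj2 _ _.

Lemma oct_d3 : tdegree Y0 X 1 oct_w.
Proof.
apply: hdegD; first exact: (hdeg_comp d1 (hdeg_prj1 _ _)).
exact: (hdeg_comp (hdeg_comp (hdeg_prj1 _ _) d2) (hdeg_prj2 _ _)).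
Qed.

Lemma oct_c3 : oct_w \oc tdf Y0 = - (tdf X \oc oct_w).
Proof.
have ca : a \oc tdf X' = - (tdf X \oc a) - o1 \oc b.
  rewrite -acompA c2 /= acompNr acompA ext_df1 acompDl -!acompA.
  by rewrite opprD.
rewrite /oct_w /= acompDl -!(acompA _ _ (ext_df _)) ext_df1 ext_df2 acompDr.
rewrite !acompA c1 ca acompDr !acompDl !acompNl !acompA; zmod.
Qed.

Local Notation W := (text oct_d3 oct_c3).

Definition oct_a : thom V W :=
  inj1 (tcar X) (tcar Y0) \oc prj1 (tcar X) (tcar Z') \oc prj1 (tcar Y) (tcar X')
  + inj2 (tcar X) (tcar Y0) \oc inj1 (tcar Z') (tcar X') \oc prj2 (tcar X) (tcar Z')
      \oc prj1 (tcar Y) (tcar X')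
  + inj2 (tcar X) (tcar Y0) \oc inj2 (tcar Z') (tcar X') \oc prj2 (tcar Y) (tcar X').

Definition oct_b : thom W V :=
  inj1 (tcar Y) (tcar X') \oc inj1 (tcar X) (tcar Z') \oc prj1 (tcar X) (tcar Y0)
  + inj1 (tcar Y) (tcar X') \oc inj2 (tcar X) (tcar Z') \oc prj1 (tcar Z') (tcar X')
      \oc prj2 (tcar X) (tcar Y0)
  + inj2 (tcar Y) (tcar X') \oc prj2 (tcar Z') (tcar X') \oc prj2 (tcar X) (tcar Y0).

Lemma oct_ab : oct_a \oc oct_b = aid _.
Proof.
apply: oplus_ext_in; last (apply: oplus_ext_in); rewrite /oct_a /oct_b /= !expE !zeroE //.
Qed.

Lemma oct_ba : oct_b \oc oct_a = aid _.
Proof.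
apply: oplus_ext_in; first (apply: oplus_ext_in); rewrite /oct_a /oct_b /= !expE !zeroE //.
Qed.

Lemma oct_ca : chain oct_a.
Proof.
split.
  apply: hdegD; first apply: hdegD.
  - exact: (hdeg_comp (hdeg_comp (hdeg_inj1 (tpi X) (tpi Y0)) (hdeg_prj1 (tpi X) (tpi Z')))
      (hdeg_prj1 (tpi Y) (tpi X'))).
  - exact: (hdeg_comp (hdeg_comp (hdeg_comp (hdeg_inj2 (tpi X) (tpi Y0))
      (hdeg_inj1 (tpi Z') (tpi X'))) (hdeg_prj2 (tpi X) (tpi Z')))
      (hdeg_prj1 (tpi Y) (tpi X'))).
  - exact: (hdeg_comp (hdeg_comp (hdeg_inj2 (tpi X) (tpi Y0)) (hdeg_inj2 (tpi Z') (tpi X')))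
      (hdeg_prj2 (tpi Y) (tpi X'))).
exact: (ext_map_assoc (tdf X) (tdf Z') (tdf X') o1 o2).
Qed.

Lemma oct_iso : aiso (kcl oct_ca : ahom (V : HK) W).
Proof.
have cb : chain oct_b.
  split.
    apply: hdegD; first apply: hdegD.
    - exact: (hdeg_comp (hdeg_comp (hdeg_inj1 (tpi Y) (tpi X')) (hdeg_inj1 (tpi X) (tpi Z')))
        (hdeg_prj1 (tpi X) (tpi Y0))).
    - exact: (hdeg_comp (hdeg_comp (hdeg_comp (hdeg_inj1 (tpi Y) (tpi X'))
        (hdeg_inj2 (tpi X) (tpi Z'))) (hdeg_prj1 (tpi Z') (tpi X')))
        (hdeg_prj2 (tpi X) (tpi Y0))).
    - exact: (hdeg_comp (hdeg_comp (hdeg_inj2 (tpi Y) (tpi X')) (hdeg_prj2 (tpi Z') (tpi X')))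
        (hdeg_prj2 (tpi X) (tpi Y0))).
  rewrite -[LHS]acomp1l -oct_ba -acompA (acompA oct_a) oct_ab acomp1l.
  rewrite -[tdf W]acomp1r -oct_ab (acompA (tdf W)) -(chain_d oct_ca).
  by rewrite !acompA oct_ba acomp1l.
apply/aisoP; exists (kcl cb); rewrite !kclM; split; apply: kcl_eq1.
  exact: oct_ba.
exact: oct_ab.
Qed.

Local Notation inY := (kcl (chain_inl d1 c1) : ahom X (Y : HK)).
Local Notation outY := (kcl (chain_prr d1 c1) : ahom (Y : HK) Z').
Local Notation inV := (kcl (chain_inl d2 c2) : ahom (Y : HK) (V : HK)).
Local Notation outV := (kcl (chain_prr d2 c2) : ahom (V : HK) X').
Local Notation wY := (kcl (chain_w d1 c1) : ahom Z' X[1]).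
Local Notation wV := (kcl (chain_w d2 c2) : ahom X' (tsh 1 Y : HK)).

Local Notation outW := (kcl (chain_prr oct_d3 oct_c3) : ahom (W : HK) (Y0 : HK)).
Local Notation inW := (kcl (chain_inl oct_d3 oct_c3) : ahom X (W : HK)).
Local Notation wW := (kcl (chain_w oct_d3 oct_c3) : ahom (Y0 : HK) X[1]).
Local Notation VW := (kcl oct_ca : ahom (V : HK) (W : HK)).

(** Regrouping [V] as the extension [W] of [Y0] by [X] makes [Y0] the third vertex. The relations
    hold already for chain maps, except the last one, which needs a homotopy. *)
Lemma oct_std : exists (Y' : HK) (f : ahom Z' Y') (g : ahom Y' X')
    (m : ahom (V : HK) Y') (n : ahom Y' X[1]),
  [/\ kdist f g (ksh 1 outY \oc wV), kdist (inV \oc inY) m n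
    & [/\ f \oc outY = m \oc inV, n \oc f = wY, g \oc m = outV
    & wV \oc g = ksh 1 inY \oc n]].
Proof.
have [r [r1 r2]] := (aisoP _).1 oct_iso.
exists Y0, (kcl (chain_inl oct_db oct_cb)), (kcl (chain_prr oct_db oct_cb)),
  (outW \oc VW), wW.
split; last split.
- have -> : ksh 1 outY \oc wV = (kcl (chain_w oct_db oct_cb) : ahom X' Z'[1]).
    by rewrite kshE kclM; exact: kcl_eq1.
  exact: ext_dist.
- have -> : inV \oc inY = r \oc inW.
    apply: (aiso_mono oct_iso); rewrite [RHS]acompA r2 acomp1l !kclM.
    by apply: kcl_eq1; rewrite /oct_a !expE !zeroE.
  apply: (kdist_iso2 _ _ (ext_dist oct_d3 oct_c3)); first by exists VW.
  by rewrite -acompA r2 acomp1r.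
- by rewrite !kclM; apply: kcl_eq1; rewrite /oct_a !expE !zeroE.
- by rewrite !kclM; apply: kcl_eq1; rewrite /oct_w !expE !zeroE.
- by rewrite !kclM; apply: kcl_eq1; rewrite /oct_a !expE !zeroE.
rewrite kshE !kclM; apply/kcl_eq; exists (inj2 (tcar X) (tcar Z') \oc prj1 _ _).
split.
  have i1 : tdegree Y (tsh 1 Y) (-1) (aid (tcar Y)).
    by apply: hdeg_shiftr; exact: hdeg_id.
  have := hdeg_comp (hdeg_comp i1 (hdeg_inj2 (tpi X) (tpi Z'))) (hdeg_prj1 (tpi Z') (tpi X')).
  by rewrite acomp1l; apply: hdeg_eq.
have o2E : o2 = inj1 _ _ \oc a + inj2 _ _ \oc b.
  by rewrite /a /b !acompA -acompDl oplus_id acomp1l.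
rewrite {1}o2E /oct_w /= /ext_df /= !expE !zeroE; zmod.
Qed.

End Octahedron.

(** Transport of [oct_std] along the isomorphisms [t1] and [t2] with extensions and along an
    isomorphism [h] from the constructed third triangle to the given one. *)
Lemma kdist_oct (X Y Z X' Y' Z' : HK)
    (u : ahom X Y) (j : ahom Y Z') (k : ahom Z' X[1])
    (v : ahom Y Z) (l : ahom Z X') (i : ahom X' Y[1])
    (m : ahom Z Y') (n : ahom Y' X[1]) :
  kdist u j k -> kdist v l i -> kdist (v \oc u) m n ->
  exists (f : ahom Z' Y') (g : ahom Y' X'),
    [/\ kdist f g (ksh 1 j \oc i),
        f \oc j = m \oc v, n \oc f = k, g \oc m = l
      & i \oc g = ksh 1 u \oc n].
Proof.
move=> [o1 [d1 [c1 [t1 [t1i uE jE kE]]]]] dv dvu.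
have [r1 [r1t t1r]] := (aisoP _).1 t1i.
have ir1 : aiso r1 by exists t1.
have dv' : kdist (v \oc t1) l (ksh 1 r1 \oc i).
  apply: (kdist_iso ir1 (aiso_id _) (aiso_id _)) dv.
  - by rewrite acomp1l -acompA t1r acomp1r.
  - by rewrite acomp1l acomp1r.
  - by rewrite acomp1r.
have [o2 [d2 [c2 [t2 [t2i vE lE iE]]]]] := dv'.
have [r2 [r2t t2r]] := (aisoP _).1 t2i.
have [Y0 [f0 [g0 [m0 [n0 [dfg dmn [e1 e2 e3 e4]]]]]]] := oct_std d2 c2.
have vuE : v \oc u = t2 \oc ((kcl (chain_inl d2 c2) : ahom (text d1 c1 : HK)
    (text d2 c2 : HK)) \oc kcl (chain_inl d1 c1)).
  by rewrite uE !acompA vE.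
have dmn' : kdist (v \oc u) (m0 \oc r2) n0.
  by rewrite vuE; apply: kdist_iso2 dmn => //; rewrite -acompA r2t acomp1r.
have [|h [h1 h2 hi]] := @kdist_mor5 _ _ _ _ _ _ _ _ _ _ _ _ (aid X) (aid Z) dmn' dvu.
  by rewrite acomp1l acomp1r.
have {}hi := hi (aiso_id _) (aiso_id _).
have [h' [hh1 hh2]] := (aisoP _).1 hi.
rewrite acomp1r in h1; rewrite ksh_id acomp1l in h2.
exists (h \oc f0), (g0 \oc h'); split.
- have -> : ksh 1 j \oc i
      = ksh 1 (kcl (chain_prr d1 c1) : ahom (text d1 c1 : HK) Z') \oc kcl (chain_w d2 c2).
    rewrite -jE -iE ksh_comp -acompA; congr (_ \oc _).
    by rewrite acompA -ksh_comp t1r ksh_id acomp1l.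
  by apply: kdist_iso2 dfg => //; rewrite -acompA hh1 acomp1r.
- apply: (aiso_epi t1i); rewrite -!acompA jE e1 vE -h1 !acompA.
  by rewrite -(acompA _ r2) r2t acomp1r.
- by rewrite acompA -h2 e2 kE.
- apply: (aiso_epi t2i); rewrite lE -h1 !acompA -(acompA _ h') hh1 acomp1r.
  by rewrite -acompA r2t acomp1r e3.
have ir1' : aiso (ksh 1 r1).
  by apply/aisoP; exists (ksh 1 t1); rewrite -!ksh_comp r1t t1r !ksh_id.
apply: (aiso_mono ir1').
rewrite !acompA iE e4 -ksh_comp uE acompA r1t acomp1l -acompA.
by rewrite h2 -!acompA hh2 acomp1r.
Qed.

Definition kt_tri : triangulated_category.
Proof.
refine (@TriangulatedCategory HK (kshift E 1) (@kshD _ _ E 1) (kshift E (-1))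
  (fun X => kK (addNr 1) X) (fun X => kK_iso (addNr 1) X) (fun X Y f => kK_nat (addNr 1) f)
  (fun X => kK (addrN 1) X) (fun X => kK_iso (addrN 1) X) (fun X Y f => kK_nat (addrN 1) f)
  (@kdist T L E) kdist_iso kdist_id kdist_complete _ kdist_mor kdist_oct).
by move=> X Y Z u v w; split; [exact: kdist_rot1 | exact: kdist_rot2].
Defined.

End HomotopyTriangulated.

(** * General facts on triangulated categories *)

Section Triangulated.
Variable T : triangulated_category.
Implicit Types X Y Z W : T.

Definition sh X Y (f : ahom X Y) : ahom (shift X) (shift Y) := fmap shift f.
Definition ush X Y (f : ahom X Y) : ahom (unshift X) (unshift Y) := fmap unshift f.

Lemma sh_id X : sh (aid X) = aid (shift X).
Proof. exact: (fmap_id (@shift T) X). Qed.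
Lemma sh_comp X Y Z (g : ahom Y Z) (f : ahom X Y) : sh (g \oc f) = sh g \oc sh f.
Proof. exact: (fmap_comp (@shift T) g f). Qed.

Lemma shD X Y (f g : ahom X Y) : sh (f + g) = sh f + sh g.
Proof. exact: (shift_add f g). Qed.
Lemma sh0 X Y : sh (0 : ahom X Y) = 0.
Proof. by apply: (addIr (sh 0)); rewrite -shD !add0r. Qed.
Lemma shN X Y (f : ahom X Y) : sh (- f) = - sh f.
Proof. by apply: (addIr (sh f)); rewrite -shD !addNr sh0. Qed.
Lemma shB X Y (f g : ahom X Y) : sh (f - g) = sh f - sh g.
Proof. by rewrite shD shN. Qed.
Lemma sh_iso X Y (f : ahom X Y) : aiso f -> aiso (sh f).
Proof.
move=> [g [/= h1 h2]]; exists (sh g); split; rewrite /= -sh_comp ?h1 ?h2 sh_id //.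
Qed.

Lemma sh_inj X Y (f g : ahom X Y) : sh f = sh g -> f = g.
Proof.
move=> e; apply: (aiso_epi (shiftK_iso X)).
rewrite (shiftK_nat f) (shiftK_nat g); congr (_ \oc _).
exact: (congr1 (@ush _ _) e).
Qed.

Lemma ush_inj X Y (f g : ahom X Y) : ush f = ush g -> f = g.
Proof.
move=> e; apply: (aiso_epi (unshiftK_iso X)).
rewrite (unshiftK_nat f) (unshiftK_nat g); congr (_ \oc _).
exact: (congr1 (@sh _ _) e).
Qed.

Lemma sh_full X Y (h : ahom (shift X) (shift Y)) : exists f : ahom X Y, sh f = h.
Proof.
have [r [r1 r2]] := (aisoP _).1 (shiftK_iso X).
exists (shiftK Y \oc ush h \oc r); apply: ush_inj.
apply: (aiso_mono (shiftK_iso Y)).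
set f := _ \oc r; rewrite -[LHS](shiftK_nat f).
by rewrite /f -acompA r1 acomp1r.
Qed.

Lemma sh_isoE X Y (f : ahom X Y) : aiso (sh f) -> aiso f.
Proof.
move=> /aisoP[g [g1 g2]]; have [h hE] := sh_full g.
apply/aisoP; exists h; split; apply: sh_inj; rewrite sh_comp hE sh_id //.
Qed.

Lemma eq_from_id0l X Y (f g : ahom X Y) : aid X = 0 -> f = g.
Proof. by move=> e; rewrite -[f]acomp1r -[g]acomp1r e !acomp0r. Qed.
Lemma eq_from_id0r X Y (f g : ahom X Y) : aid Y = 0 -> f = g.
Proof. by move=> e; rewrite -[f]acomp1l -[g]acomp1l e !acomp0l. Qed.

Lemma sh_id0 X : aid X = 0 -> aid (shift X) = 0.
Proof. by move=> e; rewrite -sh_id e sh0. Qed.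

Lemma iso_id0 X Y (f : ahom X Y) : aid X = 0 -> aid Y = 0 -> aiso f.
Proof.
by move=> e e'; exists 0; split; rewrite /=; [exact: eq_from_id0l|exact: eq_from_id0l].
Qed.

Lemma dist_rotl X Y Z (u : ahom X Y) (v : ahom Y Z) (w : ahom Z (shift X)) :
  dist u v w -> dist v w (- sh u).
Proof. exact: (dist_rot u v w).1. Qed.

Lemma dist_vu X Y Z (u : ahom X Y) (v : ahom Y Z) (w : ahom Z (shift X)) :
  dist u v w -> v \oc u = 0.
Proof.
move=> d; have [|h [hE _]] := dist_mor (f := aid X) (g := u) (dist_id X) d.
  by [].
by rewrite -hE acomp0r.
Qed.

Lemma dist_wv X Y Z (u : ahom X Y) (v : ahom Y Z) (w : ahom Z (shift X)) :
  dist u v w -> w \oc v = 0.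
Proof. by move/dist_rotl/dist_vu. Qed.

Lemma dist_uw X Y Z (u : ahom X Y) (v : ahom Y Z) (w : ahom Z (shift X)) :
  dist u v w -> sh u \oc w = 0.
Proof.
by move/dist_rotl/dist_rotl/dist_vu; rewrite acompNl => /eqP; rewrite oppr_eq0 => /eqP.
Qed.

(** [f] is completed to a morphism from the rotated identity triangle [W -> 0 -> shift W]; its last
    component is a shift, by fullness. *)
Lemma dist_wker X Y Z W (u : ahom X Y) (v : ahom Y Z) (w : ahom Z (shift X))
  (f : ahom W Y) : dist u v w -> v \oc f = 0 -> exists g, f = u \oc g.
Proof.
move=> d vf; have := dist_rotl (dist_id W) => dW.
have [|h [_ hE]] := dist_mor (f := f) (g := 0) dW (dist_rotl d).
  by rewrite acomp0l vf.
have [g gE] := sh_full h; exists g; apply: sh_inj; rewrite sh_comp gE.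
by move: hE; rewrite sh_id !acompNr acompNl acomp1r => /oppr_inj.
Qed.

Lemma dist_wcoker X Y Z W (u : ahom X Y) (v : ahom Y Z) (w : ahom Z (shift X))
  (f : ahom Y W) : dist u v w -> f \oc u = 0 -> exists g, f = g \oc v.
Proof.
move=> d fu.
have dW : @dist T azero W W 0 (aid W) 0.
  apply: (dist_rot _ _ _).2; apply: (dist_iso (aiso_id _) (aiso_id _)
    (@iso_id0 azero (shift azero) 0 _ _) _ _ _ (dist_id W)).
  - exact: aid_azero.
  - exact/sh_id0/aid_azero.
  - by [].
  - by rewrite !acomp0l.
  - by apply: eq_from_id0l; exact: aid_azero.
have [|h [hE _]] := dist_mor (f := 0) (g := f) d dW.
  by rewrite fu acomp0r.
by exists h; rewrite hE acomp1l.
Qed.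

(** The composites of [h] with a fill-in [h'] in the other direction are the identity on the two
    adjacent maps, so they differ from the identity by a map of square zero. *)
Lemma dist_five X Y Z X' Y' Z'
    (u : ahom X Y) (v : ahom Y Z) (w : ahom Z (shift X))
    (u' : ahom X' Y') (v' : ahom Y' Z') (w' : ahom Z' (shift X'))
    (f : ahom X X') (g : ahom Y Y') (h : ahom Z Z') :
  dist u v w -> dist u' v' w' -> aiso f -> aiso g ->
  g \oc u = u' \oc f -> h \oc v = v' \oc g -> sh f \oc w = w' \oc h -> aiso h.
Proof.
move=> d d' fi gi e1 e2 e3.
have [[f' [f1 f2]] [g' [g1 g2]]] := ((aisoP _).1 fi, (aisoP _).1 gi).
have e1' : g' \oc u' = u \oc f'.
  apply: (aiso_mono gi); rewrite !acompA g2 acomp1l e1 -acompA f2.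
  by rewrite acomp1r.
have [h' [k2 k3]] := dist_mor d' d e1'.
have k3' : sh f' \oc w' = w \oc h' := k3.
have nil (A B C : T) (a : ahom A B) (b : ahom B C) (c : ahom C (shift A)) (n : ahom C C) :
    dist a b c -> n \oc b = b -> c \oc n = c -> aiso n.
  move=> dd nb cn; have [|t tE] := dist_wcoker (f := n - aid _) (dist_rotl dd).
    by rewrite acompBl nb acomp1l subrr.
  apply: unipotent_iso; rewrite {1}tE -acompA acompBr cn acomp1r subrr.
  exact: acomp0r.
apply: (@aiso_lr _ _ _ h h' h').
- apply: (nil _ _ _ _ _ _ _ d); first by rewrite -acompA e2 acompA k2 -acompA g1 acomp1r.
  by rewrite acompA -k3' -acompA -e3 acompA -sh_comp f1 sh_id acomp1l.
- apply: (nil _ _ _ _ _ _ _ d'); first by rewrite -acompA k2 acompA e2 -acompA g2 acomp1r.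
  by rewrite acompA -e3 -acompA -k3' acompA -sh_comp f2 sh_id acomp1l.
Qed.

Lemma dist_mor_iso X Y Z X' Y' Z'
    (u : ahom X Y) (v : ahom Y Z) (w : ahom Z (shift X))
    (u' : ahom X' Y') (v' : ahom Y' Z') (w' : ahom Z' (shift X'))
    (f : ahom X X') (g : ahom Y Y') :
  dist u v w -> dist u' v' w' -> aiso f -> aiso g -> g \oc u = u' \oc f ->
  exists h : ahom Z Z', [/\ aiso h, h \oc v = v' \oc g & sh f \oc w = w' \oc h].
Proof.
move=> d d' fi gi e; have [h [h1 h2]] := dist_mor d d' e.
by exists h; split=> //; exact: (dist_five d d' fi gi e h1 h2).
Qed.

Lemma cone_uniq X Y Z Z' (u : ahom X Y) (v : ahom Y Z) (w : ahom Z (shift X))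
    (v' : ahom Y Z') (w' : ahom Z' (shift X)) :
  dist u v w -> dist u v' w' ->
  exists h : ahom Z Z', [/\ aiso h, h \oc v = v' & w = w' \oc h].
Proof.
move=> d d'; have [|h [h1 h2 h3]] :=
  dist_mor_iso d d' (aiso_id X) (aiso_id Y) _; first by rewrite acomp1l acomp1r.
by exists h; rewrite h2 -h3 sh_id acomp1l acomp1r.
Qed.

Lemma dist_mor1 X Y Z X' Y' Z'
    (u : ahom X Y) (v : ahom Y Z) (w : ahom Z (shift X))
    (u' : ahom X' Y') (v' : ahom Y' Z') (w' : ahom Z' (shift X'))
    (g : ahom Y Y') (h : ahom Z Z') :
  dist u v w -> dist u' v' w' -> h \oc v = v' \oc g ->
  exists f : ahom X X', g \oc u = u' \oc f /\ sh f \oc w = w' \oc h.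
Proof.
move=> d d' e; have [k [k1 k2]] := dist_mor (dist_rotl d) (dist_rotl d') e.
have [f fE] := sh_full k; exists f; split; last by rewrite fE.
apply: sh_inj; rewrite !sh_comp fE; apply: oppr_inj.
by move: k2; rewrite acompNr acompNl.
Qed.

Lemma dist_mor2 X Y Z X' Y' Z'
    (u : ahom X Y) (v : ahom Y Z) (w : ahom Z (shift X))
    (u' : ahom X' Y') (v' : ahom Y' Z') (w' : ahom Z' (shift X'))
    (f : ahom X X') (h : ahom Z Z') :
  dist u v w -> dist u' v' w' -> sh f \oc w = w' \oc h ->
  exists g : ahom Y Y', [/\ g \oc u = u' \oc f, h \oc v = v' \oc g
    & aiso f -> aiso h -> aiso g].
Proof.
move=> d d' e; have [g [g1 g2]] := dist_mor1 (dist_rotl d) (dist_rotl d') e.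
have {}g2 : g \oc u = u' \oc f.
  apply: sh_inj; rewrite !sh_comp; apply: oppr_inj.
  by move: g2; rewrite acompNr acompNl.
exists g; split=> // fi hi; apply: sh_isoE.
apply: (dist_five (dist_rotl (dist_rotl d)) (dist_rotl (dist_rotl d')) hi
  (sh_iso fi) e).
  by rewrite acompNr acompNl -!sh_comp g2.
by rewrite acompNr acompNl -!sh_comp g1.
Qed.

Lemma cone0_iso X Y Z (u : ahom X Y) (v : ahom Y Z) (w : ahom Z (shift X)) :
  dist u v w -> aid Z = 0 -> aiso u.
Proof.
move=> d z0.
have [|s sE] := dist_wker (f := aid Y) d; first exact: eq_from_id0r.
have [|t tE] := dist_wcoker (f := aid _) (dist_rotl (dist_rotl d)).
  exact: eq_from_id0l.
have [r rE] := sh_full t.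
apply: (@aiso_lr _ _ _ u (- r) s); last by rewrite -sE; exact: aiso_id.
suff -> : - r \oc u = aid X by exact: aiso_id.
by apply: sh_inj; rewrite sh_comp shN sh_id rE tE acompNl acompNr.
Qed.

Lemma mid0_iso X Y Z (u : ahom X Y) (v : ahom Y Z) (w : ahom Z (shift X)) :
  dist u v w -> aid Y = 0 -> aiso w.
Proof.
by move=> d y0; exact: (cone0_iso (dist_rotl (dist_rotl d)) (sh_id0 y0)).
Qed.

End Triangulated.

(** * Composition of exact equivalences *)

Section Compose.

Lemma is_iso_fmap (C D : category) (F : functor C D) (X Y : C) (f : hom X Y) :
  is_iso f -> is_iso (fmap F f).
Proof.
move=> [g [h1 h2]]; exists (fmap F g); split.
  apply: heq_trans (fmap_id F _); apply: heq_trans (fmap_heq F h1).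
  by apply: heq_sym; exact: fmap_comp.
apply: heq_trans (fmap_id F _); apply: heq_trans (fmap_heq F h2).
by apply: heq_sym; exact: fmap_comp.
Qed.

Lemma is_iso_comp (C : category) (X Y Z : C) (g : hom Y Z) (f : hom X Y) :
  is_iso g -> is_iso f -> is_iso (comp g f).
Proof.
move=> [g' [g1 g2]] [f' [f1 f2]]; exists (comp f' g'); split.
  apply: heq_trans f1; apply: heq_trans (compA _ _ _) _.
  apply: comp_heq (heq_refl _); apply: heq_trans (heq_sym (compA _ _ _)) _.
  by apply: heq_trans (comp1r f'); apply: comp_heq g1; exact: heq_refl.
apply: heq_trans g2; apply: heq_trans (compA _ _ _) _.
apply: comp_heq (heq_refl _); apply: heq_trans (heq_sym (compA _ _ _)) _.
by apply: heq_trans (comp1r g); apply: comp_heq f2; exact: heq_refl.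
Qed.

Variables (C : triangle_category) (D E : triangulated_category).
Variables (F : exact_equivalence C D) (G : exact_equivalence D E).

Definition comp_functor : functor C E.
Proof.
refine (@Functor C E (fun X => G (F X)) (fun X Y f => fmap G (fmap F f)) _ _ _).
- by move=> X Y f g e; apply/fmap_heq/fmap_heq.
- move=> X; apply: heq_trans (fmap_heq G (fmap_id F X)) _.
  exact: (fmap_id G (F X)).
- move=> X Y Z g f; apply: heq_trans (fmap_heq G (fmap_comp F g f)) _.
  exact: (fmap_comp G).
Defined.

Definition comp_shift (X : C) : hom (comp_functor (trshift X)) (@trshift E (comp_functor X)) :=
  comp (eqv_shift G (F X)) (fmap G (eqv_shift F X)).

Definition comp_equivalence : exact_equivalence C E.
Proof.
refine (@ExactEquivalence C E comp_functor _ _ comp_shift _ _ _).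
- have [f1 f2] := eqv_ff F; have [g1 g2] := eqv_ff G.
  split=> [X Y f g /= e|X Y h]; first by apply: f1; exact: g1.
  have [k kE] := g2 _ _ h; have [f fE] := f2 _ _ k.
  by exists f; apply: heq_trans kE; exact: (fmap_heq G).
- move=> Z; have [Y [g gi]] := eqv_es G Z; have [X [f fi]] := eqv_es F Y.
  exists X, (@comp E _ _ _ g (fmap G f)).
  by apply: is_iso_comp => //; exact: is_iso_fmap.
- move=> X; apply: is_iso_comp; first exact: eqv_shift_iso.
  by apply: is_iso_fmap; exact: eqv_shift_iso.
- move=> X Y f.
  have eF : eqv_shift F Y \oc fmap F (fmap trshift f)
    = sh (fmap F f) \oc eqv_shift F X := eqv_shift_nat F f.
  have eG : eqv_shift G (F Y) \oc fmap G (sh (fmap F f))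
    = sh (fmap G (fmap F f)) \oc eqv_shift G (F X) := eqv_shift_nat G (fmap F f).
  have GM (A B A' : D) (a : ahom A B) (b : ahom A' A) :
    fmap G (a \oc b) = fmap G a \oc fmap G b := fmap_comp G a b.
  change (eqv_shift G (F Y) \oc fmap G (eqv_shift F Y) \oc fmap G (fmap F (fmap trshift f))
    = sh (fmap G (fmap F f)) \oc (eqv_shift G (F X) \oc fmap G (eqv_shift F X))).
  by rewrite acompA -eG -!acompA -!GM eF.
- move=> X Y Z u v w d.
  have := eqv_dist G (eqv_dist F d).
  have GM (A B A' : D) (a : ahom A B) (b : ahom A' A) :
    fmap G (a \oc b) = fmap G a \oc fmap G b := fmap_comp G a b.
  have -> : @comp E _ _ _ (eqv_shift G (F X)) (fmap G (comp (eqv_shift F X) (fmap F w)))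
     = eqv_shift G (F X) \oc (fmap G (eqv_shift F X) \oc fmap G (fmap F w)).
    by rewrite -GM.
  by rewrite acompA.
Defined.

End Compose.

(** * The stable category is the homotopy category *)

Section StableHomotopy.
Variables (T : additive_category) (L : Type) (E : L -> T).
Local Notation TW := (tw_add E).
Local Notation FR := (tw_frobenius E).
Local Notation HK := (kt_add E).
Local Notation KT := (kt_tri E).
Local Notation thom X Y := (ahom (tcar X) (tcar Y)).
Local Notation tdegree X Y := (hdeg (tpi X) (tpi Y)).

Definition kq (X Y : TW) (f : ahom X Y) : ahom (X : HK) (Y : HK) :=
  zpi (null_sub X Y) f.

Lemma kqE (X Y : TW) (f : thom X Y) (h : chain f) : kq (cmk h : ahom X Y) = kcl h.
Proof. by []. Qed.

Lemma kq_kcl (X Y : TW) (f : ahom X Y) : kq f = kcl (cvalP f).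
Proof. by rewrite -kqE; congr kq; exact: cval_inj. Qed.

Lemma kqM (X Y Z : TW) (g : ahom Y Z) (f : ahom X Y) : kq (g \oc f) = kq g \oc kq f.
Proof. by rewrite !kq_kcl kclM; exact: kcl_eq1. Qed.

Lemma kq1 (X : TW) : kq (aid X) = aid (X : HK).
Proof. by rewrite kq_kcl; exact: kcl_eq1. Qed.

Lemma kq_eq (X Y : FR) (f g : ahom X Y) : kq f = kq g <-> stable_eq f g.
Proof.
rewrite /stable_eq stably_trivial_nullh; exact: zpi_eq.
Qed.

(* [w] is the connecting morphism of the conflation [i, p]. *)
Definition conn (X Y Z : TW) (i : ahom X Y) (p : ahom Y Z)
    (w : ahom (Z : HK) (tsh 1 X : HK)) : Prop :=
  exists (r : thom Y X) (s : thom Z Y) (o : thom Z X) (dw : tdegree Z X 1 o)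
    (wd : o \oc tdf Z = - (tdf X \oc o)),
    [/\ gsplit (cval i) (cval p) r s, tdegree Y X 0 r, tdegree Z Y 0 s,
        tdf Y \oc s = s \oc tdf Z + cval i \oc o
      & r \oc tdf Y = tdf X \oc r + o \oc cval p /\ w = kcl (chain_w dw wd)].

Lemma conn_exists (X Y Z : TW) (i : ahom X Y) (p : ahom Y Z) :
  tconf i p -> exists w, conn i p w.
Proof.
move=> [r [s [sp dr ds]]].
have [o [dw wd e1 e2]] := gs_wP sp (cvalP i) (cvalP p) dr ds.
by exists (kcl (chain_w dw wd)), r, s, o, dw, wd; split.
Qed.

Lemma conn_dist (X Y Z : TW) (i : ahom X Y) (p : ahom Y Z) w :
  conn i p w -> kdist (kq i) (kq p) w.
Proof.
move=> [r [s [o [dw [wd [sp dr ds e1 [e2 wE]]]]]]].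
have [ci cp] := (cvalP i, cvalP p).
have ct : @chain _ _ _ (text dw wd) Y (cval i \oc prj1 _ _ + s \oc prj2 _ _).
  split.
    apply: hdegD; first exact: (hdeg_comp (chain_deg ci) (hdeg_prj1 _ _)).
    exact: (hdeg_comp ds (hdeg_prj2 _ _)).
  rewrite /= acompDl -!(acompA _ _ (ext_df _)) ext_df1 ext_df2 acompDr acompDr.
  rewrite !acompA (chain_d ci) e1 !acompDl ?acompA; zmod.
have ct' : @chain _ _ _ Y (text dw wd) (inj1 _ _ \oc r + inj2 _ _ \oc cval p).
  split.
    apply: hdegD; first exact: (hdeg_comp (hdeg_inj1 _ _) dr).
    exact: (hdeg_comp (hdeg_inj2 _ _) (chain_deg cp)).
  rewrite /= acompDr acompDl !acompA ext_df1i ext_df2i -!acompA e2 (chain_d cp).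
  rewrite !acompDr !acompDl ?acompA; zmod.
exists o, dw, wd, (kcl ct); split=> //.
- apply/aisoP; exists (kcl ct'); rewrite !kclM; split; apply: kcl_eq1.
    rewrite !expE !(gsE sp) !zeroE oplus_id //.
  by rewrite !expE !zeroE (gs_id sp).
- by rewrite kq_kcl kclM; apply: kcl_eq1; rewrite !expE !zeroE.
- by rewrite kq_kcl kclM; apply: kcl_eq1; rewrite !expE !(gsE sp) !zeroE.
Qed.

(** The homotopy is [- (r' \oc cval g \oc s)], the off-diagonal component of [g] with respect to the
    graded splittings. *)
Lemma conn_nat (X Y Z X' Y' Z' : TW) (i : ahom X Y) (p : ahom Y Z) w
    (i' : ahom X' Y') (p' : ahom Y' Z') w' f g h :
  conn i p w -> conn i' p' w' -> g \oc i = i' \oc f -> h \oc p = p' \oc g ->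
  ksh 1 (kq f) \oc w = w' \oc kq h.
Proof.
move=> [r [s [o [dw [wd [sp dr ds e1 [e2 ->]]]]]]].
move=> [r' [s' [o' [dw' [wd' [sp' dr' ds' e1' [e2' ->]]]]]]].
move=> /(congr1 (@cval _ _ _ _ _)) e3 /(congr1 (@cval _ _ _ _ _)) e4.
rewrite !cval_comp in e3 e4.
rewrite !kq_kcl kshE !kclM; apply/kcl_eq.
exists (- (r' \oc cval g \oc s)); split.
  apply/hdegN/hdeg_shiftr.
  exact: (hdeg_comp (hdeg_comp dr' (chain_deg (cvalP g))) ds).
have k1 : r' \oc tdf Y' \oc cval g \oc s
    = r' \oc cval g \oc s \oc tdf Z + cval f \oc o.
  rewrite -(acompA r') -(chain_d (cvalP g)) -!acompA e1 !acompDr !acompA.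
  by rewrite (acl e3) ?acompA !(gsE sp') !acompE.
have k2 : r' \oc tdf Y' \oc cval g \oc s
    = tdf X' \oc r' \oc cval g \oc s + o' \oc cval h.
  by rewrite e2' !acompDl ?acompA (acl (esym e4)) ?acompA !(gsE sp) !acompE.
rewrite /= !acompNl !acompNr !acompA; move: k1; rewrite k2.
move=> /(canRL (addKr _)) ->; zmod.
Qed.

Lemma kq_iso (X Y : stable_cat FR) (f : hom X Y) : is_iso f ->
  aiso (kq f : ahom (X : HK) (Y : HK)).
Proof.
move=> [g [g1 g2]]; apply/aisoP; exists (kq g).
by rewrite -!kqM -!kq1; split; apply: (kq_eq _ _).2.
Qed.

Lemma hull_conn (X : FR) : exists w, conn (hull_in X) (hull_out X) w.
Proof. apply: conn_exists; exact: (hull_conflation X). Qed.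

(** The stable shift is formed with an arbitrarily chosen injective hull, the shift [tsh 1] is
    explicit. The connecting map of the hull conflation compares them, and is invertible because the
    hull is contractible. *)
Definition hullw (X : FR) : ahom (cosyz X : HK) (tsh 1 X : HK) :=
  sval (cid (hull_conn X)).

Lemma hullw_conn (X : FR) : conn (hull_in X) (hull_out X) (hullw X).
Proof. by rewrite /hullw; case: cid. Qed.

Lemma hullw_iso (X : FR) : aiso (hullw X).
Proof.
have d := conn_dist (hullw_conn X).
apply: (mid0_iso (T := KT) d).
have := injective_contractible (@hull_injective FR X) => c.
by rewrite -kq1 -(zpi0 (null_sub _ _)); apply/zpi_eq; rewrite subr0.
Qed.

Definition stable_equivalence : exact_equivalence (stable_triangle_category FR) KT.
Proof.
refine (@ExactEquivalence (stable_triangle_category FR) KT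
  (@Functor (stable_cat FR) (add_cat HK) (fun X => X) (fun X Y f => kq f)
   (fun X Y f g e => (kq_eq f g).2 e) kq1 (fun X Y Z g f => kqM g f)) _ _ hullw hullw_iso _ _).
- split=> [X Y f g /= /kq_eq //|X Y h].
  by have [f fE] := zpi_surj h; exists f.
- by move=> Y; exists Y, (aid (Y : HK)); exact: aiso_id.
- move=> X Y f; have [h [h1 h2]] := cosyz_mapP f.
  by symmetry; exact: (conn_nat (hullw_conn X) (hullw_conn Y) h1 h2).
move=> X Y Z u v w [X' [Y' [Z' [i [p [w0 [f [g [h [[ci [e [e1 e2]]]]]]]]]]]]].
move=> [[fi gi hi] [k1 k2 k3]].
have [o oc] := conn_exists ci.
(* The extension [e] of [hull_in] maps the given conflation to the hull conflation, and connecting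
   maps are natural. *)
have oE : o = hullw X' \oc kq w0.
  have := conn_nat oc (hullw_conn X') (f := aid X') (g := e) (h := w0).
  rewrite acomp1r => /(_ e1 e2) <-.
  by rewrite kq1 ksh_id acomp1l.
have := conn_dist oc; rewrite oE.
apply: (kdist_iso (kq_iso fi) (kq_iso gi) (kq_iso hi)).
- by rewrite -[RHS]kqM -kqM; apply: (kq_eq _ _).2.
- by rewrite -[RHS]kqM -kqM; apply: (kq_eq _ _).2.
have [k [l1 l2]] := cosyz_mapP f.
rewrite acompA (conn_nat (hullw_conn X') (hullw_conn X) l1 l2).
have e3 : kq (cosyz_map f \oc w0) = kq (w \oc h) := (kq_eq _ _).2 k3.
rewrite !kqM in e3.
by rewrite -acompA e3 acompA.
Defined.

End StableHomotopy.

(** * Homogeneous pieces *)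

(** The shift being fully faithful, statements about [shiftz k] pass from [k] to [k + 1] and back;
    one equivalence then covers positive and negative [k]. *)
Lemma int_iff_ind (P : int -> Prop) :
  P 0 -> (forall k, P k <-> P (k + 1)) -> forall k, P k.
Proof.
move=> P0 PS; elim/int_rec => // n IHn.
  by have := (PS n).1 IHn; rewrite -PoszD addn1.
by apply/PS; rewrite intS opprD addrC addrA addrN add0r.
Qed.

Section ZShift.
Variables (K : fieldType) (T : linear_triangulated_category K).
Implicit Types X Y : T.

Fixpoint itf (F : functor (add_cat T) (add_cat T)) (n : nat) X Y (f : ahom X Y) :
    ahom (iter n (fun Y : T => F Y : T) X) (iter n (fun Y : T => F Y : T) Y) :=
  match n with 0 => f | n'.+1 => fmap F (itf F n' f) end.

Definition zf (k : int) X Y (f : ahom X Y) : ahom (shiftz k X) (shiftz k Y) :=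
  match k with
  | Posz m => itf shift m f
  | Negz m => itf unshift m.+1 f
  end.

Lemma zf_id k X : zf k (aid X) = aid (shiftz k X).
Proof.
have h (F : functor (add_cat T) (add_cat T)) n : itf F n (aid X) = aid _.
  by elim: n => //= n ->; exact: (fmap_id F).
by case: k => n; exact: h.
Qed.

Lemma zf_comp k X Y Z (g : ahom Y Z) (f : ahom X Y) :
  zf k (g \oc f) = zf k g \oc zf k f.
Proof.
have h (F : functor (add_cat T) (add_cat T)) n :
    itf F n (g \oc f) = itf F n g \oc itf F n f.
  by elim: n => //= n ->; exact: (fmap_comp F).
by case: k => n; exact: h.
Qed.

(** [shiftz] iterates [shift] or [unshift] according to the sign, so the comparison is an identity
    for [k >= 0] and a counit [unshiftK] for negative [k]. Only invertibility and naturality are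
    kept. *)
Lemma zsig_ex k : exists s : forall X, ahom (shift (shiftz k X)) (shiftz (k + 1) X),
  (forall X, aiso (s X)) /\
  (forall X Y (f : ahom X Y), s Y \oc sh (zf k f) = zf (k + 1) f \oc s X).
Proof.
case: k => [m|[|m]].
- have -> : (Posz m + 1 = Posz m.+1)%R by rewrite -addn1.
  exists (fun X => aid _); split=> [X|X Y f]; first exact: aiso_id.
  by rewrite acomp1l acomp1r.
- exists (fun X => unshiftK X); split=> [X|X Y f]; first exact: unshiftK_iso.
  by symmetry; exact: (unshiftK_nat f).
have -> : Negz m.+1 + 1 = Negz m by rewrite !NegzE; lia.
exists (fun X => unshiftK _); split=> [X|X Y f]; first exact: unshiftK_iso.
by symmetry; exact: (unshiftK_nat (zf (Negz m) f)).
Qed.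

Definition zsig k X : ahom (shift (shiftz k X)) (shiftz (k + 1) X) :=
  sval (cid (zsig_ex k)) X.

Lemma zsig_iso k X : aiso (zsig k X).
Proof. by rewrite /zsig; case: cid => s [h1 h2] /=. Qed.

Lemma zsig_nat k X Y (f : ahom X Y) :
  zsig k Y \oc sh (zf k f) = zf (k + 1) f \oc zsig k X.
Proof. by rewrite /zsig; case: cid => s [h1 h2] /=. Qed.

Lemma zf_inj k X Y (f g : ahom X Y) : zf k f = zf k g -> f = g.
Proof.
move: k; apply: int_iff_ind => // k; split=> h e; apply: h.
  apply: sh_inj; apply: (aiso_mono (zsig_iso k Y)).
  by rewrite !zsig_nat e.
by apply: (aiso_epi (zsig_iso k X)); rewrite -!zsig_nat e.
Qed.

Lemma zf_full k X Y (f : ahom (shiftz k X) (shiftz k Y)) : exists g, zf k g = f.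
Proof.
move: k f; apply: int_iff_ind => [f|k]; first by exists f.
have [[r [r1 r2]] [s [s1 s2]]] := ((aisoP _).1 (zsig_iso k X), (aisoP _).1 (zsig_iso k Y)).
split=> h f.
  have [f0 f0E] := sh_full (s \oc f \oc zsig k X).
  have [g gE] := h f0; exists g; apply: (aiso_epi (zsig_iso k X)).
  by rewrite -zsig_nat gE f0E !acompA s2 acomp1l.
have [g gE] := h (zsig k Y \oc sh f \oc r); exists g.
apply: sh_inj; apply: (aiso_mono (zsig_iso k Y)).
by rewrite zsig_nat gE -acompA r1 acomp1r.
Qed.

Lemma zfD k X Y (f g : ahom X Y) : zf k (f + g) = zf k f + zf k g.
Proof.
move: k; apply: int_iff_ind => // k; split=> h.
  apply: (aiso_epi (zsig_iso k X)); rewrite -zsig_nat h shD acompDr.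
  by rewrite !zsig_nat acompDl.
apply: sh_inj; apply: (aiso_mono (zsig_iso k Y)).
by rewrite zsig_nat h shD acompDr !zsig_nat acompDl.
Qed.

Lemma zf0 k X Y : zf k (0 : ahom X Y) = 0.
Proof. by apply: (addIr (zf k 0)); rewrite -zfD !add0r. Qed.

Lemma zfN k X Y (f : ahom X Y) : zf k (- f) = - zf k f.
Proof. by apply: (addIr (zf k f)); rewrite -zfD !addNr zf0. Qed.

Lemma zf_sum k X Y (I : Type) (r : seq I) (P : pred I) (F : I -> ahom X Y) :
  zf k (\sum_(i <- r | P i) F i) = \sum_(i <- r | P i) zf k (F i).
Proof. by elim/big_rec2: _ => [|i y x _ <-]; [exact: zf0 | exact: zfD]. Qed.

Lemma zf_scale k X Y (c : K) (f : ahom X Y) : zf k (lscale c f) = lscale c (zf k f).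
Proof.
move: k; apply: int_iff_ind => // k; split=> h.
  apply: (aiso_epi (zsig_iso k X)).
  rewrite -zsig_nat h -lscale_compl -zsig_nat lscale_compr.
  by congr (_ \oc _); exact: lscale_shift.
apply: sh_inj; apply: (aiso_mono (zsig_iso k Y)).
rewrite zsig_nat h -lscale_compl -zsig_nat lscale_compr.
by congr (_ \oc _); symmetry; exact: lscale_shift.
Qed.

(** Zero by default when [k] and [l] differ. Between the objects considered, maps of unequal shifts
    vanish anyway, so one formula serves all pairs of indices without casts in statements. *)
Definition zcast k l X : ahom (shiftz k X) (shiftz l X) :=
  match k =P l with
  | ReflectT e => eq_rect k (fun l => ahom (shiftz k X) (shiftz l X)) (aid _) l e
  | ReflectF _ => 0
  end.

Lemma zcast_id k X : zcast k k X = aid _.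
Proof. by rewrite /zcast; case: eqP => // e; rewrite (Prop_irrelevance e erefl). Qed.

Lemma zcast_neq k l X : k != l -> zcast k l X = 0.
Proof. by rewrite /zcast; case: eqP. Qed.

Lemma zcast_iso k l X : k = l -> aiso (zcast k l X).
Proof. by move=> <-; rewrite zcast_id; exact: aiso_id. Qed.

Lemma zcast_nat k l X Y (f : ahom X Y) :
  zcast k l Y \oc zf k f = zf l f \oc zcast k l X.
Proof.
have [<-|ne] := eqVneq k l; first by rewrite !zcast_id acomp1l acomp1r.
by rewrite !zcast_neq // acomp0l acomp0r.
Qed.

Definition zmap k l X Y (f : ahom X Y) : ahom (shiftz k X) (shiftz l Y) :=
  locked (zcast k l Y \oc zf k f).

Lemma zmapE k l X Y (f : ahom X Y) : zmap k l f = zcast k l Y \oc zf k f.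
Proof. by rewrite /zmap -lock. Qed.

Lemma zmap_id k X Y (f : ahom X Y) : zmap k k f = zf k f.
Proof. by rewrite zmapE zcast_id acomp1l. Qed.

Lemma zmap_neq k l X Y (f : ahom X Y) : k != l -> zmap k l f = 0.
Proof. by move=> ne; rewrite zmapE zcast_neq // acomp0l. Qed.

Lemma zmap0 k l X Y : zmap k l (0 : ahom X Y) = 0.
Proof. by rewrite zmapE zf0 acomp0r. Qed.

(** Meant for [l = k + 1], where it is an isomorphism, and zero otherwise. *)
Definition sg k l X : ahom (shift (shiftz k X)) (shiftz l X) :=
  locked (zcast (k + 1) l X \oc zsig k X).

Lemma sgE k l X : sg k l X = zcast (k + 1) l X \oc zsig k X.
Proof. by rewrite /sg -lock. Qed.

Lemma sg_iso k X : aiso (sg k (k + 1) X).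
Proof. by rewrite !sgE zcast_id acomp1l; exact: zsig_iso. Qed.

Lemma sg_nat k l X Y (f : ahom X Y) : sg k l Y \oc sh (zf k f) = zf l f \oc sg k l X.
Proof. by rewrite !sgE -acompA zsig_nat !acompA zcast_nat. Qed.

End ZShift.

(** * Maps between cones of two-term complexes in [T] *)

Section Cells.
Variables (K : fieldType) (T : linear_triangulated_category K) (E : bool -> T).
Hypothesis E_neq : forall (a b : bool) (n : int) (f : ahom (E a) (shiftz n (E b))),
  n != 0 -> f = 0.
Hypothesis E_21 : forall f : ahom (E true) (E false), f = 0.

Lemma cell_neq (a b : bool) (k l : int) (f : ahom (shiftz k (E a)) (shiftz l (E b))) :
  k != l -> f = 0.
Proof.
move: k l f; apply: (@int_iff_ind (fun k => forall l (f : ahom (shiftz k (E a))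
  (shiftz l (E b))), k != l -> f = 0)) => [l f ne|k].
  by apply: E_neq; rewrite eq_sym.
split=> h l f ne; last first.
  have := h (l + 1) (zsig l _ \oc sh f \oc sval (cid (zsig_iso k (E a)))).
  rewrite (inj_eq (addIr 1)) => /(_ ne) /(congr1 (fun x => x \oc zsig k _)).
  case: cid => s [/= s1 s2]; rewrite -acompA s1 acomp1r acomp0l => e.
  by apply: sh_inj; apply: (aiso_mono (zsig_iso l _)); rewrite e sh0 acomp0r.
have [l' le] : exists l', l = l' + 1 by exists (l - 1); rewrite subrK.
move: f ne; rewrite le (inj_eq (addIr 1)) => f ne.
have [s [s1 s2]] := (aisoP _).1 (zsig_iso l' (E b)).
have [g gE] := sh_full (s \oc f \oc zsig k (E a)).
have g0 : g = 0 by exact: h.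
apply: (aiso_epi (zsig_iso k (E a))); rewrite acomp0l.
by rewrite -[LHS]acomp1l -s2 -!acompA (acompA s) -gE g0 sh0 acomp0r.
Qed.

Lemma cell_21 (k l : int) (f : ahom (shiftz k (E true)) (shiftz l (E false))) : f = 0.
Proof.
have [e|ne] := eqVneq k l; last exact: cell_neq.
by move: f; rewrite -e => f; have [g <-] := zf_full f; rewrite (E_21 g) zf0.
Qed.

Definition addE (a : bool) (S : T) : Prop :=
  exists (I : finType) (ij : I -> ahom (E a) S) (pj : I -> ahom S (E a)),
    biproduct (X := fun _ => E a) ij pj.

Lemma addE_hom0 a b S S' (k l : int) : addE a S -> addE b S' ->
  (forall f : ahom (shiftz k (E a)) (shiftz l (E b)), f = 0) ->
  forall f : ahom (shiftz k S) (shiftz l S'), f = 0.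
Proof.
move=> [I [ij [pj [_ _ h]]]] [I' [ij' [pj' [_ _ h']]]] z f.
rewrite -[f]acomp1l -[f]acomp1r -!zf_id -h -h' !zf_sum acomp_suml big1 // => i _.
rewrite acomp_sumr acomp_sumr big1 // => j _.
have e := z (zf l (pj' i) \oc f \oc zf k (ij j)).
by rewrite !zf_comp !acompA -!(acompA (zf l (ij' i))) e acomp0l acomp0r.
Qed.

Lemma addE_neq a b S S' (k l : int) : addE a S -> addE b S' -> k != l ->
  forall f : ahom (shiftz k S) (shiftz l S'), f = 0.
Proof. by move=> h h' ne; apply: addE_hom0 h h' _ => f; exact: cell_neq. Qed.

Lemma addE_21 S S' (k l : int) : addE true S -> addE false S' ->
  forall f : ahom (shiftz k S) (shiftz l S'), f = 0.
Proof. by move=> h h'; apply: addE_hom0 h h' _ => f; exact: cell_21. Qed.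

Lemma addE_zero a : addE a azero.
Proof.
exists void, (fun i : void => match i with end), (fun i : void => match i with end).
by split=> [[]|[]|]; rewrite big1 ?aid_azero // => -[].
Qed.

Lemma addE_sum a S S' : addE a S -> addE a S' -> addE a (oplus S S').
Proof.
move=> [I [ij [pj b]]] [I' [ij' [pj' b']]]; exists (I + I')%type.
do 2!eexists; exact: (@biproduct_sum T I I' (fun=> E a) _ _ _ _ _ _ b b').
Qed.

Lemma addE_one a : addE a (E a).
Proof.
exists unit, (fun=> aid _), (fun=> aid _); split=> [i|[] []|] //.
  exact: acomp1l.
by rewrite (bigD1 tt) //= big1 ?addr0 ?acomp1l // => -[].
Qed.

(** For an exceptional pair this amounts to a generalised Kronecker module. *)
Record kron := Kron {
  kS1 : T;
  kS2 : T;
  kh1 : addE false kS1;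
  kh2 : addE true kS2;
  kphi : ahom kS1 kS2
}.

Record shkron := ShKron { sk : int; sq :> kron }.

Section Cone.
Variable x : shkron.
Local Notation Z1 := (shiftz (sk x) (kS1 x)).
Local Notation Z2 := (shiftz (sk x) (kS2 x)).

Definition cob_ex := cid (dist_complete (zf (sk x) (kphi x))).
Definition cob : T := sval cob_ex.
Definition cb_ex := cid (svalP cob_ex).
Definition cb : ahom Z2 cob := sval cb_ex.
Definition cp_ex := cid (svalP cb_ex).
Definition cp : ahom cob (shift Z1) := sval cp_ex.
Lemma cdist : dist (zf (sk x) (kphi x)) cb cp.
Proof. exact: svalP cp_ex. Qed.

End Cone.

Variables x y : shkron.
Local Notation k := (sk x).
Local Notation l := (sk y).

Lemma sS1_neq (z : T) (f : ahom (shift (shiftz k (kS1 x))) z) :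
  (forall g : ahom (shiftz (k + 1) (kS1 x)) z, g = 0) -> f = 0.
Proof.
move=> h; have [s [s1 s2]] := (aisoP _).1 (zsig_iso k (kS1 x)).
by rewrite -[f]acomp1r -s1 acompA (h (f \oc s)) acomp0l.
Qed.

Lemma sS1'_neq (z : T) (f : ahom z (shift (shiftz l (kS1 y)))) :
  (forall g : ahom z (shiftz (l + 1) (kS1 y)), g = 0) -> f = 0.
Proof.
move=> h; have [s [s1 s2]] := (aisoP _).1 (zsig_iso l (kS1 y)).
by rewrite -[f]acomp1l -s1 -acompA (h (_ \oc f)) acomp0r.
Qed.

(** The composite goes from a shift of copies of [E2] to a shift of copies of [E1]. Hence maps from
    [S2] into a cone factor through [cb], and the restriction of a map of cones to [S2] is
    defined. *)
Lemma S2_cone (f : ahom (shiftz k (kS2 x)) (cob y)) : cp y \oc f = 0.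
Proof. by apply: sS1'_neq => g; exact: addE_21 (kh2 x) (kh1 y) _. Qed.

Lemma S2_cone_fac (f : ahom (shiftz k (kS2 x)) (cob y)) :
  exists g : ahom (shiftz k (kS2 x)) (shiftz l (kS2 y)), f = cb y \oc g.
Proof. exact: dist_wker (dist_rotl (cdist y)) (S2_cone f). Qed.

Lemma S2_cone_neq (f : ahom (shiftz k (kS2 x)) (cob y)) : k != l -> f = 0.
Proof.
move=> ne; have [g ->] := S2_cone_fac f.
by rewrite (addE_neq (kh2 x) (kh2 y) ne g) acomp0r.
Qed.

Lemma S1_S1 (f : ahom (shift (shiftz k (kS1 x))) (shift (shiftz l (kS1 y)))) :
  k != l -> f = 0.
Proof.
move=> ne; apply: sS1_neq => g; apply: sS1'_neq => h.
by apply: addE_neq (kh1 x) (kh1 y) _ h; rewrite (inj_eq (addIr 1)).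
Qed.

Lemma S1_S2 (f : ahom (shift (shiftz k (kS1 x))) (shiftz l (kS2 y))) :
  l != k + 1 -> f = 0.
Proof.
move=> ne; apply: sS1_neq => h.
by apply: addE_neq (kh1 x) (kh2 y) _ h; rewrite eq_sym.
Qed.

(** Such an [f] factors through a map from the shifted [kS1 x] to [kS2 y], which vanishes unless
    [l = k + 1]. This is the uniqueness of fill-ins on which functoriality rests. *)
Lemma cone_hom0 (f : ahom (cob x) (cob y)) : l != k + 1 ->
  f \oc cb x = 0 -> cp y \oc f = 0 -> f = 0.
Proof.
move=> ne fb pf; have [t tE] := dist_wcoker (dist_rotl (cdist x)) fb.
have pt : cp y \oc t = 0.
  have [|r rE] := dist_wcoker (f := cp y \oc t) (dist_rotl (dist_rotl (cdist x))).
    by rewrite -acompA -tE pf.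
  have [r0 r0E] := sh_full r; rewrite rE -r0E.
  by rewrite (addE_21 (kh2 x) (kh1 y) r0) sh0 acomp0l.
by have [q qE] := dist_wker (dist_rotl (cdist y)) pt; rewrite tE qE (S1_S2 q ne) !acompE.
Qed.

Lemma cone_sq_ex (m1 : ahom (kS1 x) (kS1 y)) (m2 : ahom (kS2 x) (kS2 y)) :
  kphi y \oc m1 = m2 \oc kphi x ->
  exists f : ahom (cob x) (cob y), f \oc cb x = cb y \oc zmap k l m2 /\
    cp y \oc f = sh (zmap k l m1) \oc cp x.
Proof.
move=> e; have [kl|ne] := eqVneq k l; last first.
  by exists 0; rewrite !zmap_neq // sh0 acomp0l !acomp0r acomp0l.
have [|f [f1 f2]] := dist_mor (f := zmap k l m1) (g := zmap k l m2) (cdist x) (cdist y).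
  by rewrite !zmapE !acompA -zcast_nat -!acompA -!zf_comp e.
by exists f; rewrite f1 -f2.
Qed.

Lemma cone_sq_surj (f : ahom (cob x) (cob y)) : k = l ->
  exists (m1 : ahom (kS1 x) (kS1 y)) (m2 : ahom (kS2 x) (kS2 y)),
    [/\ kphi y \oc m1 = m2 \oc kphi x, f \oc cb x = cb y \oc zmap k l m2 &
    cp y \oc f = sh (zmap k l m1) \oc cp x].
Proof.
move=> kl; have zfull (X Y : T) (g : ahom (shiftz k X) (shiftz l Y)) :
    exists g0 : ahom X Y, zmap k l g0 = g.
  by move: g; rewrite -kl => g; have [g0 <-] := zf_full g; exists g0; rewrite zmap_id.
have [g gE] := S2_cone_fac (f \oc cb x).
have [m2 m2E] := zfull _ _ g.
have [|h hE] := dist_wcoker (f := cp y \oc f) (dist_rotl (cdist x)).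
  by rewrite -acompA S2_cone.
have [h0 h0E] := sh_full h; have [m1 m1E] := zfull _ _ h0.
exists m1, m2; rewrite m1E h0E m2E hE gE; split=> //.
(* It is not yet known that [h] completes [g] to a commutative square. Some [q] does, and its
   fill-in [f'] differs from [f] by a map through [cp x]; so [h] and [sh q] differ by a map through
   [cp y], which the shift of [kphi y] kills. *)
have [|q qE] := dist_wker (f := g \oc zf k (kphi x)) (cdist y).
  by rewrite acompA -gE -acompA (dist_vu (cdist x)) acomp0r.
have [f' [f1 f2]] := dist_mor (f := q) (cdist x) (cdist y) qE.
have [|t tE] := dist_wcoker (f := f - f') (dist_rotl (cdist x)).
  by rewrite acompBl gE f1 subrr.
have [|r rE] := dist_wcoker (f := h - sh q - cp y \oc t) (dist_rotl (dist_rotl (cdist x))).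
  rewrite !acompBl -hE -acompA -tE acompBr (_ : sh q \oc cp x = cp y \oc f') ?subrr //.
have [r0 r0E] := sh_full r.
have hq : h = sh q + cp y \oc t.
  apply/eqP; rewrite -subr_eq0 opprD addrA rE -r0E.
  by rewrite (addE_21 (kh2 x) (kh1 y) r0) sh0 acomp0l.
have e1 : zf l (kphi y) \oc h0 = g \oc zf k (kphi x).
  apply: sh_inj; rewrite qE !sh_comp h0E hq acompDr !acompA.
  by rewrite (dist_uw (cdist y)) acomp0l addr0.
apply: (@zf_inj _ _ l); rewrite !zf_comp.
apply: (aiso_epi (@zcast_iso _ _ k l _ kl)).
rewrite -!acompA -!zcast_nat; rewrite -zmapE.
by rewrite m1E e1 acompA -zcast_nat -m2E zmapE.
Qed.

Lemma sg_full (X Y : T) (g : ahom (shift (shiftz k X)) (shiftz l Y)) : l = k + 1 ->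
  exists m : ahom X Y, g = zf l m \oc sg k l X.
Proof.
move=> e; move: g; rewrite e => g; have [s [s1 s2]] := (aisoP _).1 (sg_iso k X).
have [m mE] := zf_full (g \oc s); exists m.
by rewrite mE -acompA s1 acomp1r.
Qed.

(** The degree one map defined by the extension class [m]: leave the first cone by its connecting
    map, apply [m], enter the second cone. *)
Definition cext (m : ahom (kS1 x) (kS2 y)) : ahom (cob x) (cob y) :=
  cb y \oc zf l m \oc sg k l (kS1 x) \oc cp x.

Lemma cext_surj (f : ahom (cob x) (cob y)) : l = k + 1 -> exists m, f = cext m.
Proof.
move=> e; have kl : k != l by rewrite e -subr_eq0 opprD addrA subrr sub0r.
have [|t ->] := dist_wcoker (f := f) (dist_rotl (cdist x)); first exact: S2_cone_neq.
have [|q ->] := dist_wker (f := t) (dist_rotl (cdist y)); first exact: S1_S1.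
have [m ->] := sg_full q e; exists m.
by rewrite /cext !acompA.
Qed.

(** With [cext_surj] and [cext_null] this identifies the degree one maps with the cokernel of [(m1,
    m2) |-> kphi y \oc m1 + m2 \oc kphi x], the first extension group of two-term complexes. *)
Lemma cext0 (m : ahom (kS1 x) (kS2 y)) : l = k + 1 -> cext m = 0 ->
  exists (m1 : ahom (kS1 x) (kS1 y)) (m2 : ahom (kS2 x) (kS2 y)),
    m = kphi y \oc m1 + m2 \oc kphi x.
Proof.
move=> e m0; have kl : k != l by rewrite e -subr_eq0 opprD addrA subrr sub0r.
have [|r rE] := dist_wcoker (f := cb y \oc zf l m \oc sg k l (kS1 x))
  (dist_rotl (dist_rotl (cdist x))) => //.
have [|r2 r2E] := dist_wker (f := r) (dist_rotl (cdist y)).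
  have [r0 r0E] := sh_full (cp y \oc r); rewrite -r0E.
  by rewrite (addE_21 (kh2 x) (kh1 y) r0) sh0.
have [m2 m2E] := sg_full r2 e.
have [|r1 r1E] := dist_wker (f := zf l m \oc sg k l (kS1 x)
    + r2 \oc sh (zf k (kphi x))) (cdist y).
  by rewrite acompDr (acompA _ (zf l m)) rE (acompA _ r2) -r2E acompNr addNr.
have [m1 m1E] := sg_full r1 e.
exists m1, (- m2).
have sgi : aiso (sg k l (kS1 x)) by rewrite e; exact: sg_iso.
apply: (@zf_inj _ _ l); apply: (aiso_epi sgi).
rewrite zfD !zf_comp zfN acompDl acompNl acompNl -!acompA -m1E -r1E -(sg_nat _ _ (kphi x)).
by rewrite (acompA (zf l m2)) -m2E addrK.
Qed.

Lemma cext_null (m1 : ahom (kS1 x) (kS1 y)) (m2 : ahom (kS2 x) (kS2 y)) :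
  cext (kphi y \oc m1 + m2 \oc kphi x) = 0.
Proof.
rewrite /cext zfD !zf_comp acompDr acompDl acompDl (acompA _ _ (zf l m1)).
rewrite (dist_vu (cdist y)) !acomp0l add0r (acompA (cb y)).
rewrite -(acompA _ (zf l (kphi x))) -(sg_nat _ _ (kphi x)).
by rewrite -!acompA (dist_uw (cdist x)) !acomp0r.
Qed.

End Cells.

(** * Homotopy classes between homogeneous twisted complexes *)

Section Homogeneous.
Variables (K : fieldType) (T : linear_triangulated_category K) (E : bool -> T).
Hypothesis E_neq : forall (a b : bool) (n : int) (f : ahom (E a) (shiftz n (E b))),
  n != 0 -> f = 0.
Hypothesis E_21 : forall f : ahom (E true) (E false), f = 0.

Local Notation tw := (tw E).
Local Notation HK := (kt_add E).
Local Notation thom X Y := (ahom (tcar X) (tcar Y)).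
Local Notation tdegree X Y := (hdeg (tpi X) (tpi Y)).

Definition conc (S : T) (n : int) : grading S := fun m => if m == n then aid S else 0.

Lemma honest_conc a (S : T) n : addE E a S -> honest E (conc S n).
Proof.
move=> [I [ij [pj b]]]; exists I, (fun=> a), (fun=> n), ij, pj; split=> // m.
rewrite /conc; case: eqVneq => [_|ne]; first by case: b => _ _ <-.
by rewrite big_pred0.
Qed.

Lemma conc_deg (S S' : T) n n' k (f : ahom S S') : n' = n + k ->
  hdeg (conc S n) (conc S' n') k f.
Proof.
move=> -> m; rewrite /conc (inj_eq (addIr k)).
by case: eqP => _; rewrite !acompE.
Qed.

Lemma conc_deg0 (S S' : T) n n' k (f : ahom S S') :
  hdeg (conc S n) (conc S' n') k f -> n' != n + k -> f = 0.
Proof.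
move=> h ne; have := h n; rewrite /conc eqxx acomp1r eq_sym (negPf ne).
by rewrite acomp0l.
Qed.

Section Ho.
Variable x : shkron E.
Local Notation k := (sk x).

(** Shifting by [k] lowers degrees by [k]; for [k = 0] the source sits in degree -1 and the target
    in degree 0, as in a mapping cone. *)
Definition ho_gr : grading (oplus (kS1 x) (kS2 x)) :=
  psum (conc (kS1 x) (- k - 1)) (conc (kS2 x) (- k)).

Lemma ho_hon : honest E ho_gr.
Proof. by apply: honest_sum; [exact: honest_conc (kh1 x)|exact: honest_conc (kh2 x)]. Qed.

Definition ho_df := inj2 (kS1 x) (kS2 x) \oc kphi x \oc prj1 (kS1 x) (kS2 x).

Lemma ho_deg : hdeg ho_gr ho_gr 1 ho_df.
Proof.
have d : hdeg (conc (kS1 x) (- k - 1)) (conc (kS2 x) (- k)) 1 (kphi x).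
  by apply: conc_deg; rewrite subrK.
exact: (hdeg_comp (hdeg_comp (hdeg_inj2 _ _) d) (hdeg_prj1 _ _)).
Qed.

Lemma ho_dd : ho_df \oc ho_df = 0.
Proof. by rewrite /ho_df !expE !zeroE. Qed.

Definition ho : tw := Tw ho_hon ho_deg ho_dd.
End Ho.

Section HoHom.
Variables x y : shkron E.
Local Notation k := (sk x).
Local Notation l := (sk y).
Local Notation S1 := (kS1 x).
Local Notation S2 := (kS2 x).
Local Notation S1' := (kS1 y).
Local Notation S2' := (kS2 y).
Implicit Type m : thom (ho x) (ho y).

Definition m1 m : ahom S1 S1' := prj1 _ _ \oc m \oc inj1 _ _.
Definition m2 m : ahom S2 S2' := prj2 _ _ \oc m \oc inj2 _ _.
Definition mh m : ahom S1 S2' := prj2 _ _ \oc m \oc inj1 _ _.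

Lemma S2_S1_0 (f : ahom S2 S1') : f = 0.
Proof. exact: (addE_21 E_neq E_21 (k := 0) (l := 0) (kh2 x) (kh1 y)). Qed.

(** The fourth entry goes from copies of [E2] to copies of [E1] and vanishes. *)
Lemma ho_homE m :
  m = inj1 _ _ \oc m1 m \oc prj1 _ _ + inj2 _ _ \oc m2 m \oc prj2 _ _
    + inj2 _ _ \oc mh m \oc prj1 _ _.
Proof.
apply: oplus_ext_in; apply: oplus_ext_out; rewrite /m1 /m2 /mh !expE !zeroE //.
exact: S2_S1_0.
Qed.

Lemma ho_hdeg n m : tdegree (ho x) (ho y) n m ->
  [/\ (l + n != k -> m1 m = 0), (l + n != k -> m2 m = 0) & (l + n != k + 1 -> mh m = 0)].
Proof.
move=> h; split=> ne.
- have d : hdeg (conc S1 (- k - 1)) (conc S1' (- l - 1)) (0 + (n + 0)) (m1 m) :=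
    hdeg_comp (hdeg_comp (hdeg_prj1 _ _) h) (hdeg_inj1 _ _).
  by apply: (conc_deg0 d); apply: contra ne => /eqP e; apply/eqP; lia.
- have d : hdeg (conc S2 (- k)) (conc S2' (- l)) (0 + (n + 0)) (m2 m) :=
    hdeg_comp (hdeg_comp (hdeg_prj2 _ _) h) (hdeg_inj2 _ _).
  by apply: (conc_deg0 d); apply: contra ne => /eqP e; apply/eqP; lia.
have d : hdeg (conc S1 (- k - 1)) (conc S2' (- l)) (0 + (n + 0)) (mh m) :=
    hdeg_comp (hdeg_comp (hdeg_prj2 _ _) h) (hdeg_inj1 _ _).
by apply: (conc_deg0 d); apply: contra ne => /eqP e; apply/eqP; lia.
Qed.

Lemma ho_chainE m : chain m ->
  [/\ (l != k -> m1 m = 0), (l != k -> m2 m = 0), (l != k + 1 -> mh m = 0)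
    & kphi y \oc m1 m = m2 m \oc kphi x].
Proof.
move=> [/ho_hdeg]; rewrite addr0 => -[h1 h2 h3] e; split=> //.
have := congr1 (fun f => prj2 _ _ \oc f \oc inj1 _ _) e.
by rewrite /= /ho_df /m1 /m2 !expE !zeroE => ->.
Qed.

Lemma ho_chain0 (a : ahom S1 S1') (b : ahom S2 S2') : l = k ->
  kphi y \oc a = b \oc kphi x ->
  @chain _ _ _ (ho x) (ho y) (inj1 _ _ \oc a \oc prj1 _ _ + inj2 _ _ \oc b \oc prj2 _ _).
Proof.
move=> e ab; split.
  have d1 : hdeg (conc S1 (- k - 1)) (conc S1' (- l - 1)) 0 a by apply: conc_deg; lia.
  have d2 : hdeg (conc S2 (- k)) (conc S2' (- l)) 0 b by apply: conc_deg; lia.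
  apply: hdegD; first exact: (hdeg_comp (hdeg_comp (hdeg_inj1 _ _) d1) (hdeg_prj1 _ _)).
  exact: (hdeg_comp (hdeg_comp (hdeg_inj2 _ _) d2) (hdeg_prj2 _ _)).
by rewrite /= /ho_df !expE !zeroE (acl ab) !acompA.
Qed.

Lemma ho_chain1 (a : ahom S1 S2') : l = k + 1 ->
  @chain _ _ _ (ho x) (ho y) (inj2 _ _ \oc a \oc prj1 _ _).
Proof.
move=> e; split; last by rewrite /= /ho_df !expE !zeroE.
have d1 : hdeg (conc S1 (- k - 1)) (conc S2' (- l)) 0 a by apply: conc_deg; lia.
exact: (hdeg_comp (hdeg_comp (hdeg_inj2 _ _) d1) (hdeg_prj1 _ _)).
Qed.

Lemma ho_null m : chain m -> nullh m ->
  if l == k + 1 then exists a b, mh m = kphi y \oc a + b \oc kphi x else m = 0.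
Proof.
move=> _ [h [/ho_hdeg[h1 h2 _] mE]]; case: eqVneq => e.
  exists (m1 h), (m2 h).
  by rewrite /mh mE /= /ho_df /m1 /m2 !expE !zeroE.
have {}e : l - 1 != k by apply: contra e => /eqP <-; rewrite subrK.
rewrite mE /= /ho_df (ho_homE h) h1 // h2 //.
by rewrite !expE !zeroE.
Qed.

Lemma ho_null1 m a b : l = k + 1 -> chain m ->
  mh m = kphi y \oc a + b \oc kphi x -> nullh m.
Proof.
move=> e cm mE; have [z1 z2 _ _] := ho_chainE cm.
have ne : l != k by rewrite e -subr_eq0 addrAC subrr add0r.
exists (inj1 _ _ \oc a \oc prj1 _ _ + inj2 _ _ \oc b \oc prj2 _ _); split.
  have d1 : hdeg (conc S1 (- k - 1)) (conc S1' (- l - 1)) (-1) a by apply: conc_deg; lia.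
  have d2 : hdeg (conc S2 (- k)) (conc S2' (- l)) (-1) b by apply: conc_deg; lia.
  apply: hdegD; first exact: (hdeg_comp (hdeg_comp (hdeg_inj1 _ _) d1) (hdeg_prj1 _ _)).
  exact: (hdeg_comp (hdeg_comp (hdeg_inj2 _ _) d2) (hdeg_prj2 _ _)).
by rewrite [LHS]ho_homE (z1 ne) (z2 ne) mE /= /ho_df !expE !zeroE.
Qed.

(* [f] in [T] corresponds to the chain map [m]. *)
Definition Rel m (f : ahom (cob x) (cob y)) : Prop :=
  if l == k + 1 then f = cext (mh m)
  else f \oc cb x = cb y \oc zmap k l (m2 m) /\ cp y \oc f = sh (zmap k l (m1 m)) \oc cp x.

Lemma rel_ex m : chain m -> exists f, Rel m f.
Proof.
move=> cm; have [z1 z2 z3 e] := ho_chainE cm; rewrite /Rel.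
case: eqP => e1; first by eexists.
exact: cone_sq_ex.
Qed.

Lemma rel_uniq m f g : Rel m f -> Rel m g -> f = g.
Proof.
rewrite /Rel; case: eqP => [_ -> -> //|/eqP ne [f1 f2] [g1 g2]].
apply/eqP; rewrite -subr_eq0; apply/eqP; apply: (cone_hom0 E_neq E_21 ne).
  by rewrite acompBl f1 g1 subrr.
by rewrite acompBr f2 g2 subrr.
Qed.

Lemma zmapD p q X Y (f g : ahom X Y) : zmap p q (f + g) = zmap p q f + zmap p q g :> ahom (shiftz p X : T) _.
Proof. by rewrite !zmapE zfD acompDr. Qed.

Lemma rel_lin c m m' f f' : Rel m f -> Rel m' f' ->
  Rel (lscale c m + m') (lscale c f + f').
Proof.
rewrite /Rel; have -> : m1 (lscale c m + m') = lscale c (m1 m) + m1 m'.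
  by rewrite /m1 acompDr acompDl -lscale_compr -lscale_compl.
have -> : m2 (lscale c m + m') = lscale c (m2 m) + m2 m'.
  by rewrite /m2 acompDr acompDl -lscale_compr -lscale_compl.
have -> : mh (lscale c m + m') = lscale c (mh m) + mh m'.
  by rewrite /mh acompDr acompDl -lscale_compr -lscale_compl.
have zzs X Y (g : ahom X Y) : zmap k l (lscale c g) = lscale c (zmap k l g) :> ahom (shiftz k X : T) _.
  by rewrite !zmapE zf_scale -lscale_compr.
case: eqP => _ [].
  by move=> -> ->; rewrite /cext zfD zf_scale acompDr !acompDl -!(lscale_compl, lscale_compr).
move=> f1 f2 [g1 g2]; split.
  by rewrite acompDl -lscale_compl f1 g1 zmapD zzs acompDr -lscale_compr.
rewrite acompDr -lscale_compr f2 g2 zmapD zzs shD acompDl.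
by rewrite lscale_compl; congr (_ \oc _ + _); symmetry; exact: lscale_shift.
Qed.

Lemma rel0 : Rel 0 0.
Proof.
rewrite /Rel /mh /m1 /m2 !acomp0r !acomp0l; case: eqP => _.
  by rewrite /cext zf0 !zeroE.
by rewrite !zmap0 sh0 acomp0l acomp0r.
Qed.

Lemma rel_null m f : chain m -> nullh m -> Rel m f -> f = 0.
Proof.
move=> cm /(ho_null cm); case: ifP => [e1|e1 m0 r]; last first.
  by apply: (rel_uniq r); rewrite m0; exact: rel0.
by move=> [a [b mE]]; rewrite /Rel e1 mE => ->; exact: cext_null.
Qed.

Lemma rel_surj f : exists2 m, chain m & Rel m f.
Proof.
have [e|ne] := eqVneq l (k + 1).
  have [a ->] := cext_surj E_neq E_21 f e.
  exists (inj2 _ _ \oc a \oc prj1 _ _); first exact: ho_chain1.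
  by rewrite /Rel (introT eqP e) /mh !expE !zeroE.
have [e|ne'] := eqVneq k l; last first.
  exists 0; first exact: chain0.
  have -> : f = 0; last exact: rel0.
  apply: (cone_hom0 E_neq E_21 ne); first exact: (S2_cone_neq E_neq E_21).
  have [|t ->] := dist_wcoker (f := cp y \oc f) (dist_rotl (cdist x)).
    by rewrite -acompA (S2_cone_neq E_neq E_21 (f \oc cb x) ne') acomp0r.
  by rewrite (S1_S1 E_neq t ne') acomp0l.
have [a [b [ab f1 f2]]] := cone_sq_surj E_neq E_21 f e.
exists (inj1 _ _ \oc a \oc prj1 _ _ + inj2 _ _ \oc b \oc prj2 _ _).
  exact: ho_chain0.
rewrite /Rel (negPf ne); set m := (X in m2 X).
have -> : m1 m = a by rewrite /m1 /m !expE !zeroE.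
by have -> : m2 m = b by rewrite /m2 /m !expE !zeroE.
Qed.

Lemma zmap_eq0 p q X Y (f : ahom X Y) : p = q ->
  zmap p q f = 0 :> ahom (shiftz p X : T) _ -> f = 0.
Proof. by move=> <-; rewrite zmap_id -(zf0 p X Y) => /zf_inj. Qed.

(** In degree one a zero class is a boundary by [cext0]. In degree zero the components of [m] factor
    through maps from copies of [E2] to copies of [E1], so [m] itself is zero. *)
Lemma rel_inj m : chain m -> Rel m 0 -> nullh m.
Proof.
move=> cm; have [z1 z2 z3 e] := ho_chainE cm; rewrite /Rel.
case: eqP => [lk /esym/(cext0 E_neq E_21 lk)[a [b mE]]|/eqP ne [/esym e1 /esym e2]].
  exact: ho_null1 mE.
suff -> : m = 0 by exact: nullh0.
rewrite (ho_homE m) (z3 ne).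
have [lk|nlk] := eqVneq l k; last by rewrite z1 // z2 // !zeroE.
rewrite acomp0l in e1; rewrite acomp0r in e2.
have g2 : zmap k l (m2 m) = 0.
  have [q ->] := dist_wker (cdist y) e1.
  have -> : q = 0; last by rewrite acomp0r.
  exact: (addE_21 E_neq E_21 (kh2 x) (kh1 y)).
have g1 : zmap k l (m1 m) = 0.
  apply: sh_inj; rewrite sh0.
  have [r ->] := dist_wcoker (dist_rotl (dist_rotl (cdist x))) e2.
  have [r0 <-] := sh_full r.
  by rewrite (addE_21 E_neq E_21 (kh2 x) (kh1 y) r0) sh0 acomp0l.
by rewrite (zmap_eq0 (esym lk) g1) (zmap_eq0 (esym lk) g2) !zeroE.
Qed.

End HoHom.
End Homogeneous.

(** * The comparison functor on homogeneous pieces *)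

Section Tau.
Variables (K : fieldType) (T : linear_triangulated_category K) (E : bool -> T).
Hypothesis E_neq : forall (a b : bool) (n : int) (f : ahom (E a) (shiftz n (E b))),
  n != 0 -> f = 0.
Hypothesis E_21 : forall f : ahom (E true) (E false), f = 0.

Local Notation tw := (tw E).
Local Notation HK := (kt_add E).
Local Notation KT := (kt_tri E).
Local Notation thom X Y := (ahom (tcar X) (tcar Y)).
Local Notation tdegree X Y := (hdeg (tpi X) (tpi Y)).

Lemma zmap_sg (k l r : int) (X Y Z : T) (g : ahom Y Z) (f : ahom X Y) : l = r ->
  zmap l r g \oc zf l f \oc sg k l X = zf r (g \oc f) \oc sg k r X.
Proof. by move=> <-; rewrite zmap_id zf_comp. Qed.

Lemma sg_zmap (k l r : int) (X Y : T) (f : ahom X Y) : k = l ->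
  sg l r Y \oc sh (zmap k l f) = zf r f \oc sg k r X.
Proof. by move=> <-; rewrite zmap_id sg_nat. Qed.

Lemma zmap_comp (k l r : int) (X Y Z : T) (g : ahom Y Z) (f : ahom X Y) : k = l ->
  zmap l r g \oc zmap k l f = zmap k r (g \oc f).
Proof. by move=> <-; rewrite zmap_id !zmapE zf_comp !acompA. Qed.

Lemma zsig_zmap (k l : int) (X Y : T) (f : ahom X Y) :
  zsig l Y \oc sh (zmap k l f) = zmap (k + 1) (l + 1) f \oc zsig k X.
Proof.
have [<-|ne] := eqVneq k l; first by rewrite !zmap_id zsig_nat.
by rewrite !zmap_neq ?(inj_eq (addIr 1)) // sh0 acomp0l acomp0r.
Qed.

Lemma zsig_sg (k l : int) (X : T) : l = k + 1 ->
  zsig l X \oc sh (sg k l X) = sg (k + 1) (l + 1) X \oc sh (zsig k X).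
Proof. by move=> ->; rewrite !sgE !zcast_id !acomp1l. Qed.

Section Far.
Variables x y : shkron E.
Local Notation k := (sk x).
Local Notation l := (sk y).

Lemma cob_far (f : ahom (cob x) (cob y)) : l != k -> l != k + 1 -> f = 0.
Proof.
rewrite eq_sym => n1 n2; apply: (cone_hom0 E_neq E_21 n2).
  exact: (S2_cone_neq E_neq E_21).
have [|t ->] := dist_wcoker (f := cp y \oc f) (dist_rotl (cdist x)).
  by rewrite -acompA (S2_cone_neq E_neq E_21 (f \oc cb x) n1) acomp0r.
by rewrite (S1_S1 E_neq t n1) acomp0l.
Qed.

Lemma ho_far (m : thom (ho x) (ho y)) : chain m -> l != k -> l != k + 1 -> m = 0.
Proof.
move=> /ho_chainE[z1 z2 z3 _] n1 n2.
by rewrite (ho_homE E_neq E_21 m) z1 // z2 // z3 // !zeroE.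
Qed.

Lemma Rel0 (m : thom (ho x) (ho y)) f : l != k + 1 -> Rel m f ->
  f \oc cb x = cb y \oc zmap k l (m2 m) /\ cp y \oc f = sh (zmap k l (m1 m)) \oc cp x.
Proof. by rewrite /Rel => /negPf ->. Qed.

Lemma Rel1 (m : thom (ho x) (ho y)) f : l = k + 1 -> Rel m f -> f = cext (mh m).
Proof. by rewrite /Rel => /eqP ->. Qed.
End Far.

Lemma rel_id (x : shkron E) : Rel (x := x) (y := x) (aid (tcar (ho x))) (aid (cob x)).
Proof.
have ne : sk x != sk x + 1 by rewrite eq_sym -subr_eq0 addrAC subrr add0r.
rewrite /Rel (negPf ne) /m1 /m2 !acomp1r prj1_inj1 prj2_inj2 !zmap_id !zf_id sh_id.
by rewrite !acomp1l !acomp1r.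
Qed.

Lemma m1_comp (x y z : shkron E) (m : thom (ho x) (ho y)) (m' : thom (ho y) (ho z)) :
  m1 (m' \oc m) = m1 m' \oc m1 m.
Proof.
by rewrite {1}(ho_homE E_neq E_21 m') {1}(ho_homE E_neq E_21 m) /m1 !expE !zeroE.
Qed.
Lemma m2_comp (x y z : shkron E) (m : thom (ho x) (ho y)) (m' : thom (ho y) (ho z)) :
  m2 (m' \oc m) = m2 m' \oc m2 m.
Proof.
by rewrite {1}(ho_homE E_neq E_21 m') {1}(ho_homE E_neq E_21 m) /m2 !expE !zeroE.
Qed.
Lemma mh_comp (x y z : shkron E) (m : thom (ho x) (ho y)) (m' : thom (ho y) (ho z)) :
  mh (m' \oc m) = m2 m' \oc mh m + mh m' \oc m1 m.
Proof.
rewrite {1}(ho_homE E_neq E_21 m') {1}(ho_homE E_neq E_21 m) /mh /m1 /m2 !expE !zeroE.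
exact: addrC.
Qed.

(** By cases on the two differences of indices. Two degree one maps compose to zero because
    [cp y \oc cb y = 0]; a degree one and a degree zero map compose by the formula for [mh]; all
    other maps are zero. *)
Lemma rel_comp (x y z : shkron E) (m : thom (ho x) (ho y)) (m' : thom (ho y) (ho z)) f f' :
  chain m -> chain m' -> Rel m f -> Rel m' f' -> Rel (x := x) (y := z) (m' \oc m) (f' \oc f).
Proof.
move=> cm cm' r r'.
have [lk1|nlk1] := eqVneq (sk y) (sk x + 1).
  have nlk : sk y != sk x by rewrite lk1 -subr_eq0 addrAC subrr add0r.
  rewrite (Rel1 lk1 r).
  have [rl1|nrl1] := eqVneq (sk z) (sk y + 1).
    rewrite (Rel1 rl1 r').
    have -> : cext (mh m') \oc cext (mh m) = 0.
      rewrite /cext -!acompA (acompA (cp y)) (dist_wv (cdist y)).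
      by rewrite !(acomp0l, acomp0r).
    have n1 : sk z != sk x + 1 by rewrite rl1 lk1 -subr_eq0 addrAC subrr add0r.
    have n2 : sk x != sk z by rewrite rl1 lk1 -subr_eq0 !opprD !addrA subrr.
    by rewrite /Rel (negPf n1) !zmap_neq // sh0 !(acomp0l, acomp0r).
  have [f1 f2] := Rel0 nrl1 r'.
  have [rl|nrl] := eqVneq (sk z) (sk y); last first.
    by rewrite (ho_far cm' nrl nrl1) (cob_far f' nrl nrl1) !acomp0l; exact: rel0.
  have rk1 : sk z = sk x + 1 by rewrite rl.
  rewrite /Rel (introT eqP rk1) mh_comp.
  have [_ _ z3 _] := ho_chainE cm'.
  rewrite (z3 nrl1) acomp0l addr0 /cext -(acompA (cb z)) -(zmap_sg _ _ _ (esym rl)).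
  by rewrite !acompA f1.
have [lk|nlk] := eqVneq (sk y) (sk x); last first.
  by rewrite (ho_far cm nlk nlk1) (cob_far f nlk nlk1) !acomp0r; exact: rel0.
have [f1 f2] := Rel0 nlk1 r.
have [rl1|nrl1] := eqVneq (sk z) (sk y + 1).
  have rk1 : sk z = sk x + 1 by rewrite rl1 lk.
  rewrite /Rel (introT eqP rk1) mh_comp (Rel1 rl1 r').
  have [_ _ z3 _] := ho_chainE cm.
  rewrite (z3 nlk1) acomp0r add0r /cext zf_comp -!acompA f2; congr (_ \oc (_ \oc _)).
  by rewrite acompA sg_zmap // acompA.
have nrk1 : sk z != sk x + 1 by rewrite -lk.
have [g1 g2] := Rel0 nrl1 r'.
rewrite /Rel (negPf nrk1) m1_comp m2_comp.
rewrite -(zmap_comp (sk z) (m1 m') (m1 m) (esym lk)).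
rewrite -(zmap_comp (sk z) (m2 m') (m2 m) (esym lk)); split.
  by rewrite -acompA f1 acompA g1 acompA.
by rewrite acompA g2 -acompA f2 acompA sh_comp.
Qed.

Section Shift.
Variable x : shkron E.
Definition xs : shkron E := ShKron (sk x + 1) (sq x).

(** [tsh 1 (ho x)] and [ho (xs x)] have the same grading and opposite differentials; the sign is
    absorbed by -1 on [kS1]. *)
Definition eta_m : ahom (oplus (kS1 x) (kS2 x)) (oplus (kS1 x) (kS2 x)) :=
  inj2 _ _ \oc prj2 _ _ - inj1 _ _ \oc prj1 _ _.

Lemma eta_mm : eta_m \oc eta_m = aid _.
Proof.
rewrite /eta_m !expE !zeroE -oplus_id; zmod.
Qed.

Lemma conc_shift (S : T) n m : pshift (conc S n) 1 m = conc S (n - 1) m.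
Proof. by rewrite /pshift /conc eq_sym -subr_eq eq_sym. Qed.

Lemma eta_chain : @chain _ _ _ (tsh 1 (ho x)) (ho xs) eta_m /\
  @chain _ _ _ (ho xs) (tsh 1 (ho x)) eta_m.
Proof.
have g n : tpi (tsh 1 (ho x)) n = tpi (ho xs) n.
  rewrite /= /pshift /ho_gr /psum -![conc _ _ (n + 1)]/(pshift (conc _ _) 1 n) !conc_shift.
  have -> : - sk x - 1 - 1 = - sk xs - 1 by rewrite /= opprD.
  by have -> : - sk x - 1 = - sk xs by rewrite /= opprD.
have c n : tpi (ho xs) n \oc eta_m = eta_m \oc tpi (ho xs) n.
  by rewrite /= /ho_gr /psum /eta_m /xs /= !expE !zeroE; zmod.
split; split=> [n|].
- by rewrite addr0 g c.
- by rewrite /= /ho_df /eta_m /xs /= !expE !zeroE; zmod.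
- by rewrite addr0 g c.
by rewrite /= /ho_df /eta_m /xs /= !expE !zeroE; zmod.
Qed.

Definition heta : ahom (tsh 1 (ho x) : HK) (ho xs : HK) := kcl eta_chain.1.

Lemma heta_iso : aiso heta.
Proof.
apply/aisoP; exists (kcl eta_chain.2); rewrite !kclM; split; apply: kcl_eq1;
  exact: eta_mm.
Qed.

Lemma ceta_ex : exists h : ahom (shift (cob x)) (cob xs),
  [/\ aiso h, h \oc sh (cb x) = cb xs \oc zsig (sk x) (kS2 x)
    & cp xs \oc h = - (sh (zsig (sk x) (kS1 x)) \oc sh (cp x))].
Proof.
(* Three rotations shift the triangle and reverse the signs of all three maps; the sign put on
   [zsig] at [kS1] makes the first square commute, and [- h] restores the sign of the second. *)
have d := dist_rotl (dist_rotl (dist_rotl (cdist x))).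
have [|h [h1 h2 h3]] := dist_mor_iso (f := - zsig (sk x) (kS1 x)) (g := zsig (sk x) (kS2 x))
  d (cdist xs) (aisoN (zsig_iso _ _)) (zsig_iso _ _).
  by rewrite !acompNr zsig_nat.
exists (- h); split; first exact: aisoN.
  by rewrite acompNl -acompNr.
by rewrite acompNr -h3 shN acompNl acompNr opprK.
Qed.

Definition ceta : ahom (shift (cob x)) (cob xs) := sval (cid ceta_ex).
Lemma ceta_iso : aiso ceta. Proof. by rewrite /ceta; case: cid => h []. Qed.
Lemma ceta_b : ceta \oc sh (cb x) = cb xs \oc zsig (sk x) (kS2 x).
Proof. by rewrite /ceta; case: cid => h []. Qed.
Lemma ceta_p : cp xs \oc ceta = - (sh (zsig (sk x) (kS1 x)) \oc sh (cp x)).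
Proof. by rewrite /ceta; case: cid => h []. Qed.
End Shift.

(** Conjugation by [eta_m] changes the sign of [mh] only, and the minus sign in [ceta_p] compensates
    for it. *)
Lemma rel_shift (x y : shkron E) (m : thom (ho x) (ho y)) f
  (f' : ahom (cob (xs x)) (cob (xs y))) : Rel m f ->
  f' \oc ceta x = ceta y \oc sh f ->
  Rel (x := xs x) (y := xs y) (eta_m y \oc m \oc eta_m x) f'.
Proof.
move=> r e.
have e1 : m1 (x := xs x) (y := xs y) (eta_m y \oc m \oc eta_m x) = m1 m.
  by rewrite /m1 /eta_m /= !expE !zeroE opprK; zmod.
have e2 : m2 (x := xs x) (y := xs y) (eta_m y \oc m \oc eta_m x) = m2 m.
  by rewrite /m2 /eta_m /= !expE !zeroE.
have e3 : mh (x := xs x) (y := xs y) (eta_m y \oc m \oc eta_m x) = - mh m.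
  by rewrite /mh /eta_m /= !expE !zeroE.
have [lk|nlk] := eqVneq (sk y) (sk x + 1).
  have lk' : sk (xs y) = sk (xs x) + 1 by rewrite /= lk.
  rewrite /Rel (introT eqP lk') e3; apply: (aiso_epi (ceta_iso x)).
  rewrite e (Rel1 lk r) /cext -!acompA ceta_p zfN.
  rewrite ?(acompNr, acompNl) opprK.
  rewrite !sh_comp !acompA ceta_b -!acompA; congr (_ \oc _).
  rewrite !acompA zsig_nat -!acompA; congr (_ \oc _).
  by rewrite !acompA zsig_sg.
have nlk' : sk (xs y) != sk (xs x) + 1 by rewrite /= (inj_eq (addIr 1)).
have [f1 f2] := Rel0 nlk r.
rewrite /Rel (negPf nlk') e1 e2; split.
  apply: (aiso_epi (zsig_iso (sk x) (kS2 x))); rewrite -[LHS]acompA -ceta_b acompA e.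
  rewrite -acompA -sh_comp f1 sh_comp acompA ceta_b -acompA zsig_zmap.
  by rewrite acompA.
apply: (aiso_epi (ceta_iso x)); rewrite -acompA e acompA ceta_p acompNl -!acompA.
rewrite -sh_comp f2 ceta_p acompNr; congr (- _).
by rewrite sh_comp !acompA -!sh_comp zsig_zmap.
Qed.

Lemma tau_ex (x y : shkron E) (a : ahom (ho x : HK) (ho y : HK)) :
  exists f, exists2 m : thom (ho x) (ho y), Rel m f & exists c : chain m, a = kcl c.
Proof.
have [m [c e]] := kcl_surj a; have [f r] := rel_ex c.
by exists f, m => //; exists c.
Qed.

(** A representative is chosen through [Rel]; by [tauE] the value depends on the homotopy class
    only. *)
Definition tau (x y : shkron E) (a : ahom (ho x : HK) (ho y : HK)) :
  ahom (cob x) (cob y) := sval (cid (tau_ex a)).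

Lemma tauE (x y : shkron E) (m : thom (ho x) (ho y)) (c : chain m) f :
  Rel m f -> tau (kcl c : ahom (ho x : HK) (ho y : HK)) = f.
Proof.
move=> r; rewrite /tau; case: cid => g [m' r' [c' /kcl_eq e]] /=.
apply/esym/eqP; rewrite -subr_eq0; apply/eqP; apply: (rel_null E_neq E_21 _ e); first exact: chainB.
have := rel_lin (-1) r' r; set a := lscale _ _ + _; set b := lscale _ _ + _.
have sN (X Y : T) (h : ahom X Y) : lscale (-1) h = - h.
  exact: (scaleN1r (h : lhom X Y)).
by rewrite /a /b !sN addrC [X in Rel _ X]addrC.
Qed.

Lemma tauP (x y : shkron E) (a : ahom (ho x : HK) (ho y : HK)) :
  exists (m : thom (ho x) (ho y)) (c : chain m), a = kcl c /\ Rel m (tau a).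
Proof.
have [m [c ->]] := kcl_surj a; have [f r] := rel_ex c.
by exists m, c; rewrite (tauE _ r).
Qed.

Lemma tau_id (x : shkron E) : tau (aid (ho x : HK)) = aid (cob x).
Proof. exact: (tauE (chain_id (ho x)) (rel_id x)). Qed.

Lemma tau_comp (x y z : shkron E) (b : ahom (ho y : HK) (ho z)) (a : ahom (ho x : HK) (ho y)) :
  tau (b \oc a) = tau b \oc tau a.
Proof.
have [[m [c [-> r]]] [m' [c' [-> r']]]] := conj (tauP a) (tauP b).
by rewrite kclM; apply: tauE; exact: rel_comp.
Qed.

Lemma tau_lin c (x y : shkron E) (m m' : thom (ho x) (ho y)) (cm : chain m) (cm' : chain m')
  (cl : chain (lscale c m + m')) :
  tau (kcl cl : ahom (ho x : HK) (ho y : HK)) =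
  lscale c (tau (kcl cm : ahom (ho x : HK) (ho y : HK))) + tau (kcl cm' : ahom (ho x : HK) (ho y : HK)).
Proof.
have [[f r] [f' r']] := conj (rel_ex cm) (rel_ex cm').
by rewrite (tauE cm r) (tauE cm' r') (tauE cl (rel_lin c r r')).
Qed.

Lemma tauD (x y : shkron E) (a b : ahom (ho x : HK) (ho y)) : tau (a + b) = tau a + tau b.
Proof.
have [[m [c [-> r]]] [m' [c' [-> r']]]] := conj (tauP a) (tauP b).
have e : lscale 1 m + m' = m + m' by rewrite lscale1.
have cl : chain (lscale 1 m + m') by rewrite e; exact: chain_add.
rewrite kclD -(lscale1 (tau (kcl c))) -(tau_lin _ _ cl); congr tau.
by apply: kcl_eq1; rewrite e.
Qed.

Lemma tau0 (x y : shkron E) : tau (0 : ahom (ho x : HK) (ho y)) = 0.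
Proof. by apply: (addIr (tau 0)); rewrite -tauD !add0r. Qed.

Lemma tau_inj (x y : shkron E) (a b : ahom (ho x : HK) (ho y)) : tau a = tau b -> a = b.
Proof.
move=> e; apply/eqP; rewrite -subr_eq0; apply/eqP.
have : tau (a - b) = 0 by apply: (addIr (tau b)); rewrite -tauD subrK add0r e.
have [m [c [-> r]]] := tauP (a - b) => t0; rewrite t0 in r.
by rewrite -(kcl0 (chain0 _ _)); apply/kcl_eq; rewrite subr0; exact: (rel_inj E_neq E_21 c r).
Qed.

Lemma tau_surj (x y : shkron E) f : exists a : ahom (ho x : HK) (ho y), tau a = f.
Proof.
by have [m c r] := rel_surj E_neq E_21 f; exists (kcl c); exact: tauE.
Qed.

Lemma tau_shift (x y : shkron E) (a : ahom (ho x : HK) (ho y)) (b : ahom (ho (xs x) : HK) (ho (xs y))) :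
  b \oc heta x = heta y \oc ksh 1 a -> tau b \oc ceta x = ceta y \oc sh (tau a).
Proof.
move=> e; have [m [c [aE r]]] := tauP a.
have [s [s1 s2]] := (aisoP _).1 (ceta_iso x).
have r' := rel_shift (f' := ceta y \oc sh (tau a) \oc s) r.
have c2 : @chain _ _ _ (ho (xs x)) (ho (xs y)) (eta_m y \oc m \oc eta_m x).
  apply: (@chain_comp _ _ _ (ho (xs x)) (tsh 1 (ho x)) (ho (xs y))); last exact: (eta_chain x).2.
  apply: (@chain_comp _ _ _ (tsh 1 (ho x)) (tsh 1 (ho y)) (ho (xs y))); first exact: (eta_chain y).1.
  exact: chain_sh.
have bE : b = kcl c2.
  apply: (aiso_epi (heta_iso x)); rewrite e aE kshE !kclM; apply: kcl_eq1.
  by rewrite -!acompA eta_mm acomp1r.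
rewrite bE (tauE c2 (r' _)) -!acompA s1 ?acomp1r //.
Qed.

End Tau.

(** * Splitting twisted complexes *)

Section FiniteBiproducts.
Variable A : additive_category.

Lemma biproduct_seq (I : finType) (X : I -> A) (s : seq I) : uniq s ->
  exists (S : A) (ij : forall i, ahom (X i) S) (pj : forall i, ahom S (X i)),
  [/\ forall i, i \in s -> pj i \oc ij i = aid (X i),
      forall i j, i != j -> pj i \oc ij j = 0
    & \sum_(i <- s) (ij i \oc pj i) = aid S].
Proof.
elim: s => [_|x s IH /= /andP[xs us]].
  exists azero, (fun=> 0), (fun=> 0); split=> // [i j _|]; first exact: acomp0l.
  by rewrite big_nil aid_azero.
have [S [ij [pj [h1 h2 h3]]]] := IH us.
pose ij' := @dfwith I (fun i => ahom (X i) (oplus (X x) S) : Type)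
  (fun i => inj2 (X x) S \oc ij i) x (inj1 (X x) S).
pose pj' := @dfwith I (fun i => ahom (oplus (X x) S) (X i) : Type)
  (fun i => pj i \oc prj2 (X x) S) x (prj1 (X x) S).
have [ix px] : ij' x = inj1 _ _ /\ pj' x = prj1 _ _ by split; exact: dfwith_in.
have io i : x != i -> ij' i = inj2 _ _ \oc ij i by move=> ne; exact: dfwith_out.
have po i : x != i -> pj' i = pj i \oc prj2 _ _ by move=> ne; exact: dfwith_out.
exists (oplus (X x) S), ij', pj'; split=> [i|i j|].
- rewrite inE; case: (eqVneq x i) => [<- _|ne]; first by rewrite ix px prj1_inj1.
  rewrite /= => js; rewrite io // po // -acompA (acompA (prj2 _ _)).
  by rewrite prj2_inj2 acomp1l h1.
- case: (eqVneq x i) => [<-|ne]; case: (eqVneq x j) => [<-|ne'] // ne2.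
  + by rewrite px io // acompA prj1_inj2 acomp0l.
  + by rewrite ix po // -acompA prj2_inj1 acomp0r.
  + by rewrite io // po // -acompA (acompA (prj2 _ _)) prj2_inj2 acomp1l h2.
rewrite big_cons ix px -oplus_id; congr (_ + _).
rewrite -[X in X \oc prj2 _ _]acomp1r -h3 acomp_sumr acomp_suml.
rewrite [RHS]big_seq [LHS]big_seq; apply: eq_bigr => i si.
have ne : x != i by apply: contraNneq xs => ->.
by rewrite io // po // !acompA.
Qed.

Lemma biproduct_ex (I : finType) (X : I -> A) :
  exists (S : A) (ij : forall i, ahom (X i) S) (pj : forall i, ahom S (X i)),
  biproduct ij pj.
Proof.
have [S [ij [pj [h1 h2 h3]]]] := biproduct_seq X (index_enum_uniq I).
by exists S, ij, pj; split=> // i; apply: h1; rewrite mem_index_enum.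
Qed.

Lemma biproduct_iso (I : finType) (X : I -> A) (S S' : A) ij pj (f : ahom S S') :
  @biproduct _ I X S ij pj -> aiso f ->
  exists ij' pj', @biproduct _ I X S' ij' pj'.
Proof.
move=> [h1 h2 h3] /aisoP[g [gf fg]].
exists (fun i => f \oc ij i), (fun i => pj i \oc g); split=> [i|i j ne|].
- by rewrite acompA -(acompA (pj i)) gf acomp1r h1.
- by rewrite acompA -(acompA (pj i)) gf acomp1r h2.
under eq_bigr => i _ do rewrite acompA -(acompA f).
by rewrite -acomp_suml -acomp_sumr h3 acomp1r fg.
Qed.

Section Sub.
Variables (L : Type) (E : L -> A) (S : A) (p : grading S) (I : finType) (l : I -> L)
  (k : I -> int) (ij : forall i, ahom (E (l i)) S) (pj : forall i, ahom S (E (l i))).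
Hypothesis bip : biproduct ij pj.
Hypothesis pE : forall n, p n = \sum_(i | k i == n) (ij i \oc pj i).

Lemma pj_gr i n : pj i \oc p n = if k i == n then pj i else 0.
Proof.
have [h1 h2 h3] := bip; rewrite pE acomp_sumr big_mkcond (bigD1 i) //= big1 ?addr0.
  by case: ifP => // _; rewrite acompA h1 acomp1l.
by move=> j ji; case: ifP => // _; rewrite acompA h2 ?acomp0l // eq_sym.
Qed.

Lemma gr_ij i n : p n \oc ij i = if k i == n then ij i else 0.
Proof.
have [h1 h2 h3] := bip; rewrite pE acomp_suml big_mkcond (bigD1 i) //= big1 ?addr0.
  by case: ifP => // _; rewrite -acompA h1 acomp1r.
by move=> j ji; case: ifP => // _; rewrite -acompA h2 ?acomp0r.
Qed.

Lemma entry_deg (d : ahom S S) i j : hdeg p p 1 d -> k i != k j + 1 ->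
  pj i \oc d \oc ij j = 0.
Proof.
move=> hd ne; have e := gr_ij j (k j); rewrite eqxx in e.
by rewrite -e acompA -(acompA (pj i)) -hd acompA pj_gr (negPf ne) !acomp0l.
Qed.

Record subsum (P : pred I) := SubSum {
  ss : A;
  sgr : grading ss;
  si : ahom ss S;
  sp : ahom S ss;
  scell : forall i : {i | P i}, ahom (E (l (val i))) ss;
  spr : forall i : {i | P i}, ahom ss (E (l (val i)));
  ssb : biproduct scell spr;
  sgrE : forall n, sgr n = \sum_(i | k (val i) == n) (scell i \oc spr i);
  spi : sp \oc si = aid ss;
  sip : si \oc sp = \sum_(i | P i) (ij i \oc pj i);
  si_deg : hdeg sgr p 0 si;
  sp_deg : hdeg p sgr 0 sp
}.

Lemma subsum_ex (P : pred I) : exists s : subsum P, True.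
Proof.
have [h1 h2 h3] := bip.
have [S' [ij' [pj' b]]] := biproduct_ex (fun i : {i | P i} => E (l (val i))).
have [k1 k2 k3] := b.
pose si := \sum_i (ij (val i) \oc pj' i); pose sp := \sum_i (ij' i \oc pj (val i)).
pose gr n := \sum_(i : {i | P i} | k (val i) == n) (ij' i \oc pj' i).
have pp i : pj' i \oc sp = pj (val i).
  rewrite acomp_sumr (bigD1 i) //= big1 ?addr0 => [|j ji].
    by rewrite acompA k1 acomp1l.
  by rewrite acompA k2 ?acomp0l // eq_sym.
have ii i : si \oc ij' i = ij (val i).
  rewrite acomp_suml (bigD1 i) //= big1 ?addr0 => [|j ji].
    by rewrite -acompA k1 acomp1r.
  by rewrite -acompA k2 ?acomp0r.
refine (ex_intro _ (@SubSum P S' gr si sp ij' pj' b (fun n => erefl)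
  _ _ _ _) Logic.I).
- rewrite -k3 acomp_suml; apply: eq_bigr => i _; rewrite -acompA; congr (_ \oc _).
  rewrite acomp_sumr (bigD1 i) //= big1 ?addr0 => [|j ji].
    by rewrite acompA h1 acomp1l.
  by rewrite acompA h2 ?acomp0l // (inj_eq val_inj) eq_sym.
- rewrite {1}/sp acomp_sumr; under eq_bigr => i _ do rewrite acompA ii.
  exact: (esym (big_sub P (fun i => ij i \oc pj i))).
- move=> n; rewrite addr0 {1}/si acomp_sumr /gr acomp_sumr [RHS]big_mkcond /=.
  apply: eq_bigr => i _; rewrite acompA gr_ij.
  by case: ifP => _; rewrite ?acomp0l // acompA ii.
move=> n; rewrite addr0 {2}/sp acomp_suml /gr acomp_suml [LHS]big_mkcond /=.
apply: eq_bigr => i _; rewrite -[RHS]acompA pj_gr.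
by case: ifP => _; rewrite ?acomp0r // -acompA pp.
Qed.

Lemma sub_zero (P Q : pred I) (s : subsum P) (t : subsum Q) (d : ahom S S) :
  (forall i j, P i -> Q j -> pj i \oc d \oc ij j = 0) -> sp s \oc d \oc si t = 0.
Proof.
move=> z; have m0 : si s \oc sp s \oc d \oc (si t \oc sp t) = 0.
  rewrite !sip !acomp_suml big1 // => i Pi; rewrite acomp_sumr big1 // => j Qj.
  by rewrite !acompA -!(acompA (ij i)) z // acomp0l acomp0r.
have : sp s \oc (si s \oc sp s \oc d \oc (si t \oc sp t)) \oc si t = 0.
  by rewrite m0 acomp0r acomp0l.
by rewrite !acompA spi acomp1l -acompA spi acomp1r.
Qed.

End Sub.
End FiniteBiproducts.

Section Minimal.
Variables (K : fieldType) (T : linear_triangulated_category K) (E : bool -> T).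
Hypothesis E_end : forall (a : bool) (f : ahom (E a) (E a)), f = 0 \/ aiso f.
Hypothesis E_21 : forall f : ahom (E true) (E false), f = 0.

Local Notation tw := (tw E).
Local Notation HK := (kt_add E).
Local Notation thom X Y := (ahom (tcar X) (tcar Y)).

(** Sums of homogeneous pieces up to isomorphism. The predicate bounds the indices that occur, which
    is the measure used in the proof of exactness. *)
Inductive hspan (P : int -> Prop) : HK -> Prop :=
| hspan_zero : hspan P azero
| hspan_ho x : P (sk x) -> hspan P (ho x)
| hspan_plus X Y : hspan P X -> hspan P Y -> hspan P (oplus X Y)
| hspan_iso (X Y : HK) (f : ahom X Y) : aiso f -> hspan P X -> hspan P Y.

Lemma hspan_sub (P Q : int -> Prop) X : (forall k, P k -> Q k) -> hspan P X -> hspan Q X.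
Proof.
move=> h; elim=> {X} [|x px|X Y _ sX _ sY|X Y f fi _ sX].
- exact: hspan_zero.
- by apply: hspan_ho; exact: h.
- exact: hspan_plus.
- exact: hspan_iso fi sX.
Qed.

Lemma addE_cells (I : finType) (l : I -> bool) (S : T) (a : bool)
  (ij : forall i, ahom (E (l i)) S) (pj : forall i, ahom S (E (l i))) :
  biproduct ij pj -> (forall i, l i = a) -> addE E a S.
Proof.
move=> b la; have e : l = fun=> a by exact/funext.
by move: ij pj b; rewrite e => ij pj b; exists I, ij, pj.
Qed.

Section BlockIso.
Variables (X R : tw) (x : shkron E).
Variables (i1 : ahom (kS1 x) (tcar X)) (i2 : ahom (kS2 x) (tcar X)) (i3 : thom R X)
  (p1 : ahom (tcar X) (kS1 x)) (p2 : ahom (tcar X) (kS2 x)) (p3 : thom X R).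
Local Notation d := (tdf X).
Hypotheses (gi1 : hdeg (conc (kS1 x) (- sk x - 1)) (tpi X) 0 i1)
  (gi2 : hdeg (conc (kS2 x) (- sk x)) (tpi X) 0 i2) (gi3 : hdeg (tpi R) (tpi X) 0 i3)
  (gp1 : hdeg (tpi X) (conc (kS1 x) (- sk x - 1)) 0 p1)
  (gp2 : hdeg (tpi X) (conc (kS2 x) (- sk x)) 0 p2) (gp3 : hdeg (tpi X) (tpi R) 0 p3).
Hypotheses (d1 : d \oc i1 = i2 \oc kphi x) (d2 : d \oc i2 = 0) (d3 : d \oc i3 = i3 \oc tdf R).
Hypotheses (q1 : p1 \oc d = 0) (q2 : p2 \oc d = kphi x \oc p1) (q3 : p3 \oc d = tdf R \oc p3).
Hypotheses (o11 : p1 \oc i1 = aid _) (o22 : p2 \oc i2 = aid _) (o33 : p3 \oc i3 = aid _)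
  (o12 : p1 \oc i2 = 0) (o21 : p2 \oc i1 = 0) (o13 : p1 \oc i3 = 0) (o31 : p3 \oc i1 = 0)
  (o23 : p2 \oc i3 = 0) (o32 : p3 \oc i2 = 0)
  (io : i1 \oc p1 + i2 \oc p2 + i3 \oc p3 = aid _).

Lemma block_iso : exists f : ahom (oplus (ho x : HK) R) X, aiso f.
Proof.
have cf : @chain _ _ _ (tplus (ho x) R) X (i1 \oc prj1 _ _ \oc prj1 _ _
    + i2 \oc prj2 _ _ \oc prj1 _ _ + i3 \oc prj2 _ _).
  have pr1 := hdeg_prj1 (tpi (ho x)) (tpi R); have pr2 := hdeg_prj2 (tpi (ho x)) (tpi R).
  split.
    apply: hdegD; first apply: hdegD.
    - exact: (hdeg_comp (hdeg_comp gi1 (hdeg_prj1 _ _)) pr1).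
    - exact: (hdeg_comp (hdeg_comp gi2 (hdeg_prj2 _ _)) pr1).
    - exact: (hdeg_comp gi3 pr2).
  by rewrite /= /ext_df /= /ho_df !expE !zeroE d1 d2 d3 !zeroE.
have cg : @chain _ _ _ X (tplus (ho x) R) (inj1 _ _ \oc (inj1 _ _ \oc p1)
    + inj1 _ _ \oc (inj2 _ _ \oc p2) + inj2 _ _ \oc p3).
  have in1 := hdeg_inj1 (tpi (ho x)) (tpi R); have in2 := hdeg_inj2 (tpi (ho x)) (tpi R).
  split.
    apply: hdegD; first apply: hdegD.
    - exact: (hdeg_comp in1 (hdeg_comp (hdeg_inj1 _ _) gp1)).
    - exact: (hdeg_comp in1 (hdeg_comp (hdeg_inj2 _ _) gp2)).
    - exact: (hdeg_comp in2 gp3).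
  rewrite /= /ext_df /= /ho_df !expE !zeroE.
  by rewrite (acl q1) (acl q2) (acl q3) !zeroE !acompA.
exists (kcl cf); apply/aisoP; exists (kcl cg); rewrite !kclM; split; apply: kcl_eq1.
  rewrite !expE.
  rewrite !(acl o11, acl o22, acl o33, acl o12, acl o21, acl o13, acl o31, acl o23, acl o32).
  rewrite !zeroE.
  transitivity (inj1 (oplus (kS1 x) (kS2 x)) (tcar R) \oc (inj1 _ _ \oc prj1 _ _ +
    inj2 _ _ \oc prj2 _ _) \oc prj1 _ _ + inj2 _ _ \oc prj2 _ _); first by rewrite !expE.
  by rewrite oplus_id acomp1r oplus_id.
by rewrite -io !expE !zeroE.
Qed.
End BlockIso.

Section Cells.
Variables (X : tw) (I : finType) (l : I -> bool) (k : I -> int)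
  (ij : forall i, ahom (E (l i)) (tcar X)) (pj : forall i, ahom (tcar X) (E (l i))).
Hypothesis bip : biproduct ij pj.
Hypothesis pE : forall n, tpi X n = \sum_(i | k i == n) (ij i \oc pj i).
Local Notation d := (tdf X).

Lemma cells_honest (P : pred I) (s : subsum (tpi X) k ij pj P) : honest E (sgr s).
Proof.
exists {i | P i}, (fun i => l (val i)), (fun i => k (val i)), (@scell _ _ _ _ _ _ _ _ _ _ _ s), (@spr _ _ _ _ _ _ _ _ _ _ _ s).
split; [exact: ssb|exact: sgrE].
Qed.

(* Gaussian elimination of an invertible entry [c^-1] of the differential: with
   [h = ij b \oc c \oc pj a], the idempotent [d h + h d] splits off a
   contractible summand. *)
Lemma cancel_pair (a b : I) : pj a \oc d \oc ij b <> 0 -> aiso (pj a \oc d \oc ij b) ->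
  exists (P : pred I) (X' : tw) (ij' : forall i : {i | P i}, ahom (E (l (val i))) (tcar X'))
    (pj' : forall i : {i | P i}, ahom (tcar X') (E (l (val i)))),
  [/\ ~~ P a, biproduct ij' pj',
    forall n, tpi X' n = \sum_(i | k (val i) == n) (ij' i \oc pj' i)
    & exists f : ahom (X' : HK) X, aiso f].
Proof.
have [h1 h2 h3] := bip.
set e0 := pj a \oc d \oc ij b => ne0 /aisoP[c [c1 c2]].
have kab : k a = k b + 1.
  by apply/eqP; apply: contraT => /(entry_deg bip pE (@tdeg _ _ _ X)).
have ab : a != b by apply/eqP => ab; move: kab; rewrite ab; lia.
pose P i := (i != a) && (i != b).
have [s _] := subsum_ex bip pE P.
have sa : pj a \oc si s = 0.
  rewrite -[si s]acomp1r -(spi s) (acompA (si s)) sip acomp_suml acomp_sumr big1 //.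
  by move=> i /andP[ia _]; rewrite !acompA h2 ?acomp0l // eq_sym.
have sb : sp s \oc ij b = 0.
  rewrite -[sp s]acomp1l -(spi s) -(acompA (sp s)) sip -acompA acomp_suml acomp_sumr big1 //.
  by move=> i /andP[_ ib]; rewrite -acompA h2 ?acomp0r.
have q1 : ij a \oc pj a + (ij b \oc pj b + si s \oc sp s) = aid _.
  rewrite -h3 (bigD1 a) //= (bigD1 b) //=; last by rewrite eq_sym.
  by congr (_ + (_ + _)); rewrite sip.
pose h := ij b \oc c \oc pj a.
have dd : d \oc d = 0 by exact: tdd.
have hh : h \oc h = 0 by rewrite /h !acompA (acl (h2 a b ab)) !acompE.
have dgh : hdeg (tpi X) (tpi X) (-1) h.
  move=> n; rewrite /h -!(acompA _ _ (tpi X n)) (pj_gr bip pE) !acompA (gr_ij bip pE).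
  have -> : (k b == n + -1) = (k a == n) by rewrite kab -subr_eq opprK.
  by case: ifP; rewrite ?acomp0l ?acomp0r.
pose e := d \oc h + h \oc d.
have eb : (aid _ - e) \oc ij b = 0.
  rewrite acompBl acomp1l /e acompDl /h !acompA !(acl (h2 a b ab)) acomp0r add0r.
  rewrite -!acompA (acompA (pj a)) -/e0 c1 acomp1r subrr //.
have ae : pj a \oc (aid _ - e) = 0.
  rewrite acompBr acomp1r /e acompDr /h !acompA (h2 a b ab) !acomp0l addr0.
  by rewrite -/e0 c2 acomp1l subrr.
have hi : h \oc si s = 0 by rewrite /h -acompA sa acomp0r.
have ph : sp s \oc h = 0 by rewrite /h !acompA sb !acomp0l.
have hdh : h \oc d \oc h = h.
  by rewrite /h -!acompA (acompA d) (acompA (pj a)) (acompA (pj a)) -/e0 (acompA c) c1 acomp1l.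
have dge : hdeg (tpi X) (tpi X) 0 (aid _ - e).
  apply: hdegB; first exact: hdeg_id.
  apply: hdegD; first by exact: (hdeg_eq _ (hdeg_comp (@tdeg _ _ _ X) dgh)).
  exact: (hdeg_eq _ (hdeg_comp dgh (@tdeg _ _ _ X))).
have ee : e \oc e = e.
  rewrite /e; move: (h) hh hdh => g gg gdg.
  have dgdg : d \oc g \oc d \oc g = d \oc g by rewrite -!acompA (acompA g) gdg.
  by rewrite acompDl !acompDr !acompA (acl gg) (acl dd) dgdg gdg !acompE.
have f1 : (aid _ - e) \oc (aid _ - e) = aid _ - e.
  by rewrite acompBl !acompBr !acomp1l !acomp1r ee subrr subr0.
have ed : d \oc e = e \oc d.
  by rewrite /e acompDl acompDr !acompA dd -[h \oc d \oc d]acompA dd !acompE.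
have fd : d \oc (aid _ - e) = (aid _ - e) \oc d.
  by rewrite acompBr acompBl ed acomp1r acomp1l.
have g1 : aid _ - e = (aid _ - e) \oc (ij a \oc pj a + (ij b \oc pj b + si s \oc sp s))
    \oc (aid _ - e) by rewrite q1 acomp1r f1.
(* The idempotent [aid _ - e] kills the cells [a] and [b], on the respective side, so [r] and [t]
   identify its image with the sum of the remaining cells. *)
pose r := sp s \oc (aid _ - e); pose t := (aid _ - e) \oc si s.
have tr : t \oc r = aid _ - e.
  rewrite [RHS]g1 /t /r; move: (aid _ - e) eb ae => F Fb aF.
  rewrite !acompDr !acompDl !acompA Fb !acomp0l add0r.
  by rewrite -(acompA _ (pj a) F) aF acomp0r add0r.
have rt : r \oc t = aid _.
  rewrite /r /t -acompA (acompA (aid _ - e)) f1 acompBl acompBr acomp1l spi /e.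
  move: (h) hi ph => g gi pg.
  by rewrite acompDl -(acompA d) gi acomp0r add0r !acompA pg !acomp0l subr0.
have dr : hdeg (tpi X) (sgr s) 0 r by exact: (hdeg_comp (sp_deg s) dge).
have dt : hdeg (sgr s) (tpi X) 0 t by exact: (hdeg_comp dge (si_deg s)).
have dd' : hdeg (sgr s) (sgr s) 1 (r \oc d \oc t).
  exact: (hdeg_comp (hdeg_comp dr (@tdeg _ _ _ X)) dt).
have rf : r \oc (aid _ - e) = r by rewrite /r -acompA f1.
have ft : (aid _ - e) \oc t = t by rewrite /t acompA f1.
clearbody r t.
have dd2 : r \oc d \oc t \oc (r \oc d \oc t) = 0.
  by rewrite !acompA -(acompA _ t) tr -(acompA r) fd !acompA rf -(acompA r) dd acomp0r acomp0l.
pose X' := @Tw _ _ E (ss s) (sgr s) (r \oc d \oc t) (cells_honest s) dd' dd2.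
have cr : @chain _ _ _ X X' r.
  by split=> //=; rewrite -(acompA _ t) tr -acompA fd acompA rf.
have ct : @chain _ _ _ X' X t.
  by split=> //=; rewrite !acompA tr -fd -acompA ft.
exists P, X', (@scell _ _ _ _ _ _ _ _ _ _ _ s), (@spr _ _ _ _ _ _ _ _ _ _ _ s).
split; [by rewrite /P eqxx|exact: ssb|exact: sgrE|].
exists (kcl ct); apply/aisoP; exists (kcl cr); rewrite !kclM; split.
  exact: kcl_eq1.
apply/kcl_eq; exists (- h); split; first exact: hdegN.
by rewrite tr /e acompNr acompNl addrAC subrr add0r opprD.
Qed.

(** [blk i] is the index of the homogeneous piece to which the cell [i] belongs. Once only entries
    from [E1] to [E2] are left, each of them raises the degree by one and therefore stays inside a
    block; the block of [a] and its complement are subcomplexes. *)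
Lemma split_block (a : I) :
  (forall i j, pj i \oc d \oc ij j <> 0 -> l j = false /\ l i = true) ->
  exists (x : shkron E) (P : pred I) (R : tw)
    (ij' : forall i : {i | P i}, ahom (E (l (val i))) (tcar R))
    (pj' : forall i : {i | P i}, ahom (tcar R) (E (l (val i)))),
  [/\ ~~ P a, biproduct ij' pj',
    forall n, tpi R n = \sum_(i | k (val i) == n) (ij' i \oc pj' i)
    & exists f : ahom (oplus (ho x : HK) R) X, aiso f].
Proof.
move=> mini; pose blk i := if l i then - k i else - k i - 1.
have nblk i j : blk i != blk j -> pj i \oc d \oc ij j = 0.
  move=> ne; apply: contrapT => z; have [lj li] := mini _ _ z.
  apply: z; apply: (entry_deg bip pE (@tdeg _ _ _ X)); apply: contra ne => /eqP.
  by rewrite /blk lj li => ->; apply/eqP; lia.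
have nl i j : ~~ (l i && ~~ l j) -> pj i \oc d \oc ij j = 0.
  by move=> ne; apply: contrapT => /mini[lj li]; rewrite lj li in ne.
pose P1 i := (blk i == blk a) && ~~ l i; pose P2 i := (blk i == blk a) && l i.
pose P3 i := blk i != blk a.
have [[s1 _] [s2 _] [s3 _]] := And3 (subsum_ex bip pE P1) (subsum_ex bip pE P2)
  (subsum_ex bip pE P3).
have [h1 h2 h3] := bip.
have ort (P Q : pred I) (s : subsum (tpi X) k ij pj P) (t : subsum (tpi X) k ij pj Q) :
    (forall i, P i -> Q i -> False) -> sp s \oc si t = 0.
  move=> pq; rewrite -[sp s]acomp1r; apply: sub_zero => i j Pi Qj.
  by rewrite acomp1r h2 //; apply/eqP => e; apply: (pq i) => //; rewrite e.
have q1 : si s1 \oc sp s1 + si s2 \oc sp s2 + si s3 \oc sp s3 = aid _.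
  rewrite !sip -h3 [RHS](bigID (fun i => blk i == blk a)) /=; congr (_ + _).
  by rewrite [RHS](bigID l) /= addrC.
have zz_ (P Q : pred I) (s : subsum (tpi X) k ij pj P) (t : subsum (tpi X) k ij pj Q) :
    (forall i j, P i -> Q j -> blk i != blk j \/ ~~ (l i && ~~ l j)) ->
    sp s \oc d \oc si t = 0.
  by move=> h; apply: sub_zero => i j Pi Qj; case: (h i j Pi Qj); [exact: nblk|exact: nl].
have z11 : sp s1 \oc d \oc si s1 = 0.
  by apply: zz_ => i j /andP[_ /negPf li] _; right; rewrite li.
have z12 : sp s1 \oc d \oc si s2 = 0.
  by apply: zz_ => i j /andP[_ /negPf li] _; right; rewrite li.
have z22 : sp s2 \oc d \oc si s2 = 0.
  by apply: zz_ => i j _ /andP[_ li]; right; rewrite li andbF.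
have z13 : sp s1 \oc d \oc si s3 = 0.
  by apply: zz_ => i j /andP[/eqP bi _] bj; left; rewrite bi eq_sym.
have z23 : sp s2 \oc d \oc si s3 = 0.
  by apply: zz_ => i j /andP[/eqP bi _] bj; left; rewrite bi eq_sym.
have z31 : sp s3 \oc d \oc si s1 = 0.
  by apply: zz_ => i j bi /andP[/eqP bj _]; left; rewrite bj.
have z32 : sp s3 \oc d \oc si s2 = 0.
  by apply: zz_ => i j bi /andP[/eqP bj _]; left; rewrite bj.
have o12 : sp s1 \oc si s2 = 0.
  by apply: ort => i /andP[_ /negPf li] /andP[_]; rewrite li.
have o21 : sp s2 \oc si s1 = 0.
  by apply: ort => i /andP[_ li] /andP[_]; rewrite li.
have o13 : sp s1 \oc si s3 = 0 by apply: ort => i /andP[bi _] /negP.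
have o31 : sp s3 \oc si s1 = 0 by apply: ort => i /negP bi /andP[/bi].
have o23 : sp s2 \oc si s3 = 0 by apply: ort => i /andP[bi _] /negP.
have o32 : sp s3 \oc si s2 = 0 by apply: ort => i /negP bi /andP[/bi].
have d1 : d \oc si s1 = si s2 \oc (sp s2 \oc d \oc si s1).
  rewrite -[LHS]acomp1l -q1 !acompDl -!(acompA (si _)) !(acompA (sp _)) z11 z31.
  by rewrite !acomp0r add0r addr0.
have d2 : d \oc si s2 = 0.
  rewrite -[LHS]acomp1l -q1 !acompDl -!(acompA (si _)) !(acompA (sp _)) z12 z22 z32.
  by rewrite !acomp0r !addr0.
have d3 : d \oc si s3 = si s3 \oc (sp s3 \oc d \oc si s3).
  rewrite -[LHS]acomp1l -q1 !acompDl -!(acompA (si _)) !(acompA (sp _)) z13 z23.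
  by rewrite !acomp0r !add0r.
have p1 : sp s1 \oc d = 0.
  by rewrite -[LHS]acomp1r -q1 !acompDr !acompA z11 z12 z13 !acomp0l !addr0.
have p2 : sp s2 \oc d = sp s2 \oc d \oc si s1 \oc sp s1.
  by rewrite -[LHS]acomp1r -q1 !acompDr !acompA z22 z23 !acomp0l !addr0.
have p3 : sp s3 \oc d = sp s3 \oc d \oc si s3 \oc sp s3.
  by rewrite -[LHS]acomp1r -q1 !acompDr !acompA z31 z32 !acomp0l !add0r.
have a1 : addE E false (ss s1).
  by apply: (addE_cells (ssb s1)) => -[i /= /andP[_ /negPf]].
have a2 : addE E true (ss s2) by apply: (addE_cells (ssb s2)) => -[i /= /andP[_]].
pose x := ShKron (blk a) (Kron a1 a2 (sp s2 \oc d \oc si s1)).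
have dd3 : sp s3 \oc d \oc si s3 \oc (sp s3 \oc d \oc si s3) = 0.
  by rewrite !acompA -p3 -(acompA _ d d) tdd acomp0r acomp0l.
have dg3 : hdeg (sgr s3) (sgr s3) 1 (sp s3 \oc d \oc si s3).
  exact: (hdeg_comp (hdeg_comp (sp_deg s3) (@tdeg _ _ _ X)) (si_deg s3)).
pose R := @Tw _ _ E (ss s3) (sgr s3) _ (cells_honest s3) dg3 dd3.
have g1 n : sgr s1 n = conc (ss s1) (- blk a - 1) n.
  rewrite sgrE /conc; case: (eqVneq n) => [->|ne]; last first.
    apply: big_pred0 => -[i /= Pi]; apply: contraNF ne => /eqP <-.
    by have /andP[/eqP <- /negPf li] := Pi; rewrite /blk li; apply/eqP; lia.
  have [_ _ <-] := ssb s1; apply: eq_bigl => -[i /= Pi].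
  by have /andP[/eqP <- /negPf li] := Pi; rewrite /blk li; apply/eqP; lia.
have g2 n : sgr s2 n = conc (ss s2) (- blk a) n.
  rewrite sgrE /conc; case: (eqVneq n) => [->|ne]; last first.
    apply: big_pred0 => -[i /= Pi]; apply: contraNF ne => /eqP <-.
    by have /andP[/eqP <- li] := Pi; rewrite /blk li; apply/eqP; lia.
  have [_ _ <-] := ssb s2; apply: eq_bigl => -[i /= Pi].
  by have /andP[/eqP <- li] := Pi; rewrite /blk li; apply/eqP; lia.
have i1 : hdeg (conc (ss s1) (- blk a - 1)) (tpi X) 0 (si s1).
  by move=> n; rewrite -g1; exact: si_deg.
have i2 : hdeg (conc (ss s2) (- blk a)) (tpi X) 0 (si s2).
  by move=> n; rewrite -g2; exact: si_deg.
have r1 : hdeg (tpi X) (conc (ss s1) (- blk a - 1)) 0 (sp s1).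
  by move=> n; rewrite -g1; exact: sp_deg.
have r2 : hdeg (tpi X) (conc (ss s2) (- blk a)) 0 (sp s2).
  by move=> n; rewrite -g2; exact: sp_deg.
exists x, P3, R, (@scell _ _ _ _ _ _ _ _ _ _ _ s3), (@spr _ _ _ _ _ _ _ _ _ _ _ s3).
split; [by rewrite /P3 eqxx|exact: ssb|exact: sgrE|].
exact: (block_iso (x := x) (R := R) i1 i2 (si_deg s3) r1 r2 (sp_deg s3) d1 d2 d3 p1 p2 p3
  (spi s1) (spi s2) (spi s3) o12 o21 o13 o31 o23 o32 q1).
Qed.

End Cells.

(** Induction on the number of cells. A nonzero entry that does not go from [E1] to [E2] is an
    endomorphism of a cell, hence invertible and can be cancelled; if there is none, the block of
    any cell splits off. *)
Theorem hspan_tw (X : tw) : hspan (fun=> True) (X : HK).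
Proof.
have [I [l [k [ij [pj [b pE]]]]]] := thon X.
have [n] := ubnP #|I|; elim: n => // n IH in X I l k ij pj b pE * => /ltnSE cI.
have less (P : pred I) a : ~~ P a -> (#|{: {i | P i}}| < n)%N.
  move=> Pa; rewrite card_sig; apply: leq_trans cI.
  apply: proper_card; apply/properP; split; first exact/subsetP.
  by exists a; rewrite !inE.
have [|mini] := pselect (exists i j, pj i \oc tdf X \oc ij j <> 0 /\
    ~ (l j = false /\ l i = true)).
  move=> [i [j [ne nl]]].
  have ai : aiso (pj i \oc tdf X \oc ij j).
    move: (pj i \oc tdf X \oc ij j) ne nl.
    case: (l i) (l j) => -[] f ne nl; first by case: (E_end f).
    - by case: nl.
    - by case: ne; exact: E_21.
    by case: (E_end f).
  have [P [X' [ij' [pj' [Pi b' pE' [f fi]]]]]] := cancel_pair b pE ne ai.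
  by apply: (hspan_iso fi); apply: (IH X' _ _ _ _ _ b' pE'); exact: less Pi.
have [a _|I0] := pickP (fun i : I => true); last first.
  apply: (@hspan_iso _ azero _ 0); last exact: hspan_zero.
  have x0 : aid (tcar X) = 0 by have [_ _ <-] := b; apply: big_pred0 => i; have := I0 i.
  apply/aisoP; exists 0; split; rewrite acomp0l.
    by rewrite aid_azero.
  by rewrite -(kcl0 (chain0 _ _)); apply: kcl_eq1; rewrite x0.
have [|x [P [R [ij' [pj' [Pa b' pE' [f fi]]]]]]] := split_block b pE a.
  by move=> i j ne; apply: contrapT => nl; apply: mini; exists i, j.
apply: (hspan_iso fi); apply: hspan_plus; first exact: hspan_ho.
by apply: (IH R _ _ _ _ _ b' pE'); exact: less Pa.
Qed.

End Minimal.

Section Entries.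
Variables (A : additive_category) (I J : finType) (X : I -> A) (Y : J -> A) (S S' : A)
  (ij : forall i, ahom (X i) S) (pj : forall i, ahom S (X i))
  (ij' : forall i, ahom (Y i) S') (pj' : forall i, ahom S' (Y i)).
Hypotheses (b : biproduct ij pj) (b' : biproduct ij' pj').

Lemma bip_in (Z : A) (f g : ahom S Z) : (forall j, f \oc ij j = g \oc ij j) -> f = g.
Proof.
move=> e; rewrite -[f]acomp1r -[g]acomp1r; have [_ _ <-] := b.
by rewrite !acomp_sumr; apply: eq_bigr => i _; rewrite !acompA e.
Qed.

Lemma bip_out (Z : A) (f g : ahom Z S') : (forall j, pj' j \oc f = pj' j \oc g) -> f = g.
Proof.
move=> e; rewrite -[f]acomp1l -[g]acomp1l; have [_ _ <-] := b'.
by rewrite !acomp_suml; apply: eq_bigr => i _; rewrite -!acompA e.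
Qed.

Lemma bip_sum_in (Z : A) (f : forall i, ahom (X i) Z) j :
  (\sum_i (f i \oc pj i)) \oc ij j = f j.
Proof.
have [h1 h2 h3] := b; rewrite acomp_suml (bigD1 j) //= big1 ?addr0 => [|i ne].
  by rewrite -acompA h1 acomp1r.
by rewrite -acompA h2 ?acomp0r.
Qed.

Lemma bip_sum_out (Z : A) (f : forall i, ahom Z (Y i)) j :
  pj' j \oc (\sum_i (ij' i \oc f i)) = f j.
Proof.
have [h1 h2 h3] := b'; rewrite acomp_sumr (bigD1 j) //= big1 ?addr0 => [|i ne].
  by rewrite acompA h1 acomp1l.
by rewrite acompA h2 ?acomp0l // eq_sym.
Qed.

Lemma bip_mat (a : forall i j, ahom (X i) (Y j)) i j :
  pj' j \oc (\sum_k (ij' k \oc (\sum_l (a l k \oc pj l)))) \oc ij i = a i j.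
Proof. by rewrite bip_sum_out bip_sum_in. Qed.
End Entries.

(** * The functor on all twisted complexes *)

Section Functor.
Variables (K : fieldType) (T : linear_triangulated_category K) (E : bool -> T).
Hypothesis E_neq : forall (a b : bool) (n : int) (f : ahom (E a) (shiftz n (E b))),
  n != 0 -> f = 0.
Hypothesis E_21 : forall f : ahom (E true) (E false), f = 0.
Hypothesis E_end : forall (a : bool) (f : ahom (E a) (E a)), f = 0 \/ aiso f.

Local Notation tw := (tw E).
Local Notation HK := (kt_add E).
Local Notation thom X Y := (ahom (tcar X) (tcar Y)).

Lemma hspan_bip P (X : HK) : hspan P X -> exists (J : finType) (x : J -> shkron E)
  (ij : forall j, ahom (ho (x j) : HK) X) (pj : forall j, ahom X (ho (x j) : HK)),
  biproduct ij pj.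
Proof.
elim=> {X} [|x _|X Y _ [J [x [ij [pj b]]]] _ [J' [x' [ij' [pj' b']]]]|X Y f fi _ [J [x [ij [pj b]]]]].
- exists void, (fun j : void => match j with end), (fun j : void => match j with end),
    (fun j : void => match j with end); split=> [[]|[]|].
  by rewrite aid_azero; apply: big_pred0 => -[].
- exists unit, (fun=> x), (fun=> aid _), (fun=> aid _); split=> [i|[] []|] //.
    exact: acomp1l.
  rewrite (bigD1 tt) //= big1 ?addr0 => [|[]] //; exact: (@acomp1l HK).
- exists (J + J')%type, (fun j => match j with inl j => x j | inr j => x' j end).
  do 2!eexists; exact: (@biproduct_sum HK J J' (fun k => ho match k with inl j => x j
    | inr j => x' j end : HK) X Y ij pj ij' pj' b b').
- have [ij' [pj' b']] := biproduct_iso b fi.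
  by exists J, x, ij', pj'.
Qed.

(** A splitting of [X] into homogeneous pieces together with a sum in [T] of the corresponding
    cones. It is chosen once for every [X]; on maps the functor is the matrix of the values of [tau]
    on the entries. *)
Record decomp (X : HK) := Decomp {
  dJ : finType;
  dx : dJ -> shkron E;
  di : forall j, ahom (ho (dx j) : HK) X;
  dp : forall j, ahom X (ho (dx j) : HK);
  db : biproduct di dp;
  dS : T;
  ei : forall j, ahom (cob (dx j)) dS;
  ep : forall j, ahom dS (cob (dx j));
  eb : biproduct ei ep
}.

Lemma decomp_ex (X : HK) : exists d : decomp X, True.
Proof.
have [J [x [ij [pj b]]]] := hspan_bip (hspan_tw E_end E_21 X).
have [S [ij' [pj' b']]] := biproduct_ex (fun j => cob (x j)).
by exists (Decomp b b').
Qed.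

Definition dec X : decomp X := sval (cid (decomp_ex X)).
Local Notation F_ X := (dS (dec X)).
Local Notation i_ X := (@di _ (dec X)).
Local Notation p_ X := (@dp _ (dec X)).
Local Notation I_ X := (@ei _ (dec X)).
Local Notation P_ X := (@ep _ (dec X)).
Local Notation tauD := (tauD E_neq E_21).
Local Notation tau0 := (tau0 E_neq E_21).
Local Notation tau_comp := (tau_comp E_neq E_21).

Definition Fm (X Y : HK) (f : ahom X Y) : ahom (F_ X) (F_ Y) :=
  \sum_k (I_ Y k \oc (\sum_l (tau (p_ Y k \oc f \oc i_ X l) \oc P_ X l))).

Lemma FmE (X Y : HK) (f : ahom X Y) k l :
  P_ Y k \oc Fm f \oc I_ X l = tau (p_ Y k \oc f \oc i_ X l).
Proof. exact: (bip_mat (eb (dec X)) (eb (dec Y)) (fun l k => tau (p_ Y k \oc f \oc i_ X l))). Qed.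

Lemma F_ext (X Y : HK) (f g : ahom (F_ X) (F_ Y)) :
  (forall k l, P_ Y k \oc f \oc I_ X l = P_ Y k \oc g \oc I_ X l) -> f = g.
Proof.
move=> e; apply: (bip_in (eb (dec X))) => l; apply: (bip_out (eb (dec Y))) => k.
by rewrite !acompA e.
Qed.

Lemma tau_sum (I : finType) (x y : shkron E) (a : I -> ahom (ho x : HK) (ho y : HK)) :
  tau (\sum_i a i) = \sum_i tau (a i).
Proof. by elim/big_rec2: _ => [|i y' x' _ <-]; [exact: tau0 | exact: tauD]. Qed.

Lemma Fm_id X : Fm (aid X) = aid (F_ X).
Proof.
apply: F_ext => k l; rewrite FmE !acomp1r.
have [[h1 h2 _] [k1 k2 _]] := conj (db (dec X)) (eb (dec X)).
have [->|ne] := eqVneq k l; first by rewrite h1 k1 (tau_id E_neq E_21).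
by rewrite h2 // k2 // tau0.
Qed.

Lemma Fm_comp X Y Z (g : ahom Y Z) (f : ahom X Y) : Fm (g \oc f) = Fm g \oc Fm f.
Proof.
apply: F_ext => k l; rewrite FmE.
rewrite -[Fm g]acomp1r; have [_ _ <-] := eb (dec Y).
rewrite !(acomp_sumr, acomp_suml).
transitivity (\sum_j tau (p_ Z k \oc g \oc i_ Y j \oc (p_ Y j \oc f \oc i_ X l))).
  rewrite -tau_sum; congr tau; rewrite -[g in LHS]acomp1r; have [_ _ <-] := db (dec Y).
  rewrite !(acomp_sumr, acomp_suml); apply: eq_bigr => j _; rewrite !acompA //.
by apply: eq_bigr => j _; rewrite tau_comp -!FmE !acompA.
Qed.

Lemma FmD X Y (f g : ahom X Y) : Fm (f + g) = Fm f + Fm g.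
Proof.
by apply: F_ext => k l; rewrite FmE !acompDr !acompDl !FmE tauD.
Qed.
Lemma Fm0 X Y : Fm (0 : ahom X Y) = 0.
Proof. by apply: (addIr (Fm 0)); rewrite -FmD !add0r. Qed.

Lemma Fm_sum (I : finType) X Y (f : I -> ahom X Y) : Fm (\sum_i f i) = \sum_i Fm (f i).
Proof. by elim/big_rec2: _ => [|i y' x' _ <-]; [exact: Fm0 | exact: FmD]. Qed.

Lemma Fm_inj X Y (f g : ahom X Y) : Fm f = Fm g -> f = g.
Proof.
move=> e; apply: (bip_in (db (dec X))) => l; apply: (bip_out (db (dec Y))) => k.
rewrite !acompA; apply: (tau_inj E_neq E_21); by rewrite -!FmE e.
Qed.

Lemma Fm_full X Y (h : ahom (F_ X) (F_ Y)) : exists f, Fm f = h.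
Proof.
pose a l k := sval (cid (tau_surj E_neq E_21 (P_ Y k \oc h \oc I_ X l))).
exists (\sum_k (i_ Y k \oc (\sum_l (a l k \oc p_ X l)))).
apply: F_ext => k l; rewrite FmE (bip_mat (db (dec X)) (db (dec Y)) a) /a.
by case: cid.
Qed.

Definition Ff : functor (add_cat HK) (add_cat T) :=
  @Functor (add_cat HK) (add_cat T) (fun X => F_ X) (fun X Y f => Fm f)
    (fun X Y f g e => congr1 _ e) Fm_id (fun X Y Z g f => Fm_comp g f).

Lemma Fm_iso X Y (f : ahom X Y) : aiso f -> aiso (Fm f).
Proof.
move=> /aisoP[g [gf fg]]; apply/aisoP; exists (Fm g).
by rewrite -!Fm_comp gf fg !Fm_id.
Qed.

(** The chosen splitting of [ho x] need not be the one with a single piece, so the value at [ho x]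
    is only isomorphic to [cob x]. *)
Definition Fal (x : shkron E) : ahom (F_ (ho x)) (cob x) :=
  \sum_j (tau (i_ (ho x) j) \oc P_ (ho x) j).

Lemma Fal_iso x : aiso (Fal x).
Proof.
apply/aisoP; exists (\sum_j (I_ (ho x) j \oc tau (p_ (ho x) j))).
have [[h1 h2 h3] [k1 k2 k3]] := conj (db (dec (ho x))) (eb (dec (ho x))).
split.
  apply: F_ext => k l; rewrite acompA (bip_sum_out (eb (dec (ho x)))) -acompA.
  rewrite (bip_sum_in (eb (dec (ho x)))) -tau_comp acomp1r.
  have [->|ne] := eqVneq k l; first by rewrite h1 k1 (tau_id E_neq E_21).
  by rewrite h2 // k2 // tau0.
rewrite acomp_suml.
under eq_bigr => j _ do rewrite -acompA (bip_sum_out (eb (dec (ho x)))) -tau_comp.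
by rewrite -tau_sum h3 (tau_id E_neq E_21).
Qed.

Lemma Fal_nat x y (a : ahom (ho x : HK) (ho y : HK)) :
  Fal y \oc Fm a = tau a \oc Fal x.
Proof.
apply: (bip_in (eb (dec (ho x)))) => l; rewrite -!acompA (bip_sum_in (eb (dec (ho x)))).
rewrite /Fal acomp_suml -tau_comp.
transitivity (tau (\sum_j i_ (ho y) j \oc (p_ (ho y) j \oc a \oc i_ (ho x) l))); last first.
  congr tau; have [_ _ h] := db (dec (ho y)); rewrite -[RHS]acomp1l -h acomp_suml.
  by apply: eq_bigr => j _; rewrite !acompA.
rewrite tau_sum; apply: eq_bigr => j _; rewrite tau_comp -FmE !acompA //.
Qed.

Lemma eta0_ex x : exists h : ahom (F_ (tsh 1 (ho x))) (shift (F_ (ho x))),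
  aiso h /\ ceta x \oc sh (Fal x) \oc h = Fal (xs x) \oc Fm (heta x).
Proof.
have ci : aiso (ceta x \oc sh (Fal x)).
  by apply: aiso_comp; [exact: ceta_iso|exact: sh_iso (Fal_iso x)].
have [s [s1 s2]] := (aisoP _).1 ci.
exists (s \oc (Fal (xs x) \oc Fm (heta x))); split; last by rewrite acompA s2 acomp1l.
apply: aiso_comp; first by apply/aisoP; exists (ceta x \oc sh (Fal x)).
by apply: aiso_comp; [exact: Fal_iso|apply: Fm_iso; exact: heta_iso].
Qed.

Definition eta0 x := sval (cid (eta0_ex x)).
Lemma eta0_iso x : aiso (eta0 x). Proof. by rewrite /eta0; case: cid => h []. Qed.
Lemma eta0E x : ceta x \oc sh (Fal x) \oc eta0 x = Fal (xs x) \oc Fm (heta x).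
Proof. by rewrite /eta0; case: cid => h []. Qed.

Lemma eta0_nat x y (a : ahom (ho x : HK) (ho y : HK)) :
  eta0 y \oc Fm (ksh 1 a) = sh (Fm a) \oc eta0 x.
Proof.
have ci : aiso (ceta y \oc sh (Fal y)).
  by apply: aiso_comp; [exact: ceta_iso|exact: sh_iso (Fal_iso y)].
apply: (aiso_mono ci); rewrite !acompA eta0E -(acompA _ _ (sh (Fm a))) -sh_comp.
have [s [s1 s2]] := (aisoP _).1 (heta_iso x).
pose b := heta y \oc ksh 1 a \oc s.
have bE : b \oc heta x = heta y \oc ksh 1 a by rewrite /b -acompA s1 acomp1r.
rewrite -acompA -Fm_comp -bE Fm_comp acompA Fal_nat -acompA -eta0E !acompA.
by rewrite (tau_shift E_neq E_21 bE) -!acompA Fal_nat sh_comp !acompA.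
Qed.

(** The comparison of shifts is known on pieces as [eta0] and is extended along the splitting;
    naturality of [eta0] gives it back on [ho x]. *)
Definition Feta (X : HK) : ahom (F_ (tsh 1 X)) (shift (F_ X)) :=
  \sum_j (sh (Fm (i_ X j)) \oc eta0 _ \oc Fm (ksh 1 (p_ X j))).

Lemma sh_sum (I : finType) (X Y : T) (f : I -> ahom X Y) : sh (\sum_i f i) = \sum_i sh (f i).
Proof. by elim/big_rec2: _ => [|i y' x' _ <-]; [exact: sh0 | exact: shD]. Qed.

Lemma ksh_sum k (I : finType) (X Y : HK) (f : I -> ahom X Y) :
  ksh k (\sum_i f i) = \sum_i ksh k (f i).
Proof.
elim/big_rec2: _ => [|i y' x' _ <-]; last exact: kshD.
by apply: (addIr (ksh k 0)); rewrite -kshD !add0r.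
Qed.

Lemma Feta_nat X Y (f : ahom X Y) : Feta Y \oc Fm (ksh 1 f) = sh (Fm f) \oc Feta X.
Proof.
transitivity (\sum_j \sum_k (sh (Fm (i_ Y j)) \oc eta0 _ \oc
    Fm (ksh 1 (p_ Y j \oc f \oc i_ X k)) \oc Fm (ksh 1 (p_ X k)))).
  rewrite /Feta acomp_suml; apply: eq_bigr => j _.
  rewrite -(acompA _ _ (Fm (ksh 1 f))) -Fm_comp -ksh_comp -{1}[p_ Y j \oc f]acomp1r.
  have [_ _ <-] := db (dec X).
  rewrite acomp_sumr ksh_sum Fm_sum acomp_sumr; apply: eq_bigr => k _.
  by rewrite -!acompA -Fm_comp -ksh_comp !acompA.
rewrite exchange_big /Feta acomp_sumr; apply: eq_bigr => k _.
under eq_bigr => j _ do rewrite -(acompA (sh _)) eta0_nat.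
rewrite -acomp_suml !acompA; congr (_ \oc _).
under eq_bigr => j _ do rewrite acompA -sh_comp -Fm_comp.
rewrite -acomp_suml; congr (_ \oc _); rewrite -sh_comp -Fm_comp -sh_sum -Fm_sum.
congr (sh (Fm _)); rewrite -[RHS]acomp1l; have [_ _ <-] := db (dec Y).
by rewrite acomp_suml; apply: eq_bigr => j _; rewrite !acompA.
Qed.

Lemma Feta_ho x : Feta (ho x) = eta0 x.
Proof.
rewrite /Feta; under eq_bigr => j _ do
  rewrite -eta0_nat -acompA -Fm_comp -ksh_comp.
have [_ _ h] := db (dec (ho x : HK)).
by rewrite -acomp_sumr -Fm_sum -ksh_sum h ksh_id Fm_id acomp1r.
Qed.

Lemma Feta_iso X : aiso (Feta X).
Proof.
pose s x := sval (cid ((aisoP _).1 (eta0_iso x))).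
have s1 x : s x \oc eta0 x = aid _ by rewrite /s; case: cid => g [].
have s2 x : eta0 x \oc s x = aid _ by rewrite /s; case: cid => g [].
have [h1 h2 h3] := db (dec X).
have k0 (V W : HK) : ksh 1 (0 : ahom V W) = 0.
  by apply: (addIr (ksh 1 0)); rewrite -kshD !add0r.
apply/aisoP; exists (\sum_j (Fm (ksh 1 (i_ X j)) \oc s _ \oc sh (Fm (p_ X j)))); split.
  transitivity (\sum_j Fm (ksh 1 (i_ X j)) \oc Fm (ksh 1 (p_ X j))).
    rewrite acomp_suml; apply: eq_bigr => j _; rewrite /Feta acomp_sumr (bigD1 j) //=.
    rewrite big1 => [|i ne]; last first.
      rewrite !acompA -(acompA _ (sh _) (sh _)) -sh_comp -Fm_comp h2 1?eq_sym // Fm0 sh0.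
      by rewrite acomp0r !acomp0l.
    rewrite addr0 !acompA -(acompA _ (sh _) (sh _)) -sh_comp -Fm_comp h1 Fm_id sh_id acomp1r.
    by rewrite -(acompA _ (s _)) s1 acomp1r.
  under eq_bigr => j _ do rewrite -Fm_comp -ksh_comp.
  by rewrite -Fm_sum -ksh_sum h3 ksh_id Fm_id.
transitivity (\sum_j sh (Fm (i_ X j)) \oc sh (Fm (p_ X j))).
  rewrite acomp_suml; apply: eq_bigr => j _; rewrite acomp_sumr (bigD1 j) //=.
  rewrite big1 => [|i ne]; last first.
    rewrite !acompA -(acompA _ (Fm _) (Fm _)) -Fm_comp -ksh_comp h2 1?eq_sym // k0 Fm0.
    by rewrite acomp0r !acomp0l.
  rewrite addr0 !acompA -(acompA _ (Fm _) (Fm _)) -Fm_comp -ksh_comp h1 ksh_id Fm_id acomp1r.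
  by rewrite -(acompA _ (eta0 _)) s2 acomp1r.
under eq_bigr => j _ do rewrite -sh_comp -Fm_comp.
by rewrite -sh_sum -Fm_sum h3 Fm_id sh_id.
Qed.

End Functor.

(** * Sums and splittings of triangles *)

Section Toolkit.
Variable T : triangulated_category.
Implicit Types X Y Z W : T.

Definition bip2 (A : additive_category) (X Y S : A) (i1 : ahom X S) (i2 : ahom Y S)
    (p1 : ahom S X) (p2 : ahom S Y) : Prop :=
  [/\ p1 \oc i1 = aid X, p2 \oc i2 = aid Y, p1 \oc i2 = 0, p2 \oc i1 = 0
    & i1 \oc p1 + i2 \oc p2 = aid S].

Lemma bip2_sym (A : additive_category) (X Y S : A) (i1 : ahom X S) (i2 : ahom Y S) p1 p2 :
  bip2 i1 i2 p1 p2 -> bip2 i2 i1 p2 p1.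
Proof. by move=> [h1 h2 h3 h4 h5]; split; rewrite // addrC. Qed.

(** Adding an identity summand [R] to [u] does not change the cone. A cone [C] of the enlarged map
    is compared with [Z] in both directions, and the two composites are invertible by the five
    lemma. *)
Lemma dist_sum1 X Y Z R XR YR (u : ahom X Y) (v : ahom Y Z) (w : ahom Z (shift X))
    (i1 : ahom X XR) (i2 : ahom R XR) p1 p2 (j1 : ahom Y YR) (j2 : ahom R YR) q1 q2 :
  bip2 i1 i2 p1 p2 -> bip2 j1 j2 q1 q2 -> dist u v w ->
  dist (j1 \oc u \oc p1 + j2 \oc p2) (v \oc q1) (sh i1 \oc w).
Proof.
move=> [a1 a2 a3 a4 a5] [b1 b2 b3 b4 b5] d; set U := _ + _.
have [C [m [n dU]]] := dist_complete U.
have Ui1 : U \oc i1 = j1 \oc u by rewrite /U acompDl -!acompA a1 a4 !(acomp0r, acomp1r) addr0.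
have Ui2 : U \oc i2 = j2 by rewrite /U acompDl -!acompA a2 a3 !(acomp0r, acomp1r) add0r.
have qU1 : q1 \oc U = u \oc p1.
  by rewrite /U acompDr !acompA b1 b3 acomp1l acomp0l addr0.
have qU2 : q2 \oc U = p2 by rewrite /U acompDr !acompA b2 b4 acomp1l !acomp0l add0r.
have [a [aE1 aE2]] := dist_mor (f := i1) (g := j1) d dU (esym Ui1).
have [c [cE1 cE2]] := dist_mor (f := p1) (g := q1) dU d qU1.
rewrite -!/(sh _) in aE2 cE2.
have ai : aiso a.
  apply: (aiso_lr (g := c) (h := c)).
    apply: (dist_five (f := aid _) (g := aid _) d d); rewrite ?acomp1r ?acomp1l //;
      try exact: aiso_id.
      by rewrite -acompA aE1 acompA cE1 -acompA b1 acomp1r.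
    by rewrite sh_id acomp1l acompA -cE2 -acompA -aE2 acompA -sh_comp a1 sh_id acomp1l.
  apply: (dist_five (f := aid _) (g := aid _) dU dU); rewrite ?acomp1r ?acomp1l //;
    try exact: aiso_id.
    rewrite -acompA cE1 acompA aE1 -acompA.
    have -> : j1 \oc q1 = aid _ - j2 \oc q2 by rewrite -b5 addrK.
    by rewrite acompBr acomp1r -Ui2 !acompA (dist_vu dU) !acomp0l subr0.
  rewrite sh_id acomp1l acompA -aE2 -acompA -cE2 acompA -sh_comp.
  have -> : i1 \oc p1 = aid _ - i2 \oc p2 by rewrite -a5 addrK.
  by rewrite shB sh_id acompBl acomp1l -qU2 !sh_comp -!acompA (dist_uw dU) !acomp0r subr0.
have [b [ba ab]] := (aisoP _).1 ai.
apply: (dist_iso (f := aid _) (g := aid _) (h := b) _ _ _ _ _ _ dU).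
- exact: aiso_id.
- exact: aiso_id.
- by apply/aisoP; exists a.
- by rewrite acomp1l acomp1r.
- apply: (aiso_mono ai); rewrite acomp1r !acompA ab acomp1l aE1 -acompA.
  have -> : j1 \oc q1 = aid _ - j2 \oc q2 by rewrite -b5 addrK.
  by rewrite acompBr acomp1r -Ui2 !acompA (dist_vu dU) !acomp0l subr0.
rewrite -/(sh (aid _)) sh_id acomp1l aE2 -acompA ab acomp1r //.
Qed.

(** The zero connecting map makes [f] a monomorphism and lifts the identity of [Z] along [g]. *)
Lemma split_dist X Y Z (f : ahom X Y) (g : ahom Y Z) : dist f g 0 ->
  exists r s, bip2 f s r g.
Proof.
move=> d; have [|s sE] := dist_wker (f := aid Z) (dist_rotl d); first exact: acomp0l.
have mono (W : T) (x : ahom W X) : f \oc x = 0 -> x = 0.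
  move=> e; have [|t tE] := dist_wker (f := sh x) (dist_rotl (dist_rotl d)).
    by rewrite acompNl -sh_comp e sh0 oppr0.
  by apply: sh_inj; rewrite sh0 tE acomp0l.
have gf := dist_vu d.
have [|r rE] := dist_wker (f := aid Y - s \oc g) d.
  by rewrite acompBr acomp1r acompA -sE acomp1l subrr.
exists r, s; split=> //.
- apply/eqP; rewrite -subr_eq0; apply/eqP; apply: mono.
  by rewrite acompBr acompA -rE acompBl -acompA gf acomp0r acomp1l acomp1r subr0 subrr.
- by apply: mono; rewrite acompA -rE acompBl -acompA -sE acomp1l acomp1r subrr.
by rewrite -rE subrK.
Qed.

Lemma dist_cocomplete Y Z (v : ahom Y Z) : exists X (u : ahom X Y) (w : ahom Z (shift X)),
  dist u v w.
Proof.
have [C [a [b d]]] := dist_complete v.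
have [k [k1 k2]] := (aisoP _).1 (unshiftK_iso C).
have [u0 u0E] := sh_full (b \oc unshiftK C).
exists (unshift C), (- u0), (k \oc a); apply/dist_rot; rewrite -/(sh _) shN opprK u0E.
apply: (dist_iso (f := aid _) (g := aid _) (h := k) _ _ _ _ _ _ d).
- exact: aiso_id.
- exact: aiso_id.
- by apply/aisoP; exists (unshiftK C).
- by rewrite acomp1l acomp1r.
- by rewrite acomp1r.
by rewrite -/(sh (aid _)) sh_id acomp1l -acompA k2 acomp1r.
Qed.

Lemma dist_unshift X Y Z (u : ahom X Y) (v : ahom Y Z) (w : ahom Z (shift X)) :
  dist (sh u) (sh v) (- sh w) -> dist u v w.
Proof.
move=> d; do 3![apply/dist_rot]; rewrite -!/(sh _).
apply: (dist_iso (f := aid _) (g := - aid _) (h := aid _) _ _ _ _ _ _ d).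
- exact: aiso_id.
- exact: aisoN (aiso_id _).
- exact: aiso_id.
- by rewrite acompNl acomp1l acomp1r.
- by rewrite acompNr acompNl opprK acomp1l acomp1r.
by rewrite -/(sh (aid _)) sh_id acomp1l acomp1r.
Qed.

Lemma dist_precomp X Y Z X' (u : ahom X Y) (v : ahom Y Z) (w : ahom Z (shift X))
    (c : ahom X' X) (c' : ahom X X') : c' \oc c = aid _ -> c \oc c' = aid _ ->
  dist u v w -> dist (u \oc c) v (sh c' \oc w).
Proof.
move=> c1 c2 d.
apply: (dist_iso (f := c') (g := aid _) (h := aid _) _ _ _ _ _ _ d).
- by apply/aisoP; exists c.
- exact: aiso_id.
- exact: aiso_id.
- by rewrite acomp1l -acompA c2 acomp1r.
- by rewrite acomp1l acomp1r.
by rewrite acomp1r.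
Qed.
End Toolkit.

(** * Maps whose triangles are preserved by a functor *)

Section Good.
Variables (S T : triangulated_category) (F : S -> T)
  (Fm : forall X Y : S, ahom X Y -> ahom (F X) (F Y))
  (eta : forall X, ahom (F (shift X)) (shift (F X))).
Hypotheses (Fm_id : forall X, Fm (aid X) = aid (F X))
  (Fm_comp : forall X Y Z (g : ahom Y Z) (f : ahom X Y), Fm (g \oc f) = Fm g \oc Fm f)
  (FmD : forall X Y (f g : ahom X Y), Fm (f + g) = Fm f + Fm g)
  (Fm_full : forall X Y (h : ahom (F X) (F Y)), exists f, Fm f = h)
  (eta_iso : forall X, aiso (eta X))
  (eta_nat : forall X Y (f : ahom X Y), eta Y \oc Fm (sh f) = sh (Fm f) \oc eta X).
Implicit Types X Y Z : S.

Lemma gFm0 X Y : Fm (0 : ahom X Y) = 0.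
Proof. by apply: (addIr (Fm 0)); rewrite -FmD !add0r. Qed.
Lemma gFmN X Y (f : ahom X Y) : Fm (- f) = - Fm f.
Proof. by apply: (addIr (Fm f)); rewrite -FmD !addNr gFm0. Qed.
Lemma gFm_iso X Y (f : ahom X Y) : aiso f -> aiso (Fm f).
Proof.
move=> /aisoP[g [gf fg]]; apply/aisoP; exists (Fm g).
by rewrite -!Fm_comp gf fg !Fm_id.
Qed.

Definition Fdist X Y Z (u : ahom X Y) (v : ahom Y Z) (w : ahom Z (shift X)) : Prop :=
  dist (Fm u) (Fm v) (eta X \oc Fm w).

(** Quantified over all triangles on [u]; as these are isomorphic, one of them suffices by
    [good_ex]. By [good_rot] the property may be tested on any map of the triangle. *)
Definition good X Y (u : ahom X Y) : Prop :=
  forall Z (v : ahom Y Z) (w : ahom Z (shift X)), dist u v w -> Fdist u v w.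

Lemma Fdist_iso X Y Z X' Y' Z' (u : ahom X Y) (v : ahom Y Z) (w : ahom Z (shift X))
    (u' : ahom X' Y') (v' : ahom Y' Z') (w' : ahom Z' (shift X'))
    (f : ahom X X') (g : ahom Y Y') (h : ahom Z Z') :
  aiso f -> aiso g -> aiso h -> g \oc u = u' \oc f -> h \oc v = v' \oc g ->
  sh f \oc w = w' \oc h -> Fdist u v w -> Fdist u' v' w'.
Proof.
move=> fi gi hi e1 e2 e3.
apply: (dist_iso (f := Fm f) (g := Fm g) (h := Fm h)); try exact: gFm_iso.
- by rewrite -!Fm_comp e1.
- by rewrite -!Fm_comp e2.
by rewrite -/(sh _) acompA -eta_nat -!acompA -!Fm_comp e3.
Qed.

Lemma good_iso X Y X' Y' (u : ahom X Y) (u' : ahom X' Y') (f : ahom X X') (g : ahom Y Y') :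
  aiso f -> aiso g -> g \oc u = u' \oc f -> good u -> good u'.
Proof.
move=> fi gi e gu Z' v' w' d'; have [Z [v [w d]]] := dist_complete u.
have [h [hi h1 h2]] := dist_mor_iso d d' fi gi e.
exact: Fdist_iso fi gi hi e h1 h2 (gu _ _ _ d).
Qed.

Lemma good_ex X Y Z (u : ahom X Y) (v : ahom Y Z) (w : ahom Z (shift X)) :
  dist u v w -> Fdist u v w -> good u.
Proof.
move=> d fd Z' v' w' d'; have [h [hi h1 h2]] := cone_uniq d d'.
apply: (Fdist_iso (aiso_id _) (aiso_id _) hi _ _ _ fd).
- by rewrite acomp1l acomp1r.
- by rewrite acomp1r.
by rewrite sh_id acomp1l.
Qed.

Lemma Fdist_rot X Y Z (u : ahom X Y) (v : ahom Y Z) (w : ahom Z (shift X)) :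
  Fdist u v w <-> Fdist v w (- sh u).
Proof.
have [e [e1 e2]] := (aisoP _).1 (eta_iso X).
split=> [d|d].
  apply: (dist_iso (f := aid _) (g := aid _) (h := e) _ _ _ _ _ _ (dist_rotl d)).
  - exact: aiso_id.
  - exact: aiso_id.
  - by apply/aisoP; exists (eta X).
  - by rewrite acomp1l acomp1r.
  - by rewrite acomp1r acompA e1 acomp1l.
  rewrite -/(sh (aid _)) sh_id acomp1l gFmN acompNr acompNl eta_nat -acompA e2.
  by rewrite acomp1r.
apply/dist_rot; rewrite -/(sh _).
apply: (dist_iso (f := aid _) (g := aid _) (h := eta X) _ _ _ _ _ _ d) => //.
- exact: aiso_id.
- exact: aiso_id.
- by rewrite acomp1l acomp1r.
- by rewrite acomp1r.
by rewrite -/(sh (aid _)) sh_id acomp1l gFmN acompNr acompNl eta_nat.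
Qed.

Lemma good_rot X Y Z (u : ahom X Y) (v : ahom Y Z) (w : ahom Z (shift X)) :
  dist u v w -> (good u <-> good v).
Proof.
move=> d; split=> g.
  by apply: (good_ex (dist_rotl d)); apply/(Fdist_rot u v w); exact: g.
by apply: (good_ex d); apply/(Fdist_rot u v w); exact: (g _ _ _ (dist_rotl d)).
Qed.

Lemma F_bip2 X Y Z i1 i2 p1 p2 : @bip2 S X Y Z i1 i2 p1 p2 ->
  bip2 (Fm i1) (Fm i2) (Fm p1) (Fm p2).
Proof.
move=> [h1 h2 h3 h4 h5]; split; rewrite -?Fm_comp -?FmD ?h1 ?h2 ?h3 ?h4 ?h5 ?Fm_id //;
  exact: gFm0.
Qed.

Lemma bip2_oplus (A : additive_category) (X Y : A) :
  bip2 (inj1 X Y) (inj2 X Y) (prj1 X Y) (prj2 X Y).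
Proof. by split; rewrite ?prj1_inj1 ?prj2_inj2 ?prj1_inj2 ?prj2_inj1 ?oplus_id. Qed.

Lemma good_inj1 X Y R (u : ahom X Y) : good u -> good (inj1 Y R \oc u).
Proof.
move=> gu; have [Z [v [w d]]] := dist_complete u.
have b1 := bip2_oplus Y R; have b2 := bip2_oplus Z R.
have d1 := dist_sum1 b1 b2 (dist_rotl d).
have d2 := dist_sum1 (F_bip2 b1) (F_bip2 b2) ((Fdist_rot _ _ _).1 (gu _ _ _ d)).
have d3 : dist (inj1 Y R \oc u) (inj1 Z R \oc v \oc prj1 Y R + inj2 Z R \oc prj2 Y R)
    (w \oc prj1 Z R).
  by apply/dist_rot; rewrite -/(sh _) sh_comp -acompNr.
apply: (good_ex d3); apply/Fdist_rot; rewrite /Fdist FmD !Fm_comp.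
have -> : eta (oplus Y R) \oc Fm (- sh (inj1 Y R \oc u))
    = sh (Fm (inj1 Y R)) \oc (eta Y \oc Fm (- sh u)).
  by rewrite sh_comp -acompNr Fm_comp !acompA eta_nat.
exact: d2.
Qed.

(** The cone [Y'] of [u] is split, with summands [Z'] and [X']. Taking [v] as the cocone of
    [g \oc m] factors [u] as [v \oc u'], where [u'] has cone [Z'] and [v] has cone [X']. In the
    target the octahedral axiom yields a cone [Y0] of [Fm u] with the images of the two summands,
    and the absence of maps from [X'] to [Z'] forces the comparison with [F Y'] to respect the maps
    of the triangle. *)
Lemma cut X Y Y' Z' X' (u : ahom X Y) (m : ahom Y Y') (n : ahom Y' (shift X))
    (f : ahom Z' Y') (g : ahom Y' X') :
  dist u m n -> dist f g 0 -> (forall a : ahom X' Z', a = 0) ->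
  exists B (u' : ahom X B) (v : ahom B Y) (j : ahom B Z') (k : ahom Z' (shift X))
    (l : ahom Y X') (i : ahom X' (shift B)),
  [/\ dist u' j k, dist v l i & good u' -> good v -> good u].
Proof.
move=> du dfg z.
have [B [v [i dv]]] := dist_cocomplete (g \oc m).
have [f' [g' [d1 e1 e2 e3 e4]]] := octahedral (dist_rotl du) (dist_rotl dfg) (dist_rotl dv).
rewrite -!/(sh _) in d1 e1 e2 e3 e4.
have [u' u'E] := sh_full f'; have [j jE] := sh_full g'.
have vu : v \oc u' = u.
  apply: sh_inj; rewrite sh_comp u'E; apply: oppr_inj; rewrite -e2 acompNl //.
have fj : f \oc j = m \oc v.
  by apply: sh_inj; rewrite !sh_comp jE; apply: oppr_inj; rewrite -!acompNl e4 acompNr acompNl.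
have ui : sh u' \oc n = i \oc g by rewrite u'E.
have dk : dist u' j (n \oc f).
  by apply: dist_unshift; rewrite u'E jE sh_comp -acompNr.
exists B, u', v, j, (n \oc f), (g \oc m), i; split=> // gu gv.
have [r [s b]] := split_dist dfg.
have ji : sh j \oc i = 0.
  have e : sh f \oc (sh j \oc i) = 0.
    by rewrite acompA -sh_comp fj sh_comp -acompA (dist_uw dv) acomp0r.
  by have [h _ _ _ _] := b; rewrite -[LHS]acomp1l -sh_id -h sh_comp -acompA e acomp0r.
apply: (good_ex du).
have [Y0 [m0 [n0 d0]]] := dist_complete (Fm u).
have d0' : dist (Fm v \oc Fm u') m0 n0 by rewrite -Fm_comp vu.
have fdu := gu _ _ _ dk; have fdv := gv _ _ _ dv.
have [f0 [g0 [dT t1 t2 t3 t4]]] := octahedral fdu fdv d0'.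
rewrite -!/(sh _) in dT t4.
have w0 : sh (Fm j) \oc (eta B \oc Fm i) = 0.
  by rewrite acompA -eta_nat -acompA -Fm_comp ji gFm0 acomp0r.
rewrite w0 in dT; have [r0 [s0 b0]] := split_dist dT.
have bF := F_bip2 b.
(* The two splittings are chosen independently. Matching them gives an isomorphism [th], whose
   compatibility with [m] and [n] is still to be proved. *)
pose th := Fm f \oc r0 + Fm s \oc g0; pose th' := f0 \oc Fm r + s0 \oc Fm g.
have [a1 a2 a3 a4 a5] := b0; have [c1 c2 c3 c4 c5] := bF.
have thi : th' \oc th = aid _ /\ th \oc th' = aid _.
  rewrite /th /th'; split; rewrite !expE !(acl c1, acl c2, acl c3, acl c4, acl a1, acl a2, acl a3, acl a4).
    by rewrite !zeroE a5.
  by rewrite !zeroE c5.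
have thf : th \oc f0 = Fm f by rewrite /th acompDl -!acompA a1 a4 !(acomp0r, acomp1r) addr0.
have gth : Fm g \oc th = g0 by rewrite /th acompDr !acompA c2 c4 !(acomp0l, acomp1l) add0r.
have homz (a : ahom (F X') (F Z')) : a = 0.
  by have [a' <-] := Fm_full a; rewrite (z a') gFm0.
(* The difference factors through [Fm f] and vanishes on [Fm v], so it comes from a map
   [F X' -> F Z'], which is zero by fullness. The argument for [n] is dual. *)
have thm : th \oc m0 = Fm m.
  apply/eqP; rewrite -subr_eq0; apply/eqP; set de := _ - _.
  have gd : Fm g \oc de = 0 by rewrite /de acompBr acompA gth t3 -Fm_comp subrr.
  have deE : de = Fm f \oc (Fm r \oc de).
    by rewrite -[LHS]acomp1l -c5 acompDl -[Fm s \oc _ \oc _]acompA gd acomp0r addr0 acompA.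
  have dv0 : de \oc Fm v = 0.
    by rewrite /de acompBl -!acompA -t1 acompA thf -!Fm_comp fj subrr.
  have [|q qE] := dist_wcoker (f := Fm r \oc de) fdv; first by rewrite -acompA dv0 acomp0r.
  by rewrite deE qE (homz q) acomp0l acomp0r.
have nth : eta X \oc Fm n \oc th = n0.
  apply/eqP; rewrite -subr_eq0; apply/eqP; set de := _ - _.
  have df : de \oc f0 = 0.
    by rewrite /de acompBl -!acompA thf t2 -Fm_comp subrr.
  have deE : de = de \oc s0 \oc g0.
    by rewrite -[LHS]acomp1r -a5 acompDr !acompA df acomp0l add0r.
  have ud : sh (Fm u') \oc de = 0.
    rewrite /de acompBr -t4 !acompA -eta_nat -(acompA (eta B)) -Fm_comp ui Fm_comp.
    by rewrite -!acompA gth subrr.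
  have [|q qE] := dist_wker (f := de \oc s0) (dist_rotl (dist_rotl fdu)).
    by rewrite acompNl acompA ud acomp0l oppr0.
  by rewrite deE qE (homz q) acomp0r acomp0l.
have thi' : aiso th by apply/aisoP; exists th'.
apply: (dist_iso (f := aid _) (g := aid _) (h := th) _ _ _ _ _ _ d0) => //.
- exact: aiso_id.
- exact: aiso_id.
- by rewrite acomp1l acomp1r.
- by rewrite acomp1r.
by rewrite -/(sh (aid _)) sh_id acomp1l nth.
Qed.

End Good.

(** * The interchange of the two middle summands *)

Section Swap.
Variables (U : additive_category) (A B C D : U).

Definition swap4 (A B C D : U) :
    ahom (oplus (oplus A B) (oplus C D)) (oplus (oplus A C) (oplus B D)) :=
  inj1 _ _ \oc (inj1 A C \oc prj1 A B \oc prj1 _ _ + inj2 A C \oc prj1 C D \oc prj2 _ _)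
  + inj2 _ _ \oc (inj1 B D \oc prj2 A B \oc prj1 _ _ + inj2 B D \oc prj2 C D \oc prj2 _ _).

Lemma swap4_inj1 : swap4 A B C D \oc inj1 _ _
  = inj1 _ _ \oc inj1 A C \oc prj1 _ _ + inj2 _ _ \oc inj1 B D \oc prj2 _ _.
Proof. by rewrite /swap4 !expE !zeroE. Qed.

Lemma swap4_inj2 : swap4 A B C D \oc inj2 _ _
  = inj1 _ _ \oc inj2 A C \oc prj1 _ _ + inj2 _ _ \oc inj2 B D \oc prj2 _ _.
Proof. by rewrite /swap4 !expE !zeroE. Qed.

Definition swap4_d1 (a : ahom A B) (c : ahom C D) (h : ahom C B) :
    ahom (oplus (oplus A B) (oplus C D)) (oplus (oplus A B) (oplus C D)) :=
  inj1 _ _ \oc (inj2 A B \oc a \oc prj1 A B) \oc prj1 _ _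
  + inj2 _ _ \oc (inj2 C D \oc c \oc prj1 C D) \oc prj2 _ _
  + inj1 _ _ \oc (inj2 A B \oc h \oc prj1 C D) \oc prj2 _ _.

Definition swap4_d2 (a : ahom A B) (c : ahom C D) (h : ahom C B) :
    ahom (oplus (oplus A C) (oplus B D)) (oplus (oplus A C) (oplus B D)) :=
  inj2 _ _ \oc (inj1 B D \oc a \oc prj1 A C + inj2 B D \oc c \oc prj2 A C
  + inj1 B D \oc h \oc prj2 A C) \oc prj1 _ _.

(** The left differential is that of an extension of two homogeneous pieces, the right one that of
    the single piece built on a block triangular map. *)
Lemma swap4_d a c h : swap4 A B C D \oc swap4_d1 a c h = swap4_d2 a c h \oc swap4 A B C D.
Proof.
apply: oplus_ext_in; rewrite -!acompA ?swap4_inj1 ?swap4_inj2.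
  have -> : swap4_d1 a c h \oc inj1 _ _ = inj1 _ _ \oc (inj2 A B \oc a \oc prj1 A B).
    by rewrite /swap4_d1 !expE !zeroE.
  by rewrite acompA swap4_inj1 /swap4_d2 !expE !zeroE.
have -> : swap4_d1 a c h \oc inj2 _ _ = inj2 _ _ \oc (inj2 C D \oc c \oc prj1 C D)
    + inj1 _ _ \oc (inj2 A B \oc h \oc prj1 C D).
  by rewrite /swap4_d1 !expE !zeroE.
by rewrite acompDr !acompA swap4_inj1 swap4_inj2 /swap4_d2 !expE !zeroE.
Qed.

Lemma swap4_prj2 : (inj1 _ _ \oc prj2 A C \oc prj1 _ _ + inj2 _ _ \oc prj2 B D \oc prj2 _ _)
  \oc swap4 A B C D = prj2 _ _.
Proof.
apply: oplus_ext_in; rewrite -acompA ?swap4_inj1 ?swap4_inj2 ?prj2_inj1 ?prj2_inj2.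
  by rewrite !expE !zeroE.
by rewrite -[RHS]oplus_id !expE !zeroE.
Qed.
End Swap.

Lemma swap4K (U : additive_category) (A B C D : U) :
  swap4 A C B D \oc swap4 A B C D = aid _.
Proof.
apply: oplus_ext_in; rewrite -acompA acomp1l ?swap4_inj1 ?swap4_inj2.
  rewrite acompDr !acompA swap4_inj1 swap4_inj2 -[RHS]acomp1r -oplus_id.
  by rewrite !expE !zeroE.
rewrite acompDr !acompA swap4_inj1 swap4_inj2 -[RHS]acomp1r -oplus_id.
by rewrite !expE !zeroE.
Qed.

Lemma acomp_conj (U : additive_category) (X Y : U) (s : ahom X Y) (s' : ahom Y X) d1 d2 :
  s' \oc s = aid _ -> s \oc s' = aid _ -> s \oc d1 = d2 \oc s -> s' \oc d2 = d1 \oc s'.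
Proof.
by move=> h1 h2 h; rewrite -[LHS]acomp1r -h2 !acompA -(acompA s') -h acompA h1 acomp1l.
Qed.

Lemma swap4_d' (U : additive_category) (A B C D : U) (a : ahom A B) (c : ahom C D) h :
  swap4 A C B D \oc swap4_d2 a c h = swap4_d1 a c h \oc swap4 A C B D.
Proof. exact: (acomp_conj (swap4K A B C D) (swap4K A C B D) (swap4_d a c h)). Qed.

(** * Extensions of homogeneous pieces of equal index *)

Section Base.
Variables (K : fieldType) (T : linear_triangulated_category K) (E : bool -> T).
Hypothesis E_neq : forall (a b : bool) (n : int) (f : ahom (E a) (shiftz n (E b))),
  n != 0 -> f = 0.
Hypothesis E_21 : forall f : ahom (E true) (E false), f = 0.
Hypothesis E_end : forall (a : bool) (f : ahom (E a) (E a)), f = 0 \/ aiso f.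

Local Notation tw := (tw E).
Local Notation HK := (kt_add E).
Local Notation KT := (kt_tri E).
Local Notation thom X Y := (ahom (tcar X) (tcar Y)).

Section Extension.
Variables (k : int) (qx qz : kron E) (h : ahom (kS1 qz) (kS2 qx)).
Local Notation A := (kS1 qx).
Local Notation B := (kS2 qx).
Local Notation C := (kS1 qz).
Local Notation D := (kS2 qz).

Definition kphi_ext : ahom (oplus A C) (oplus B D) :=
  inj1 B D \oc kphi qx \oc prj1 A C + inj2 B D \oc kphi qz \oc prj2 A C
  + inj1 B D \oc h \oc prj2 A C.

Definition kron_ext : kron E :=
  Kron (addE_sum (kh1 qx) (kh1 qz)) (addE_sum (kh2 qx) (kh2 qz)) kphi_ext.

Local Notation x := (ShKron k qx).
Local Notation y := (ShKron k kron_ext).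
Local Notation z := (ShKron k qz).

Lemma zf_bip2 X Y S i1 i2 p1 p2 : @bip2 T X Y S i1 i2 p1 p2 ->
  bip2 (zf k i1) (zf k i2) (zf k p1) (zf k p2).
Proof.
move=> [h1 h2 h3 h4 h5].
by split; rewrite -?zf_comp -?zfD ?h1 ?h2 ?h3 ?h4 ?h5 ?zf_id ?zf0.
Qed.

(** Octahedral axiom for [kphi_ext], factored as [kphi qx] plus the identity of [C], then the shear
    [c] of [B] plus [C] by [h], then the identity of [B] plus [kphi qz]. The outer factors have the
    cones of [x] and [z], and the shear brings [h] into the connecting map. *)
Lemma cob_ext : exists (f : ahom (cob x) (cob y)) (g : ahom (cob y) (cob z)),
  dist f g (- (sh (cb x) \oc sh (zf k h) \oc cp z)) /\
  [/\ f \oc cb x = cb y \oc zf k (inj1 B D), cp y \oc f = sh (zf k (inj1 A C)) \oc cp x,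
      g \oc cb y = cb z \oc zf k (prj2 B D) & cp z \oc g = sh (zf k (prj2 A C)) \oc cp y].
Proof.
have b1 := zf_bip2 (bip2_oplus A C); have b2 := zf_bip2 (bip2_oplus B C).
have b3 := zf_bip2 (bip2_oplus B D).
have d1 := dist_sum1 b1 b2 (cdist x).
have d2 := dist_sum1 (bip2_sym b2) (bip2_sym b3) (cdist z).
pose c := aid (oplus B C) + inj1 B C \oc h \oc prj2 B C.
pose c' := aid (oplus B C) - inj1 B C \oc h \oc prj2 B C.
have cc : c' \oc c = aid _ by rewrite /c /c' !expE !zeroE addrK.
have cc' : c \oc c' = aid _ by rewrite /c /c' !expE !zeroE -?addrA ?addNr ?addrN ?addr0.
have d3 := dist_precomp (c := zf k c) (c' := zf k c') _ _ d2.
rewrite -!zf_comp cc cc' zf_id in d3; move: (d3 erefl erefl) => {}d3.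
rewrite -!(zf_comp, zfD) in d1 d3.
have d4 := cdist y.
have e : zf k kphi_ext = zf k ((inj2 B D \oc kphi qz \oc prj2 B C + inj1 B D \oc prj1 B C) \oc c)
    \oc zf k (inj1 B C \oc kphi qx \oc prj1 A C + inj2 B C \oc prj2 A C).
  rewrite -zf_comp; congr zf; rewrite /kphi_ext /c !expE !zeroE; zmod.
rewrite /= e in d4.
have [f [g [dd e1 e2 e3 e4]]] := octahedral d1 d3 d4.
rewrite -!/(sh _) in dd e4.
exists f, g; split.
  move: dd; congr dist; rewrite !sh_comp -!acompA; rewrite -acompNr; congr (_ \oc _).
  rewrite !acompA -!sh_comp -!zf_comp -acompNl -shN -zfN; congr (sh (zf k _) \oc _).
  by rewrite /c' !expE !zeroE.
split.
- have := congr1 (fun t => t \oc zf k (inj1 B C)) e1.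
  rewrite -!acompA -!zf_comp prj1_inj1 zf_id acomp1r => ->; congr (_ \oc zf k _).
  by rewrite /c !expE !zeroE.
- by [].
- by [].
have := congr1 (fun t => sh (zf k (prj2 B C)) \oc t) e4.
rewrite !acompA -!sh_comp -!zf_comp.
have -> : prj2 B C \oc c' \oc inj2 B C = aid C by rewrite /c' !expE !zeroE.
have -> : prj2 B C \oc (inj1 B C \oc kphi qx \oc prj1 A C + inj2 B C \oc prj2 A C) = prj2 A C.
  by rewrite !expE !zeroE.
by rewrite zf_id sh_id acomp1l.
Qed.

Definition ext_u : thom (ho x) (ho y) :=
  inj1 _ _ \oc inj1 A C \oc prj1 _ _ + inj2 _ _ \oc inj1 B D \oc prj2 _ _.
Definition ext_v : thom (ho y) (ho z) :=
  inj1 _ _ \oc prj2 A C \oc prj1 _ _ + inj2 _ _ \oc prj2 B D \oc prj2 _ _.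
Definition ext_w : thom (ho z) (ho x) := inj2 A B \oc h \oc prj1 C D.

Lemma ext_u_chain : chain ext_u.
Proof. by apply: ho_chain0 => //=; rewrite /kphi_ext !expE !zeroE. Qed.

Lemma ext_v_chain : chain ext_v.
Proof. by apply: ho_chain0 => //=; rewrite /kphi_ext !expE !zeroE. Qed.

Lemma ext_w_deg : hdeg (tpi (ho z)) (tpi (ho x)) 1 ext_w.
Proof.
have d : hdeg (conc C (- k - 1)) (conc B (- k)) 1 h by apply: conc_deg; rewrite subrK.
exact: (hdeg_comp (hdeg_comp (hdeg_inj2 _ _) d) (hdeg_prj1 _ _)).
Qed.

Lemma ext_w_d : ext_w \oc tdf (ho z) = - (tdf (ho x) \oc ext_w).
Proof. by rewrite /= /ho_df /ext_w !expE !zeroE. Qed.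

Local Notation Y0 := (text ext_w_deg ext_w_d).

Lemma psum_conc (X Y : T) n : psum (conc X n) (conc Y n) = conc (oplus X Y) n.
Proof.
apply/funext => i; rewrite /psum /conc; case: eqP => _; last by rewrite !zeroE.
by rewrite !acomp1r oplus_id.
Qed.

Lemma ext_t_chain : @chain _ _ _ Y0 (ho y) (swap4 A B C D).
Proof.
have a1 := hdeg_inj1 (conc A (- k - 1)) (conc C (- k - 1)).
have a2 := hdeg_inj2 (conc A (- k - 1)) (conc C (- k - 1)).
have b1 := hdeg_inj1 (conc B (- k)) (conc D (- k)).
have b2 := hdeg_inj2 (conc B (- k)) (conc D (- k)).
rewrite !psum_conc in a1 a2 b1 b2.
have p1 := hdeg_prj1 (tpi (ho x)) (tpi (ho z)).
have p2 := hdeg_prj2 (tpi (ho x)) (tpi (ho z)).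
split; last exact: (swap4_d (kphi qx) (kphi qz) h).
apply: hdegD; apply: (hdeg_comp (k := 0) (l := 0)); try apply: hdegD.
- exact: (hdeg_inj1 (conc _ _) (conc _ _)).
- exact: (hdeg_comp (hdeg_comp a1 (hdeg_prj1 _ _)) p1).
- exact: (hdeg_comp (hdeg_comp a2 (hdeg_prj1 _ _)) p2).
- exact: (hdeg_inj2 (conc _ _) (conc _ _)).
- exact: (hdeg_comp (hdeg_comp b1 (hdeg_prj2 _ _)) p1).
- exact: (hdeg_comp (hdeg_comp b2 (hdeg_prj2 _ _)) p2).
Qed.

Lemma ext_t_chain' : @chain _ _ _ (ho y) Y0 (swap4 A C B D).
Proof.
have a1 := hdeg_prj1 (conc A (- k - 1)) (conc C (- k - 1)).
have a2 := hdeg_prj2 (conc A (- k - 1)) (conc C (- k - 1)).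
have b1 := hdeg_prj1 (conc B (- k)) (conc D (- k)).
have b2 := hdeg_prj2 (conc B (- k)) (conc D (- k)).
rewrite !psum_conc in a1 a2 b1 b2.
have p1 := hdeg_prj1 (conc (oplus A C) (- k - 1)) (conc (oplus B D) (- k)).
have p2 := hdeg_prj2 (conc (oplus A C) (- k - 1)) (conc (oplus B D) (- k)).
split; last exact: (swap4_d' (kphi qx) (kphi qz) h).
apply: hdegD; apply: (hdeg_comp (k := 0) (l := 0)); try apply: hdegD.
- exact: (hdeg_inj1 (tpi (ho x)) (tpi (ho z))).
- exact: (hdeg_comp (hdeg_comp (hdeg_inj1 _ _) a1) p1).
- exact: (hdeg_comp (hdeg_comp (hdeg_inj2 _ _) b1) p2).
- exact: (hdeg_inj2 (tpi (ho x)) (tpi (ho z))).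
- exact: (hdeg_comp (hdeg_comp (hdeg_inj1 _ _) a2) p1).
- exact: (hdeg_comp (hdeg_comp (hdeg_inj2 _ _) b2) p2).
Qed.

Lemma ext_t_iso : aiso (kcl ext_t_chain : ahom (Y0 : HK) (ho y)).
Proof.
by apply/aisoP; exists (kcl ext_t_chain'); rewrite !kclM; split; apply: kcl_eq1;
  exact: swap4K.
Qed.

Lemma ext_kdist : @dist KT _ _ _ (kcl ext_u_chain : ahom (ho x : KT) (ho y))
  (kcl ext_v_chain : ahom (ho y : KT) (ho z)) (kcl (chain_w ext_w_deg ext_w_d)).
Proof.
exists ext_w, ext_w_deg, ext_w_d, (kcl ext_t_chain); split=> //.
- exact: ext_t_iso.
- by rewrite kclM; apply: kcl_eq1; symmetry; exact: swap4_inj1.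
by rewrite kclM; apply: kcl_eq1; exact: swap4_prj2.
Qed.

End Extension.
End Base.

(** * Exactness on extensions of pieces of equal index *)

Section Exactness.
Variables (K : fieldType) (T : linear_triangulated_category K) (E : bool -> T).
Hypothesis E_neq : forall (a b : bool) (n : int) (f : ahom (E a) (shiftz n (E b))),
  n != 0 -> f = 0.
Hypothesis E_21 : forall f : ahom (E true) (E false), f = 0.
Hypothesis E_end : forall (a : bool) (f : ahom (E a) (E a)), f = 0 \/ aiso f.

Local Notation tw := (tw E).
Local Notation HK := (kt_add E).
Local Notation KT := (kt_tri E).
Local Notation thom X Y := (ahom (tcar X) (tcar Y)).

Definition Fo (X : KT) : T := dS (dec E_21 E_end X).
Definition FM (X Y : KT) (f : ahom X Y) : ahom (Fo X) (Fo Y) := Fm E_21 E_end f.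
(* The sign makes the functor exact: a map of cones of degree one goes through
   the connecting morphism [cp] of one triangle and the map [cb] of another. *)
Definition Feps (X : KT) : ahom (Fo (shift X)) (shift (Fo X)) := - Feta E_neq E_21 E_end X.

Lemma FM_id X : FM (aid X) = aid (Fo X). Proof. exact: (Fm_id E_neq). Qed.
Lemma FM_comp X Y Z (g : ahom Y Z) (f : ahom X Y) : FM (g \oc f) = FM g \oc FM f.
Proof. exact: (Fm_comp E_neq). Qed.
Lemma FM_D X Y (f g : ahom X Y) : FM (f + g) = FM f + FM g.
Proof. exact: (FmD E_neq). Qed.
Lemma FM_full X Y (h : ahom (Fo X) (Fo Y)) : exists f, FM f = h.
Proof. exact: (Fm_full E_neq). Qed.
Lemma Feps_iso X : aiso (Feps X).
Proof. exact: aisoN (Feta_iso E_neq E_21 E_end X). Qed.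
Lemma Feps_nat X Y (f : ahom X Y) : Feps Y \oc FM (sh f) = sh (FM f) \oc Feps X.
Proof. by rewrite acompNl acompNr; congr (- _); exact: (Feta_nat E_neq). Qed.

Local Notation good := (@good KT T Fo FM Feps).
Local Notation good_iso := (good_iso FM_id FM_comp Feps_nat).
Local Notation good_ex := (good_ex FM_id FM_comp Feps_nat).
Local Notation good_rot := (good_rot FM_id FM_comp FM_D Feps_iso Feps_nat).

Section Base.
Variables (k : int) (qx qz : kron E) (h : ahom (kS1 qz) (kS2 qx)).
Local Notation x := (ShKron k qx).
Local Notation y := (ShKron k (kron_ext h)).
Local Notation z := (ShKron k qz).
Local Notation w := (kcl (chain_w (ext_w_deg k h) (ext_w_d k h)) : ahom (ho z : HK) (tsh 1 (ho x) : HK)).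

Lemma tau_same (x y : shkron E) (m : thom (ho x) (ho y)) (c : chain m) f : sk y = sk x ->
  f \oc cb x = cb y \oc zmap (sk x) (sk y) (m2 m) ->
  cp y \oc f = sh (zmap (sk x) (sk y) (m1 m)) \oc cp x ->
  tau (kcl c : ahom (ho x : HK) (ho y : HK)) = f.
Proof.
move=> e h1 h2; apply: (tauE E_neq E_21); rewrite /Rel.
have -> : (sk y == sk x + 1) = false.
  by apply/negbTE; rewrite e eq_sym -subr_eq0 addrAC subrr add0r.
by split.
Qed.

(** Both sides are [cext h] with target the cone of [xs x]. *)
Lemma ext_third : ceta x \oc (sh (cb x) \oc sh (zf k h) \oc cp z) =
  tau (heta x \oc w).
Proof.
have c : @chain _ _ _ (ho z) (ho (xs x)) (eta_m x \oc ext_w k h).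
  exact: (chain_comp (X := ho z) (Y := tsh 1 (ho x)) (Z := ho (xs x)) (eta_chain x).1
    (chain_w (ext_w_deg k h) (ext_w_d k h))).
have -> : heta x \oc w = (kcl c : ahom (ho z : HK) (ho (xs x))).
  by rewrite /heta kclM; apply: kcl_eq1.
symmetry; apply: (tauE E_neq E_21); rewrite /Rel /= eqxx /cext.
have -> : mh (x := z) (y := xs x) (eta_m x \oc ext_w k h) = h.
  by rewrite /mh /eta_m /ext_w /= !expE !zeroE.
rewrite sgE zcast_id acomp1l !acompA (ceta_b x) -!(acompA (cb _)); congr (_ \oc _).
by congr (_ \oc _); exact: zsig_nat.
Qed.

(** The triangle of [cob_ext] is the image of [ext_kdist]: its first two maps are recognised by
    their effect on both ends, the third by [ext_third]. The minus sign of the connecting map in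
    [cob_ext] is the one in [Feps]. *)
Lemma good_ext : good (kcl (ext_u_chain k h) : ahom (ho x : KT) (ho y)).
Proof.
apply: (good_ex (ext_kdist k h)).
have [f [g [d [f1 f2 g1 g2]]]] := cob_ext k h.
have tf : tau (kcl (ext_u_chain k h) : ahom (ho x : HK) (ho y)) = f.
  apply: tau_same => //=; rewrite zmap_id.
    by rewrite f1; congr (_ \oc zf k _); rewrite /m2 /ext_u /= !expE !zeroE.
  by rewrite f2; congr (sh (zf k _) \oc _); rewrite /m1 /ext_u /= !expE !zeroE.
have tg : tau (kcl (ext_v_chain k h) : ahom (ho y : HK) (ho z)) = g.
  apply: tau_same => //=; rewrite zmap_id.
    by rewrite g1; congr (_ \oc zf k _); rewrite /m2 /ext_v /= !expE !zeroE.
  by rewrite g2; congr (sh (zf k _) \oc _); rewrite /m1 /ext_v /= !expE !zeroE.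
pose al v := Fal E_21 E_end v.
have ai v : aiso (al v) by exact: Fal_iso.
have an v v' (a : ahom (ho v : HK) (ho v')) : al v' \oc Fm E_21 E_end a = tau a \oc al v.
  exact: (Fal_nat E_neq).
pose be v := sval (cid ((aisoP _).1 (ai v))).
have be1 v : be v \oc al v = aid _ by rewrite /be; case: cid => ? [].
have be2 v : al v \oc be v = aid _ by rewrite /be; case: cid => ? [].
have bi v : aiso (be v) by apply/aisoP; exists (al v).
have bn v v' (a : ahom (ho v : HK) (ho v')) : be v' \oc tau a = Fm E_21 E_end a \oc be v.
  apply: (aiso_epi (ai v)); rewrite -!acompA be1 acomp1r -an acompA be1 acomp1l //.
apply: (dist_iso (bi x) (bi y) (bi z) _ _ _ d).
- by rewrite -tf bn.
- by rewrite -tg bn.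
rewrite -/(sh _) acompNr /Feps !acompNl; congr (- _).
apply: (aiso_epi (ai z)); rewrite -[RHS]acompA be1 acomp1r.
have ci : aiso (ceta x \oc sh (al x)).
  by apply: aiso_comp; [exact: ceta_iso|exact: sh_iso].
apply: (aiso_mono ci); rewrite !acompA -(acompA _ (sh (al x))) -sh_comp be2 sh_id acomp1r.
rewrite Feta_ho (eta0E E_neq) -[RHS]acompA.
transitivity (Fal E_21 E_end (xs x) \oc Fm E_21 E_end (heta x \oc w)); last first.
  by rewrite (Fm_comp E_neq).
by rewrite (Fal_nat E_neq) -ext_third !acompA.
Qed.
End Base.

End Exactness.

Section OplusMap.
Variable A : additive_category.

Definition omap (X X' Y Y' : A) (f : ahom X Y) (g : ahom X' Y') :
  ahom (oplus X X') (oplus Y Y') := inj1 _ _ \oc f \oc prj1 _ _ + inj2 _ _ \oc g \oc prj2 _ _.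

Lemma omap_comp (X X' Y Y' Z Z' : A) (f' : ahom Y Z) (g' : ahom Y' Z')
  (f : ahom X Y) (g : ahom X' Y') : omap f' g' \oc omap f g = omap (f' \oc f) (g' \oc g).
Proof. by rewrite /omap !expE !zeroE. Qed.

Lemma omap_id (X X' : A) : omap (aid X) (aid X') = aid _.
Proof. by rewrite /omap !acomp1r oplus_id. Qed.

Lemma omap0 (X X' Y Y' : A) : omap (0 : ahom X Y) (0 : ahom X' Y') = 0.
Proof. by rewrite /omap !zeroE. Qed.

Lemma omapD (X X' Y Y' : A) (f f' : ahom X Y) (g g' : ahom X' Y') :
  omap f g + omap f' g' = omap (f + f') (g + g').
Proof. by rewrite /omap !acompDr !acompDl addrACA. Qed.

Lemma bip2_omap (X Y S X' Y' S' : A) (i1 : ahom X S) (i2 : ahom Y S) p1 p2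
    (i1' : ahom X' S') (i2' : ahom Y' S') p1' p2' :
  bip2 i1 i2 p1 p2 -> bip2 i1' i2' p1' p2' ->
  bip2 (omap i1 i1') (omap i2 i2') (omap p1 p1') (omap p2 p2').
Proof.
move=> [h1 h2 h3 h4 h5] [k1 k2 k3 k4 k5].
by split; rewrite ?omap_comp ?omapD ?h1 ?h2 ?h3 ?h4 ?h5 ?k1 ?k2 ?k3 ?k4 ?k5 ?omap_id ?omap0.
Qed.

Lemma bip2_iso (X Y S : A) (i1 : ahom X S) (i2 : ahom Y S) p1 p2 : bip2 i1 i2 p1 p2 ->
  aiso (i1 \oc prj1 X Y + i2 \oc prj2 X Y).
Proof.
move=> [h1 h2 h3 h4 h5]; apply/aisoP; exists (inj1 _ _ \oc p1 + inj2 _ _ \oc p2).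
rewrite !expE !(acl h1, acl h2, acl h3, acl h4) !zeroE; split=> //; exact: oplus_id.
Qed.
End OplusMap.

Section Generic.
Variable T : triangulated_category.

Lemma bip2_dist X Y (S : T) i1 i2 p1 p2 : @bip2 T X Y S i1 i2 p1 p2 -> dist i1 p2 0.
Proof.
move=> b.
have z : bip2 (0 : ahom (azero : T) X) (aid X) 0 (aid X).
  by split; rewrite ?acomp0l ?acomp0r ?acomp1l ?add0r // aid_azero.
have dW : @dist T azero Y Y 0 (aid Y) 0.
  have [C [v [w d]]] := dist_complete (0 : ahom (azero : T) Y).
  have vi : aiso v.
    apply: (cone0_iso (dist_rotl d)); apply: sh_id0; exact: aid_azero.
  have [v' [v1 v2]] := (aisoP _).1 vi.
  apply: (dist_iso (aiso_id _) (aiso_id _) _ _ _ _ d) => //.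
  - by apply/aisoP; exists v; split; [exact: v2|exact: v1].
  - by rewrite acomp1l acomp1r.
  - by rewrite v1 acomp1r.
  rewrite acomp0l; apply: eq_from_id0r; apply: sh_id0; exact: aid_azero.
have := dist_sum1 z (bip2_sym b) dW.
by rewrite !acomp0r add0r acomp1r acomp1l.
Qed.

End Generic.

(** * Exactness in general, by reduction of the indices in the cone *)

Section Exactness.
Variables (K : fieldType) (T : linear_triangulated_category K) (E : bool -> T).
Hypothesis E_neq : forall (a b : bool) (n : int) (f : ahom (E a) (shiftz n (E b))),
  n != 0 -> f = 0.
Hypothesis E_21 : forall f : ahom (E true) (E false), f = 0.
Hypothesis E_end : forall (a : bool) (f : ahom (E a) (E a)), f = 0 \/ aiso f.

Local Notation tw := (tw E).
Local Notation HK := (kt_add E).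
Local Notation KT := (kt_tri E).
Local Notation thom X Y := (ahom (tcar X) (tcar Y)).

Lemma hom_far P Q (X Y : HK) : hspan P X -> hspan Q Y ->
  (forall k l, P k -> Q l -> l <> k /\ l <> k + 1) -> forall f : ahom X Y, f = 0.
Proof.
move=> sX sY h; elim: sX => {X} [|x px|X X' _ IH _ IH'|X X' g gi _ IH] f.
- by rewrite -[f]acomp1r aid_azero acomp0r.
- elim: sY f => {Y} [|y qy|Y Y' _ IH _ IH'|Y Y' g gi _ IH] f.
  + by rewrite -[f]acomp1l aid_azero acomp0l.
  + have [m [c ->]] := kcl_surj f; have [/eqP n1 /eqP n2] := h _ _ px qy.
    by rewrite -(kcl0 (chain0 _ _)); apply: kcl_eq1; exact: (ho_far E_neq E_21 c n1 n2).
  + by apply: oplus_ext_out; rewrite acomp0r; [exact: IH|exact: IH'].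
  + have [g' [g1 g2]] := (aisoP _).1 gi.
    by rewrite -[f]acomp1l -g2 -acompA (IH (g' \oc f)) acomp0r.
- by apply: oplus_ext_in; rewrite acomp0l; [exact: IH|exact: IH'].
have [g' [g1 g2]] := (aisoP _).1 gi.
by rewrite -[f]acomp1r -g2 acompA (IH (f \oc g)) acomp0l.
Qed.

Lemma hspan_id0 P (X : HK) : aid X = 0 -> hspan P X.
Proof.
move=> x0; apply: (@hspan_iso _ _ _ _ azero X 0); last exact: hspan_zero.
by apply/aisoP; exists 0; rewrite !acomp0l x0 aid_azero.
Qed.

Lemma hspan_retract P R (C : HK) : hspan P C ->
  (forall (x : shkron E) (i : ahom (ho x : HK) C) (p : ahom C (ho x : HK)), p \oc i = aid _ ->
     R (sk x) \/ aid (ho x : HK) = 0) -> hspan R C.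
Proof.
elim=> {C} [|x px|X Y _ IH _ IH'|X Y f fi _ IH] h.
- exact: hspan_zero.
- have [rx|z] := h x (aid _) (aid _) (acomp1l _); first exact: hspan_ho.
  exact: hspan_id0.
- apply: hspan_plus; [apply: IH|apply: IH'] => x i p e.
    apply: (h x (inj1 _ _ \oc i) (p \oc prj1 _ _)).
    by rewrite acompA prj1_inj1_.
  apply: (h x (inj2 _ _ \oc i) (p \oc prj2 _ _)).
  by rewrite acompA prj2_inj2_.
apply: (hspan_iso fi); apply: IH => x i p e.
have [g [g1 g2]] := (aisoP _).1 fi.
by apply: (h x (f \oc i) (p \oc g)); rewrite acompA -(acompA p) g1 acomp1r.
Qed.

Lemma hspan_shift P (X : HK) : hspan P X -> hspan (fun k => P (k - 1)) (tsh 1 X : HK).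
Proof.
elim=> {X} [|x px|X Y _ IH _ IH'|X Y f fi _ IH].
- apply: hspan_id0; rewrite -(ksh_id 1 (azero : HK)) aid_azero.
  exact: (@sh0 KT).
- have [g [g1 g2]] := (aisoP _).1 (heta_iso x).
  apply: (@hspan_iso _ _ _ _ (ho (xs x)) _ g); last by apply: hspan_ho; rewrite /= addrK.
  by apply/aisoP; exists (heta x).
- apply: (@hspan_iso _ _ _ _ (oplus (tsh 1 X : HK) (tsh 1 Y)) _
    (ksh 1 (inj1 X Y) \oc prj1 _ _ + ksh 1 (inj2 X Y) \oc prj2 _ _)); last exact: hspan_plus.
  apply: (bip2_iso (p1 := ksh 1 (prj1 X Y)) (p2 := ksh 1 (prj2 X Y))).
  split; rewrite -!ksh_comp ?bipE ?ksh_id //; try exact: (@sh0 KT).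
  by rewrite -kshD oplus_id ksh_id.
by apply: (hspan_iso _ IH (f := ksh 1 f)); exact: (@sh_iso KT _ _ f fi).
Qed.

Lemma hspan_split P (Q : int -> Prop) (X : HK) : hspan P X ->
  exists (A B : HK) i1 i2 p1 p2, [/\ hspan (fun k => P k /\ Q k) A,
    hspan (fun k => P k /\ ~ Q k) B & @bip2 HK A B X i1 i2 p1 p2].
Proof.
elim=> {X} [|x px|X Y _ [A [B [i1 [i2 [p1 [p2 [sA sB b]]]]]]] _
    [A' [B' [i1' [i2' [p1' [p2' [sA' sB' b']]]]]]]|X Y f fi _
    [A [B [i1 [i2 [p1 [p2 [sA sB b]]]]]]]].
- exists azero, azero, 0, 0, 0, 0; split; try exact: hspan_zero.
  by split; rewrite !acomp0l ?addr0 ?aid_azero.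
- have [q|nq] := pselect (Q (sk x)).
    exists (ho x), azero, (aid _), 0, (aid _), 0; split.
    + by apply: hspan_ho.
    + exact: hspan_zero.
    by split; rewrite ?acomp0l ?acomp0r ?acomp1l ?addr0 ?aid_azero.
  exists azero, (ho x), 0, (aid _), 0, (aid _); split.
  + exact: hspan_zero.
  + by apply: hspan_ho.
  by split; rewrite ?acomp0l ?acomp0r ?acomp1l ?add0r ?aid_azero.
- exists (oplus A A'), (oplus B B').
  exists (omap i1 i1'), (omap i2 i2'), (omap p1 p1'), (omap p2 p2').
  by split; [exact: hspan_plus|exact: hspan_plus|exact: bip2_omap].
have [g [g1 g2]] := (aisoP _).1 fi.
exists A, B, (f \oc i1), (f \oc i2), (p1 \oc g), (p2 \oc g); split=> //.
have [h1 h2 h3 h4 h5] := b.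
split; rewrite ?acompA; try by rewrite -?(acompA _ g f) g1 acomp1r.
by rewrite -[RHS]g2 -[f in RHS]acomp1r -h5 acompDr acompDl !acompA.
Qed.

Local Notation good := (@good KT T (Fo E_21 E_end) (FM E_21 E_end) (Feps E_neq E_21 E_end)).
Local Notation good_iso := (good_iso (FM_id E_neq E_21 E_end) (FM_comp E_neq E_21 E_end)
  (Feps_nat E_neq E_21 E_end)).
Local Notation good_rot := (good_rot (FM_id E_neq E_21 E_end) (FM_comp E_neq E_21 E_end)
  (FM_D E_neq E_21 E_end) (Feps_iso E_neq E_21 E_end) (Feps_nat E_neq E_21 E_end)).
Local Notation good_inj1 := (good_inj1 (FM_id E_neq E_21 E_end) (FM_comp E_neq E_21 E_end)
  (FM_D E_neq E_21 E_end) (Feps_iso E_neq E_21 E_end) (Feps_nat E_neq E_21 E_end)).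
Local Notation cut := (cut (FM_id E_neq E_21 E_end) (FM_comp E_neq E_21 E_end)
  (FM_D E_neq E_21 E_end) (@FM_full _ _ _ E_neq E_21 E_end) (Feps_nat E_neq E_21 E_end)).
Local Notation all_ X := (hspan_tw E_end E_21 X).
Implicit Types X Y Z C : KT.

(** Maps preserve the index or raise it by one, so an inclusion and a retraction between nonzero
    objects of one index each force equality. *)
Lemma retract_single p q (X Y : HK) (i : ahom X Y) (r : ahom Y X) :
  hspan (eq p) X -> hspan (eq q) Y -> r \oc i = aid X -> p = q \/ aid X = 0.
Proof.
move=> sX sY e; have [|ne] := eqVneq p q; [by left|right].
have [e1|ne1] := eqVneq q (p + 1).
  rewrite -e; have -> : r = 0; last by rewrite acomp0l.
  by apply: (hom_far sY sX) => _ _ <- <-; split; lia.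
rewrite -e; have -> : i = 0; last by rewrite acomp0r.
by apply: (hom_far sX sY) => _ _ <- <-; split; lia.
Qed.

Lemma hspan_unshift k (X : HK) : hspan (eq (k + 1)) (tsh 1 X : HK) -> hspan (eq k) X.
Proof.
move=> s; apply: (hspan_retract (all_ X)) => x i p e.
have sx : hspan (eq (sk x + 1)) (tsh 1 (ho x) : HK).
  apply: (hspan_sub _ (hspan_shift (@hspan_ho _ _ _ (eq (sk x)) x erefl))) => j /= ->.
  by rewrite subrK.
have [|e1|e1] := retract_single (i := ksh 1 i) (r := ksh 1 p) sx s.
- by rewrite -ksh_comp e ksh_id.
- by left; lia.
by right; apply: (@sh_inj KT); rewrite (@sh_id KT) (@sh0 KT).
Qed.

(** Sums of pieces of equal index are single pieces, obtained from [kron_ext] with the zero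
    class. *)
Lemma hspan_one k (X : HK) : hspan (eq k) X -> exists (q : kron E) (f : ahom (ho (ShKron k q) : HK) X), aiso f.
Proof.
elim=> {X} [|x ->|X Y _ [q [f fi]] _ [q' [f' fi']]|X Y f fi _ [q [g gi]]].
- pose q := Kron (addE_zero E false) (addE_zero E true) 0; exists q, 0.
  apply: (@iso_id0 KT); last exact: aid_azero.
  rewrite -[LHS]/(kcl (chain_id _)) -(kcl0 (chain0 _ _)); apply: kcl_eq1.
  rewrite -oplus_id -[prj1 _ _]acomp1l -[prj2 _ _]acomp1l /= !aid_azero !acomp0l !acomp0r addr0 //.
- by case: x => k' q; exists q, (aid _); exact: aiso_id.
- have b := bip2_oplus X Y.
  have [g gg] : exists g : ahom (ho (ShKron k (kron_ext (0 : ahom (kS1 q') (kS2 q)))) : HK) (oplus X Y), aiso g.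
    have d2 := @ext_kdist _ _ _ k q q' 0.
    have d1 := bip2_dist (T := KT) (bip2_oplus X Y).
    have w0 : kcl (chain_w (ext_w_deg k (0 : ahom (kS1 q') (kS2 q))) (ext_w_d k 0)) = 0.
      rewrite -(kcl0 (chain0 _ _)); apply: kcl_eq1.
      by rewrite /ext_w acomp0r acomp0l.
    rewrite w0 in d2.
    have [|g [_ _ gi]] := dist_mor2 (T := KT) (f := f) (h := f') d2 d1.
      by rewrite acomp0r acomp0l.
    by exists g; exact: gi.
  by exists (kron_ext 0), g.
by exists q, (f \oc g); exact: aiso_comp.
Qed.

(** Between pieces of equal index a cocycle of degree one has only the component from [kS1] to
    [kS2], so up to isomorphism the triangle is one of those in [ext_kdist]. *)
Lemma base_good k X Y Z (u : ahom X Y) (v : ahom Y Z) (w : ahom Z (shift X)) :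
  dist u v w -> hspan (eq k) X -> hspan (eq k) Z -> good u /\ hspan (eq k) Y.
Proof.
move=> d /hspan_one[qx [a ai]] /hspan_one[qz [c ci]].
have [a' [a1 a2]] := (aisoP _).1 ai.
have [w0 [cw wE]] := kcl_surj (ksh 1 a' \oc w \oc c).
have [dw wd] := w_chain cw.
have [h hE] : exists h : ahom (kS1 qz) (kS2 qx), w0 = ext_w k h.
  exists (mh (x := ShKron k qz) (y := ShKron k qx) w0).
  have [z1 z2 _] := ho_hdeg (x := ShKron k qz) (y := ShKron k qx) dw.
  rewrite {1}(ho_homE (x := ShKron k qz) (y := ShKron k qx) E_neq E_21 w0).
  by rewrite z1 ?z2 ?acomp0r ?acomp0l ?add0r //=; lia.
have d0 := ext_kdist k h.
have [|b [b1 _ bi]] := dist_mor2 (T := KT) (f := (a : @ahom KT _ _)) (h := (c : @ahom KT _ _)) d0 d.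
  have -> : kcl (chain_w (ext_w_deg k h) (ext_w_d k h)) = (kcl cw : ahom (ho _ : HK) _).
    by apply: kcl_eq1; rewrite hE.
  rewrite -wE; transitivity (ksh 1 a \oc (ksh 1 a' \oc w \oc c)); first by [].
  by rewrite !acompA -ksh_comp a2 ksh_id acomp1l.
have ge := @good_ext _ _ _ E_neq E_21 E_end k qx qz h.
split; first exact: (good_iso ai (bi ai ci) b1 ge).
by apply: (hspan_iso (bi ai ci)); exact: hspan_ho.
Qed.

Lemma cone_span k X Y C (u : ahom X Y) (m : ahom Y C) (n : ahom C (shift X)) :
  dist u m n -> hspan (eq k) X -> hspan (fun l => l = k \/ l = k + 1) Y ->
  hspan (fun l => l = k \/ l = k + 1) C.
Proof.
move=> d sX sY; apply: (hspan_retract (all_ C)) => x i p e.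
have [|ne] := pselect (sk x = k \/ sk x = k + 1); [by left|right].
have sx : hspan (eq (sk x)) (ho x : HK) by exact: hspan_ho.
have ni : n \oc i = 0.
  by apply: (hom_far sx (hspan_shift sX)) => _ l <- /= h; split; lia.
have [j ij] := dist_wker (dist_rotl d) ni.
rewrite -e; have [e1|ne1] := eqVneq (sk x) (k - 1).
  rewrite ij acompA; have -> : p \oc m = 0; last by rewrite acomp0l.
  by apply: (hom_far sY sx) => l _ h <-; split; lia.
rewrite ij; have -> : j = 0; last by rewrite !acomp0r.
by apply: (hom_far sx sY) => _ l <- h; split; lia.
Qed.

(** No map lowers the index, so none goes from the part of index [k + 1] to the part of index [k],
    as [cut] requires. *)
Lemma cone_cut k X Y C (u : ahom X Y) (m : ahom Y C) (n : ahom C (shift X)) :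
  dist u m n -> hspan (fun l => l = k \/ l = k + 1) C ->
  exists A D B (u' : ahom X B) (v : ahom B Y) (j : ahom B A) (h : ahom A (shift X))
    (l : ahom Y D) (i : ahom D (shift B)),
  [/\ hspan (eq k) A, hspan (eq (k + 1)) D, dist u' j h, dist v l i & good u' -> good v -> good u].
Proof.
move=> d sC; have [A [D [i1 [i2 [p1 [p2 [sA sD b]]]]]]] := hspan_split (fun l => l = k) sC.
have {}sA : hspan (eq k) A by apply: (hspan_sub _ sA) => l [].
have {}sD : hspan (eq (k + 1)) D by apply: (hspan_sub _ sD) => l; lia.
have [|B [u' [v [j [h [l [i [d1 d2 g]]]]]]]] := cut d (bip2_dist (T := KT) b).
  by apply: (hom_far sD sA) => _ _ <- <-; split; lia.
by exists A, D, B, u', v, j, h, l, i.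
Qed.

(** The triangle on [u'] has outer terms [X] and [A] of index [k]. The one on [v] rotates back to
    [D' -> B -> Y] with [D'] again of index [k]. Both are covered by [base_good]. *)
Lemma heart_good k X Y (u : ahom X Y) : hspan (eq k) X -> hspan (eq k) Y -> good u.
Proof.
move=> sX sY; have [C [m [n d]]] := dist_complete u.
have sY' : hspan (fun l => l = k \/ l = k + 1) Y by apply: (hspan_sub _ sY) => l; lia.
have [A [D [B [u' [v [j [h [l [i [sA sD d1 d2 g]]]]]]]]]] := cone_cut d (cone_span d sX sY').
have [gu sB] := base_good d1 sX sA; apply: g => //.
have [D' [t [r dt]]] := dist_cocomplete v.
have [c [ci _ _]] := cone_uniq d2 (dist_rotl dt).
have sD' : hspan (eq k) D' by apply: hspan_unshift; exact: (hspan_iso ci sD).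
by apply/(good_rot dt); have [] := base_good dt sD' sY.
Qed.

(** Summands of [Y] of index other than [k] and [k + 1] receive no map from [X] and are split off.
    After the cone is cut, [v] rotates to a map between objects of index [k + 1]. *)
Lemma source_good k X Y (u : ahom X Y) : hspan (eq k) X -> good u.
Proof.
move=> sX; have [Y1 [R [i1 [i2 [p1 [p2 [sY sR b]]]]]]] :=
  hspan_split (fun l => l = k \/ l = k + 1) (all_ Y).
have {}sY : hspan (fun l => l = k \/ l = k + 1) Y1 by apply: (hspan_sub _ sY) => l [].
have p2u : p2 \oc u = 0 by apply: (hom_far sX sR) => _ l <- [_ h]; split; lia.
suff g : good (p1 \oc u).
  have [h1 h2 h3 h4 h5] := b.
  apply: (good_iso (aiso_id X) (bip2_iso b) _ (good_inj1 (R := R) g)).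
  rewrite acomp1r acompDl !acompA prj1_inj1_ prj2_inj1_ !acomp0l addr0.
  by rewrite -[RHS]acomp1l -h5 acompDl -[i2 \oc _ \oc _]acompA p2u acomp0r addr0.
move: (p1 \oc u) => {p2u} u1; have [C [m [n d]]] := dist_complete (u1 : @ahom KT _ _).
have [A [D [B [u' [v [j [h [l [i [sA sD d1 d2 g]]]]]]]]]] := cone_cut d (cone_span d sX sY).
have [gu sB] := base_good d1 sX sA; apply: g => //.
apply/(good_rot d2)/(good_rot (dist_rotl d2)); apply: (heart_good (k := k + 1)) => //.
by apply: (hspan_sub _ (hspan_shift sB)) => j' /= ->; rewrite subrK.
Qed.

Lemma hspan_bounded (X : HK) : hspan (fun=> True) X ->
  exists n : nat, hspan (fun k => (`|k| < n)%N) X.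
Proof.
elim=> {X} [|x _|X Y _ [n sX] _ [m sY]|X Y f fi _ [n sX]].
- by exists 0%N; exact: hspan_zero.
- by exists `|sk x|.+1; apply: hspan_ho; exact: ltnSn.
- exists (n + m)%N; apply: hspan_plus.
    by apply: (hspan_sub _ sX) => k; lia.
  by apply: (hspan_sub _ sY) => k; lia.
by exists n; exact: hspan_iso fi sX.
Qed.

(** Induction on the length of an interval of indices containing those of the cone. Cutting off the
    top index leaves a map with a shorter cone and a map whose cone has a single index; the latter
    rotates to a map covered by [source_good]. *)
Theorem all_good X Y (u : ahom X Y) : good u.
Proof.
have [C [m [n d]]] := dist_complete u.
have [N sC] := hspan_bounded (all_ C).
(* The interval from [- N] to [N] has [N + N + 1] indices; with this count the base case of the
   induction is a single index. *)
have {}sC : hspan (fun k : int => - N%:Z <= k < - N%:Z + (N + N).+1%:Z) C.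
  by apply: (hspan_sub _ sC) => k; lia.
move: (N + N)%N (- N%:Z) sC => {N} N a.
elim: N X Y C u m n d => [|N IH] X Y C u m n d sC.
  have {}sC : hspan (eq a) C by apply: (hspan_sub _ sC) => k; lia.
  by apply/(good_rot d)/(good_rot (dist_rotl d)); exact: (source_good (k := a)).
have [A [D [i1 [i2 [p1 [p2 [sA sD b]]]]]]] := hspan_split (fun k : int => k < a + N.+1%:Z) sC.
have {}sD : hspan (eq (a + N.+1%:Z)) D by apply: (hspan_sub _ sD) => l; lia.
have [|B [u' [v [j [h [l [i [d1 d2 g]]]]]]]] := cut d (bip2_dist (T := KT) b).
  by apply: (hom_far sD sA) => _ l <- [h1 h2]; split; lia.
apply: g; first by apply: (IH _ _ _ _ _ _ d1); apply: (hspan_sub _ sA) => k; lia.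
by apply/(good_rot d2)/(good_rot (dist_rotl d2)); exact: (source_good sD).
Qed.

End Exactness.

(** * The equivalence between twisted complexes and [T] *)

Section Equivalence.
Variables (K : fieldType) (T : linear_triangulated_category K) (E : bool -> T).
Hypothesis E_neq : forall (a b : bool) (n : int) (f : ahom (E a) (shiftz n (E b))),
  n != 0 -> f = 0.
Hypothesis E_21 : forall f : ahom (E true) (E false), f = 0.
Hypothesis E_end : forall (a : bool) (f : ahom (E a) (E a)), f = 0 \/ aiso f.
Hypothesis E_gen : forall X : T, generated E X.

Local Notation HK := (kt_add E).
Local Notation KT := (kt_tri E).
Local Notation thom X Y := (ahom (tcar X) (tcar Y)).
Local Notation Fo := (Fo E_21 E_end).
Local Notation FM := (FM E_21 E_end).
Local Notation Feps := (Feps E_neq E_21 E_end).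
Local Notation FM_id := (FM_id E_neq E_21 E_end).
Local Notation FM_comp := (FM_comp E_neq E_21 E_end).

Lemma FM_dist (X Y Z : KT) (u : ahom X Y) (v : ahom Y Z) (w : ahom Z (shift X)) :
  dist u v w -> dist (FM u) (FM v) (Feps X \oc FM w).
Proof. exact: (all_good E_neq E_21 E_end). Qed.

Lemma FM_iso (X Y : KT) (f : ahom X Y) : aiso f -> aiso (FM f).
Proof. exact: (Fm_iso E_neq). Qed.

(** The essential image is a triangulated subcategory: fullness lifts the maps whose cones are
    needed. It contains both generators, which are cones of degenerate two-term complexes. *)
Lemma FM_es (Y : T) : exists (X : KT) (f : ahom (Fo X) Y), aiso f.
Proof.
apply: (@E_gen Y (fun Y => exists (X : KT) (f : ahom (Fo X) Y), aiso f)).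
- split=> [|X Y' f fi [X' [g gi]]|X [X' [g gi]]|X [X' [g gi]]
    |X Y' Z u v w d [X' [f fi]] [Y1 [g gi]]].
  + exists azero, 0; apply: iso_id0; last exact: aid_azero.
    by rewrite -FM_id aid_azero; exact: (Fm0 E_neq).
  + by exists X', (f \oc g); exact: aiso_comp.
  + exists (shift X'), (sh g \oc Feps X'); apply: aiso_comp; first exact: sh_iso.
    exact: Feps_iso.
  + have [r [r1 r2]] := (aisoP _).1 (unshiftK_iso X).
    have [h hE] := sh_full (r \oc g \oc FM (unshiftK X') \oc
      sval (cid ((aisoP _).1 (Feps_iso E_neq E_21 E_end (unshift X'))))).
    exists (unshift X'), h; apply: sh_isoE; rewrite hE; case: cid => s [s1 s2] /=.
    apply: aiso_comp; last by apply/aisoP; exists (Feps (unshift X')).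
    apply: aiso_comp; last exact: FM_iso (unshiftK_iso _).
    by apply: aiso_comp => //; apply/aisoP; exists (unshiftK X).
  have [g' [g1 g2]] := (aisoP _).1 gi.
  have [u' u'E] := FM_full E_neq (E_21 := E_21) (E_end := E_end) (g' \oc u \oc f).
  have [C [m [n dC]]] := dist_complete u'.
  have [|h [hi _ _]] := dist_mor_iso (FM_dist dC) d fi gi.
    by rewrite u'E !acompA g2 acomp1l.
  by exists C, h.
case.
  (* [E true] is the cone of [0 -> E true]. *)
  pose x := ShKron 0 (Kron (addE_zero E false) (addE_one E true) 0).
  have ci : aiso (cb x).
    apply: (cone0_iso (dist_rotl (cdist x))); apply: sh_id0.
    exact: aid_azero.
  have [s [s1 s2]] := (aisoP _).1 ci.
  exists (ho x), (s \oc Fal E_21 E_end x); apply: aiso_comp; last exact: Fal_iso.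
  by apply/aisoP; exists (cb x).
(* The cone of [E false -> 0] is the shift of [E false], hence the index -1. *)
pose x := ShKron (-1) (Kron (addE_one E false) (addE_zero E true) 0).
have ci : aiso (cp x).
  apply: (mid0_iso (cdist x)); rewrite -zf_id (_ : aid _ = 0) ?zf0 //.
  exact: aid_azero.
have e : -1 + 1 = 0 :> int by [].
exists (ho x), (zsig (-1) (E false) \oc cp x \oc Fal E_21 E_end x).
apply: aiso_comp; last exact: Fal_iso.
by apply: aiso_comp => //; exact: zsig_iso.
Qed.

Definition kt_equivalence : exact_equivalence KT T.
Proof.
refine (@ExactEquivalence KT T (Ff E_neq E_21 E_end) _ FM_es
  (fun X => Feps X) (Feps_iso E_neq E_21 E_end) _ FM_dist).
- split=> [X Y f g|X Y h]; [exact: (Fm_inj E_neq)|exact: (Fm_full E_neq)].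
- move=> X Y f; exact: (Feps_nat E_neq E_21 E_end f).
Defined.

Theorem generated_algebraic : algebraic T.
Proof.
exists (tw_frobenius E); constructor.
exact: comp_equivalence (stable_equivalence E) kt_equivalence.
Qed.

Lemma FM_lin (X Y : KT) (c : K) (m m' : thom X Y) (cm : chain m) (cm' : chain m')
    (cl : chain (lscale c m + m')) :
  FM (kcl cl) = lscale c (FM (kcl cm)) + FM (kcl cm').
Proof.
apply: F_ext => k l.
rewrite acompDr acompDl -lscale_compr -lscale_compl !FmE.
have [[i0 [ci iE]] [p0 [cp pE]]] := conj (kcl_surj (di (d := dec E_21 E_end X) l))
  (kcl_surj (dp (d := dec E_21 E_end Y) k)).

have cE : p0 \oc (lscale c m + m') \oc i0 = lscale c (p0 \oc m \oc i0) + p0 \oc m' \oc i0.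
  by rewrite acompDr acompDl lscale_compl lscale_compr.
have c3 : chain (lscale c (p0 \oc m \oc i0) + p0 \oc m' \oc i0).
  by rewrite -cE; exact: (chain_comp (chain_comp cp cl) ci).
rewrite iE pE !kclM; transitivity (tau (kcl c3 : ahom (ho (dx l) : HK) (ho (dx k)))).
  by congr tau; exact: kcl_eq1.
exact: (tau_lin E_neq E_21 _ _ c3).
Qed.

End Equivalence.

(** * Hom modules *)

Section Coordinates.
Variables (K : fieldType) (V : lmodType K).
Hypothesis V_fin : finite_dimensional V.
Variable P : V -> Prop.
Hypothesis P0 : P 0.
Hypothesis P_lin : forall c u v, P u -> P v -> P (c *: u + v).

Definition lcomb (n : nat) (e : 'I_n -> V) (r : 'rV[K]_n) : V := \sum_i r 0 i *: e i.

Lemma lcomb_lin n (e : 'I_n -> V) c r s : lcomb e (c *: r + s) = c *: lcomb e r + lcomb e s.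
Proof.
rewrite /lcomb scaler_sumr -big_split; apply: eq_bigr => i _.
by rewrite !mxE scalerDl scalerA.
Qed.

Lemma lcomb_mul n m (e : 'I_n -> V) (f : 'I_m -> V) (A : 'M[K]_(m, n)) (r : 'rV[K]_m) :
  (forall i, f i = lcomb e (row i A)) -> lcomb f r = lcomb e (r *m A).
Proof.
move=> fE; rewrite /lcomb; under eq_bigr => i _ do rewrite fE scaler_sumr.
rewrite exchange_big; apply: eq_bigr => j _; rewrite mxE scaler_suml.
by apply: eq_bigr => i _; rewrite mxE scalerA.
Qed.

Lemma lcomb0 n (e : 'I_n -> V) : lcomb e 0 = 0.
Proof. by rewrite /lcomb big1 // => i _; rewrite mxE scale0r. Qed.

Definition lfree m := exists e : 'I_m -> V, (forall i, P (e i)) /\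
  (forall r, lcomb e r = 0 -> r = 0).

(** A maximal independent family in [P]. Its length is bounded because the matrix of coordinates
    with respect to a spanning family of [V] is row free. *)
Lemma basis_ex : exists (m : nat) (e : 'I_m -> V),
  [/\ forall r, P (lcomb e r), forall r, lcomb e r = 0 -> r = 0
    & forall v, P v -> exists r, lcomb e r = v].
Proof.
have [n [b bE]] := V_fin.
have bd m : `[< lfree m >] -> (m <= n)%N.
  move=> /asboolP[e [_ e_inj]].
  pose A := \matrix_(i < m, j < n) (sval (cid (bE (e i)))) j.
  have fE i : e i = lcomb b (row i A).
    rewrite /lcomb [LHS](svalP (cid (bE (e i)))); apply: eq_bigr => j _.
    by rewrite !mxE.
  have : row_free A.
    rewrite -kermx_eq0; apply/rowV0P => u /sub_kermxP uA.
    by apply: e_inj; rewrite (lcomb_mul _ fE) uA lcomb0.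
  by rewrite /row_free => /eqP <-; exact: rank_leq_col.
have ex0 : exists m, `[< lfree m >].
  by exists 0%N; apply/asboolP; exists (fun=> 0); split=> [[]|r _] //; apply/rowP => -[].
have [m /asboolP[e [eP e_inj]] mx] := ex_maxnP ex0 bd.
exists m, e; split=> // [r|v Pv].
  rewrite /lcomb; elim/big_rec: _ => // i x _ Px; exact: P_lin.
apply: contrapT => nv.
have : (m.+1 <= m)%N; last by rewrite ltnn.
apply: mx; apply/asboolP.
exists (fun i => if unlift ord0 i is Some j then e j else v); split=> [i|r].
  by case: unlift.
rewrite /lcomb big_ord_recl unlift_none.
under eq_bigr => i _ do rewrite liftK.
pose r' : 'rV[K]_m := \row_j r 0 (lift ord0 j).
have -> : \sum_(i < m) r 0 (lift ord0 i) *: e i = lcomb e r'.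
  by apply: eq_bigr => i _; rewrite mxE.
have [z|nz] := eqVneq (r 0 ord0) 0.
  rewrite z scale0r add0r => /e_inj r0; apply/rowP => i; rewrite mxE.
  case: (unliftP ord0 i) => [j ->|-> //].
  by have := congr1 (fun f : 'rV_m => f 0 j) r0; rewrite !mxE.
move=> e0; case: nv; exists (- (r 0 ord0)^-1 *: r').
have := lcomb_lin e (- (r 0 ord0)^-1) r' 0; rewrite !addr0 => ->.
rewrite lcomb0 addr0; apply: (scalerI nz); rewrite scalerA mulrN divff // scaleN1r.
by apply/eqP; rewrite eq_sym -subr_eq0 opprK; apply/eqP.
Qed.

End Coordinates.

Lemma fd_fin (K : fieldType) (V : lmodType K) (I : finType) (e : I -> V) :
  (forall v, exists c : I -> K, v = \sum_i c i *: e i) -> finite_dimensional V.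
Proof.
move=> h; exists #|I|, (fun i => e (enum_val i)) => v; have [c ->] := h v.
exists (fun i => c (enum_val i)); rewrite (reindex (@enum_val I xpredT)) //=.
exists enum_rank => i _; [exact: enum_valK|exact: enum_rankK].
Qed.

Section LambdaModules.
Variables (K : fieldType) (T : linear_triangulated_category K) (E : bool -> T).
Hypothesis E_fd : forall l l', finite_dimensional (lhom (E l) (E l')).

Local Notation E0 := (oplus (E false) (E true)).
Local Notation A := (endo_algebra E0).
Local Notation tw := (tw E).
Local Notation thom X Y := (ahom (tcar X) (tcar Y)).

Definition ein (l : bool) : ahom (E l) E0 :=
  match l with false => inj1 _ _ | true => inj2 _ _ end.
Definition epr (l : bool) : ahom E0 (E l) :=
  match l with false => prj1 _ _ | true => prj2 _ _ end.

Lemma epr_ein l : epr l \oc ein l = aid _.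
Proof. by case: l; rewrite /= ?prj1_inj1 ?prj2_inj2. Qed.

Lemma ein_epr : \sum_l (ein l \oc epr l) = aid E0.
Proof. by rewrite big_bool /= addrC oplus_id. Qed.

(** Spanned by the composites that pass from a summand of [E0] to a cell of [X] by a member of a
    finite spanning family of maps. *)
Lemma tw_fd (X : tw) : finite_dimensional (lhom E0 (tcar X)).
Proof.
have [I [l [k [ij [pj [[h1 h2 h3] _]]]]]] := thon X.
pose n a b := sval (cid (E_fd a b)).
pose e a b : 'I_(n a b) -> lhom (E a) (E b) := sval (cid (svalP (cid (E_fd a b)))).
have eE a b (v : lhom (E a) (E b)) : exists c : 'I_(n a b) -> K, v = \sum_j c j *: e a b j.
  exact: (svalP (cid (svalP (cid (E_fd a b)))) v).
pose J : finType := {p : (I * bool)%type & 'I_(n p.2 (l p.1))}.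
apply: (@fd_fin _ (lhom E0 (tcar X)) J (fun j => ij (tag j).1 \oc e _ _ (tagged j) \oc epr (tag j).2)) => v.
pose c (i : I) (a : bool) := sval (cid (eE a (l i) (pj i \oc v \oc ein a))).
have cE i a : pj i \oc v \oc ein a = \sum_j c i a j *: e a (l i) j.
  by rewrite /c; case: cid.
exists (fun j : J => c (tag j).1 (tag j).2 (tagged j)).
rewrite -(@sig_big_dep _ 0 +%R _ _ xpredT (fun _ _ => true)
  (fun p j => (c p.1 p.2 j *: (ij p.1 \oc e _ _ j \oc epr p.2 : lhom E0 (tcar X))))).
rewrite -(pair_bigA _ (fun i a => \sum_j c i a j *: (ij i \oc e a (l i) j \oc epr a : lhom E0 (tcar X)))) /=.
rewrite -[LHS]acomp1l -h3 acomp_suml; apply: eq_bigr => i _.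
rewrite -[LHS]acomp1r -ein_epr acomp_sumr; apply: eq_bigr => a _.
transitivity (ij i \oc (pj i \oc v \oc ein a) \oc epr a); first by rewrite !acompA.
rewrite cE acomp_sumr acomp_suml; apply: eq_bigr => j _.
by rewrite -lscale_compr -lscale_compl.
Qed.

(* The right module of the maps [v : E0 -> S] with [p \oc v = v], written in
   coordinates because modules are carried by a [vectType]. *)
Section Module.
Variables (S : T) (S_fd : finite_dimensional (lhom E0 S)) (p : ahom S S).

Definition lpred (v : lhom E0 S) : Prop := p \oc v = v.

Lemma lpred0 : lpred 0. Proof. exact: acomp0r. Qed.
Lemma lpred_lin c u v : lpred u -> lpred v -> lpred (c *: u + v).
Proof.
move=> hu hv; rewrite /lpred acompDr hv; congr (_ + _).
transitivity (lscale c (p \oc u)); last by rewrite hu.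
by symmetry; exact: lscale_compr.
Qed.

Definition lb_ex := cid (basis_ex S_fd lpred0 lpred_lin).
Definition ldim : nat := sval lb_ex.
Definition lbas : 'I_ldim -> lhom E0 S := sval (cid (svalP lb_ex)).
Lemma lbasP : [/\ forall r, lpred (lcomb lbas r), forall r, lcomb lbas r = 0 -> r = 0
    & forall v, lpred v -> exists r, lcomb lbas r = v].
Proof. exact: svalP (cid (svalP lb_ex)). Qed.

Definition lv (r : 'rV[K]_ldim) : ahom E0 S := lcomb lbas r.

Lemma lvP r : p \oc lv r = lv r. Proof. by case: lbasP => h _ _; exact: h. Qed.
Lemma lv_lin c r s : lv (c *: r + s) = lscale c (lv r) + lv s.
Proof. exact: (lcomb_lin lbas). Qed.
Lemma lv0 : lv 0 = 0. Proof. exact: (lcomb0 lbas). Qed.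
Lemma lvD r s : lv (r + s) = lv r + lv s.
Proof. by have := lv_lin 1 r s; rewrite scale1r lscale1. Qed.
Lemma lvN r : lv (- r) = - lv r.
Proof. by apply: (addIr (lv r)); rewrite -lvD !addNr lv0. Qed.
Lemma lvB r s : lv (r - s) = lv r - lv s. Proof. by rewrite lvD lvN. Qed.
Lemma lv_inj r s : lv r = lv s -> r = s.
Proof.
move=> e; apply/eqP; rewrite -subr_eq0; apply/eqP; case: lbasP => _ h _; apply: h.
by rewrite -[LHS]/(lv _) lvB e subrr.
Qed.

(** The value 0 outside [lpred] is a mere default. *)
Definition lc (v : ahom E0 S) : 'rV[K]_ldim :=
  if pselect (lpred v) is left h then sval (cid ((let: And3 _ _ f := lbasP in f) v h)) else 0.

Lemma lcK v : p \oc v = v -> lv (lc v) = v.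
Proof. by rewrite /lc => h; case: pselect => // h'; case: cid. Qed.

Lemma lpred_act r (a : ahom E0 E0) : p \oc (lv r \oc a) = lv r \oc a.
Proof. by rewrite acompA lvP. Qed.

Definition lact (r : 'rV[K]_ldim) (a : ahom E0 E0) : 'rV[K]_ldim := lc (lv r \oc a).

Lemma lv_act r a : lv (lact r a) = lv r \oc a.
Proof. by rewrite lcK // lpred_act. Qed.

Lemma lact_linl a : linear (lact^~ a).
Proof.
move=> c r s; apply: lv_inj; rewrite lv_act !lv_lin !lv_act acompDl.
by rewrite lscale_compl.
Qed.
Lemma lact_addr r a b : lact r (a + b) = lact r a + lact r b.
Proof. by apply: lv_inj; rewrite lvD !lv_act acompDr. Qed.
Lemma lact_in r c : lact r (kalg_in A c) = c *: r.
Proof.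
apply: lv_inj; rewrite lv_act; have := lv_lin c r 0; rewrite !addr0 lv0 addr0 => ->.
transitivity (lscale c (lv r \oc aid E0)); last by rewrite acomp1r.
by rewrite lscale_compr.
Qed.
Lemma lactM r a b : lact r (a \oc b) = lact (lact r a) b.
Proof. by apply: lv_inj; rewrite !lv_act acompA. Qed.

Definition lmod : fdmod A :=
  @FdMod K A 'rV[K]_ldim lact lact_linl lact_addr lact_in lactM.

Lemma lv_sum (I : Type) (r : seq I) (Q : pred I) (f : I -> lmod) :
  lv (\sum_(i <- r | Q i) f i) = \sum_(i <- r | Q i) lv (f i).
Proof. by elim/big_rec2: _ => [|i y x _ <-]; [exact: lv0 | exact: lvD]. Qed.

Lemma mhom_to (M : fdmod A) (g : M -> ahom E0 S) :
  (forall c x y, g (c *: x + y) = lscale c (g x) + g y) ->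
  (forall x a, g (act x a) = g x \oc a) -> (forall x, p \oc g x = g x) ->
  exists f : mhom M lmod, forall x, lv (f x) = g x.
Proof.
move=> g1 g2 g3.
have fl : linear (fun x : M => lc (g x) : lmod).
  by move=> c x y; apply: lv_inj; rewrite lv_lin !lcK.
have fa x a : lc (g (act x a)) = act (lc (g x) : lmod) a.
  by apply: lv_inj; rewrite lcK // g2 [RHS]lv_act lcK.
by exists (MHom fl fa) => x /=; rewrite lcK.
Qed.
End Module.

Definition Lam_deg (X : tw) (n : int) : fdmod A := lmod (tw_fd X) (tpi X n).

End LambdaModules.

(** * Homotopies and quasi-isomorphisms of complexes *)

Lemma int_succ_ind (P : int -> Prop) : (forall n, P (n + 1)) -> forall n, P n.
Proof. by move=> h n; rewrite -(subrK 1 n). Qed.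

(** Data constructed in degrees of the form [n + 1] are carried to all degrees; the cast along
    [n - 1 + 1 = n] stays inside this proof and disappears at [n + 1]. *)
Lemma int_reindex (P : int -> Type) (a : forall n, P (n + 1)) :
  exists f : forall n, P n, forall n, f (n + 1) = a n.
Proof.
exists (fun n => eq_rect (n - 1 + 1) P (a (n - 1)) n (subrK 1 n)) => n.
move: (subrK 1 (n + 1)); have -> : n + 1 - 1 = n by rewrite addrK.
by move=> e; rewrite (Prop_irrelevance e erefl).
Qed.

Section Complexes.
Variables (K : fieldType) (A : kalgebra K).
Implicit Types X Y Z N : bcomplex A.

Lemma mhom_sum (M N : fdmod A) (f : mhom M N) (I : Type) (r : seq I) (P : pred I) (F : I -> M) :
  f (\sum_(i <- r | P i) F i) = \sum_(i <- r | P i) f (F i).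
Proof. by elim/big_rec2: _ => [|i y x _ <-]; [exact: mhom0 | exact: mhomD]. Qed.

Lemma mhomB (M N : fdmod A) (f : mhom M N) x y : f (x - y) = f x - f y.
Proof. by rewrite mhomD mhomN. Qed.

Definition mhom_sub (M N : fdmod A) (f g : mhom M N) : mhom M N := mhom_lin (-1) g f.
Lemma mhom_subE (M N : fdmod A) (f g : mhom M N) x : mhom_sub f g x = f x - g x.
Proof. by rewrite /= scaleN1r addrC. Qed.

Definition mhom_add (M N : fdmod A) (f g : mhom M N) : mhom M N := mhom_lin 1 f g.
Lemma mhom_addE (M N : fdmod A) (f g : mhom M N) x : mhom_add f g x = f x + g x.
Proof. by rewrite /= scale1r. Qed.

Definition cmap_sub X Y (f g : cmap X Y) : cmap X Y := cmap_lin (-1) g f.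
Lemma cmap_subE X Y (f g : cmap X Y) n x : cmap_sub f g n x = f n x - g n x.
Proof. by rewrite /= scaleN1r addrC. Qed.

Definition cnull X Y (f : cmap X Y) : Prop :=
  exists h : forall n, mhom (X (n + 1)) (Y n), forall n x,
    f (n + 1) x = cd Y n (h n x) + h (n + 1) (cd X (n + 1) x).

Definition chtp X Y (f g : cmap X Y) : Prop := cnull (cmap_sub f g).

Lemma cnull_eq X Y (f g : cmap X Y) : cmap_eq f g -> cnull f -> cnull g.
Proof. by move=> e [h hE]; exists h => n x; rewrite -e hE. Qed.

Lemma cnull_lin X Y c (f g : cmap X Y) : cnull f -> cnull g -> cnull (cmap_lin c f g).
Proof.
move=> [h hE] [k kE]; exists (fun n => mhom_lin c (h n) (k n)) => n x /=.
by rewrite hE kE mhomD mhomZ scalerDr addrACA.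
Qed.

Lemma cnull_compl X Y Z (g : cmap Y Z) (f : cmap X Y) : cnull f -> cnull (cmap_comp g f).
Proof.
move=> [h hE]; exists (fun n => mhom_comp (g n) (h n)) => n x /=.
by rewrite hE mhomD cfunE.
Qed.

Lemma cnull_compr X Y Z (g : cmap Y Z) (f : cmap X Y) : cnull g -> cnull (cmap_comp g f).
Proof.
move=> [h hE]; exists (fun n => mhom_comp (h n) (f (n + 1))) => n x /=.
by rewrite hE cfunE.
Qed.

Lemma chtp_refl X Y (f g : cmap X Y) : cmap_eq f g -> chtp f g.
Proof.
have [z0 z1] : (exists z : forall n, mhom (X (n + 1)) (Y n), forall n x, z n x = 0) /\ True.
  split=> //; have z1 n : linear (fun _ : X (n + 1) => 0 : Y n) by move=> c x y; rewrite scaler0 addr0.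
  have z2 n (v : X (n + 1)) a : 0 = act (0 : Y n) a by rewrite act0.
  by exists (fun n => MHom (z1 n) (z2 n)).
move=> e; have [z zE] := z0; exists z => n x; rewrite cmap_subE e subrr !zE mhom0 addr0 //.
Qed.

Lemma chtp_sym X Y (f g : cmap X Y) : chtp f g -> chtp g f.
Proof.
move=> h; have z : chtp f f by apply: chtp_refl.
apply: cnull_eq (cnull_lin (-1) h z) => n x /=.
by rewrite !scaleN1r addNr addr0 opprD opprK addrC.
Qed.

Lemma chtp_trans X Y (f g k : cmap X Y) : chtp f g -> chtp g k -> chtp f k.
Proof.
move=> h1 h2; apply: cnull_eq (cnull_lin 1 h1 h2) => n x /=.
by rewrite !scaleN1r scale1r addrC addrA addrK.
Qed.

Lemma chtp_compl X Y Z (g : cmap Y Z) (f f' : cmap X Y) :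
  chtp f f' -> chtp (cmap_comp g f) (cmap_comp g f').
Proof.
move=> h; apply: cnull_eq (cnull_compl g h) => n x.
by rewrite [LHS]/= mhomD mhomZ.
Qed.

Lemma chtp_compr X Y Z (g g' : cmap Y Z) (f : cmap X Y) :
  chtp g g' -> chtp (cmap_comp g f) (cmap_comp g' f).
Proof. by move=> h; apply: cnull_eq (cnull_compr f h). Qed.

Lemma chtp_lin X Y c (f f' g g' : cmap X Y) : chtp f f' -> chtp g g' ->
  chtp (cmap_lin c f g) (cmap_lin c f' g').
Proof.
move=> h1 h2; apply: cnull_eq (cnull_lin c h1 h2) => n x /=.
by rewrite !scaleN1r scalerDr scalerN opprD addrACA.
Qed.

Definition acyclic N := forall n (x : N (n + 1)), cd N (n + 1) x = 0 -> exists y : N n, x = cd N n y.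

Lemma qis_cone X Y (s : cmap X Y) : quasi_iso s -> acyclic (cone s).
Proof.
move=> qs n [m y] /= [/eqP]; rewrite oppr_eq0 => /eqP dm sm.
have [inj _] := qs (n + 1); have [_ sur] := qs n.
have [|z mE] := inj m dm.
  by exists (- y); rewrite mhomN; apply/eqP; rewrite -addr_eq0; apply/eqP.
have [|x' [w [dx' yE]]] := sur (y + s (n + 1) z).
  by rewrite mhomD -cfunE -mE [LHS]addrC.
exists (x' - z, w) => /=; congr pair.
  by rewrite mhomB dx' sub0r opprK.
by rewrite mhomB [RHS]addrAC -yE addrK.
Qed.

Lemma qis_comp X Y Z (g : cmap Y Z) (f : cmap X Y) :
  quasi_iso g -> quasi_iso f -> quasi_iso (cmap_comp g f).
Proof.
move=> qg qf n; have [gi gs] := qg n; have [fi fs] := qf n; split=> [x dx|z dz].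
  by move=> e; apply: (fi _ dx); apply: gi e; rewrite -cfunE dx mhom0.
have [y [w [dy ->]]] := gs z dz; have [x [v [dx ->]]] := fs y dy.
by exists x, (g n v + w); split=> //; rewrite /= !mhomD cfunE addrA.
Qed.

(* Homotopic maps become equal in the derived category: both factor through the
   cylinder, whose two inclusions are sections of the same quasi-isomorphism. *)
Section Cylinder.
Variable X : bcomplex A.

Program Definition cyl_d (n : int) :
  mhom (mprod (X (n + 1)) (mprod (X n) (X n)))
       (mprod (X (n + 1 + 1)) (mprod (X (n + 1)) (X (n + 1)))) :=
  @MHom _ _ (mprod (X (n + 1)) (mprod (X n) (X n)))
       (mprod (X (n + 1 + 1)) (mprod (X (n + 1)) (X (n + 1))))
    (fun v => (- cd X (n + 1) v.1, (cd X n v.2.1 + v.1, cd X n v.2.2 - v.1))) _ _.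
Next Obligation.
move=> n c [u [a b]] [u' [a' b']] /=; rewrite !mfun_lin; congr (_, (_, _)) => /=.
- by rewrite opprD -scalerN.
- by rewrite scalerDr addrACA.
- by rewrite opprD scalerDr scalerN addrACA.
Qed.
Next Obligation.
by move=> n [u [a b]] r /=; rewrite !mfun_act !actD -!scaleN1r !actZ.
Qed.

Program Definition cyl : bcomplex A :=
  @BComplex _ _ (fun n => mprod (X (n + 1)) (mprod (X n) (X n))) cyl_d _ _.
Next Obligation.
move=> n [u [a b]] /=; rewrite !mhomN !mhomD !mhomN !cdd oppr0 !add0r oppr0.
by congr (_, (_, _)); rewrite /= ?opprK ?addNr ?addrN.
Qed.
Next Obligation.
have [N hN] := cx_bounded X; exists N.+1 => n hn [u [a b]].
by congr (_, (_, _)); apply: hN; move: hn; lia.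
Qed.

Program Definition cyl_in1 : cmap X cyl :=
  @CMap _ _ X cyl (fun n => @MHom _ _ (X n) (cyl n) (fun x => (0, (x, 0))) _ _) _.
Next Obligation. by move=> n c u v; congr (_, (_, _)); rewrite /= scaler0 addr0. Qed.
Next Obligation. by move=> n v a /=; rewrite !act0. Qed.
Next Obligation. by move=> n y /=; rewrite !mhom0 oppr0 addr0 subr0. Qed.

Program Definition cyl_in2 : cmap X cyl :=
  @CMap _ _ X cyl (fun n => @MHom _ _ (X n) (cyl n) (fun x => (0, (0, x))) _ _) _.
Next Obligation. by move=> n c u v; congr (_, (_, _)); rewrite /= scaler0 addr0. Qed.
Next Obligation. by move=> n v a /=; rewrite !act0. Qed.
Next Obligation. by move=> n y /=; rewrite !mhom0 oppr0 addr0 subr0. Qed.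

Program Definition cyl_out : cmap cyl X :=
  @CMap _ _ cyl X (fun n => @MHom _ _ (cyl n) (X n) (fun v => v.2.1 + v.2.2) _ _) _.
Next Obligation. by move=> n c [u [a b]] [u' [a' b']] /=; rewrite scalerDr addrACA. Qed.
Next Obligation. by move=> n [u [a b]] r /=; rewrite actD. Qed.
Next Obligation. by move=> n [u [a b]] /=; rewrite mhomD addrACA subrr addr0. Qed.

Lemma cyl_qis : quasi_iso cyl_out.
Proof.
move=> n; split=> [[u [a b]] [/eqP]|y dy].
  rewrite oppr_eq0 => /eqP du da db [y /= yE].
  exists (a, (0, y)) => /=; congr (_, (_, _)).
  - by rewrite -[LHS]opprK; congr (- _); apply/eqP; rewrite eq_sym -addr_eq0; apply/eqP.
  - by rewrite mhom0 add0r.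
  - by rewrite -yE [RHS]addrAC addrN add0r.
exists (0, (y, 0)), 0; rewrite /= dy !mhom0 oppr0 !addr0 subr0; split=> //.
Qed.

Variables (Y : bcomplex A) (f g : cmap X Y) (h : forall n, mhom (X (n + 1)) (Y n)).
Hypothesis hE : forall n x, cmap_sub f g (n + 1) x = cd Y n (h n x) + h (n + 1) (cd X (n + 1) x).

Lemma cyl_H_lin n : linear (fun v : cyl n => f n v.2.1 + g n v.2.2 + h n v.1).
Proof.
move=> c [u [a b]] [u' [a' b']] /=; rewrite !mfun_lin !scalerDr.
by rewrite [RHS]addrACA; congr (_ + _); rewrite addrACA.
Qed.

Lemma cyl_H_act n (v : cyl n) a : f n (act v a).2.1 + g n (act v a).2.2 + h n (act v a).1
  = act (f n v.2.1 + g n v.2.2 + h n v.1) a.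
Proof. by rewrite /= !mfun_act !actD. Qed.

Lemma cyl_H_d n (v : cyl n) : f (n + 1) (cyl_d n v).2.1 + g (n + 1) (cyl_d n v).2.2
  + h (n + 1) (cyl_d n v).1 = cd Y n (f n v.2.1 + g n v.2.2 + h n v.1).
Proof.
rewrite /= !mhomD !mhomN !cfunE.
have : cd Y n (h n v.1) = f (n + 1) v.1 - g (n + 1) v.1 - h (n + 1) (cd X (n + 1) v.1).
  by rewrite -cmap_subE hE addrK.
move=> ->; rewrite !addrA; congr (_ - _).
by congr (_ + _); exact: addrAC.
Qed.

Definition cyl_H : cmap cyl Y :=
  @CMap _ _ cyl Y (fun n => MHom (@cyl_H_lin n) (@cyl_H_act n)) cyl_H_d.
End Cylinder.

Local Notation QF f := (fmap (derived_functor A) (f : @hom (complex_cat A) _ _)).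

Lemma derived_qis X Y (s : cmap X Y) : quasi_iso s -> is_iso (QF s).
Proof.
move=> qs; exists (zz_bwd (zz_nil _ _) qs : @hom (derived_cat A) Y X); split.
  exact: zz_invr.
exact: zz_invl.
Qed.

Lemma derived_cancel X Y Z (s : cmap Y Z) (p q : @hom (derived_cat A) X Y) : quasi_iso s ->
  heq (comp (QF s) p) (comp (QF s) q) -> heq p q.
Proof.
move=> qs e; have [r [r1 r2]] := derived_qis qs.
apply: heq_trans (heq_sym (comp1l p)) _; apply: heq_trans _ (comp1l q).
apply: heq_trans (comp_heq (heq_sym r1) (heq_refl p)) _.
apply: heq_trans _ (comp_heq r1 (heq_refl q)).
apply: heq_trans (heq_sym (compA _ _ _)) _; apply: heq_trans _ (compA _ _ _).
exact: comp_heq (heq_refl r) e.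
Qed.

Lemma derived_comp X Y Z (g : cmap Y Z) (f : cmap X Y) :
  heq (QF (cmap_comp g f)) (comp (QF g) (QF f)).
Proof. exact: (fmap_comp (derived_functor A) (g : @hom (complex_cat A) _ _) f). Qed.

Lemma derived_eq X Y (f g : cmap X Y) : cmap_eq f g -> heq (QF f) (QF g).
Proof. exact: (@fmap_heq _ _ (derived_functor A) X Y f g). Qed.

Lemma derived_htp X Y (f g : cmap X Y) : chtp f g -> heq (QF f) (QF g).
Proof.
move=> [h hE].
have e12 : heq (QF (cyl_in1 X)) (QF (cyl_in2 X)).
  apply: (derived_cancel (@cyl_qis X)).
  apply: heq_trans (heq_sym (derived_comp _ _)) _; apply: heq_trans _ (derived_comp _ _).
  by apply: derived_eq => n x /=; rewrite addr0 add0r.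
have e1 : heq (QF f) (comp (QF (cyl_H hE)) (QF (cyl_in1 X))).
  apply: heq_trans _ (derived_comp _ _); apply: derived_eq => n x /=.
  by rewrite !mhom0 !addr0.
have e2 : heq (QF g) (comp (QF (cyl_H hE)) (QF (cyl_in2 X))).
  apply: heq_trans _ (derived_comp _ _); apply: derived_eq => n x /=.
  by rewrite !mhom0 addr0 add0r.
apply: heq_trans e1 _; apply: heq_trans _ (heq_sym e2).
exact: comp_heq (heq_refl _) e12.
Qed.

End Complexes.

(** * Hom complexes of twisted complexes and their K-projectivity *)

Section Lambda.
Variables (K : fieldType) (T : linear_triangulated_category K) (E : bool -> T).
Hypothesis E_fd : forall l l', finite_dimensional (lhom (E l) (E l')).
Hypothesis E_21 : forall f : ahom (E true) (E false), f = 0.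
Hypothesis E_end : forall (a : bool) (f : ahom (E a) (E a)), f = 0 \/ aiso f.

Local Notation E0 := (oplus (E false) (E true)).
Local Notation A := (endo_algebra E0).
Local Notation tw := (tw E).
Local Notation HK := (kt_add E).
Local Notation thom X Y := (ahom (tcar X) (tcar Y)).
Local Notation Lmod X n := (Lam_deg E_fd X n).

Section Lmap.
Variables (X Y : tw) (n m : int) (f : thom X Y) (h : tpi Y m \oc f = f \oc tpi X n).

Lemma lmap_ex : exists g : mhom (Lmod X n) (Lmod Y m), forall x, lv (g x) = f \oc lv x.
Proof.
apply: (@mhom_to _ _ _ _ (tw_fd E_fd Y) (tpi Y m) (Lmod X n) (fun x => f \oc lv x)).
- by move=> c x y; rewrite lv_lin acompDr lscale_compr.
- by move=> x a; rewrite -acompA; congr (_ \oc _); exact: lv_act.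
by move=> x; rewrite acompA h -acompA lvP.
Qed.
Definition lmap := sval (cid lmap_ex).
Lemma lmapE x : lv (lmap x) = f \oc lv x.
Proof. exact: (svalP (cid lmap_ex)). Qed.
End Lmap.

Lemma tpi_orth (X : tw) n m : tpi X n \oc tpi X m = if n == m then tpi X n else 0.
Proof.
have [I [l [k [ij [pj [b pE]]]]]] := thon X.
rewrite [tpi X m]pE acomp_sumr.
transitivity (\sum_(i | k i == m) if n == m then ij i \oc pj i else 0).
  apply: eq_bigr => i /eqP ki; rewrite acompA (gr_ij b pE) ki eq_sym.
  by case: ifP => // _; rewrite acomp0l.
by case: eqP => [->|_]; [rewrite pE | rewrite big1].
Qed.

Lemma lv_deg (X : tw) n m (x : Lmod X n) : n != m -> tpi X m \oc lv x = 0.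
Proof. by move=> ne; rewrite -(lvP x) acompA tpi_orth eq_sym (negPf ne) acomp0l. Qed.

Lemma Lam_bounded (X : tw) : exists N : nat, forall n : int, (N < `|n|)%N -> forall x : Lmod X n, x = 0.
Proof.
have [I [l [k [ij [pj [b pE]]]]]] := thon X.
exists (\max_i `|k i|)%N => n hn x; apply: lv_inj; rewrite lv0 -(lvP x).
apply: etrans (acomp0l _ (lv x)); congr (_ \oc _); rewrite pE big_pred0 //.
move=> i; apply/eqP => ki; move: hn; rewrite -ki ltnNge.
by rewrite (leq_bigmax (F := fun i => `|k i|%N)).
Qed.

Lemma Lam_dd (X : tw) n x : lmap (@tdeg _ _ _ X (n + 1)) (lmap (@tdeg _ _ _ X n) x) = 0.
Proof. by apply: lv_inj; rewrite !lmapE acompA tdd acomp0l lv0. Qed.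

Definition Lam (X : tw) : bcomplex A :=
  @BComplex _ _ (fun n => Lmod X n) (fun n => lmap (@tdeg _ _ _ X n)) (@Lam_dd X) (Lam_bounded X).

Lemma Lam_dE (X : tw) n (x : Lam X n) : lv (cd (Lam X) n x) = tdf X \oc lv x.
Proof. exact: lmapE. Qed.

Lemma chain_pi (X Y : tw) (f : thom X Y) (c : chain f) n : tpi Y n \oc f = f \oc tpi X n.
Proof. by have := chain_deg c n; rewrite addr0. Qed.

Lemma LamM_d (X Y : tw) (f : thom X Y) (c : chain f) n (x : Lam X n) :
  lmap (chain_pi c (n + 1)) (cd (Lam X) n x) = cd (Lam Y) n (lmap (chain_pi c n) x).
Proof. by apply: lv_inj; rewrite Lam_dE !lmapE !acompA (chain_d c). Qed.

Definition LamM (X Y : tw) (f : thom X Y) (c : chain f) : cmap (Lam X) (Lam Y) :=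
  @CMap _ _ (Lam X) (Lam Y) (fun n => lmap (chain_pi c n)) (LamM_d c).

Lemma LamME (X Y : tw) (f : thom X Y) (c : chain f) n (x : Lam X n) :
  lv (LamM c n x) = f \oc lv x.
Proof. exact: lmapE. Qed.

Lemma LamM_comp (X Y Z : tw) (g : thom Y Z) (f : thom X Y) (cg : chain g) (cf : chain f)
  (c : chain (g \oc f)) : cmap_eq (cmap_comp (LamM cg) (LamM cf)) (LamM c).
Proof. by move=> n x; apply: lv_inj; rewrite [cmap_comp _ _ _ _]/= !LamME acompA. Qed.

Lemma LamM_id (X : tw) (c : chain (aid (tcar X))) : cmap_eq (LamM c) (cmap_id (Lam X)).
Proof. by move=> n x; apply: lv_inj; rewrite LamME acomp1l. Qed.

Lemma LamM_null (X Y : tw) (f : thom X Y) (c : chain f) : nullh f -> cnull (LamM c).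
Proof.
move=> [h [dh fE]].
have hp n : tpi Y n \oc h = h \oc tpi X (n + 1) by have := dh (n + 1); rewrite addrK.
exists (fun n => lmap (hp n)) => n x; apply: lv_inj.
by rewrite lvD LamME Lam_dE !lmapE fE acompDl !acompA.
Qed.

Lemma LamM_htp (X Y : tw) (f g : thom X Y) (cf : chain f) (cg : chain g) :
  nullh (f - g) -> chtp (LamM cf) (LamM cg).
Proof.
move=> nf; have := LamM_null (chainB cf cg) nf; apply: cnull_eq => n x.
apply: lv_inj; rewrite cmap_subE lvB !LamME acompBl //.
Qed.

Section Cells.
Variables (X : tw) (I : finType) (l : I -> bool) (k : I -> int)
  (ij : forall i, ahom (E (l i)) (tcar X)) (pj : forall i, ahom (tcar X) (E (l i))).
Hypothesis b : biproduct ij pj.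
Hypothesis pE : forall n, tpi X n = \sum_(i | k i == n) (ij i \oc pj i).

(** [Lmod X n] is the sum, over the cells of degree [n], of the projective modules [e_l A], so a map
    out of it is prescribed by the images of one generator per cell; only the part of [m i] fixed by
    the idempotent matters. *)
Lemma mhom_gen_ex n (M : fdmod A) (m : I -> M) : exists g : mhom (Lmod X n) M,
  forall x, g x = \sum_(i | k i == n) act (m i) (ein E (l i) \oc (pj i \oc lv x)).
Proof.
pose g (x : Lmod X n) : M := \sum_(i | k i == n) act (m i) (ein E (l i) \oc (pj i \oc lv x)).
have gl : linear g.
  move=> c x y; rewrite /g scaler_sumr -big_split; apply: eq_bigr => i _ /=.
  rewrite lv_lin !acompDr act_addr; congr (_ + _).
  rewrite -[RHS]act_in -actM; congr act.
  rewrite -!lscale_compr; symmetry.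
  transitivity (lscale c ((ein E (l i) \oc (pj i \oc lv x)) \oc aid E0)); last by rewrite acomp1r.
  by rewrite lscale_compr.
have ga x a : g (act x a) = act (g x) a.
  rewrite /g.
  have -> : act (\sum_(i | k i == n) act (m i) (ein E (l i) \oc (pj i \oc lv x))) a =
      \sum_(i | k i == n) act (act (m i) (ein E (l i) \oc (pj i \oc lv x))) a.
    by elim/big_rec2: _ => [|i y' x' _ <-]; [exact: act0|exact: actD].
  apply: eq_bigr => i _; rewrite -actM; congr act.
  by rewrite [lv _](lv_act x a) !acompA.
by exists (MHom gl ga).
Qed.

Definition mhom_gen n (M : fdmod A) (m : I -> M) := sval (cid (mhom_gen_ex n m)).
Lemma mhom_genE n (M : fdmod A) (m : I -> M) x :
  mhom_gen n m x = \sum_(i | k i == n) act (m i) (ein E (l i) \oc (pj i \oc lv x)).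
Proof. exact: (svalP (cid (mhom_gen_ex n m))). Qed.

Definition gen n i : Lmod X n := lc (tw_fd E_fd X) (tpi X n) (ij i \oc epr E (l i)).
Lemma genE n i : k i = n -> lv (gen n i) = ij i \oc epr E (l i).
Proof. by move=> <-; rewrite lcK // acompA (gr_ij b pE) eqxx. Qed.

Lemma lam_expand n (x : Lmod X n) :
  x = \sum_(i | k i == n) act (gen n i) (ein E (l i) \oc (pj i \oc lv x)).
Proof.
apply: lv_inj; rewrite lv_sum -[LHS]lvP (congr1 (fun t => t \oc lv x) (pE n)) acomp_suml.
apply: eq_bigr => i /eqP ki.
rewrite [RHS]lv_act genE // !acompA; congr (_ \oc _ \oc _).
by rewrite -acompA epr_ein acomp1r.
Qed.

Lemma mhom_expand n (M : fdmod A) (g : mhom (Lmod X n) M) x :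
  g x = \sum_(i | k i == n) act (g (gen n i)) (ein E (l i) \oc (pj i \oc lv x)).
Proof. by rewrite {1}(lam_expand x) mhom_sum; apply: eq_bigr => i _; rewrite mfun_act. Qed.

Lemma pj_lv n (x : Lmod X n) i : k i != n -> pj i \oc lv x = 0.
Proof. by move=> ne; rewrite -(lvP x) acompA (pj_gr b pE) (negPf ne) acomp0l. Qed.
End Cells.

(** Projectivity: preimages are chosen for the generators, one for each cell. *)
Lemma lam_lift (X : tw) n (N' N : fdmod A) (s : mhom N' N) (g : mhom (Lmod X n) N) :
  (forall x, exists y, s y = g x) -> exists g' : mhom (Lmod X n) N', forall x, s (g' x) = g x.
Proof.
have [I [l [k [ij [pj [b pE]]]]]] := thon X.
move=> h; pose m i := sval (cid (h (gen ij n i))).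
exists (mhom_gen k pj n m) => x.
rewrite mhom_genE mhom_sum (mhom_expand b pE g x); apply: eq_bigr => i _.
by rewrite mfun_act /m; case: cid => y /= ->.
Qed.

Lemma lam_ext (X Y : tw) (f g : thom X Y) : (forall n (x : Lmod X n), f \oc lv x = g \oc lv x) -> f = g.
Proof.
have [I [l [k [ij [pj [b pE]]]]]] := thon X => h.
apply: (bip_in b) => i; have := h (k i) (gen ij (k i) i).
rewrite (genE b pE) // => /(congr1 (fun t => t \oc ein E (l i))).
by rewrite !acompA -!(acompA _ (epr E _)) epr_ein !acomp1r.
Qed.

(* Chain maps have [u = w = id], homotopies [u n = n + 1] and [w = id]. *)
Lemma lam_full (X Y : tw) (u w : int -> int) (phi : forall n, mhom (Lmod X (u n)) (Lmod Y (w n))) :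
  (forall m, exists n, u n = m) -> injective u -> injective w ->
  exists f : thom X Y, (forall n x, lv (phi n x) = f \oc lv x) /\
    forall n, tpi Y (w n) \oc f = f \oc tpi X (u n).
Proof.
have [I [l [k [ij [pj [b pE]]]]]] := thon X.
move=> us ui wi; pose v m := sval (cid (us m)); have uv m : u (v m) = m by rewrite /v; case: cid.
pose f := \sum_i (lv (phi (v (k i)) (gen ij (u (v (k i))) i)) \oc ein E (l i) \oc pj i).
have fE i : f \oc ij i = lv (phi (v (k i)) (gen ij (u (v (k i))) i)) \oc ein E (l i).
  exact: (bip_sum_in b (fun i => lv (phi (v (k i)) (gen ij (u (v (k i))) i)) \oc ein E (l i))).
exists f; split=> n => [x|].
  rewrite (mhom_expand b pE (phi n) x) lv_sum /f acomp_suml [RHS](bigID (fun i => k i == u n)) /=.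
  rewrite [X in _ = _ + X]big1 ?addr0 => [|i ne]; last first.
    by rewrite -acompA (pj_lv b pE x ne) acomp0r.
  apply: eq_bigr => i /eqP ki; rewrite [LHS]lv_act !acompA.
  have -> : v (k i) = n by apply: ui; rewrite uv.
  by [].
apply: (bip_in b) => i; rewrite -!acompA (gr_ij b pE) fE.
case: eqP => [ki|ne]; last first.
  rewrite acomp0r acompA (lv_deg (phi _ _)) ?acomp0l //; apply/eqP => /wi e; apply: ne.
  by rewrite -e uv.
have -> : n = v (k i) by apply: ui; rewrite uv.
by rewrite fE acompA lvP.
Qed.

Lemma LamM_full (X Y : tw) (phi : cmap (Lam X) (Lam Y)) :
  exists (f : thom X Y) (c : chain f), cmap_eq phi (LamM c).
Proof.
have [m|m m' //|m m' //|f [fE fp]] := @lam_full X Y id id phi; first by exists m.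
have c : chain f.
  split=> [n|]; first by rewrite addr0.
  apply: lam_ext => n x; rewrite -!acompA -Lam_dE -fE -fE.
  by rewrite -Lam_dE cfunE.
by exists f, c => n x; apply: lv_inj; rewrite LamME fE.
Qed.

Lemma LamM_nullI (X Y : tw) (f : thom X Y) (c : chain f) : cnull (LamM c) -> nullh f.
Proof.
move=> [h hE]; have [|||k [kE kp]] := @lam_full X Y (fun n => n + 1) id h; try exact: addIr.
- by move=> m; exists (m - 1); rewrite subrK.
- by [].
exists k; split.
  by apply: int_succ_ind => n; rewrite addrK kp.
apply: lam_ext; apply: int_succ_ind => n x.
by rewrite acompDl -!acompA -kE -Lam_dE -Lam_dE -kE -lvD -hE LamME.
Qed.

Definition kproj (X : HK) : Prop :=
  forall N (phi : cmap (Lam X) N), acyclic N -> cnull phi.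

Lemma kproj_ret (X Y : HK) (i : ahom X Y) (p : ahom Y X) : p \oc i = aid X -> kproj Y -> kproj X.
Proof.
have [[i0 [ci ->]] [p0 [cp ->]]] := conj (kcl_surj i) (kcl_surj p).
rewrite kclM => /kcl_eq e kY N phi aN.
have n1 : cnull (cmap_comp (cmap_comp phi (LamM cp)) (LamM ci)).
  by apply: cnull_compr; exact: kY.
have := chtp_compl phi (LamM_htp (chain_comp cp ci) (chain_id X) e).
have z : chtp (cmap_comp (cmap_comp phi (LamM cp)) (LamM ci)) (cmap_comp phi (LamM (chain_comp cp ci))).
  by apply: chtp_refl => n x /=; congr (phi n _); exact: LamM_comp.
move=> /(chtp_trans z) h; apply: cnull_eq (cnull_lin (-1) h n1) => n x.
have e1 : LamM (chain_id X) n x = x by exact: LamM_id.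
rewrite /= in e1 *; rewrite e1 !scaleN1r opprD opprK addrNK //.
Qed.

Lemma kproj_plus (X Y : HK) : kproj X -> kproj Y -> kproj (oplus X Y).
Proof.
move=> kX kY N phi aN.
pose f1 := LamM (@chain_prl _ _ _ X Y); pose f2 := LamM (chain_prr (hdeg0 (tpi Y) (tpi X) 1) (zero_wd X Y)).
pose g1 := LamM (chain_inl (hdeg0 (tpi Y) (tpi X) 1) (zero_wd X Y)); pose g2 := LamM (@chain_inr _ _ _ X Y).
have n1 : cnull (cmap_comp (cmap_comp phi g1) f1) by apply: cnull_compr; exact: kX.
have n2 : cnull (cmap_comp (cmap_comp phi g2) f2) by apply: cnull_compr; exact: kY.
apply: cnull_eq (cnull_lin 1 n1 n2) => n x.
have e : g1 n (f1 n x) + g2 n (f2 n x) = x.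
  apply: lv_inj; rewrite lvD !LamME !acompA -acompDl.
  by rewrite oplus_id acomp1l.
by rewrite -[in RHS]e mhomD /= scale1r.
Qed.

(** [q1] and [q2] project onto the source and the target of the differential, and the second part is
    a subcomplex with zero differential. The null-homotopy is found there, and then on the first
    part after subtracting what the second contributes; each time a cocycle with values in an
    acyclic complex is lifted by projectivity. *)
Lemma kproj_two (X : tw) (q1 q2 : thom X X) : q1 \oc q1 = q1 -> q2 \oc q2 = q2 ->
  (forall n, tpi X n \oc q1 = q1 \oc tpi X n) -> (forall n, tpi X n \oc q2 = q2 \oc tpi X n) ->
  q1 + q2 = aid _ -> q1 \oc tdf X = 0 -> tdf X \oc q2 = 0 -> kproj X.
Proof.
move=> q11 q22 p1 p2 q12 q1d dq2 N phi aN.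
have dq1 : tdf X \oc q1 = tdf X by rewrite -[RHS]acomp1r -q12 acompDr dq2 addr0.
have q2d : q2 \oc tdf X = tdf X by rewrite -[RHS]acomp1l -q12 acompDl q1d add0r.
have step n (g : mhom (Lmod X (n + 1)) (N (n + 1))) : (forall x, cd N (n + 1) (g x) = 0) ->
    exists h : mhom (Lmod X (n + 1)) (N n), forall x, cd N n (h x) = g x.
  by move=> gc; apply: lam_lift => y; have [z ->] := aN n _ (gc y); exists z.
have [h2 h2E] : exists h : forall n, mhom (Lmod X (n + 1)) (N n), forall n y,
    cd N n (h n y) = phi (n + 1) (lmap (p2 (n + 1)) y).
  have ex n : exists h : mhom (Lmod X (n + 1)) (N n), forall y,
      cd N n (h y) = phi (n + 1) (lmap (p2 (n + 1)) y).
    have [|h hE] := step n (mhom_comp (phi (n + 1)) (lmap (p2 (n + 1)))); last by exists h.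
    move=> y; rewrite -[RHS](mhom0 (phi (n + 1 + 1))).
    apply: etrans (esym (@cfunE _ _ _ _ phi _ (lmap (p2 (n + 1)) y))) _; congr (phi _ _).
    by apply: lv_inj; rewrite Lam_dE lmapE acompA dq2 acomp0l lv0.
  by exists (fun n => sval (cid (ex n))) => n; case: (cid (ex n)).
have [h1 h1E] : exists h : forall n, mhom (Lmod X (n + 1)) (N n), forall n y,
    cd N n (h n y) = phi (n + 1) (lmap (p1 (n + 1)) y) - h2 (n + 1) (cd (Lam X) (n + 1) y).
  have ex n : exists h : mhom (Lmod X (n + 1)) (N n), forall y,
      cd N n (h y) = phi (n + 1) (lmap (p1 (n + 1)) y) - h2 (n + 1) (cd (Lam X) (n + 1) y).
    have [|h hE] := step n (mhom_sub (mhom_comp (phi (n + 1)) (lmap (p1 (n + 1))))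
      (mhom_comp (h2 (n + 1)) (cd (Lam X) (n + 1)))); last first.
      by exists h => y; rewrite hE mhom_subE.
    move=> y; rewrite mhom_subE /= mhomB h2E -[RHS](mhom0 (phi (n + 1 + 1))).
    rewrite -(@cfunE _ _ _ _ phi _ (lmap (p1 (n + 1)) y)) -mhomB.
    congr (phi _ _); apply: lv_inj; rewrite lvB Lam_dE !lmapE !acompA dq1 q2d subrr lv0 //.
  by exists (fun n => sval (cid (ex n))) => n; case: (cid (ex n)).
exists (fun n => mhom_add (mhom_comp (h1 n) (lmap (p1 (n + 1)))) (mhom_comp (h2 n) (lmap (p2 (n + 1))))).
move=> n y; rewrite !mhom_addE /= mhomD h1E h2E.
have e1 : lmap (p1 (n + 1)) (lmap (p1 (n + 1)) y) = lmap (p1 (n + 1)) y.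
  by apply: lv_inj; rewrite !lmapE acompA q11.
have e2 : lmap (p2 (n + 1)) (lmap (p2 (n + 1)) y) = lmap (p2 (n + 1)) y.
  by apply: lv_inj; rewrite !lmapE acompA q22.
have e3 : lmap (p1 (n + 1 + 1)) (lmap (@tdeg _ _ _ X (n + 1)) y) = 0.
  by apply: lv_inj; rewrite !lmapE acompA q1d acomp0l lv0.
have e4 : lmap (p2 (n + 1 + 1)) (lmap (@tdeg _ _ _ X (n + 1)) y)
    = lmap (@tdeg _ _ _ X (n + 1)) (lmap (p1 (n + 1)) y).
  by apply: lv_inj; rewrite !lmapE !acompA q2d dq1.
rewrite e1 e2 e3 e4 mhom0 add0r addrAC subrK -mhomD; congr (phi _ _).
by apply: lv_inj; rewrite lvD !lmapE -acompDl q12 acomp1l.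
Qed.

Lemma kproj_ho (x : shkron E) : kproj (ho x).
Proof.
apply: (@kproj_two (ho x) (inj1 _ _ \oc prj1 (kS1 x) (kS2 x)) (inj2 _ _ \oc prj2 (kS1 x) (kS2 x)));
  rewrite /= /ho_df /ho_gr ?oplus_id //.
- by rewrite !expE !zeroE.
- by rewrite !expE !zeroE.
- by move=> n; rewrite /psum !expE !zeroE.
- by move=> n; rewrite /psum !expE !zeroE.
- by rewrite !expE !zeroE.
by rewrite !expE !zeroE.
Qed.

(** The splitting into homogeneous pieces leaves only complexes whose differential has a single
    step. *)
Theorem kprojective (X : tw) : kproj X.
Proof.
elim: (hspan_tw E_end E_21 X) => {X} [|x _|X Y _ kX _ kY|X Y f fi _ kX].
- move=> N phi aN; have z0 : chtp phi phi by exact: chtp_refl.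
  apply: cnull_eq z0 => n x; rewrite cmap_subE subrr.
  have -> : x = 0 by apply: lv_inj; apply: eq_from_id0r; exact: aid_azero.
  by rewrite mhom0.
- exact: kproj_ho.
- exact: kproj_plus.
have [g [g1 g2]] := (aisoP _).1 fi; exact: (kproj_ret g2).
Qed.

End Lambda.

(** * Projective resolutions *)

Lemma vect_fd (K : fieldType) (V : vectType K) : finite_dimensional V.
Proof.
exists (\dim {:V}), (fun i => (vbasis {:V})`_i) => v.
by exists (fun i => coord (vbasis {:V}) i v); rewrite -coord_vbasis // memvf.
Qed.

Section Resolution.
Variables (K : fieldType) (T : linear_triangulated_category K) (E : bool -> T).
Hypothesis E_fd : forall l l', finite_dimensional (lhom (E l) (E l')).
Hypothesis E_21 : forall f : ahom (E true) (E false), f = 0.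
Hypothesis E_scal : forall (a : bool) (f : ahom (E a) (E a)), exists c : K, f = lscale c (aid _).

Local Notation E0 := (oplus (E false) (E true)).
Local Notation A := (endo_algebra E0).
Local Notation tw := (tw E).
Local Notation HK := (kt_add E).
Local Notation thom X Y := (ahom (tcar X) (tcar Y)).
Local Notation Lmod X n := (Lam_deg E_fd X n).
Local Notation Lam := (Lam E_fd).
Implicit Types M N : bcomplex A.

Definition eid (l : bool) : A := ein E l \oc epr E l.

Lemma lscale0l (X Y : T) (f : ahom X Y) : lscale (0 : K) f = 0.
Proof. exact: (scale0r (f : lhom X Y)). Qed.

Lemma lscale0r (X Y : T) (c : K) : lscale c (0 : ahom X Y) = 0.
Proof. exact: (scaler0 (lhom X Y) c). Qed.

Lemma act_scale (M : fdmod A) (m : M) (c : K) (a : ahom E0 E0) :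
  act m (lscale c a : A) = c *: act m (a : A).
Proof.
have -> : (lscale c a : A) = (a : A) * kalg_in A c.
  transitivity (lscale c (a \oc aid E0)); first by rewrite acomp1r.
  exact: lscale_compr.
by rewrite actM act_in.
Qed.

Lemma act_suml (M : fdmod A) (I : Type) (r : seq I) (P : pred I) (F : I -> M) (a : A) :
  act (\sum_(i <- r | P i) F i) a = \sum_(i <- r | P i) act (F i) a.
Proof. by elim/big_rec2: _ => [|i y x _ <-]; [exact: act0 | exact: actD]. Qed.

Lemma act_0r (M : fdmod A) (m : M) : act m (0 : A) = 0.
Proof. by apply: (addIr (act m (0 : A))); rewrite -act_addr !add0r. Qed.

Lemma eid_eid (l : bool) : eid l * eid l = eid l.
Proof.
suff : ein E l \oc epr E l \oc (ein E l \oc epr E l) = ein E l \oc epr E l by [].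
by rewrite acompA -(acompA (ein E l)) epr_ein acomp1r.
Qed.

Lemma eid_split (M : fdmod A) (m : M) : m = act m (eid false) + act m (eid true).
Proof.
rewrite -act_addr; have -> : eid false + eid true = kalg_in A 1; last by rewrite act_in scale1r.
by rewrite rmorph1; exact: oplus_id.
Qed.

Definition fixed (l : bool) (M : fdmod A) (m : M) : Prop := act m (eid l) = m.

Lemma fixed_act l (M : fdmod A) (m : M) : fixed l (act m (eid l)).
Proof. by rewrite /fixed -actM eid_eid. Qed.

Lemma fixed_map l (M N : fdmod A) (f : mhom M N) m : fixed l m -> fixed l (f m).
Proof. by rewrite /fixed -mfun_act => ->. Qed.

Section OneLabel.
Variables (l : bool) (M : bcomplex A).

(* [b n i] is meaningful for [k i = n] only. *)
Lemma label_basis : exists (I : finType) (k : I -> int) (b : forall n, I -> M n),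
  [/\ forall n i, k i = n -> fixed l (b n i),
      forall n (m : M n), fixed l m -> exists c : I -> K,
        m = \sum_(i | k i == n) c i *: b n i /\ forall i, k i != n -> c i = 0
    & forall n (c : I -> K), \sum_(i | k i == n) c i *: b n i = 0 ->
        forall i, k i = n -> c i = 0].
Proof.
have P0 n : fixed l (0 : M n) by exact: act0.
have P_lin n (c : K) (u v : M n) : fixed l u -> fixed l v -> fixed l (c *: u + v).
  by rewrite /fixed actD actZ => -> ->.
pose ex n := basis_ex (vect_fd (fdcar (M n))) (P0 n) (P_lin n).
have [dm [e eP]] : exists (dm : int -> nat) (e : forall n, 'I_(dm n) -> M n), forall n,
    [/\ forall r, fixed l (lcomb (e n) r), forall r, lcomb (e n) r = 0 -> r = 0
    & forall v, fixed l v -> exists r, lcomb (e n) r = v].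
  exists (fun n => sval (cid (ex n))), (fun n => sval (cid (svalP (cid (ex n))))) => n.
  exact: (svalP (cid (svalP (cid (ex n))))).
have [N hN] := cx_bounded M.
pose kk (j : 'I_(N + N).+1) : int := j%:Z - N%:Z.
pose D := (\max_j dm (kk j))%N.
(* Degrees run from [- N] to [N] and [D] bounds all dimensions; a subtype of a product replaces a
   dependent sum over degrees, since the dimension varies. *)
pose I : finType := {p : 'I_(N + N).+1 * 'I_D | (p.2 < dm (kk p.1))%N}.
pose k (i : I) := kk (val i).1.
pose en n (j : nat) : M n := if insub j is Some j' then e n j' else 0.
pose rn n (r : 'rV[K]_(dm n)) (j : nat) : K := if insub j is Some j' then r 0 j' else 0.
have sumE n (F : nat -> M n) : (forall j, (dm n <= j)%N -> F j = 0) ->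
    \sum_(i : I | k i == n) F (val i).2 = \sum_(j < dm n) F j.
  move=> F0.
  have [bn|nb] := boolP (`|n| <= N)%N; last first.
    rewrite big_pred0 => [|i]; last first.
      apply/negbTE; apply: contra nb => /eqP <-; rewrite /k /kk.
      by have := ltn_ord (val i).1; move: (nat_of_ord (val i).1) => a; lia.
    symmetry; apply: big1 => j _; apply: hN; by rewrite ltnNge.
  have [j0 kj0] : exists j0, kk j0 = n.
    have lt0 : (`|(n + N%:Z)%R| < (N + N).+1)%N by lia.
    by exists (Ordinal lt0); rewrite /kk /=; lia.
  have dD : (dm n <= D)%N by rewrite -kj0 /D (leq_bigmax (F := fun j => dm (kk j))).
  rewrite -(big_sub_cond (fun p : 'I_(N + N).+1 * 'I_D => (p.2 < dm (kk p.1))%N)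
    (fun p => kk p.1 == n) (fun p => F p.2)) /=.
  rewrite (big_ord_widen_cond D xpredT (fun j => F j) dD) /=.
  rewrite (reindex_onto (fun j : 'I_D => (j0, j)) (fun p => p.2)) /=.
    apply: eq_bigl => j; rewrite unfold_in /= kj0 !eqxx !andbT //.
  by move=> [a c] /andP[_ /eqP] /= kc; congr pair; move: kc; rewrite -kj0 /kk => /addIr[e1]; apply: val_inj.
have lE n (r : 'rV_(dm n)) : \sum_(i : I | k i == n) rn n r (val i).2 *: en n (val i).2 = lcomb (e n) r.
  rewrite (sumE n (fun j => rn n r j *: en n j)) => [|j dj].
    by apply: eq_bigr => j _; rewrite /rn /en valK.
  by rewrite /rn insubF ?scale0r // ltnNge dj.
exists I, k, (fun (n : int) (i : I) => en n (nat_of_ord (val i).2)); split=> n.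
- move=> i ki; rewrite /en; case: insubP => [j _ _|_]; last exact: P0.
  have [h _ _] := eP n; have := h (delta_mx 0 j); rewrite /lcomb (bigD1 j) //= big1 ?addr0 => [|j' ne].
    by rewrite mxE !eqxx scale1r.
  by rewrite mxE (negPf ne) andbF scale0r.
- move=> m fm; have [_ _ h] := eP n; have [r rE] := h m fm.
  exists (fun i => if k i == n then rn n r (val i).2 else 0); split=> [|i /negPf -> //].
  by rewrite -rE -lE; apply: eq_bigr => i ->.
move=> c e0; have [_ h _] := eP n.
pose cn (j : nat) : K := \sum_(i : I | (k i == n) && ((val i).2 == j :> nat)) c i.
have cE i : k i = n -> cn (val i).2 = c i.
  move=> ki; rewrite /cn (bigD1 i) /=; last by rewrite ki !eqxx.
  rewrite big1 ?addr0 // => i' /andP[/andP[/eqP ki' /eqP e2]] /eqP ne; case: ne.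
  have pE (u v : 'I_(N + N).+1 * 'I_D) : u.1 = v.1 :> nat -> u.2 = v.2 :> nat -> u = v.
    by case: u v => [a1 a2] [b1 b2] /= e1 e3; congr pair; exact: val_inj.
  by apply: val_inj; apply: pE => //; move: ki'; rewrite -ki /k /kk => /addIr[].
have r0 : \row_(j < dm n) cn j = 0.
  apply: h; apply: etrans e0; rewrite -lE; apply: eq_bigr => i /eqP ki.
  rewrite -(cE i ki); congr (_ *: _); rewrite /rn; case: insubP => [j _ <-|]; first by rewrite mxE.
  by have := valP i; rewrite /= -ki => ->.
move=> i ki; have lt : ((val i).2 < dm n)%N by have := valP i; rewrite /= -ki.
have := congr1 (fun r : 'rV_(dm n) => r 0 (Ordinal lt)) r0.
by rewrite !mxE /= cE.
Qed.

(** This is the evaluation map from the tensor product of [M e_l] over [K] with [e_l A] to [M]. In a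
    basis of [M e_l] the differential has scalar entries, which define a twisted complex on copies
    of [E l]; as [E l] has only scalar endomorphisms, evaluation is bijective on the parts fixed by
    [e_l]. *)
Theorem label_complex : exists (X : tw) (q : cmap (Lam X) M),
  [/\ forall n (x : Lam X n), fixed l x -> q n x = 0 -> x = 0,
      forall n (m : M n), fixed l m -> exists2 x : Lam X n, fixed l x & q n x = m
    & l = false -> forall n (x : Lam X n), fixed l x].
Proof.
have [I [k [b [bU bA bB]]]] := label_basis.
have [S [ij [pj bip]]] := biproduct_ex (fun _ : I => E l).
have [h1 h2 h3] := bip.
have cex (j : I) : exists c : I -> K, cd M (k j) (b (k j) j) = \sum_(i | k i == k j + 1) c i *: b (k j + 1) i
    /\ forall i, k i != k j + 1 -> c i = 0.
  by apply: bA; apply: fixed_map; exact: bU.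
pose c i j := sval (cid (cex j)) i.
have c0 i j : k i != k j + 1 -> c i j = 0 by rewrite /c; case: cid => f [/= _ h]; exact: h.
have cE n j : k j = n -> cd M n (b n j) = \sum_(i | k i == n + 1) c i j *: b (n + 1) i.
  by move=> <-; rewrite /c; case: cid => f [].
pose d : ahom S S := \sum_j ((\sum_i (ij i \oc lscale (c i j) (aid _))) \oc pj j).
have dE i j : pj i \oc d \oc ij j = lscale (c i j) (aid _).
  by rewrite -acompA /d (bip_sum_in bip (fun j => \sum_i (ij i \oc lscale (c i j) (aid _))))
    (bip_sum_out bip (fun i => lscale (c i j) (aid (E l)))).
pose p n : ahom S S := \sum_(i | k i == n) (ij i \oc pj i).
have pE n : p n = \sum_(i | k i == n) (ij i \oc pj i) by [].
have hon : honest E p.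
  by exists I, (fun=> l), k, ij, pj; split.
have dg : hdeg p p 1 d.
  move=> n; apply: (bip_in bip) => j; apply: (bip_out bip) => i.
  rewrite !acompA (pj_gr bip pE) -(acompA _ (p n)) (gr_ij bip pE).
  have e := dE i j; case: (eqVneq (k i) (n + 1)) (eqVneq (k j) n) => [ki|nki] [kj|nkj];
    rewrite ?acomp0l ?acomp0r ?e //.
  - have ne : k i != k j + 1 by rewrite ki (inj_eq (addIr 1)) eq_sym.
    by rewrite c0 // lscale0l.
  - have ne : k i != k j + 1 by rewrite kj.
    by rewrite c0 // lscale0l.
have dd : d \oc d = 0.
  apply: (bip_in bip) => j; apply: (bip_out bip) => i; rewrite acomp0l acomp0r.
  transitivity (lscale (\sum_m c i m * c m j) (aid (E l))).
    have -> : d \oc d = \sum_m ((d \oc ij m) \oc (pj m \oc d)).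
      transitivity (d \oc aid S \oc d); first by rewrite acomp1r.
      by rewrite -h3 acomp_sumr acomp_suml; apply: eq_bigr => m _; rewrite !acompA.
    rewrite acomp_suml acomp_sumr.
    transitivity (\sum_m lscale (c i m * c m j) (aid (E l))); last first.
      exact: (esym (scaler_suml (aid _ : lhom (E l) (E l)) _ _ _)).
    apply: eq_bigr => m _; rewrite -acompA (acompA (pj i)) (acompA (pj i)) !dE.
    by rewrite -lscale_compl acomp1l lscaleA.
  have [e|ne] := eqVneq (k i) (k j + 1 + 1); last first.
    rewrite big1 ?lscale0l // => m _.
    have [km|nm] := eqVneq (k m) (k j + 1); last by rewrite (c0 m j) // mulr0.
    by rewrite (c0 i m) ?mul0r // km.
  (* Independence of the basis turns the vanishing of the squared differential of [M] into that of
     the sums of products of coefficients. *)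
  have := cdd (b (k j) j); rewrite (cE (k j) j erefl) mhom_sum.
  under eq_bigr => m /eqP km do rewrite mhomZ (cE _ m km) scaler_sumr.
  rewrite exchange_big /=.
  under eq_bigr => i' _ do under eq_bigr => m _ do rewrite scalerA.
  under eq_bigr => i' _ do rewrite -scaler_suml.
  move=> /bB /(_ i e) s0.
  have -> : \sum_m c i m * c m j = 0.
    rewrite -[RHS]s0 [RHS]big_mkcond; apply: eq_bigr => m _.
    by case: eqVneq => [_|nm]; [rewrite mulrC | rewrite (c0 m j) ?mulr0].
  exact: lscale0l.
have pd i : pj i \oc d = \sum_j lscale (c i j) (pj j).
  apply: (bip_in bip) => j; rewrite dE acomp_suml (bigD1 j) //= big1 ?addr0 => [|j' ne].
    by rewrite -lscale_compl h1.
  by rewrite -lscale_compl h2 // lscale0r.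
have pdv i (v : ahom E0 S) :
    ein E l \oc (pj i \oc (d \oc v)) = \sum_j lscale (c i j) (ein E l \oc (pj j \oc v)).
  rewrite (acompA (pj i)) pd acomp_suml acomp_sumr; apply: eq_bigr => j _.
  by rewrite -lscale_compl -lscale_compr.
pose X := @Tw _ _ E S p d hon dg dd.
have bX : @biproduct _ I (fun=> E l) (tcar X) ij pj by [].
have pX n : tpi X n = \sum_(i | k i == n) (ij i \oc pj i) by [].
pose qn n : mhom (Lmod X n) (M n) := @mhom_gen K T E E_fd X I (fun=> l) k pj n (M n) (b n).
have qE n x : qn n x = \sum_(i | k i == n) act (b n i) (ein E l \oc (pj i \oc lv x)).
  exact: (@mhom_genE K T E E_fd X I (fun=> l)).
have q_d n (x : Lam X n) : qn (n + 1) (cd (Lam X) n x) = cd M n (qn n x).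
  rewrite !qE mhom_sum.
  transitivity (\sum_(i | k i == n + 1) \sum_(j | k j == n)
      act (c i j *: b (n + 1) i) (ein E l \oc (pj j \oc lv x))).
    apply: eq_bigr => i /eqP ki; rewrite Lam_dE.
    have -> : ein E l \oc (pj i \oc (d \oc lv x)) = \sum_j lscale (c i j) (ein E l \oc (pj j \oc lv x)).
      exact: pdv.
    rewrite [RHS]big_mkcond.
    transitivity (\sum_j act (b (n + 1) i) (lscale (c i j) (ein E l \oc (pj j \oc lv x)) : A)).
      by elim/big_rec2: _ => [|j y y' _ <-]; [rewrite act_0r|rewrite act_addr].
    apply: eq_bigr => j _; rewrite act_scale actZ; case: eqVneq => // nj.
    by rewrite (pj_lv bX pX x nj) acomp0r act_0r scaler0.
  rewrite exchange_big; apply: eq_bigr => j /eqP kj /=.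
  by rewrite -act_suml -(cE n j kj) mfun_act.
pose q := @CMap _ _ (Lam X) M qn q_d.
have lam i n (x : Lam X n) : fixed l x -> exists s : K, pj i \oc lv x = lscale s (epr E l).
  move=> fx; have [s sE] := E_scal (pj i \oc lv x \oc ein E l).
  exists s; have -> : lv x = lv x \oc eid l by rewrite -[LHS](congr1 (fun y => lv y) fx) [LHS]lv_act.
  by rewrite !acompA sE -lscale_compl acomp1l.
exists X, q; split=> [n x fx|n m fm|lf n x].
- pose s i := sval (cid (lam i n x fx)).
  have sE i : pj i \oc lv x = lscale (s i) (epr E l) by rewrite /s; case: cid.
  rewrite qE => q0; have {}q0 : \sum_(i | k i == n) s i *: b n i = 0.
    apply: etrans q0; apply: eq_bigr => i /eqP ki.
    rewrite sE -lscale_compr act_scale; congr (_ *: _); symmetry; exact: bU.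
  apply: lv_inj; rewrite lv0 -(lvP x) (congr1 (fun t => t \oc lv x) (pX n)) acomp_suml.
  rewrite big1 // => i /eqP ki.
  by rewrite -acompA sE (bB n s q0 i ki) lscale0l acomp0r.
- have [c' [mE _]] := bA n m fm.
  pose v : ahom E0 S := \sum_(i | k i == n) ij i \oc lscale (c' i) (epr E l).
  have pv i : k i = n -> pj i \oc v = lscale (c' i) (epr E l).
    move=> ki; rewrite /v acomp_sumr (bigD1 i) /= ?ki // big1 ?addr0 => [|j /andP[_ ji]].
      by rewrite acompA h1 acomp1l.
    by rewrite acompA h2 ?acomp0l // eq_sym.
  have vP : tpi X n \oc v = v.
    by rewrite pX acomp_suml; apply: eq_bigr => i /eqP ki; rewrite -acompA pv.
  exists (lc (tw_fd E_fd X) (tpi X n) v).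
    apply: lv_inj; rewrite [LHS]lv_act lcK // /v acomp_suml; apply: eq_bigr => i _.
    rewrite -acompA -lscale_compl; congr (_ \oc lscale _ _).
    by rewrite /eid acompA epr_ein acomp1l.
  rewrite qE mE; apply: eq_bigr => i /eqP ki; rewrite lcK // pv // -lscale_compr act_scale.
  by congr (_ *: _); exact: bU.
apply: lv_inj; rewrite [LHS]lv_act; rewrite -[RHS]acomp1r -ein_epr big_bool /= acompDr.
have -> : lv x \oc (ein E true \oc epr E true) = 0.
  rewrite acompA; apply: etrans (acomp0l _ (epr E true)); congr (_ \oc _).
  apply: (bip_out bip) => i; rewrite acomp0r.
  by move: (pj i \oc _); rewrite lf => f; exact: E_21.
by rewrite add0r lf.
Qed.

End OneLabel.
End Resolution.

Lemma addN_eq (V : zmodType) (x y : V) : 0 = - x + y -> y = x.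
Proof. by move=> e; rewrite -[y](addKr (- x)) -e addr0 opprK. Qed.

Lemma subD_eq (V : zmodType) (x y z : V) : x = y + z -> x - y = z.
Proof. by move=> ->; rewrite addrC addKr. Qed.

Lemma sub4_eq (V : zmodType) (a b d e : V) : a - d = b + e -> a - b - (d + e) = 0.
Proof. by move=> h; rewrite opprD addrA [a - b - d]addrAC h addrAC addrK subrr. Qed.

Section Products.
Variables (K : fieldType) (A : kalgebra K).

Lemma mfst_ex (M N : fdmod A) : exists f : mhom (mprod M N) M, forall x, f x = x.1.
Proof.
have f1 : linear (fun x : mprod M N => x.1) by [].
have f2 v a : (act (v : mprod M N) a).1 = act v.1 a by [].
by exists (MHom f1 f2).
Qed.
Definition mfst (M N : fdmod A) := sval (cid (mfst_ex M N)).
Lemma mfstE (M N : fdmod A) x : mfst M N x = x.1. Proof. exact: (svalP (cid (mfst_ex M N))). Qed.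

Lemma msnd_ex (M N : fdmod A) : exists f : mhom (mprod M N) N, forall x, f x = x.2.
Proof.
have f1 : linear (fun x : mprod M N => x.2) by [].
have f2 v a : (act (v : mprod M N) a).2 = act v.2 a by [].
by exists (MHom f1 f2).
Qed.
Definition msnd (M N : fdmod A) := sval (cid (msnd_ex M N)).
Lemma msndE (M N : fdmod A) x : msnd M N x = x.2. Proof. exact: (svalP (cid (msnd_ex M N))). Qed.

Lemma mpair_ex (L M N : fdmod A) (f : mhom L M) (g : mhom L N) :
  exists h : mhom L (mprod M N), forall x, h x = (f x, g x).
Proof.
have f1 : linear (fun x : L => (f x, g x) : mprod M N).
  by move=> c x y; rewrite !mfun_lin.
have f2 v a : (f (act v a), g (act v a)) = act ((f v, g v) : mprod M N) a.
  by rewrite !mfun_act.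
by exists (MHom f1 f2).
Qed.
End Products.

(** * Lifting along quasi-isomorphisms and resolutions *)

Section Lifting.
Variables (K : fieldType) (T : linear_triangulated_category K) (E : bool -> T).
Hypothesis E_fd : forall l l', finite_dimensional (lhom (E l) (E l')).
Hypothesis E_21 : forall f : ahom (E true) (E false), f = 0.
Hypothesis E_end : forall (a : bool) (f : ahom (E a) (E a)), f = 0 \/ aiso f.
Hypothesis E_scal : forall (a : bool) (f : ahom (E a) (E a)), exists c : K, f = lscale c (aid _).

Local Notation E0 := (oplus (E false) (E true)).
Local Notation A := (endo_algebra E0).
Local Notation tw := (tw E).
Local Notation HK := (kt_add E).
Local Notation thom X Y := (ahom (tcar X) (tcar Y)).
Local Notation Lmod X n := (Lam_deg E_fd X n).
Local Notation Lam := (Lam E_fd).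
Local Notation LamM := (LamM E_fd).
Implicit Types M N : bcomplex A.

(** A null-homotopy of the composite of [g] with [Y -> cone s] has two components: a chain map to
    [M], which is the lift, and a homotopy. *)
Lemma lam_qis_lift (X : tw) M N (s : cmap M N) (g : cmap (Lam X) N) : quasi_iso s ->
  exists g' : cmap (Lam X) M, chtp (cmap_comp s g') g.
Proof.
move=> /qis_cone ac; have [h hE] := kprojective (E_fd := E_fd) E_21 E_end (cmap_comp (cone_in s) g) ac.
have [a [b ab]] : exists (a : forall n, mhom (Lmod X (n + 1)) (M (n + 1)))
    (b : forall n, mhom (Lmod X (n + 1)) (N n)), forall n x, h n x = (a n x, b n x).
  exists (fun n => mhom_comp (mfst _ _) (h n)), (fun n => mhom_comp (msnd _ _) (h n)) => n x.
  by rewrite /= mfstE msndE; case: (h n x).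
have E1 n x : a (n + 1) (cd (Lam X) (n + 1) x) = cd M (n + 1) (a n x).
  have := congr1 fst (hE n x); rewrite !ab => e.
  have {}e : 0 = - cd M (n + 1) (a n x) + a (n + 1) (cd (Lam X) (n + 1) x) := e.
  exact: addN_eq e.
have E2 n x : g (n + 1) x = s (n + 1) (a n x) + cd N n (b n x) + b (n + 1) (cd (Lam X) (n + 1) x).
  by have := congr1 snd (hE n x); rewrite !ab.
have [f fE] := int_reindex (P := fun n => mhom (Lmod X n) (M n)) a.
have fd n (x : Lam X n) : f (n + 1) (cd (Lam X) n x) = cd M n (f n x).
  by move: n x; apply: int_succ_ind => n x; rewrite !fE E1.
exists (@CMap _ _ (Lam X) M f fd), (fun n => mhom_opp (b n)) => n x.
by rewrite cmap_subE /= fE E2 mhomN -!addrA opprD addrA addrN add0r opprD.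
Qed.

Section ShiftLam.
Variable X : tw.

Lemma lam_sh_ex n : exists f : mhom (Lmod (tsh 1 X) n) (Lmod X (n + 1)), forall x, lv (f x) = lv x.
Proof.
apply: (@mhom_to _ _ _ _ (tw_fd E_fd X) (tpi X (n + 1)) (Lmod (tsh 1 X) n) (fun x => lv x)).
- by move=> c x y; rewrite lv_lin.
- by move=> x a; exact: lv_act.
by move=> x; exact: lvP.
Qed.

Lemma lam_ush_ex n : exists f : mhom (Lmod X (n + 1)) (Lmod (tsh 1 X) n), forall x, lv (f x) = lv x.
Proof.
apply: (@mhom_to _ _ _ _ (tw_fd E_fd (tsh 1 X)) (tpi (tsh 1 X) n) (Lmod X (n + 1)) (fun x => lv x)).
- by move=> c x y; rewrite lv_lin.
- by move=> x a; exact: lv_act.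
by move=> x; exact: lvP.
Qed.

Lemma lam_sh_cmap : exists f : cmap (Lam (tsh 1 X)) (cshift (Lam X)), forall n x, lv (f n x) = lv x.
Proof.
pose f n := sval (cid (lam_sh_ex n)); have fE n x : lv (f n x) = lv x by rewrite /f; case: cid.
have fd n (x : Lam (tsh 1 X) n) : f (n + 1) (cd (Lam (tsh 1 X)) n x) = cd (cshift (Lam X)) n (f n x).
  by apply: lv_inj; rewrite fE Lam_dE [RHS]lvN Lam_dE fE acompNl.
by exists (@CMap _ _ (Lam (tsh 1 X)) (cshift (Lam X)) f fd).
Qed.

Lemma lam_ush_cmap : exists f : cmap (cshift (Lam X)) (Lam (tsh 1 X)), forall n x, lv (f n x) = lv x.
Proof.
pose f n := sval (cid (lam_ush_ex n)); have fE n x : lv (f n x) = lv x by rewrite /f; case: cid.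
have fd n (x : cshift (Lam X) n) : f (n + 1) (cd (cshift (Lam X)) n x) = cd (Lam (tsh 1 X)) n (f n x).
  by apply: lv_inj; rewrite fE Lam_dE [LHS]lvN Lam_dE fE acompNl.
by exists (@CMap _ _ (cshift (Lam X)) (Lam (tsh 1 X)) f fd).
Qed.

Definition lsh := sval (cid lam_sh_cmap).
Lemma lshE n x : lv (lsh n x) = lv x. Proof. exact: (svalP (cid lam_sh_cmap)). Qed.
Definition lush := sval (cid lam_ush_cmap).
Lemma lushE n x : lv (lush n x) = lv x. Proof. exact: (svalP (cid lam_ush_cmap)). Qed.

Lemma lushK n x : lsh n (lush n x) = x. Proof. by apply: lv_inj; rewrite lshE lushE. Qed.
End ShiftLam.

(** [g] and the null-homotopy of its composite with [s] form a map from the shifted complex to the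
    acyclic cone of [s]. The shift being again of the form [Lam], this map is null-homotopic, and
    the first component of a homotopy contracts [g]. *)
Lemma lam_qis_inj (X : tw) M N (s : cmap M N) (g : cmap (Lam X) M) : quasi_iso s ->
  cnull (cmap_comp s g) -> cnull g.
Proof.
move=> /qis_cone ac [h hE].
pose ps n := sval (cid (mpair_ex (g (n + 1)) (mhom_opp (h n)))).
have psE n x : ps n x = (g (n + 1) x, - h n x) by rewrite /ps; case: cid.
have psd n (x : cshift (Lam X) n) : ps (n + 1) (cd (cshift (Lam X)) n x) = cd (cone s) n (ps n x).
  rewrite !psE /= !mhomN cfunE; congr pair => //.
  by rewrite opprK; symmetry; exact: subD_eq (hE n x).
pose psi := @CMap _ _ (cshift (Lam X)) (cone s) ps psd.
have [k kE] := kprojective (E_fd := E_fd) E_21 E_end (cmap_comp psi (lsh X)) ac.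
have n2 : cnull psi.
  apply: (@cnull_eq _ _ _ _ (cmap_comp (cmap_comp psi (lsh X)) (lush X))).
    by move=> n x /=; rewrite lushK.
  by apply: cnull_compr; exists k.
have [m mE] := n2.
pose al n : mhom (Lam X (n + 1 + 1)) (M (n + 1)) := mhom_opp (mhom_comp (mfst _ _) (m n)).
have [f fE] := int_reindex (P := fun n => mhom (Lam X (n + 1)) (M n)) al.
exists f; apply: int_succ_ind => n x; rewrite !fE /al /= !mfstE mhomN.
have := congr1 fst (mE n x); have -> : psi (n + 1) x = (g (n + 1 + 1) x, - h (n + 1) x) by exact: psE.
have e : m (n + 1) (cd (cshift (Lam X)) (n + 1) x) = - m (n + 1) (cd (Lam X) (n + 1 + 1) x) by exact: mhomN.
by rewrite e.
Qed.

(** Fullness of [LamM] turns the composite of [r] with the projection to the shifted [Lam X2] into a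
    cocycle [w]. The extension of [X1] by [X2] along [w] maps to [M] by [c] on [X2] and by minus the
    [M]-component of [r] on [X1]; this compares the triangle of the extension with that of [c]. *)
Lemma cocone_resolution (X2 : tw) M (c : cmap (Lam X2) M) (X1 : tw) (r : cmap (Lam X1) (cone c)) :
  quasi_iso r -> exists (P : tw) (q : cmap (Lam P) M), quasi_iso q.
Proof.
move=> qr; have [w [cw wE]] := LamM_full (cmap_comp (lush X2) (cmap_comp (cone_out c) r)).
have [dw wd] := w_chain cw.
have rw n x : lv (r n x).1 = w \oc lv x.
  by rewrite -(LamME cw) -wE; symmetry; exact: (lushE (X := X2)).
pose P := text dw wd.
have p1 n : tpi X2 n \oc prj1 (tcar X2) (tcar X1) = prj1 _ _ \oc tpi P n.
  by have := hdeg_prj1 (tpi X2) (tpi X1) n; rewrite addr0.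
have p2 n : tpi X1 n \oc prj2 (tcar X2) (tcar X1) = prj2 _ _ \oc tpi P n.
  by have := hdeg_prj2 (tpi X2) (tpi X1) n; rewrite addr0.
have i1 n : tpi P n \oc inj1 (tcar X2) (tcar X1) = inj1 _ _ \oc tpi X2 n.
  by have := hdeg_inj1 (tpi X2) (tpi X1) n; rewrite addr0.
have i2 n : tpi P n \oc inj2 (tcar X2) (tcar X1) = inj2 _ _ \oc tpi X1 n.
  by have := hdeg_inj2 (tpi X2) (tpi X1) n; rewrite addr0.
pose P1 n : mhom (Lmod P n) (Lmod X2 n) := @lmap _ _ _ E_fd P X2 n n (prj1 _ _) (p1 n).
pose P2 n : mhom (Lmod P n) (Lmod X1 n) := @lmap _ _ _ E_fd P X1 n n (prj2 _ _) (p2 n).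
pose I1 n : mhom (Lmod X2 n) (Lmod P n) := @lmap _ _ _ E_fd X2 P n n (inj1 _ _) (i1 n).
pose I2 n : mhom (Lmod X1 n) (Lmod P n) := @lmap _ _ _ E_fd X1 P n n (inj2 _ _) (i2 n).
pose wm n (y : Lmod X1 n) : Lmod X2 (n + 1) := (r n y).1.
pose bm n (y : Lmod X1 n) : M n := (r n y).2.
have P1d n y : P1 (n + 1) (cd (Lam P) n y) = cd (Lam X2) n (P1 n y) + wm n (P2 n y).
  apply: lv_inj; rewrite lvD rw !lmapE acompA [prj1 _ _ \oc _]ext_df1.
  by rewrite acompDl !acompA.
have P2d n y : P2 (n + 1) (cd (Lam P) n y) = cd (Lam X1) n (P2 n y).
  by apply: lv_inj; rewrite !lmapE acompA [prj2 _ _ \oc _]ext_df2 !acompA.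
have IP n y2 y1 : P1 n (I1 n y2 + I2 n y1) = y2 /\ P2 n (I1 n y2 + I2 n y1) = y1.
  split; apply: lv_inj; rewrite !lmapE lvD !lmapE acompDr !acompA !bipE acomp0l acomp1l.
    by rewrite addr0.
  by rewrite add0r.
have Pinj n (y y' : Lam P n) : P1 n y = P1 n y' -> P2 n y = P2 n y' -> y = y'.
  move=> e1 e2; apply: lv_inj; apply: oplus_ext_out.
    by have := congr1 (fun t => lv t) e1; rewrite !lmapE.
  by have := congr1 (fun t => lv t) e2; rewrite !lmapE.
have wmD n x y : wm n (x + y) = wm n x + wm n y by rewrite /wm mhomD.
have wmN n x : wm n (- x) = - wm n x by rewrite /wm mhomN.
have bmN n x : bm n (- x) = - bm n x by rewrite /bm mhomN.
have rd n x : wm (n + 1) (cd (Lam X1) n x) = - cd (Lam X2) (n + 1) (wm n x) /\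
    bm (n + 1) (cd (Lam X1) n x) = c (n + 1) (wm n x) + cd M n (bm n x).
  by rewrite /wm /bm cfunE.
pose qn n : mhom (Lmod P n) (M n) := mhom_sub (mhom_comp (c n) (P1 n))
  (mhom_comp (mhom_comp (msnd _ _) (r n)) (P2 n)).
have qE n y : qn n y = c n (P1 n y) - bm n (P2 n y) by rewrite mhom_subE /= msndE.
have qd n (y : Lam P n) : qn (n + 1) (cd (Lam P) n y) = cd M n (qn n y).
  rewrite !qE P1d P2d (rd n _).2 mhomB mhomD cfunE opprD addrA.
  by congr (_ - _); exact: addrK.
pose q := @CMap _ _ (Lam P) M qn qd.
have {}qE n y : q n y = c n (P1 n y) - bm n (P2 n y) := qE n y.
clearbody q; exists P, q => n; have [ri rs] := qr n; split.
- move: n ri rs; apply: int_succ_ind => n ri rs y dy [m ym].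
  have y1d : cd (Lam X1) (n + 1 + 1) (P2 (n + 1 + 1) y) = 0 by rewrite -P2d dy mhom0.
  have y2d : wm (n + 1 + 1) (P2 (n + 1 + 1) y) = - cd (Lam X2) (n + 1 + 1) (P1 (n + 1 + 1) y).
    by have := P1d _ y; rewrite dy mhom0 => /esym /addr0_eq /esym.
  have cy : bm (n + 1 + 1) (P2 (n + 1 + 1) y) = c (n + 1 + 1) (P1 (n + 1 + 1) y) - cd M (n + 1) m.
    by rewrite -ym qE subKr.
  have [|z zE] := ri _ y1d.
    exists (P1 (n + 1 + 1) y, - m); rewrite /= mhomN -cy -y2d.
    by rewrite /wm /bm; case: (r _ _).
  have [_ rs'] := qr n.
  have e1 : P1 (n + 1 + 1) y - wm (n + 1) z = P1 (n + 1 + 1) y - wm (n + 1) z by [].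
  (* [z] settles the component in [X1]. What remains is a cycle of the cone, and surjectivity of [r]
     one degree lower replaces [z] by [z + x1] and supplies the component [- u] in [X2]. *)
  have [|x1 [[u v] [dx e]]] := rs' (P1 (n + 1 + 1) y - wm (n + 1) z, - (m + bm (n + 1) z)).
    rewrite /= mhomB; have := (rd (n + 1) z).1; rewrite -zE y2d => /oppr_inj ->.
    rewrite subrr oppr0 mhomB mhomN mhomD; congr pair.
    have := (rd (n + 1) z).2; rewrite -zE cy => e.
    exact: sub4_eq e.
  have := congr1 fst e; rewrite /= => e1'; exists (I1 (n + 1) (- u) + I2 (n + 1) (z + x1)).
  have [p1E p2E] := IP _ (- u) (z + x1); apply: Pinj.
    rewrite P1d p1E p2E mhomN wmD addrCA.
    by rewrite [_ + wm _ _]addrC -e1' addrC subrK.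
  by rewrite P2d p2E mhomD dx addr0.
move=> y dy; have [|x1 [[u v] [dx e]]] := rs (0, y).
  by rewrite /= !mhom0 dy oppr0 addr0.
have := congr1 fst e; have := congr1 snd e; rewrite /= => e2 e1.
have [p1E p2E] := IP _ u (- x1); exists (I1 (n + 1) u + I2 (n + 1) (- x1)), v; split.
  apply: Pinj; rewrite ?mhom0 ?P1d ?P2d p2E ?p1E ?mhomN ?dx ?oppr0 // wmN /wm.
  by apply/eqP; rewrite subr_eq0 eq_sym -subr_eq0; apply/eqP.
rewrite qE p1E p2E bmN opprK /bm [LHS]e2 addrA; congr (_ + _); exact: addrC.
Qed.

(** Since [c] is bijective on the [e2]-part, the cone of [c] is exact there, as [key] shows. The
    second cover [r] is bijective on the [e1]-part, and its source has no [e2]-part because there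
    are no maps from [E2] to [E1]; hence it is a quasi-isomorphism. *)
Lemma resolution M : exists (P : tw) (q : cmap (Lam P) M), quasi_iso q.
Proof.
have [X2 [c [c1 c2 _]]] := label_complex E_fd E_21 E_scal true M.
have [X1 [r [r1 r2 r3]]] := label_complex E_fd E_21 E_scal false (cone c).
apply: (@cocone_resolution X2 M c X1 r) => n.
have key k (x : cone c (k + 1)) : fixed true x -> cd (cone c) (k + 1) x = 0 -> exists y, x = cd (cone c) k y.
  case: x => [x m] fx /= e; have fm : fixed true m by have := congr1 snd fx.
  have [z fz zE] := c2 _ _ fm; exists (z, 0); rewrite /= zE mhom0 addr0; congr pair.
  have fx1 : fixed true x by have := congr1 fst fx.
  symmetry; apply: addr0_eq; apply: c1.
    by rewrite /fixed actD fx1; congr (_ + _); exact: fixed_map.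
  rewrite mhomD (cfunE c) zE; apply: etrans (addrC _ _) _; have e2 := congr1 snd e; exact: e2.
split=> [x dx [y yE]|y dy].
  have [z _ zE] := r2 _ _ (fixed_act false y); exists z.
  apply/eqP; rewrite -subr_eq0; apply/eqP; apply: r1; first exact: r3.
  rewrite mhomB cfunE zE mfun_act -yE.
  have : fixed false (r (n + 1) x) by apply: fixed_map; exact: r3.
  by move=> ->; rewrite subrr.
have [x fx xE] := r2 _ _ (fixed_act false y).
have [|z zE] := key n _ (fixed_act true y); first by rewrite mfun_act dy act0.
exists x, z; split; last by rewrite xE -zE -eid_split.
apply: r1; first exact: r3.
by rewrite cfunE xE mfun_act dy act0.
Qed.

End Lifting.

(** * The derived category *)

#[local] Instance heq_equiv (C : category) (X Y : C) : Equivalence (@heq C X Y).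
Proof. split; [exact: heq_refl | exact: heq_sym | exact: heq_trans]. Qed.
#[local] Instance comp_proper (C : category) (X Y Z : C) :
  Proper (@heq C Y Z ==> @heq C X Y ==> @heq C X Z) (@comp C X Y Z).
Proof. by move=> g g' eg f f' ef; exact: comp_heq. Qed.
#[local] Instance fmap_proper (C D : category) (F : functor C D) (X Y : C) :
  Proper (@heq C X Y ==> @heq D _ _) (@fmap C D F X Y).
Proof. by move=> g g' eg; exact: fmap_heq. Qed.

Lemma iso_cancel (C : category) (X Y Z : C) (s : hom Y Z) (f g : hom X Y) : is_iso s ->
  heq (comp s f) (comp s g) -> heq f g.
Proof.
move=> [r [r1 _]] e; rewrite -(comp1l f) -(comp1l g) -r1 -!compA.
by apply: comp_heq e; exact: heq_refl.
Qed.

(** * The quasi-inverse of an exact equivalence *)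

Section Inverse.
Variables (C : triangulated_category) (D : triangle_category).
Local Notation AC := (add_cat C).
Variable F : functor AC D.
Hypothesis Fff : fully_faithful F.
Hypothesis Fes : essentially_surjective F.
Variable si : forall X : C, hom (F (shift X)) (trshift (F X)).
Hypothesis si_iso : forall X, is_iso (si X).
Hypothesis si_nat : forall (X Y : C) (f : ahom X Y),
  heq (comp (si Y) (fmap F (fmap shift f : @hom AC _ _)))
      (comp (fmap trshift (fmap F (f : @hom AC _ _))) (si X)).
Hypothesis F_dist : forall (X Y Z : D) (u : hom X Y) (v : hom Y Z) (w : hom Z (trshift X)),
  trdist u v w -> exists (X' Y' Z' : C) (u' : @hom AC X' Y') (v' : @hom AC Y' Z')
    (w' : @hom AC Z' (shift X')) (f : hom (F X') X) (g : hom (F Y') Y) (h : hom (F Z') Z),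
  [/\ dist (u' : ahom _ _) (v' : ahom _ _) w', is_iso f, is_iso g, is_iso h &
   [/\ heq (comp g (fmap F u')) (comp u f), heq (comp h (fmap F v')) (comp v g) &
     heq (comp (fmap trshift f) (comp (si X') (fmap F w'))) (comp w h)]].

Definition qi_ob (M : D) : C := sval (cid (Fes M)).
Definition qi_map (M : D) : hom (F (qi_ob M)) M := sval (cid (svalP (cid (Fes M)))).
Lemma qi_map_iso M : is_iso (qi_map M).
Proof. exact: (svalP (cid (svalP (cid (Fes M))))). Qed.
Definition qi_inv (M : D) : hom M (F (qi_ob M)) := sval (cid (qi_map_iso M)).
Lemma qi_invl M : heq (comp (qi_inv M) (qi_map M)) (idc _).
Proof. by case: (svalP (cid (qi_map_iso M))). Qed.
Lemma qi_invr M : heq (comp (qi_map M) (qi_inv M)) (idc _).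
Proof. by case: (svalP (cid (qi_map_iso M))). Qed.

Definition preimage (X Y : C) (h : hom (F X) (F Y)) : @hom AC X Y := sval (cid (Fff.2 X Y h)).
Lemma preimageE X Y (h : hom (F X) (F Y)) : heq (fmap F (preimage h)) h.
Proof. exact: (svalP (cid (Fff.2 X Y h))). Qed.
Lemma F_inj (X Y : C) (f g : @hom AC X Y) : heq (fmap F f) (fmap F g) -> f = g.
Proof. exact: (Fff.1 X Y f g). Qed.

Lemma preimage_iso (X Y : C) (h : hom (F X) (F Y)) : is_iso h -> is_iso (preimage h).
Proof.
move=> [k [kh hk]]; exists (preimage k); split; apply: F_inj; rewrite fmap_comp fmap_id !preimageE //.
Qed.

Definition qi_hom (M N : D) (z : hom M N) : @hom AC (qi_ob M) (qi_ob N) :=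
  preimage (comp (qi_inv N) (comp z (qi_map M))).
Lemma qi_homE M N (z : hom M N) :
  heq (fmap F (qi_hom z)) (comp (qi_inv N) (comp z (qi_map M))).
Proof. exact: preimageE. Qed.

Lemma qi_invK M N (z : hom N M) : heq (comp (qi_map M) (comp (qi_inv M) z)) z.
Proof. by rewrite compA qi_invr comp1l; reflexivity. Qed.
Lemma qi_mapK M N (z : hom N (F (qi_ob M))) : heq (comp (qi_inv M) (comp (qi_map M) z)) z.
Proof. by rewrite compA qi_invl comp1l; reflexivity. Qed.
Lemma qi_homP M N (z : hom M N) : heq (comp (qi_map N) (fmap F (qi_hom z))) (comp z (qi_map M)).
Proof. by rewrite qi_homE qi_invK; reflexivity. Qed.

Lemma qi_homU M N (z : hom M N) (k : @hom AC (qi_ob M) (qi_ob N)) :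
  heq (comp (qi_map N) (fmap F k)) (comp z (qi_map M)) -> qi_hom z = k.
Proof. by move=> e; apply: F_inj; rewrite qi_homE -e qi_mapK; reflexivity. Qed.

Lemma qi_heq M N (z z' : hom M N) : heq z z' -> qi_hom z = qi_hom z'.
Proof. by move=> e; apply: qi_homU; rewrite qi_homP e; reflexivity. Qed.
Lemma qi_id M : qi_hom (idc M) = idc _.
Proof. by apply: qi_homU; rewrite fmap_id comp1l comp1r; reflexivity. Qed.
Lemma qi_comp M N P (z : hom N P) (y : hom M N) : qi_hom (comp z y) = comp (qi_hom z) (qi_hom y).
Proof.
apply: qi_homU; rewrite fmap_comp compA qi_homP -compA qi_homP compA; reflexivity.
Qed.

Definition qi_functor : functor D AC := @Functor D AC qi_ob qi_hom qi_heq qi_id qi_comp.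

Definition si_inv (X : C) : hom (trshift (F X)) (F (shift X)) := sval (cid (si_iso X)).
Lemma si_invl X : heq (comp (si_inv X) (si X)) (idc _).
Proof. by case: (svalP (cid (si_iso X))). Qed.
Lemma si_invr X : heq (comp (si X) (si_inv X)) (idc _).
Proof. by case: (svalP (cid (si_iso X))). Qed.

Definition qi_shift (M : D) : @hom AC (qi_ob (trshift M)) (shift (qi_ob M)) :=
  preimage (comp (si_inv _) (comp (fmap trshift (qi_inv M)) (qi_map _))).
Lemma qi_shiftE M : heq (comp (si _) (fmap F (qi_shift M)))
  (comp (fmap trshift (qi_inv M)) (qi_map _)).
Proof. by rewrite preimageE compA si_invr comp1l; reflexivity. Qed.

Lemma qi_shift_iso M : is_iso (qi_shift M).
Proof.
apply: preimage_iso.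
exists (comp (qi_inv _) (comp (fmap trshift (qi_map M)) (si _))); split.
  rewrite -!compA (compA (si _)) si_invr comp1l (compA (fmap trshift _)) -fmap_comp qi_invr.
  by rewrite fmap_id comp1l qi_invl; reflexivity.
rewrite -!compA qi_invK (compA (fmap trshift _)) -fmap_comp qi_invl.
by rewrite fmap_id comp1l si_invl; reflexivity.
Qed.

Lemma qi_shift_nat (M N : D) (z : hom M N) :
  heq (comp (qi_shift N) (fmap qi_functor (fmap trshift z)))
      (comp (fmap shift (fmap qi_functor z)) (qi_shift M)).
Proof.
apply: F_inj; apply: (iso_cancel (si_iso _)).
rewrite !fmap_comp compA qi_shiftE -compA qi_homP.
rewrite (compA (si _)) si_nat -compA qi_shiftE !compA -!fmap_comp qi_homE.
by rewrite -!compA qi_invr comp1r; reflexivity.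
Qed.

(** By [F_dist] a triangle of [D] is isomorphic to the image of one of [C]; composed with [qi_inv],
    the isomorphisms have invertible preimages in [C], along which the triangle is transported. *)
Lemma qi_dist (X Y Z : D) (u : hom X Y) (v : hom Y Z) (w : hom Z (trshift X)) : trdist u v w ->
  @trdist C _ _ _ (fmap qi_functor u) (fmap qi_functor v) (comp (qi_shift X) (fmap qi_functor w)).
Proof.
move=> /F_dist [X' [Y' [Z' [u' [v' [w' [f [g [h [d fi gi hi [e1 e2 e3]]]]]]]]]]].
have iso_pre (A : C) (M : D) (k : hom (F A) M) : is_iso k -> is_iso (preimage (comp (qi_inv M) k)).
  move=> [l [lk kl]]; apply: preimage_iso; exists (comp l (qi_map M)); split.
    by rewrite -compA qi_invK lk; reflexivity.
  by rewrite -compA (compA k) kl comp1l qi_invl; reflexivity.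
apply: (dist_iso (iso_pre _ _ _ fi) (iso_pre _ _ _ gi) (iso_pre _ _ _ hi) _ _ _ d); apply: F_inj.
- rewrite [heq _ _]/(heq (fmap F (comp (preimage _) u')) (fmap F (comp (qi_hom u) (preimage _)))).
  rewrite !fmap_comp !preimageE -!compA e1 qi_invK; reflexivity.
- rewrite [heq _ _]/(heq (fmap F (comp (preimage _) v')) (fmap F (comp (qi_hom v) (preimage _)))).
  rewrite !fmap_comp !preimageE -!compA e2 qi_invK; reflexivity.
apply: (iso_cancel (si_iso _)).
rewrite [heq _ _]/(heq (comp (si _) (fmap F (comp (fmap shift (preimage _)) w')))
  (comp (si _) (fmap F (comp (comp (qi_shift X) (qi_hom w)) (preimage _))))).
rewrite !fmap_comp !compA si_nat qi_shiftE preimageE fmap_comp.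
rewrite -!compA e3 qi_homE preimageE -!compA qi_invK qi_invK; reflexivity.
Qed.

Definition quasi_inverse : exact_equivalence D C.
Proof.
refine (@ExactEquivalence D C qi_functor _ _ qi_shift qi_shift_iso qi_shift_nat qi_dist).
- split=> [M N z z' e|M N k].
    have e' : qi_hom z = qi_hom z' := e.
    rewrite -(comp1r z) -(comp1r z') -!(qi_invr M) !compA -!qi_homP e'; reflexivity.
  exists (comp (qi_map N) (comp (fmap F k) (qi_inv M))).
  apply: qi_homU; rewrite -!compA qi_invl comp1r; reflexivity.
- move=> X; exists (F X), (preimage (qi_map (F X))).
  by apply: preimage_iso; exact: qi_map_iso.
Defined.

End Inverse.

(** * Maps of mapping cones *)

Section ConeMap.
Variables (K : fieldType) (A : kalgebra K).
Implicit Types X Y M N : bcomplex A.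

Lemma bij_qis X Y (f : cmap X Y) : (forall n x, f n x = 0 -> x = 0) ->
  (forall n y, exists x, f n x = y) -> quasi_iso f.
Proof.
move=> fi fs n; split=> [x dx [y fx]|y dy].
  have [z zE] := fs _ y; exists z; apply/eqP; rewrite -subr_eq0; apply/eqP; apply: fi.
  by rewrite mhomB fx cfunE zE subrr.
have [x xE] := fs _ y; exists x, 0; rewrite mhom0 addr0; split=> //.
by apply: fi; rewrite cfunE xE.
Qed.

Lemma add4_eq (V : zmodType) (a b c d e : V) : a - b = c + d -> a + e - d = b + (e + c).
Proof. by move=> /eqP; rewrite subr_eq => /eqP ->; zmod. Qed.

Lemma cone_alg1 (V : zmodType) (pu fx dh hx fd py db : V) : pu - fx = dh + hx ->
  py + hx = fd - fx + db -> py + pu = db + fd + dh.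
Proof.
move=> /(congr1 (fun t => t + fx)); rewrite subrK => ->.
move=> /(congr1 (fun t => t - hx)); rewrite addrK => ->; zmod.
Qed.

Lemma cone_alg2 (V : zmodType) (pu fx dh fd db : V) : pu - fx = dh ->
  fx + fd + db = 0 -> pu = - db - fd + dh.
Proof.
move=> /(congr1 (fun t => t + fx)); rewrite subrK => ->.
move=> /(congr1 (fun t => t - db - fd)); rewrite !addrK sub0r => <-; zmod.
Qed.

Lemma cone_alg3 (V : zmodType) (pu fx dh fd db : V) : pu - fx = dh ->
  fx + fd + db = 0 -> db + fd - dh + pu = 0.
Proof. by move=> h e; rewrite (cone_alg2 h e); zmod. Qed.

Lemma cone_alg4 (V : zmodType) (b fm hx py0 py1 db1 : V) :
  b + fm - hx + py0 = py1 + db1 -> b = - py0 + py1 + hx + (- fm + db1).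
Proof.
move=> /(congr1 (fun t => t - py0 + hx - fm)); rewrite addrK subrK addrK => ->; zmod.
Qed.

Section Map.
Variables (X Y M N : bcomplex A) (u : cmap X Y) (f : cmap M N) (q : cmap X M) (p : cmap Y N).
Variable h : forall n, mhom (X (n + 1)) (N n).
Hypothesis hE : forall n x, p (n + 1) (u (n + 1) x) - f (n + 1) (q (n + 1) x)
  = cd N n (h n x) + h (n + 1) (cd X (n + 1) x).

(** The square commutes only up to [h], whence the additional term [h n v.1]. *)
Program Definition cone_map : cmap (cone u) (cone f) :=
  @CMap _ _ (cone u) (cone f) (fun n => @MHom _ _ (cone u n) (cone f n)
     (fun v => (q (n + 1) v.1, p n v.2 + h n v.1)) _ _) _.
Next Obligation.
move=> n c [x y] [x' y'] /=; congr pair; rewrite /= !mfun_lin //.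
by rewrite scalerDr addrACA.
Qed.
Next Obligation. by move=> n [x y] a /=; rewrite !mfun_act actD. Qed.
Next Obligation.
move=> n [x y] /=; congr pair; rewrite /= mhomN; first by rewrite cfunE.
rewrite (mhomD (p _)) (mhomD (cd N n)) (cfunE p); exact: add4_eq (hE x).
Qed.

Hypotheses (qq : quasi_iso q) (qp : quasi_iso p).

(** A diagram chase with cycles and boundaries in place of the five lemma for long exact sequences;
    the correction terms coming from [h] are collected in [cone_alg1] to [cone_alg4]. *)
Lemma cone_map_qis : quasi_iso cone_map.
Proof.
move=> n; have [pi ps] := qp n; split=> [[x y] [/eqP]|[m b] [/eqP]].
  rewrite oppr_eq0 => /eqP dx du [[m b] [e1 e2]].
  have [||x0 x0E] := (qq (n + 1)).1 x; [by []|by exists (- m); rewrite mhomN|].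
  have [|x1 [m1 [dx1 mE]]] := (qq n).2 (m + q (n + 1) x0).
    by rewrite mhomD -cfunE -x0E e1 addrN.
  pose x' := x0 - x1.
  have dx' : cd X (n + 1) x' = x by rewrite mhomB dx1 subr0.
  have mE' : m = cd M n m1 - q (n + 1) x'.
    rewrite mhomB -[m](addrK (q (n + 1) x0)) mE.
    by rewrite opprB addrA; congr (_ - _); exact: addrC.
  have [||y' y'E] := pi (y + u (n + 1) x').
  - by rewrite mhomD -(cfunE u) dx'; exact: etrans (addrC _ _) du.
  - exists (b + f n m1 + h n x'); rewrite [LHS]mhomD 2!(mhomD (cd N n)) -(cfunE f).
    have h1 := hE x'; rewrite dx' in h1; apply: cone_alg1 h1 _.
    by apply: etrans e2 _; rewrite mE' mhomB.
  exists (- x', y'); rewrite /= !mhomN opprK dx' -y'E; congr pair.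
  by symmetry; apply: etrans (addrC _ _) _; exact: addrK.
rewrite oppr_eq0 => /eqP dm fm.
have [x [m0 [dx mE]]] := (qq (n + 1)).2 m dm.
have h1 := hE x; rewrite dx mhom0 addr0 in h1.
have [||y0 y0E] := (qp (n + 1)).1 (u (n + 1 + 1) x).
- by rewrite -cfunE dx mhom0.
- exists (- b + (- f (n + 1) m0) + h (n + 1) x); rewrite 2!(mhomD (cd N (n + 1))) !mhomN -(cfunE f).
  by apply: cone_alg2 h1 _; rewrite -(mhomD (f _)) -mE.
have [|y1 [b1 [dy1 bE]]] := ps (b + f (n + 1) m0 - h (n + 1) x + p (n + 1) y0).
  rewrite 3!(mhomD (cd N (n + 1))) mhomN -(cfunE f) -(cfunE p) -y0E.
  by apply: cone_alg3 h1 _; rewrite -(mhomD (f _)) -mE.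
exists (x, - y0 + y1), (- m0, b1).
rewrite /= dx oppr0 !mhomD !mhomN dy1 -y0E addr0 addrN opprK; split=> //.
congr pair; first exact: mE.
by move: bE; exact: cone_alg4.
Qed.
End Map.
End ConeMap.

(** * Maps in the derived category out of Hom complexes *)

Section DerivedHom.
Variables (K : fieldType) (T : linear_triangulated_category K) (E : bool -> T).
Hypothesis E_fd : forall l l', finite_dimensional (lhom (E l) (E l')).
Hypothesis E_21 : forall f : ahom (E true) (E false), f = 0.
Hypothesis E_end : forall (a : bool) (f : ahom (E a) (E a)), f = 0 \/ aiso f.
Hypothesis E_scal : forall (a : bool) (f : ahom (E a) (E a)), exists c : K, f = lscale c (aid _).

Local Notation E0 := (oplus (E false) (E true)).
Local Notation A := (endo_algebra E0).
Local Notation tw := (tw E).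
Local Notation HK := (kt_add E).
Local Notation KT := (kt_tri E).
Local Notation thom X Y := (ahom (tcar X) (tcar Y)).
Local Notation Lmod X n := (Lam_deg E_fd X n).
Local Notation Lam := (Lam E_fd).
Local Notation LamM := (LamM E_fd).
Local Notation DA := (derived_cat A).
Local Notation QF f := (fmap (derived_functor A) (f : @hom (complex_cat A) _ _)).
Local Notation zz := (@zigzag (complex_cat A) (@quasi_iso K A)).
Implicit Types M N : bcomplex A.

Lemma lam_qis_injh (X : tw) M N (s : cmap M N) (g g' : cmap (Lam X) M) : quasi_iso s ->
  chtp (cmap_comp s g) (cmap_comp s g') -> chtp g g'.
Proof.
move=> qs h; apply: (lam_qis_inj E_21 E_end qs); apply: cnull_eq h => n x.
by rewrite cmap_subE /= mhomD mhomZ scaleN1r addrC.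
Qed.

Section Transport.
Variables (X : tw) (M : bcomplex A).

(* A zigzag out of [M] transports homotopy classes of maps from the K-projective [Lam X]. *)
Fixpoint zrel N (z : zz M N) : cmap (Lam X) M -> cmap (Lam X) N -> Prop :=
  match z in zigzag _ _ N return cmap (Lam X) M -> cmap (Lam X) N -> Prop with
  | zz_nil => fun g g' => chtp g g'
  | zz_fwd _ _ p f => fun g g' => exists h, zrel p g h /\ chtp (cmap_comp f h) g'
  | zz_bwd _ _ s p _ => fun g g' => exists h, zrel p g h /\ chtp (cmap_comp s g') h
  end.

Lemma zrel_htp N (z : zz M N) g h h' : zrel z g h -> chtp h h' -> zrel z g h'.
Proof.
case: z h h' => [|U V p f|U V s p Ws] h h' /=; first exact: chtp_trans.
  by move=> [k [k1 k2]] e; exists k; split=> //; exact: chtp_trans k2 e.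
move=> [k [k1 k2]] e; exists k; split=> //; apply: chtp_trans k2.
by apply: chtp_compl; exact: chtp_sym.
Qed.

Lemma zrel_total N (z : zz M N) g : exists h, zrel z g h.
Proof.
elim: z => [|U V p [h hE] f|U V s p [h hE] Ws] /=.
- by exists g; exact: chtp_refl.
- by exists (cmap_comp f h), h; split=> //; exact: chtp_refl.
by have [h' h'E] := lam_qis_lift E_21 E_end h Ws; exists h', h.
Qed.

(** The two relations for inverted arrows are existence and uniqueness of lifts along
    quasi-isomorphisms; the other relations are formal. *)
Lemma zrel_eq N (y z : zz M N) : zz_eq y z -> forall g h, zrel y g h <-> zrel z g h.
Proof.
elim=> {N y z} /=.
- by [].
- by move=> N y z _ IH g h; rewrite IH.
- by move=> N x y z _ IH1 _ IH2 g h; rewrite IH1.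
- move=> N N' y z f f' _ IH e g h; split=> -[k [k1 k2]]; exists k; rewrite IH in k1 *; split=> //;
  apply: chtp_trans k2; apply: chtp_compr; apply: chtp_refl => n x; first by symmetry; exact: e.
  exact: e.
- by move=> N N' y z s Ws Ws' _ IH g h; split=> -[k [k1 k2]]; exists k; rewrite IH in k1 *.
- move=> N y g h; split=> [[k [k1 k2]]|yh].
    by apply: zrel_htp k1 _; apply: chtp_trans k2; exact: chtp_refl.
  by exists h; split=> //; exact: chtp_refl.
- move=> N N' N'' y f f' g h; split=> [[k [[k' [k1 k2]] k3]]|[k [k1 k2]]].
    exists k'; split=> //; apply: chtp_trans k3; apply: chtp_trans (chtp_compl f' k2).
    exact: chtp_refl.
  exists (cmap_comp f k); split; first by exists k; split=> //; exact: chtp_refl.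
  by apply: chtp_trans k2; exact: chtp_refl.
- move=> N N' y s Ws g h; split=> [[k [[k' [k1 k2]] k3]]|yh].
    by apply: zrel_htp k1 _; exact: chtp_trans (chtp_sym k2) k3.
  have [h' h'E] := lam_qis_lift E_21 E_end h Ws.
  by exists h'; split=> //; exists h.
- move=> N N' y s Ws g h; split=> [[k [[k' [k1 k2]] k3]]|yh].
    apply: zrel_htp k1 _; apply: (lam_qis_injh Ws).
    by apply: chtp_trans k2 _; exact: chtp_sym.
  exists (cmap_comp s h); split; last exact: chtp_refl.
  by exists h; split=> //; exact: chtp_refl.
Qed.

Lemma zrel_comp N (z : @hom DA M N) g h : zrel z g h -> heq (comp z (QF g)) (QF h).
Proof.
elim: z h => [|U V p IH f|U V s p IH Ws] h /=.
- exact: derived_htp.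
- move=> [k [/IH e1 /derived_htp e2]].
  apply: zz_trans (zz_fwd_eq e1 (heq_refl _)) _; apply: zz_trans e2; exact: zz_comp.
move=> [k [/IH e1 /derived_htp e2]].
apply: zz_trans (zz_bwd_eq Ws Ws e1) _.
apply: zz_trans (zz_bwd_eq Ws Ws (zz_sym e2)) _.
apply: zz_trans (zz_bwd_eq Ws Ws (zz_sym (zz_comp _ _ _))) _; exact: zz_invr.
Qed.
End Transport.

(** Equal maps of the localization transport the homotopy class of the identity to the same
    class. *)
Lemma lam_faithful (X : tw) M (f g : cmap (Lam X) M) : heq (QF f) (QF g) -> chtp f g.
Proof.
move=> /zrel_eq e.
have : @zrel X (Lam X) M (QF f) (cmap_id _) f.
  by exists (cmap_id _); split; exact: chtp_refl.
move=> /e[k [k1 k2]]; apply: chtp_sym; apply: chtp_trans k2.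
apply: chtp_trans (chtp_compl g k1); exact: chtp_refl.
Qed.

Lemma lam_full_derived (X : tw) M (z : @hom DA (Lam X) M) : exists f : cmap (Lam X) M, heq (QF f) z.
Proof.
have [f fE] := zrel_total z (cmap_id (Lam X)); exists f; have := zrel_comp fE => <-.
rewrite [QF (cmap_id _)](_ : heq _ (idc _)) ?comp1r; first by reflexivity.
exact: (fmap_id (derived_functor A)).
Qed.

Definition Lm (X Y : KT) (k : ahom X Y) : @hom DA (Lam X) (Lam Y) :=
  QF (LamM (sval (cid (svalP (cid (kcl_surj k)))))).

Lemma LmE (X Y : KT) (f : thom X Y) (c : chain f) : heq (Lm (kcl c : ahom X Y)) (QF (LamM c)).
Proof.
rewrite /Lm; case: cid => f' /= h; case: cid => c' /= e.
by apply: derived_htp; apply: LamM_htp; apply/kcl_eq; exact: esym e.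
Qed.

Lemma Lm_id (X : KT) : heq (Lm (aid X)) (idc (Lam X : DA)).
Proof.
apply: heq_trans (LmE _) _; apply: heq_trans (derived_eq (LamM_id _)) _.
exact: (fmap_id (derived_functor A)).
Qed.

Lemma Lm_comp (X Y Z : KT) (g : ahom Y Z) (f : ahom X Y) :
  heq (Lm (g \oc f)) (comp (Lm g) (Lm f)).
Proof.
have [[g0 [cg ->]] [f0 [cf ->]]] := conj (kcl_surj g) (kcl_surj f).
rewrite kclM !LmE -derived_comp; apply: derived_eq => n x; symmetry; exact: LamM_comp.
Qed.

Lemma Lm_heq (X Y : KT) (f g : ahom X Y) : f = g -> heq (Lm f) (Lm g).
Proof. by move=> ->; reflexivity. Qed.

Definition Lam_functor : functor (add_cat KT) DA :=
  @Functor (add_cat KT) DA Lam Lm Lm_heq Lm_id Lm_comp.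

Lemma Lam_ff : fully_faithful Lam_functor.
Proof.
split=> [X Y f g|X Y h].
  have [[g0 [cg ->]] [f0 [cf ->]]] := conj (kcl_surj g) (kcl_surj f).
  move=> e; have {e} : heq (QF (LamM cf)) (QF (LamM cg)) by rewrite -!LmE; exact: e.
  move=> /lam_faithful e; apply/kcl_eq; apply: (@LamM_nullI _ _ _ E_fd _ _ _ (chainB cf cg)).
  apply: cnull_eq e => n x; apply: lv_inj; rewrite cmap_subE lvB !LamME acompBl //.
have [f fE] := lam_full_derived h; have [f0 [c cE]] := LamM_full f.
exists (kcl c : @ahom KT X Y); apply: heq_trans (LmE c) _; rewrite -fE.
by apply: derived_eq => n x; rewrite cE.
Qed.

Lemma Lam_es : essentially_surjective Lam_functor.
Proof.
move=> M; have [P [q qq]] := resolution E_fd E_21 E_scal M.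
by exists P, (QF q); exact: derived_qis.
Qed.

(* The sign makes the standard triangles of [kt_tri] correspond to cones of complexes. *)
Section Shift.
Variable X : KT.

Lemma nsh_ex : exists f : cmap (Lam (tsh 1 X)) (cshift (Lam X)), forall n x, f n x = - lsh E_fd X n x.
Proof.
have fd n (x : Lam (tsh 1 X) n) : mhom_opp (lsh E_fd X (n + 1)) (cd (Lam (tsh 1 X)) n x)
    = cd (cshift (Lam X)) n (mhom_opp (lsh E_fd X n) x).
  by rewrite [LHS]/= [mhom_opp (lsh E_fd X n) x]/= cfunE mhomN.
by exists (@CMap _ _ (Lam (tsh 1 X)) (cshift (Lam X)) (fun n => mhom_opp (lsh E_fd X n)) fd).
Qed.
Definition nsh := sval (cid nsh_ex).
Lemma nshE n x : lv (nsh n x) = - lv x.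
Proof. by rewrite /nsh; case: cid => f /= ->; rewrite lvN lshE. Qed.

Lemma nsh_qis : quasi_iso nsh.
Proof.
apply: bij_qis => [n x e|n y].
  by apply: lv_inj; rewrite -[lv x]opprK -nshE e lv0 oppr0 lv0.
by exists (- lush E_fd X n y); apply: lv_inj; rewrite nshE lvN lushE opprK.
Qed.
End Shift.

Definition Lam_shift (X : KT) : @hom DA (Lam (shift X)) (derived_shift A (Lam X)) := QF (nsh X).

Lemma Lam_shift_iso (X : KT) : is_iso (Lam_shift X).
Proof. exact: derived_qis (nsh_qis X). Qed.

Lemma derived_shiftE M N (f : cmap M N) :
  heq (fmap (derived_shift A) (QF f)) (QF (cshift_map f)).
Proof. exact: zz_refl. Qed.

Lemma Lam_shift_nat (X Y : KT) (f : ahom X Y) :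
  heq (comp (Lam_shift Y) (fmap Lam_functor (fmap shift f : @hom (add_cat KT) _ _)))
      (comp (fmap (derived_shift A) (fmap Lam_functor (f : @hom (add_cat KT) _ _))) (Lam_shift X)).
Proof.
have [f0 [cf ->]] := kcl_surj f.
have -> : fmap shift (kcl cf : @ahom KT X Y) = kcl (chain_sh 1 cf) :> @ahom KT (tsh 1 X) (tsh 1 Y).
  exact: kshE.
change (heq (comp (QF (nsh Y)) (Lm (kcl (chain_sh 1 cf) : @ahom KT (tsh 1 X) (tsh 1 Y))))
  (comp (fmap (derived_shift A) (Lm (kcl cf : @ahom KT X Y))) (QF (nsh X)))).
rewrite !LmE derived_shiftE -!derived_comp; apply: derived_eq => n x; apply: lv_inj.
have e1 := nshE (LamM (chain_sh 1 cf) n (x : Lam (tsh 1 X) n)).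
have e2 := LamME (chain_sh 1 cf) (x : Lam (tsh 1 X) n).
have e3 := LamME cf (nsh X n (x : Lam (tsh 1 X) n) : Lam X (n + 1)).
by rewrite nshE acompNr -[X in - X]e2 -[in RHS]e1 in e3; exact: esym e3.
Qed.

Section Cone.
Variables (X Y : KT) (u : thom X Y) (cu : chain u).
Local Notation Z := (kcone cu).

(** The summands appear in opposite order, and the sign on the [X]-component makes up for the
    cocycle [- u] of [kcone]. *)
Lemma lam_cone_ex : exists f : cmap (Lam Z) (cone (LamM cu)), forall n z,
  lv ((f n z).1 : Lam X (n + 1)) = - (prj2 (tcar Y) (tcar X) \oc lv z) /\
  lv ((f n z).2 : Lam Y n) = prj1 (tcar Y) (tcar X) \oc lv z.
Proof.
have p1 n : tpi Y n \oc prj1 (tcar Y) (tcar X) = prj1 _ _ \oc tpi Z n.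
  by have := hdeg_prj1 (tpi Y) (tpi (tsh 1 X)) n; rewrite addr0.
have p2 n : tpi X (n + 1) \oc (- prj2 (tcar Y) (tcar X)) = (- prj2 _ _) \oc tpi Z n.
  rewrite acompNr acompNl; congr (- _).
  by have := hdeg_prj2 (tpi Y) (tpi (tsh 1 X)) n; rewrite addr0.
pose f n := sval (cid (mpair_ex (@lmap _ _ _ E_fd Z X n (n + 1) (- prj2 _ _) (p2 n))
  (@lmap _ _ _ E_fd Z Y n n (prj1 _ _) (p1 n)))).
have fE n z : f n z = (@lmap _ _ _ E_fd Z X n (n + 1) (- prj2 _ _) (p2 n) z,
    @lmap _ _ _ E_fd Z Y n n (prj1 _ _) (p1 n) z) by rewrite /f; case: cid.
have fd n (z : Lam Z n) : f (n + 1) (cd (Lam Z) n z) = cd (cone (LamM cu)) n (f n z).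
  rewrite !fE; congr pair; apply: lv_inj; rewrite ?lvN ?lvD !lmapE.
    by rewrite [LHS]acompA acompNl [prj2 _ _ \oc _]ext_df2 [tdf (tsh 1 X)]/= !(acompNl, acompNr) !opprK acompA.
  rewrite acompA [prj1 _ _ \oc _]ext_df1 acompDl !(acompNl, acompNr) !acompA.
  exact: addrC.
exists (@CMap _ _ (Lam Z) (cone (LamM cu)) f fd) => n z.
change (lv ((f n z).1 : Lam X (n + 1)) = - (prj2 (tcar Y) (tcar X) \oc lv z) /\
  lv ((f n z).2 : Lam Y n) = prj1 (tcar Y) (tcar X) \oc lv z).
rewrite fE -acompNl; split; exact: lmapE.
Qed.
Definition lam_cone := sval (cid lam_cone_ex).
Lemma lam_cone1 n z : lv ((lam_cone n z).1 : Lam X (n + 1)) = - (prj2 (tcar Y) (tcar X) \oc lv z).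
Proof. by case: (svalP (cid lam_cone_ex) n z). Qed.
Lemma lam_cone2 n z : lv ((lam_cone n z).2 : Lam Y n) = prj1 (tcar Y) (tcar X) \oc lv z.
Proof. by case: (svalP (cid lam_cone_ex) n z). Qed.

Lemma lam_cone_qis : quasi_iso lam_cone.
Proof.
have i1 n : tpi Z n \oc inj1 (tcar Y) (tcar X) = inj1 _ _ \oc tpi Y n.
  by have := hdeg_inj1 (tpi Y) (tpi (tsh 1 X)) n; rewrite addr0.
have i2 n : tpi Z n \oc inj2 (tcar Y) (tcar X) = inj2 _ _ \oc tpi X (n + 1).
  by have := hdeg_inj2 (tpi Y) (tpi (tsh 1 X)) n; rewrite addr0.
apply: bij_qis => [n z e|n [x y]].
  have e1 := lam_cone1 z; have e2 := lam_cone2 z; rewrite e /= in e1 e2.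
  apply: lv_inj; rewrite lv0; apply: oplus_ext_out; rewrite acomp0r.
    by rewrite -e2; exact: lv0.
  have /esym/eqP : 0 = - (prj2 (tcar Y) (tcar X) \oc lv z) by rewrite -e1; symmetry; exact: lv0.
  by rewrite oppr_eq0 => /eqP.
pose z := @lmap _ _ _ E_fd Y Z n n (inj1 _ _) (i1 n) y -
  @lmap _ _ _ E_fd X Z (n + 1) n (inj2 _ _) (i2 n) x.
have zE : lv z = inj1 _ _ \oc lv y - inj2 _ _ \oc lv x by rewrite lvB !lmapE.
exists z; have e1 := lam_cone1 z; have e2 := lam_cone2 z.
rewrite [LHS](_ : _ = ((lam_cone n z).1, (lam_cone n z).2)); last by case: (lam_cone n z).
congr pair; apply: lv_inj.
  by apply: etrans e1 _; rewrite zE acompBr !acompA !bipE acomp0l acomp1l sub0r opprK.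
by apply: etrans e2 _; rewrite zE acompBr !acompA !bipE acomp0l acomp1l subr0.
Qed.

End Cone.

(** Resolve [M] and [N] and lift [f] to the resolutions. By fullness the lift comes from a map [u]
    of twisted complexes; as the square commutes only up to homotopy, the cones are compared by
    [cone_map]. *)
Lemma Lam_cone (M N : bcomplex A) (f : cmap M N) :
  exists (X' Y' Z' : KT) (u' : @hom (add_cat KT) X' Y') (v' : @hom (add_cat KT) Y' Z')
    (w' : @hom (add_cat KT) Z' (shift X')) (a : @hom DA (Lam X') M) (b : @hom DA (Lam Y') N)
    (c : @hom DA (Lam Z') (cone f)),
  [/\ dist (u' : @ahom KT _ _) (v' : @ahom KT _ _) w', is_iso a, is_iso b, is_iso c &
   [/\ heq (comp b (Lm u')) (comp (QF f) a), heq (comp c (Lm v')) (comp (QF (cone_in f)) b) &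
     heq (comp (fmap (derived_shift A) a) (comp (Lam_shift X') (Lm w'))) (comp (QF (cone_out f)) c)]].
Proof.
have [X [q qq]] := resolution E_fd E_21 E_scal M.
have [Y [p qp]] := resolution E_fd E_21 E_scal N.
have [g gE] := lam_qis_lift E_21 E_end (cmap_comp f q) qp.
have [u [cu uE]] := LamM_full g.
have : chtp (cmap_comp p (LamM cu)) (cmap_comp f q).
  apply: chtp_trans gE; apply: chtp_compl; apply: chtp_refl => n x; symmetry; exact: uE.
move=> [h hE0].
have hE n x : p (n + 1) (LamM cu (n + 1) x) - f (n + 1) (q (n + 1) x)
    = cd N n (h n x) + h (n + 1) (cd (Lam X) (n + 1) x).
  by rewrite -(hE0 n x) cmap_subE.
pose c := cmap_comp (cone_map hE) (lam_cone cu).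
exists X, Y, (kcone cu), (kcl cu : @ahom KT X Y),
  (kcl (chain_inl (rotB_deg cu) (rotB_d cu)) : @ahom KT Y (kcone cu)),
  (kcl (chain_prr (rotB_deg cu) (rotB_d cu)) : @ahom KT (kcone cu) (tsh 1 X)),
  (QF q), (QF p), (QF c); split.
- exact: (rotB cu).
- exact: derived_qis.
- exact: derived_qis.
- by apply: derived_qis; apply: qis_comp; [exact: cone_map_qis | exact: lam_cone_qis].
split; rewrite LmE -?derived_comp.
- by apply: derived_htp; exists h.
- apply: derived_eq => n y.
  pose y' := LamM (chain_inl (rotB_deg cu) (rotB_d cu)) n y.
  have e1 : (lam_cone cu n y').1 = 0.
    apply: lv_inj; apply: etrans (lam_cone1 y') _; rewrite LamME acompA !bipE acomp0l oppr0.
    by symmetry; exact: lv0.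
  have e2 : (lam_cone cu n y').2 = y.
    by apply: lv_inj; apply: etrans (lam_cone2 y') _; rewrite LamME acompA !bipE acomp1l.
  change ((q (n + 1) (lam_cone cu n y').1, p n (lam_cone cu n y').2 + h n (lam_cone cu n y').1)
    = ((0, p n y) : M (n + 1) * N n)).
  by rewrite e1 e2 !mhom0 addr0.
apply: derived_eq => n z.
change (q (n + 1) (nsh X n (LamM (chain_prr (rotB_deg cu) (rotB_d cu)) n z))
  = q (n + 1) (lam_cone cu n z).1).
have e1 := nshE (LamM (chain_prr (rotB_deg cu) (rotB_d cu)) n z).
have e2 := LamME (chain_prr (rotB_deg cu) (rotB_d cu)) z.
congr (q (n + 1) _); apply: lv_inj.
exact: etrans e1 (etrans (congr1 -%R e2) (esym (lam_cone1 z))).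
Qed.

End DerivedHom.

(** * The derived equivalence and its linearity *)

Section DerivedEquivalence.
Variables (K : fieldType) (T : linear_triangulated_category K) (E : bool -> T).
Hypothesis E_neq : forall a b (n : int) (f : ahom (E a) (shiftz n (E b))), n != 0 -> f = 0.
Hypothesis E_21 : forall f : ahom (E true) (E false), f = 0.
Hypothesis E_end : forall (a : bool) (f : ahom (E a) (E a)), f = 0 \/ aiso f.
Hypothesis E_gen : forall X : T, generated E X.
Hypothesis E_fd : forall l l', finite_dimensional (lhom (E l) (E l')).
Hypothesis E_scal : forall (a : bool) (f : ahom (E a) (E a)), exists c : K, f = lscale c (aid _).

Local Notation E0 := (oplus (E false) (E true)).
Local Notation A := (endo_algebra E0).
Local Notation KT := (kt_tri E).
Local Notation thom X Y := (ahom (tcar X) (tcar Y)).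
Local Notation Lam := (Lam E_fd).
Local Notation DA := (derived_cat A).
Local Notation QF f := (fmap (derived_functor A) (f : @hom (complex_cat A) _ _)).
Local Notation DT := (derived_triangle_category A).
Local Notation LF := (Lam_functor E_fd).
Local Notation Lsh := (Lam_shift E_fd).

Lemma Lam_dist (X Y Z : DA) (u : hom X Y) (v : hom Y Z) (w : hom Z (derived_shift A X)) :
  @trdist DT _ _ _ u v w ->
  exists (X' Y' Z' : KT) (u' : @hom (add_cat KT) X' Y') (v' : @hom (add_cat KT) Y' Z')
    (w' : @hom (add_cat KT) Z' (shift X')) (f : hom (LF X') X) (g : hom (LF Y') Y) (h : hom (LF Z') Z),
  [/\ dist (u' : @ahom KT _ _) (v' : @ahom KT _ _) w', is_iso f, is_iso g, is_iso h &
   [/\ heq (comp g (fmap LF u')) (comp u f), heq (comp h (fmap LF v')) (comp v g) &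
     heq (comp (fmap (derived_shift A) f) (comp (Lsh X') (fmap LF w'))) (comp w h)]].
Proof.
move=> [X0 [Y0 [Z0 [u0 [v0 [w0 [f [g [h [S [[fi gi hi] [e1 e2 e3]]]]]]]]]]]].
have [X' [Y' [Z' [u' [v' [w' [a [b [c [d ai bi ci [e1' e2' e3']]]]]]]]]]] :
    exists (X' Y' Z' : KT) (u' : @hom (add_cat KT) X' Y') (v' : @hom (add_cat KT) Y' Z')
    (w' : @hom (add_cat KT) Z' (shift X')) (f : hom (LF X') X0) (g : hom (LF Y') Y0) (h : hom (LF Z') Z0),
  [/\ dist (u' : @ahom KT _ _) (v' : @ahom KT _ _) w', is_iso f, is_iso g, is_iso h &
   [/\ heq (comp g (fmap LF u')) (comp u0 f), heq (comp h (fmap LF v')) (comp v0 g) &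
     heq (comp (fmap (derived_shift A) f) (comp (Lsh X') (fmap LF w'))) (comp w0 h)]].
  by case: S => M N m; exact: (Lam_cone E_fd E_21 E_end E_scal m).
exists X', Y', Z', u', v', w', (comp f a), (comp g b), (comp h c).
split; [exact: d|exact: is_iso_comp|exact: is_iso_comp|exact: is_iso_comp|split].
- by rewrite -compA e1' !compA e1; reflexivity.
- by rewrite -compA e2' !compA e2; reflexivity.
by rewrite fmap_comp -!compA e3' !compA e3; reflexivity.
Qed.

Definition derived_kt : exact_equivalence DT KT :=
  @quasi_inverse KT DT LF (Lam_ff E_fd E_21 E_end)
    (Lam_es E_fd E_21 E_scal) Lsh (Lam_shift_iso E_fd) (Lam_shift_nat E_fd) Lam_dist.

Lemma chain_lin (X Y : KT) (c : K) (m m' : thom X Y) : chain m -> chain m' -> chain (lscale c m + m').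
Proof.
move=> cm cm'; have cs : chain (lscale c (aid (tcar Y)) \oc m).
  split=> [n|]; rewrite -lscale_compl acomp1l.
    by rewrite -lscale_compr -lscale_compl (chain_deg cm).
  by rewrite -lscale_compr -lscale_compl (chain_d cm).
by rewrite -lscale_compl acomp1l in cs; exact: chain_add.
Qed.

(** The equivalence is an inverse obtained by choice, but the image [n] of a chain map [k] is
    characterised by a homotopy between [n] followed by the resolution [q] and [p] followed by [k];
    this condition is linear in the pair. *)
Lemma derived_kt_lin (M N : bcomplex A) (c : K) (f g : cmap M N) :
  exists (m m' : thom (derived_kt M) (derived_kt N)) (cm : chain m) (cm' : chain m')
    (cl : chain (lscale c m + m')),
  [/\ fmap derived_kt (QF f) = kcl cm, fmap derived_kt (QF g) = kcl cm' &
      fmap derived_kt (QF (cmap_lin c f g)) = kcl cl].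
Proof.
pose Fes := Lam_es E_fd E_21 E_scal; pose Fff := Lam_ff E_fd E_21 E_end.
have [m [cm mE]] := kcl_surj (fmap derived_kt (QF f)).
have [m' [cm' mE']] := kcl_surj (fmap derived_kt (QF g)).
have cl := chain_lin c cm cm'; exists m, m', cm, cm', cl; split=> //.
have [p pE] := lam_full_derived E_21 E_end (@qi_map KT DT LF Fes M).
have [q qE] := lam_full_derived E_21 E_end (@qi_map KT DT LF Fes N).
have key (k : cmap M N) (n : thom (derived_kt M) (derived_kt N)) (cn : chain n) :
    fmap derived_kt (QF k) = kcl cn -> chtp (cmap_comp q (LamM E_fd cn)) (cmap_comp k p).
  move=> kE; apply: (lam_faithful E_21 E_end); rewrite !derived_comp pE qE -LmE -kE.
  exact: (@qi_homP KT DT LF Fff Fes M N (QF k)).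
apply: (@qi_homU KT DT LF Fff Fes M N).
rewrite [fmap LF _]LmE -pE -qE -!derived_comp; apply: derived_htp.
apply: chtp_trans (chtp_trans (chtp_lin c (key _ _ _ mE) (key _ _ _ mE')) _); apply: chtp_refl => n x.
  rewrite /= -mfun_lin; congr (q n _); apply: lv_inj.
  by rewrite lv_lin !LamME acompDl lscale_compl.
by [].
Qed.

Theorem generated_derived_equivalent : derived_equivalent T A.
Proof.
exists (comp_equivalence derived_kt (kt_equivalence E_neq E_21 E_end E_gen)) => M N c f g.
have [m [m' [cm [cm' [cl [e1 e2 e3]]]]]] := derived_kt_lin c f g.
have := FM_lin E_neq E_21 E_end cm cm' cl; rewrite -e1 -e2 -e3; exact.
Qed.

End DerivedEquivalence.

Theorem corollary2p13 (K : fieldType) (T : linear_triangulated_category K)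
    (E1 E2 : T)
    (hE : full_strong_exceptional_sequence (fun i => tnth [tuple E1; E2] i))
    (hfin : finite_dimensional (lhom E1 E2)) :
  algebraic T /\ derived_equivalent T (endo_algebra (oplus E1 E2)).
Proof.
have [[h1 h2] h3 h4] := hE.
(* [false] stands for [E1] and [true] for [E2], so that [oplus (E false) (E true)] is [oplus E1 E2]
   by computation. *)
pose E (b : bool) := if b then E2 else E1.
have EE b : exists i : 'I_2, tnth [tuple E1; E2] i = E b.
  by case: b; [exists (@Ordinal 2 1 isT) | exists (@Ordinal 2 0 isT)].
have E_neq a b (n : int) (f : ahom (E a) (shiftz n (E b))) : n != 0 -> f = 0.
  by have [[i ei] [j ej]] := (EE a, EE b); move: f; rewrite -ei -ej; exact: h4.
have E_21 (f : ahom (E true) (E false)) : f = 0.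
  (* The case [n = 0] of the vanishing from the later object to the earlier one. *)
  exact: (h2 (@Ordinal 2 1 isT) (@Ordinal 2 0 isT) 0 f).
have E_bij a : bijective (fun c : K => c *: (aid (E a) : lhom (E a) (E a))).
  by have [i <-] := EE a; have [] := h1 i.
have E_scal a (f : ahom (E a) (E a)) : exists c : K, f = lscale c (aid _).
  by have [g _ gK] := E_bij a; exists (g f); rewrite -[LHS]gK.
have E_end a (f : ahom (E a) (E a)) : f = 0 \/ aiso f.
  have [c ->] := E_scal a f; have [-> | c0] := eqVneq c 0.
    by left; exact: (scale0r (aid (E a) : lhom (E a) (E a))).
  right; exists (lscale c^-1 (aid _)); split.
    change (lscale c^-1 (aid (E a)) \oc lscale c (aid (E a)) = aid (E a)).
    by rewrite -lscale_compl -lscale_compr lscaleA acomp1l mulVf // lscale1.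
  change (lscale c (aid (E a)) \oc lscale c^-1 (aid (E a)) = aid (E a)).
  by rewrite -lscale_compl -lscale_compr lscaleA acomp1l mulfV // lscale1.
have E_gen X : generated E X.
  move=> P tP hP; apply: (h3 X P tP) => i.
  have [i0|i1] := boolP (i == 0 :> nat).
    by have -> : tnth [tuple E1; E2] i = E false; last exact: hP;
      rewrite (_ : i = @Ordinal 2 0 isT) //; apply: val_inj; exact/eqP.
  have -> : tnth [tuple E1; E2] i = E true; last exact: hP.
  by rewrite (_ : i = @Ordinal 2 1 isT) //; apply: val_inj => /=; move: (ltn_ord i) i1; lia.
have E_fd l l' : finite_dimensional (lhom (E l) (E l')).
  have scal a : finite_dimensional (lhom (E a) (E a)).
    exists 1%N, (fun=> aid (E a)) => v; have [c cE] := E_scal a v.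
    by exists (fun=> c); rewrite big_ord1.
  case: l l' => [] []; try exact: scal; last exact: hfin.
  by exists 0%N, (fun=> 0) => v; exists (fun=> 0); rewrite big_ord0; exact: E_21.
split; first exact: (generated_algebraic E_neq E_21 E_end E_gen).
exact: (generated_derived_equivalent E_neq E_21 E_end E_gen E_fd E_scal).
Qed.
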